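(* Let $V:\mathbb R^3\to\mathbb R$ with $V\in\mathcal K_0$, and suppose $H=-\Delta+V$ on $L^2(\mathbb R^3)$ has no eigenvalue or resonance at zero, and no positive eigenvalues. Then the resolvent of $H$ along the positive real axis is an integral operator whose kernel satisfies, with a constant $C<\infty$ independent of $\lambda,x,y$, $$|R_V^\pm(\lambda)(x,y)|\le\frac{C}{|x-y|}\qquad\text{uniformly in }\lambda\ge0 .$$
   Context: The global Kato norm is $\|V\|_{\mathcal K}=\sup_{y\in\mathbb R^3}\int_{\mathbb R^3}\frac{|V(x)|}{|x-y|}\,dx$, and $\mathcal K_0$ is the closure of $C_c^\infty(\mathbb R^3)$ in this norm. For real $V\in\mathcal K_0$, $H=-\Delta+V$ is self-adjoint and bounded below with essential spectrum $[0,\infty)$. A resonance at zero is a nontrivial solution $\psi\notin L^2$ of $(-\Delta+V)\psi=0$ with $(1+|x|)^{-s}\psi\in L^2(\mathbb R^3)$ for all $s>\frac12$. $R_V(z)=(H-z)^{-1}$, and $R_V^\pm(\lambda)=R_V(\lambda\pm i0)$ are the boundary values on the real axis (limits in a topology weaker than $\mathcal B(L^2)$), satisfying $R_V^\pm(\lambda)=(I+R_0^\pm(\lambda)V)^{-1}R_0^\pm(\lambda)$, where $R_0^\pm(\lambda)(x,y)=\frac{e^{\pm i\sqrt\lambda|x-y|}}{4\pi|x-y|}$. *)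

(* Defs.v *)
From HB Require Import structures.
From mathcomp Require Import all_boot all_order all_algebra.
From mathcomp Require Import complex.
From mathcomp Require Import all_classical all_reals all_analysis.

Set Implicit Arguments.
Unset Strict Implicit.
Unset Printing Implicit Defensive.

Import Order.TTheory GRing.Theory Num.Theory.
Import numFieldNormedType.Exports.

Local Open Scope classical_set_scope.
Local Open Scope ring_scope.
Local Open Scope complex_scope.

Notation R3 R := (R * R * R)%type.
(* Convertible to [R3 R], with the product sigma-algebra (the Borel sets) that
   the library attaches to products of [lebesgue_measure]. *)
Notation measurable_R3 R :=
  (measurableTypeR R * measurableTypeR R * measurableTypeR R)%type.
(* The norm attached to [R[i]] by the library is itself complex-valued; this is
   the real-valued modulus. *)
Notation modulus := ComplexField.Normc.normc.

Section Space.
Context {R : realType}.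
Implicit Types (x y : R3 R) (V phi : R3 R -> R) (u f g : R3 R -> R[i]).

(* The library's norm on a product is the sup norm. *)
Definition enorm x : R := Num.sqrt (x.1.1 ^+ 2 + x.1.2 ^+ 2 + x.2 ^+ 2).

Definition leb3 : {measure set (measurable_R3 R) -> \bar R} :=
  (@lebesgue_measure R \x @lebesgue_measure R \x @lebesgue_measure R)%E.

Definition eball (r : R) : set (R3 R) := [set x | enorm x <= r].

Definition unit_vec (i : 'I_3) : R3 R :=
  ((i == 0 :> nat)%:R, (i == 1 :> nat)%:R, (i == 2 :> nat)%:R).

Definition partial (i : 'I_3) phi : R3 R -> R := 'D_(unit_vec i) phi.

Definition laplacian phi x : R := \sum_(i < 3) partial i (partial i phi) x.

Definition smooth phi : Prop := forall s : seq 'I_3,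
  continuous (foldr partial phi s) /\
  forall i x, derivable (foldr partial phi s) x (unit_vec i).

Definition bounded_support (T : nmodType) (h : R3 R -> T) : Prop :=
  exists r : R, forall x, r < enorm x -> h x = 0.

Definition test_function phi : Prop := smooth phi /\ bounded_support phi.

Definition kato_norm V : \bar R :=
  ereal_sup (range (fun y => \int[leb3]_x (`|V x| / enorm (x - y))%R%:E))%E.

Definition kato0 V : Prop := measurable_fun setT (V : measurable_R3 R -> R) /\
  forall e : R, 0 < e ->
    exists2 phi, test_function phi & (kato_norm (V \- phi)%R < e%:E)%E.

Definition cintegral f : R[i] :=
  (\int[leb3]_x complex.Re (f x)) +i* (\int[leb3]_x complex.Im (f x)).

Definition in_L2 f : Prop :=
  ((fun x => complex.Re (f x)) \in Lfun leb3 2%:E) /\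
  ((fun x => complex.Im (f x)) \in Lfun leb3 2%:E).

Definition in_L2comp f : Prop := in_L2 f /\ bounded_support f.

Definition in_L2loc f : Prop :=
  forall r : R, in_L2 (fun x => (\1_(eball r) x)%:C * f x).

Definition in_L1loc f : Prop := forall r : R,
  leb3.-integrable (eball r) (fun x => (complex.Re (f x))%:E) /\
  leb3.-integrable (eball r) (fun x => (complex.Im (f x))%:E).

Definition ae_zero f : Prop := {ae leb3, forall x, f x = 0}.

(* Real-valued test functions suffice, by linearity, for the complex-valued
   distributions below. *)
Definition weak_partial (i : 'I_3) u g : Prop :=
  [/\ in_L1loc u, in_L1loc g & forall phi, test_function phi ->
    cintegral (fun x => u x * (partial i phi x)%:C) =
    - cintegral (fun x => g x * (phi x)%:C)].

Definition in_H1 u : Prop :=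
  in_L2 u /\ forall i, exists2 g, in_L2 g & weak_partial i u g.

Definition weak_schrodinger V u f : Prop :=
  [/\ in_L1loc u, in_L1loc (fun x => (V x)%:C * u x), in_L1loc f &
    forall phi, test_function phi ->
      cintegral (fun x => - u x * (laplacian phi x)%:C
                          + (V x)%:C * u x * (phi x)%:C) =
      cintegral (fun x => f x * (phi x)%:C)].

(* The graph of H = - Laplacian + V: [u] is in the domain of H and H u = [f].
   A potential in [kato0] need not be locally square integrable, so that H is
   the form sum: its form domain is H^1 and its domain consists of the u in H^1
   for which the distribution - Laplacian u + V u is in L^2. *)
Definition schrodinger_graph V u f : Prop :=
  [/\ in_H1 u, in_L2 f & weak_schrodinger V u f].

Definition schrodinger_eigenvalue V (E : R) : Prop := exists u,
  ~ ae_zero u /\ schrodinger_graph V u (fun x => E%:C * u x).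

Definition zero_resonance V : Prop := exists psi,
  [/\ ~ ae_zero psi, ~ in_L2 psi, weak_schrodinger V psi (fun=> 0) &
    forall s : R, 2^-1 < s ->
      in_L2 (fun x => ((1 + enorm x) `^ (- s))%:C * psi x)].

(* (H - z)^{-1} f, with a dummy value when (H - z) u = f has no solution. *)
Definition resolvent V (z : R[i]) f : R3 R -> R[i] :=
  xget (fun=> 0) [set u | schrodinger_graph V u (fun x => f x + z * u x)].

Definition pairing f g : R[i] := cintegral (fun x => f x * (g x)^*%C).

(* [T] is R_V(lam + i0) (for [b = false]) or R_V(lam - i0) (for [b = true]):
   the limit of R_V(lam +/- i e) as e decreases to 0, in the weak operator
   topology from L^2_comp to L^2_loc. *)
Definition boundary_resolvent V (b : bool) (lam : R)
    (T : (R3 R -> R[i]) -> R3 R -> R[i]) : Prop :=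
  forall f, in_L2comp f -> in_L2loc (T f) /\
    forall g, in_L2comp g ->
      modulus (pairing (resolvent V (lam +i* ((-1) ^+ b * e)) f) g
               - pairing (T f) g) @[e --> 0^'+] --> (0 : R).

Definition jointly_measurable (K : R3 R -> R3 R -> R[i]) : Prop :=
  measurable_fun setT (fun p : measurable_R3 R * measurable_R3 R =>
    complex.Re (K p.1 p.2)) /\
  measurable_fun setT (fun p : measurable_R3 R * measurable_R3 R =>
    complex.Im (K p.1 p.2)).

Definition integral_operator (K : R3 R -> R3 R -> R[i]) f : R3 R -> R[i] :=
  fun x => cintegral (fun y => K x y * f y).

End Space.

(* Main.v *)
(* The kernel k_V of R_V solves k_V(.,y) = k_0(.,y) - R_0 V k_V(.,y), so it is
   enough to bound (I + R_0 V)^{-1} on {f : |f| <= M / |. - y|}, uniformly in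
   lambda.  Write V = V_1 + V_2 with V_1 a test function and V_2 of small Kato
   norm: a Neumann series inverts I + R_0 V_2.  At bounded energies the rest is
   a finite-rank perturbation whose determinant is continuous in lambda and does
   not vanish, as there is no eigenvalue or resonance; at high energies, limiting
   absorption makes (R_0 V_1)^2 small.  The solution with absorption is identified
   with the resolvent by uniqueness for the form sum, and dominated convergence
   gives the boundary values. *)
Require Import Defs.
From HB Require Import structures.
From mathcomp Require Import all_boot all_order all_algebra perm.
From mathcomp Require Import complex ring lra.
From mathcomp Require Import all_classical all_reals all_analysis.
From mathcomp Require Import measurable_realfun.
Set Implicit Arguments.
Unset Strict Implicit.
Unset Printing Implicit Defensive.
Import Order.TTheory GRing.Theory Num.Theory.
Import numFieldNormedType.Exports.
Local Open Scope classical_set_scope.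
Local Open Scope ring_scope.
Local Open Scope complex_scope.

Ltac done ::=
 trivial; hnf; intros; solve
 [ do ![solve [trivial | apply: sym_equal; trivial]
    | match goal with
     | H : is_true false |- _ => discriminate H
     | H : false = true |- _ => discriminate H
     | H : true = false |- _ => discriminate H
     | |- _ <> _ => discriminate
     end
    | contradiction | split]
 | match goal with H : ~ _ |- _ => solve [case H; trivial] end ].

Local Notation nrm := ComplexField.Normc.normc.
Local Notation dist x y := (enorm (x - y)).
Local Notation testf := test_function.
Local Notation mge0 := mulr_ge0.
Local Notation pd := partial.
Local Notation mTR := measurableTypeR.
Local Notation lap := laplacian.
Local Notation lewl := ler_wpM2l.
Local Notation lewr := ler_wpM2r.
Local Notation leewl := lee_wpmul2l.
Local Notation ltyM := lte_mul_pinfty.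
Local Notation mcomp := measurableT_comp.
Local Notation lelt := le_lt_trans.
Local Ltac fext := apply/funext.
Local Notation Re := complex.Re.
Local Notation Im := complex.Im.
Local Notation via M := (@le_trans _ _ M _ _).
Local Notation vialt M := (@lelt _ _ M _ _).

Local Notation nneg f := (forall x, 0 <= f x).

(** Energies are parametrised by [m] with $z=-m^2$ and [0 <= Re m], so that absorption and boundary
    values are treated alike. Two weights are needed. The resolvent kernel lives in [q2], that is
    $1/|x-y|$, whose singularity moves with y; there only the part [V2] of small Kato norm is
    inverted. The bounded, compactly supported part [V1] sends [q2] to $\omega(x)\omega(y)$ with
    $\omega(x)=1/(1+|x|)$, a fixed weight which $R_0V$ preserves. Hence the kernel is sought as
    [Gk - Qk]: [Gk] carries the singularity and [Qk], bounded by $\omega\omega$, all the spectral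
    information. Fredholm theory is replaced by an explicit approximation: a capped free kernel
    sampled on a net of a ball, and a finite matrix. The Fourier transform is replaced by the
    positive kernel of $(1-\Delta)^{-1}$, which gives $H^1$ regularity, form bounds and uniqueness.
    One identity serves three times: $\mathrm{Im}\int\bar F u=0$ when $-\Delta u=F$. It yields
    uniqueness for the form sum, square integrability of solutions at positive energy, and decay at
    high energy. *)

Lemma eqle d (T : porderType d) (x y : T) : x = y -> (x <= y)%O.
by move=> ->. Qed.

Lemma ltyZ {R : realType} (c : R) (h : \bar R) : 0 <= c -> (h < +oo)%E -> (c%:E * h < +oo)%E.
by move=> c0; exact: ltyM (c0 : (0 <= c%:E)%E) isT. Qed.

(** * Euclidean norm on R^3 *)

Section Euclid.
Context {R : realType}.
Implicit Types x y z : R3 R.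

Lemma enge0 x : 0 <= enorm x.
exact: sqrtr_ge0. Qed.

Lemma enorm_sqr x : enorm x ^+ 2 = x.1.1 ^+ 2 + x.1.2 ^+ 2 + x.2 ^+ 2.
by rewrite sqr_sqrtr// !addr_ge0// sqr_ge0. Qed.

Lemma enorm0 : enorm (0 : R3 R) = 0.
by rewrite /enorm /= !expr0n/= !addr0 sqrtr0. Qed.

Lemma enormN x : enorm (- x) = enorm x.
by rewrite /enorm /= !sqrrN. Qed.

Lemma enormBC x y : enorm (x - y) = enorm (y - x).
by rewrite -enormN opprB. Qed.

Lemma enorm_eq0 x : enorm x = 0 -> x = 0.
move=> x0; have := enorm_sqr x; rewrite x0 expr0n /= => /esym/eqP.
rewrite paddr_eq0 ?addr_ge0 ?sqr_ge0// paddr_eq0 ?sqr_ge0// !sqrf_eq0.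
by case: x x0 => -[a b] c /= _ /andP[/andP[/eqP-> /eqP->] /eqP->].
Qed.

Lemma enorm_gt0 x y : x <> y -> 0 < enorm (x - y).
move=> xy; rewrite lt_def enge0 andbT; apply/eqP => /enorm_eq0 /eqP.
by rewrite subr_eq0 => /eqP.
Qed.

Lemma ler_enormD x y : enorm (x + y) <= enorm x + enorm y.
rewrite -(@ler_pXn2r _ 2) ?nnegrE ?enge0 ?addr_ge0 ?enge0//.
rewrite sqrrD !enorm_sqr /=.
suff h : x.1.1 * y.1.1 + x.1.2 * y.1.2 + x.2 * y.2 <= enorm x * enorm y by lra.
apply: (via `|x.1.1 * y.1.1 + x.1.2 * y.1.2 + x.2 * y.2|); first exact: ler_norm.
rewrite -(@ler_pXn2r _ 2) ?nnegrE ?normr_ge0 ?mge0 ?enge0//.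
rewrite exprMn real_normK ?num_real// !enorm_sqr -subr_ge0.
(* Lagrange's identity: the defect in Cauchy-Schwarz is the squared length of the cross product. *)
have -> : (x.1.1 ^+ 2 + x.1.2 ^+ 2 + x.2 ^+ 2) * (y.1.1 ^+ 2 + y.1.2 ^+ 2 + y.2 ^+ 2)
 - (x.1.1 * y.1.1 + x.1.2 * y.1.2 + x.2 * y.2) ^+ 2
 = (x.1.1 * y.1.2 - x.1.2 * y.1.1) ^+ 2 + (x.1.1 * y.2 - x.2 * y.1.1) ^+ 2
 + (x.1.2 * y.2 - x.2 * y.1.2) ^+ 2 by ring.
by rewrite !addr_ge0// sqr_ge0.
Qed.

Lemma ler_dist z x y : dist x y <= dist x z + dist z y.
by apply: le_trans (ler_enormD _ _); rewrite addrA subrK. Qed.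

Lemma enorm_le_add x y : enorm x <= dist x y + enorm y.
by have := ler_enormD (x - y) y; rewrite subrK. Qed.

Lemma ler_coord1 x : `|x.1.1| <= enorm x.
by rewrite -sqrtr_sqr ler_sqrt ?addr_ge0 ?sqr_ge0// -addrA lerDl addr_ge0 ?sqr_ge0. Qed.
Lemma ler_coord2 x : `|x.1.2| <= enorm x.
by rewrite -sqrtr_sqr ler_sqrt ?addr_ge0 ?sqr_ge0//; have := sqr_ge0 x.1.1; have := sqr_ge0 x.2; lra. Qed.
Lemma ler_coord3 x : `|x.2| <= enorm x.
by rewrite -sqrtr_sqr ler_sqrt ?addr_ge0 ?sqr_ge0// lerDr addr_ge0 ?sqr_ge0. Qed.

Lemma enorm_le_coord x : enorm x <= `|x.1.1| + `|x.1.2| + `|x.2|.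
rewrite -(@ler_pXn2r _ 2) ?nnegrE ?enge0 ?addr_ge0 ?normr_ge0//.
rewrite enorm_sqr -(real_normK (num_real x.1.1)) -(real_normK (num_real x.1.2)) -(real_normK (num_real x.2)).
have := normr_ge0 x.1.1; have := normr_ge0 x.1.2; have := normr_ge0 x.2; nra.
Qed.

End Euclid.

(** * Real-valued modulus of complex numbers *)

Section Modulus.
Context {R : realType}.
Implicit Types z w : R[i].
Import ComplexField.Normc.

Lemma nrmE z : nrm z = Num.sqrt (Re z ^+ 2 + Im z ^+ 2).
by case: z. Qed.
Lemma nge0 z : 0 <= nrm z.
by rewrite nrmE sqrtr_ge0. Qed.
Lemma nrm_sqr z : nrm z ^+ 2 = Re z ^+ 2 + Im z ^+ 2.
by rewrite nrmE sqr_sqrtr// addr_ge0 ?sqr_ge0. Qed.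
Lemma nrmM z w : nrm (z * w) = nrm z * nrm w.
exact: normcM. Qed.
Lemma nrmD z w : nrm (z + w) <= nrm z + nrm w.
exact: le_normcD. Qed.
Lemma nrmN z : nrm (- z) = nrm z.
exact: normcN. Qed.
Lemma nrmB z w : nrm (z - w) <= nrm z + nrm w.
by rewrite -[nrm w]nrmN nrmD. Qed.
Lemma nrmBC z w : nrm (z - w) = nrm (w - z).
by rewrite -nrmN opprB. Qed.
Lemma nrm0 : nrm (0 : R[i]) = 0.
exact: normc0. Qed.
Lemma nrm_real (a : R) : nrm a%:C = `|a|.
by rewrite nrmE /= expr0n addr0 sqrtr_sqr. Qed.
Lemma nrm_conj z : nrm (z^*%C) = nrm z.
by case: z => a b; rewrite !nrmE /= sqrrN. Qed.
Lemma Re_le_nrm z : `|Re z| <= nrm z.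
by rewrite nrmE -sqrtr_sqr ler_sqrt ?addr_ge0 ?sqr_ge0// lerDl sqr_ge0. Qed.
Lemma Im_le_nrm z : `|Im z| <= nrm z.
by rewrite nrmE -sqrtr_sqr ler_sqrt ?addr_ge0 ?sqr_ge0// lerDr sqr_ge0. Qed.
Lemma nrm_le_ReIm z : nrm z <= `|Re z| + `|Im z|.
rewrite -(@ler_pXn2r _ 2) ?nnegrE ?nge0 ?addr_ge0 ?normr_ge0//.
rewrite nrm_sqr -(real_normK (num_real (Re z))) -(real_normK (num_real (Im z))).
have := normr_ge0 (Re z); have := normr_ge0 (Im z); nra.
Qed.
Lemma ReD z w : Re (z + w) = Re z + Re w.
by case: z; case: w. Qed.
Lemma ImD z w : Im (z + w) = Im z + Im w.
by case: z; case: w. Qed.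
Lemma ReN z : Re (- z) = - Re z.
by case: z. Qed.
Lemma ImN z : Im (- z) = - Im z.
by case: z. Qed.
Lemma ReM z w : Re (z * w) = Re z * Re w - Im z * Im w.
by case: z; case: w. Qed.
Lemma ImM z w : Im (z * w) = Re z * Im w + Im z * Re w.
by case: z; case: w. Qed.
Lemma ReJ z : Re (z^*%C) = Re z.
by case: z. Qed.
Lemma ImJ z : Im (z^*%C) = - Im z.
by case: z. Qed.
Definition ReImE := (ReD, ImD, ReN, ImN, ReM, ImM, ReJ, ImJ).
Lemma ceqP z w : Re z = Re w -> Im z = Im w -> z = w.
by case: z => a b; case: w => c d /= -> ->. Qed.
Lemma nrm_sum I (r : seq I) (F : I -> R[i]) :
 nrm (\sum_(i <- r) F i) <= \sum_(i <- r) nrm (F i).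
elim: r => [|i r IH]; first by rewrite !big_nil nrm0.
by rewrite !big_cons (le_trans (nrmD _ _))// lerD2l.
Qed.
End Modulus.

Create HintDb pos.
Ltac pos := intros; cbv beta; lazymatch goal with
 | |- is_true (@Order.le _ _ _ (@GRing.mul _ _ _)) => first [assumption | apply: mge0; pos]
 | |- is_true (@Order.le _ _ _ (@GRing.add _ _ _)) => first [assumption | apply: addr_ge0; pos]
 | |- is_true (@Order.le _ _ _ (@GRing.inv _ _)) => first [assumption | rewrite invr_ge0; pos]
 | |- is_true (@Order.le _ _ _ (@GRing.exp _ _ _)) => first [assumption | exact: sqr_ge0 | apply: exprn_ge0; pos]
 | |- is_true (@Order.lt _ _ _ (@GRing.mul _ _ _)) => first [assumption | apply: mulr_gt0; pos]
 | |- is_true (@Order.lt _ _ _ (@GRing.add _ _ _)) =>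
   first [assumption | apply: ltr_wpDr; solve [pos] | apply: ltr_wpDl; solve [pos]]
 | |- is_true (@Order.lt _ _ _ (@GRing.inv _ _)) => first [assumption | rewrite invr_gt0; pos]
 | |- is_true (@Order.lt _ _ _ (@GRing.exp _ _ _)) => first [assumption | apply: exprn_gt0; pos]
 | |- is_true (@Order.le _ _ _ (EFin _)) => rewrite lee_fin; pos
 | |- is_true (@Order.le _ _ _ _) => first [assumption | exact: nge0 | exact: enge0 | exact: normr_ge0 | exact: ler0n | exact: ler01 | solve [auto with pos nocore]
   | match goal with H : forall _, is_true _ |- _ => exact: H end | apply: ltW; pos]
 | |- is_true (@Order.lt _ _ _ _) => first [assumption | exact: ltr01 | by rewrite ltr0n | solve [auto with pos nocore]]
 end.

(** * Closure properties of measurable real, complex and vector functions *)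

Section Measurability.
Context {R : realType}.
Section MT.
Context {d : measure_display} {T : measurableType d}.

Definition mR (f : T -> R) := measurable_fun setT f.
Definition mE (f : T -> \bar R) := measurable_fun setT f.
Definition m3 (f : T -> R3 R) := measurable_fun setT (f : T -> measurable_R3 R).
Definition mC (f : T -> R[i]) := mR (fun x => Re (f x)) /\ mR (fun x => Im (f x)).

Lemma mR_cst c : mR (fun=> c). Proof. exact: measurable_cst. Qed.
Lemma mR_D f g : mR f -> mR g -> mR (fun x => f x + g x). Proof. exact: measurable_funD. Qed.
Lemma mR_M f g : mR f -> mR g -> mR (fun x => f x * g x). Proof. exact: measurable_funM. Qed.
Lemma mR_N f : mR f -> mR (fun x => - f x).
exact: measurable_funN. Qed.
Lemma mR_X f n : mR f -> mR (fun x => f x ^+ n).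
by move=> mf; apply: measurable_funX. Qed.
Lemma mR_norm f : mR f -> mR (fun x => `|f x|).
by move=> mf; apply: mcomp. Qed.
Lemma mR_comp (h : R -> R) f : measurable_fun setT h -> mR f -> mR (fun x => h (f x)).
by move=> mh mf; apply: (mcomp mh mf). Qed.
Lemma mR_cont (h : R -> R) f : continuous h -> mR f -> mR (fun x => h (f x)).
by move=> ch; apply: mR_comp; apply: continuous_measurable_fun. Qed.
Lemma mR_sqrt f : mR f -> mR (fun x => Num.sqrt (f x)).
by apply: mR_cont; exact: sqrt_continuous. Qed.
Lemma mR_inv f : mR f -> mR (fun x => (f x)^-1).
apply: mR_comp.
(* Inversion is discontinuous at 0, so it is factored as a sign times [powR] of the absolute value,
   which also returns 0 at 0. *)
have -> : (@GRing.inv R) = (fun x => (if x < 0 then -1 else 1) * powR `|x| (-1)).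
 fext => x; case: ltgtP => x0.
 - by rewrite powR_inv1 ?normr_ge0// ltr0_norm// mulN1r invrN opprK.
 - by rewrite powR_inv1 ?normr_ge0// gtr0_norm// mul1r.
 - by rewrite x0 normr0 powR_inv1// invr0 mulr0.
apply: measurable_funM.
 by apply: measurable_fun_ifT => //=; exact: measurable_fun_ltr.
by apply: (mcomp (f := fun t : R => t `^ (-1))); [exact: measurable_powR|exact: normr_measurable].
Qed.
Lemma mR_exp f : mR f -> mR (fun x => expR (f x)).
by apply: mR_comp; exact: measurable_expR. Qed.
Lemma mR_cos f : mR f -> mR (fun x => cos (f x)).
by apply: mR_cont; exact: continuous_cos. Qed.
Lemma mR_sin f : mR f -> mR (fun x => sin (f x)).
by apply: mR_cont; exact: continuous_sin. Qed.
Lemma mR_ltif f g (h k : T -> R) : mR f -> mR g -> mR h -> mR k ->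
 mR (fun x => if f x < g x then h x else k x).
by move=> mf mg mh mk; apply: measurable_fun_ifT => //; apply: measurable_fun_ltr. Qed.
Lemma mR_leif f g (h k : T -> R) : mR f -> mR g -> mR h -> mR k ->
 mR (fun x => if f x <= g x then h x else k x).
by move=> mf mg mh mk; apply: measurable_fun_ifT => //; apply: measurable_fun_ler. Qed.
Lemma mR_sum I (r : seq I) (f : I -> T -> R) : (forall i, mR (f i)) ->
 mR (fun x => \sum_(i <- r) f i x).
move=> mf; elim: r => [|i r IH].
 by rewrite (_ : (fun _ => _) = cst 0) ?funeqE// => [|x]; [exact: measurable_cst|rewrite big_nil].
rewrite (_ : (fun _ => _) = (fun x => f i x + \sum_(j <- r) f j x)); first exact: mR_D.
by fext => x; rewrite big_cons.
Qed.
Lemma mR_max f g : mR f -> mR g -> mR (fun x => Num.max (f x) (g x)).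
exact: measurable_maxr. Qed.

Lemma m3_pair f g h : mR f -> mR g -> mR h -> m3 (fun x => (f x, g x, h x)).
by move=> mf mg mh; apply: measurable_fun_pair => //; apply: measurable_fun_pair. Qed.
Lemma m3_1 f : m3 f -> mR (fun x => (f x).1.1).
by move=> mf; apply: mcomp => //; apply: mcomp. Qed.
Lemma m3_2 f : m3 f -> mR (fun x => (f x).1.2).
by move=> mf; apply: mcomp => //; apply: mcomp. Qed.
Lemma m3_3 f : m3 f -> mR (fun x => (f x).2).
by move=> mf; apply: mcomp. Qed.
Lemma m3_cst c : m3 (fun=> c). Proof. exact: measurable_cst. Qed.
Lemma m3_D f g : m3 f -> m3 g -> m3 (fun x => f x + g x).
move=> mf mg; apply: (@m3_pair (fun x => (f x).1.1 + (g x).1.1) (fun x => (f x).1.2 + (g x).1.2)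
(fun x => (f x).2 + (g x).2)); apply: mR_D; by [exact: m3_1|exact: m3_2|exact: m3_3].
Qed.
Lemma m3_N f : m3 f -> m3 (fun x => - f x).
move=> mf; apply: (@m3_pair (fun x => - (f x).1.1) (fun x => - (f x).1.2)
(fun x => - (f x).2)); apply: mR_N; by [exact: m3_1|exact: m3_2|exact: m3_3].
Qed.
Lemma m3_Z (a : R) f : m3 f -> m3 (fun x => a *: f x).
move=> mf; apply: (@m3_pair (fun x => a * (f x).1.1) (fun x => a * (f x).1.2)
(fun x => a * (f x).2)); apply: mR_M; try exact: mR_cst; by [exact: m3_1|exact: m3_2|exact: m3_3].
Qed.
Lemma mR_enorm f : m3 f -> mR (fun x => enorm (f x)).
move=> mf; apply: mR_sqrt; apply: mR_D; last by apply: mR_X; exact: m3_3.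
by apply: mR_D; apply: mR_X; [exact: m3_1|exact: m3_2].
Qed.
Lemma mR_of3 (V : measurable_R3 R -> R) f : measurable_fun setT V -> m3 f -> mR (fun x => V (f x)).
by move=> mV mf; apply: (mcomp mV mf). Qed.

Lemma mC_cst c : mC (fun=> c). Proof. by split; exact: mR_cst. Qed.
Lemma mC_D f g : mC f -> mC g -> mC (fun x => f x + g x).
by move=> [f1 f2] [g1 g2]; split; under eq_fun do rewrite ?ReImE; exact: mR_D.
Qed.
Lemma mC_N f : mC f -> mC (fun x => - f x).
by move=> [f1 f2]; split; under eq_fun do rewrite ?ReImE; exact: mR_N. Qed.
Lemma mC_M f g : mC f -> mC g -> mC (fun x => f x * g x).
move=> [f1 f2] [g1 g2]; split; under eq_fun do rewrite ?ReImE; apply: mR_D;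
repeat first [exact: mR_M|apply: mR_N].
Qed.
Lemma mC_conj f : mC f -> mC (fun x => (f x)^*%C).
move=> [f1 f2]; split.
 by under eq_fun do rewrite ReImE.
by under eq_fun do rewrite ImJ; exact: mR_N.
Qed.
Lemma mC_real f : mR f -> mC (fun x => (f x)%:C).
by move=> mf; split => //=; exact: mR_cst. Qed.
Lemma mC_pair f g : mR f -> mR g -> mC (fun x => f x +i* g x).
by []. Qed.
Lemma mC_nrm f : mC f -> mR (fun x => nrm (f x)).
move=> [f1 f2]; under eq_fun do rewrite nrmE.
by apply: mR_sqrt; apply: mR_D; exact: mR_X.
Qed.
Lemma mC_sum I (r : seq I) (f : I -> T -> R[i]) : (forall i, mC (f i)) ->
 mC (fun x => \sum_(i <- r) f i x).
move=> mf; elim: r => [|i r IH].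
 by rewrite (_ : (fun _ => _) = (fun=> 0)) ?funeqE// => [|x]; [exact: mC_cst|rewrite big_nil].
rewrite (_ : (fun _ => _) = (fun x => f i x + \sum_(j <- r) f j x)); first exact: mC_D.
by fext => x; rewrite big_cons.
Qed.
Lemma mE_EFin f : mR f -> mE (fun x => (f x)%:E).
by move=> mf; apply/measurable_EFinP. Qed.
Lemma mE_D f g : mE f -> mE g -> mE (fun x => f x + g x)%E.
exact: emeasurable_funD. Qed.
Lemma mE_M f g : mE f -> mE g -> mE (fun x => f x * g x)%E.
exact: emeasurable_funM. Qed.
Lemma mE_cst c : mE (fun=> c). Proof. exact: measurable_cst. Qed.
Lemma mR_fine f : mE f -> mR (fun x => fine (f x)).
by move=> mf; apply: mcomp => //; apply: fine_measurable. Qed.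
End MT.

Section MT2.
Context {d : measure_display} {T : measurableType d} {d' : measure_display} {T' : measurableType d'}.
Lemma mR_c (f : T' -> R) (h : T -> T') : mR f -> measurable_fun setT h -> mR (fun x => f (h x)).
by move=> mf mh; apply: (mcomp mf mh). Qed.
Lemma mE_c (f : T' -> \bar R) (h : T -> T') : mE f -> measurable_fun setT h -> mE (fun x => f (h x)).
by move=> mf mh; apply: (mcomp mf mh). Qed.
Lemma mC_c (f : T' -> R[i]) (h : T -> T') : mC f -> measurable_fun setT h -> mC (fun x => f (h x)).
by move=> [mf mg] mh; split; [apply: (mR_c mf mh)|apply: (mR_c mg mh)]. Qed.
End MT2.
Lemma m3_id : m3 (fun x : measurable_R3 R => x).
exact: measurable_id. Qed.
End Measurability.

(** * Convergence of complex sequences *)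

Section ComplexConvergence.
Context {R : realType}.
Implicit Types (u v : nat -> R[i]) (l : R[i]).

(** Taken componentwise because the norm attached to [R[i]] is complex-valued; [ccvgP] links it to
    the real modulus. *)
Definition ccvg u l :=
 (fun n => Re (u n)) @ \oo --> Re l /\
 (fun n => Im (u n)) @ \oo --> Im l.

Lemma ccvgP u l : ccvg u l <-> (fun n => nrm (u n - l)) @ \oo --> (0 : R).
split=> [[h1 h2]|h].
- apply: (@squeeze_cvgr _ _ _ _ (fun=> 0) (fun n => `|Re (u n) - Re l| + `|Im (u n) - Im l|)).
 + by near=> n; rewrite nge0/= (le_trans (nrm_le_ReIm _))// !ReImE.
 + exact: cvg_cst.
 + have k (a : nat -> R) b : a @ \oo --> b -> (fun n => `|a n - b|) @ \oo --> (0 : R).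
   move=> h; rewrite -(normr0 R) -(subrr b); apply: cvg_norm.
   by apply: cvgB => //; exact: cvg_cst.
  by rewrite -[0 in X in _ --> X]addr0; apply: cvgD; apply: k.
- split; apply/cvgrPdist_lt => e e0; have /cvgr0_norm_lt/(_ _ e0) := h; apply: filterS => n /=;
  apply: lelt; rewrite distrC (ger0_norm (nge0 _)).
 + by rewrite -ReN -ReD Re_le_nrm.
 + by rewrite -ImN -ImD Im_le_nrm.
Unshelve. all: by end_near.
Qed.

Lemma ccvg_cst l : ccvg (fun=> l) l.
by split; exact: cvg_cst. Qed.
Lemma ccvgD u v l m : ccvg u l -> ccvg v m -> ccvg (fun n => u n + v n) (l + m).
by move=> [a b] [c e]; split; rewrite ReImE; under eq_fun do rewrite ReImE; exact: cvgD.
Qed.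
Lemma ccvgN u l : ccvg u l -> ccvg (fun n => - u n) (- l).
by move=> [a b]; split; rewrite ReImE; under eq_fun do rewrite ReImE; exact: cvgN.
Qed.
Lemma ccvgB u v l m : ccvg u l -> ccvg v m -> ccvg (fun n => u n - v n) (l - m).
by move=> a b; apply: ccvgD => //; exact: ccvgN. Qed.
Lemma ccvgM u v l m : ccvg u l -> ccvg v m -> ccvg (fun n => u n * v n) (l * m).
move=> [a b] [c e]; split; rewrite ReImE; under eq_fun do rewrite ReImE.
 by apply: cvgB; exact: cvgM.
by apply: cvgD; exact: cvgM.
Qed.
Lemma ccvg_real (u : nat -> R) (l : R) : u @ \oo --> l -> ccvg (fun n => (u n)%:C) l%:C.
by move=> h; split => //=; exact: cvg_cst. Qed.
Lemma ccvg_unique u l m : ccvg u l -> ccvg u m -> l = m.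
move=> [a b] [c e]; apply: ceqP; [exact: (cvg_unique _ a c)|exact: (cvg_unique _ b e)].
Qed.
Lemma ccvg_sum I (r : seq I) (F : I -> nat -> R[i]) (L : I -> R[i]) :
 (forall i, ccvg (F i) (L i)) -> ccvg (fun n => \sum_(i <- r) F i n) (\sum_(i <- r) L i).
move=> h; elim: r => [|i r IH].
 rewrite big_nil (_ : (fun _ => _) = fun=> 0); first exact: ccvg_cst.
 by fext => n; rewrite big_nil.
rewrite big_cons (_ : (fun _ => _) = fun n => F i n + \sum_(j <- r) F j n); first exact: ccvgD.
by fext => n; rewrite big_cons.
Qed.
Lemma ccvg_prod I (r : seq I) (F : I -> nat -> R[i]) (L : I -> R[i]) :
 (forall i, ccvg (F i) (L i)) -> ccvg (fun n => \prod_(i <- r) F i n) (\prod_(i <- r) L i).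
move=> h; elim: r => [|i r IH].
 rewrite big_nil (_ : (fun _ => _) = fun=> 1); first exact: ccvg_cst.
 by fext => n; rewrite big_nil.
rewrite big_cons (_ : (fun _ => _) = fun n => F i n * \prod_(j <- r) F j n); first exact: ccvgM.
by fext => n; rewrite big_cons.
Qed.
Lemma ccvg_le u l (M : R) : ccvg u l -> (forall n, nrm (u n) <= M) -> nrm l <= M.
move=> /ccvgP h uM; rewrite leNgt; apply/negP => Ml.
have e0 : 0 < nrm l - M by rewrite subr_gt0.
have /cvgr0_norm_lt/(_ _ e0)[n _ /(_ n (leqnn n)) /=] := h.
rewrite ger0_norm ?nge0// => hn.
have := nrmB (u n) (u n - l); rewrite opprB addrCA subrr addr0 => h2.
by have := uM n; lra.
Qed.

End ComplexConvergence.

(** * Complex integrals and dominated convergence *)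

Section ComplexIntegral.
Context {R : realType} {d : measure_display} {T : measurableType d}.
Variable mu : {measure set T -> \bar R}.
Implicit Types f g : T -> R[i].

Definition cint f : R[i] :=
 (\int[mu]_x Re (f x)) +i* (\int[mu]_x Im (f x)).
Definition cintegrable f := mC f /\ (\int[mu]_x (nrm (f x))%:E < +oo)%E.

Lemma le_nnint (f g : T -> R) : mR f -> mR g -> nneg f ->
 (forall x, f x <= g x) -> (\int[mu]_x (f x)%:E <= \int[mu]_x (g x)%:E)%E.
move=> mf mg f0 fg; apply: ge0_le_integral => //.
- by move=> x _; rewrite lee_fin.
- exact: mE_EFin.
- exact: mE_EFin.
- by move=> x _; rewrite lee_fin.
Qed.

Lemma nnintD (f g : T -> R) : mR f -> mR g -> nneg f -> nneg g ->
 (\int[mu]_x (f x + g x)%:E = \int[mu]_x (f x)%:E + \int[mu]_x (g x)%:E)%E.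
move=> mf mg f0 g0; under eq_integral do rewrite EFinD.
rewrite ge0_integralD//; do ?exact: mE_EFin; by move=> x _; rewrite lee_fin.
Qed.

Lemma nnintZ (c : R) (f : T -> R) : mR f -> 0 <= c -> nneg f ->
 (\int[mu]_x (c * f x)%:E = c%:E * \int[mu]_x (f x)%:E)%E.
move=> mf c0 f0; under eq_integral do rewrite EFinM.
rewrite ge0_integralZl//; first exact: mE_EFin.
by move=> x _; rewrite lee_fin.
Qed.

Lemma nnintD_lty (f g : T -> R) : mR f -> mR g -> nneg f -> nneg g ->
 (\int[mu]_x (f x)%:E < +oo -> \int[mu]_x (g x)%:E < +oo -> \int[mu]_x (f x + g x)%:E < +oo)%E.
by move=> mf mg f0 g0 hf hg; rewrite nnintD// lte_add_pinfty. Qed.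

Lemma nnintZ_lty (c : R) (f : T -> R) : mR f -> 0 <= c -> nneg f ->
 (\int[mu]_x (f x)%:E < +oo -> \int[mu]_x (c * f x)%:E < +oo)%E.
by move=> mf c0 f0 hf; rewrite nnintZ// ltyM// lee_fin. Qed.

Lemma integrable_nn (f : T -> R) : mR f -> (\int[mu]_x (`|f x|)%:E < +oo)%E ->
 mu.-integrable setT (EFin \o f).
by move=> mf h; apply/integrableP; split => //; exact: mE_EFin. Qed.

Lemma cintegrable_le f (g : T -> R) : mC f -> mR g ->
 (forall x, nrm (f x) <= g x) -> (\int[mu]_x (g x)%:E < +oo)%E -> cintegrable f.
move=> mf mg fg ig; split => //; apply: lelt ig; apply: le_nnint => //.
 exact: mC_nrm.
by move=> x; exact: nge0.
Qed.

Lemma cintegrable_Re f : cintegrable f ->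
 mu.-integrable setT (EFin \o (fun x => Re (f x))).
move=> [[m1 m2] h]; apply: integrable_nn => //; apply: lelt h.
by apply: le_nnint => //; [exact: mR_norm|exact: mC_nrm|move=> x; exact: Re_le_nrm].
Qed.
Lemma cintegrable_Im f : cintegrable f ->
 mu.-integrable setT (EFin \o (fun x => Im (f x))).
move=> [[m1 m2] h]; apply: integrable_nn => //; apply: lelt h.
by apply: le_nnint => //; [exact: mR_norm|exact: mC_nrm|move=> x; exact: Im_le_nrm].
Qed.

Lemma cintegrableD f g : cintegrable f -> cintegrable g -> cintegrable (fun x => f x + g x).
move=> [mf hf] [mg hg]; apply: (@cintegrable_le _ (fun x => nrm (f x) + nrm (g x))).
- exact: mC_D.
- by apply: mR_D; exact: mC_nrm.
- by move=> x; exact: nrmD.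
- by apply: nnintD_lty => //; try exact: mC_nrm; move=> x; exact: nge0.
Qed.
Lemma cintegrableZ (c : R[i]) f : cintegrable f -> cintegrable (fun x => c * f x).
move=> [mf hf]; split; first by apply: mC_M => //; exact: mC_cst.
under eq_integral do rewrite nrmM.
by apply: nnintZ_lty => //; [exact: mC_nrm|exact: nge0|move=> x; exact: nge0].
Qed.
Lemma cintegrableN f : cintegrable f -> cintegrable (fun x => - f x).
by move=> h; have := cintegrableZ (-1) h; under eq_fun do rewrite mulN1r.
Qed.
Lemma cintegrableB f g : cintegrable f -> cintegrable g -> cintegrable (fun x => f x - g x).
by move=> hf hg; apply: cintegrableD => //; exact: cintegrableN. Qed.

Lemma cintD f g : cintegrable f -> cintegrable g -> cint (fun x => f x + g x) = cint f + cint g.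
move=> hf hg; apply: ceqP; rewrite ReImE /cint /=.
 under eq_Rintegral do rewrite ReImE.
 by rewrite RintegralD//; exact: cintegrable_Re.
under eq_Rintegral do rewrite ReImE.
by rewrite RintegralD//; exact: cintegrable_Im.
Qed.
Lemma cintZ (c : R[i]) f : cintegrable f -> cint (fun x => c * f x) = c * cint f.
move=> hf; have h1 := cintegrable_Re hf; have h2 := cintegrable_Im hf.
apply: ceqP; rewrite ReImE /cint /=; under eq_Rintegral do rewrite ReImE.
 rewrite RintegralB ?RintegralZl//.
  exact: (integrableZl measurableT (Re c) h1).
 exact: (integrableZl measurableT (Im c) h2).
rewrite RintegralD ?RintegralZl//.
 exact: (integrableZl measurableT (Re c) h2).
exact: (integrableZl measurableT (Im c) h1).
Qed.
Lemma cintN f : cintegrable f -> cint (fun x => - f x) = - cint f.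
by move=> hf; rewrite -mulN1r -cintZ//; congr cint; fext => x; rewrite mulN1r. Qed.
Lemma cintB f g : cintegrable f -> cintegrable g -> cint (fun x => f x - g x) = cint f - cint g.
by move=> hf hg; rewrite cintD ?cintN//; exact: cintegrableN. Qed.
Lemma cint_conj f : cintegrable f -> cint (fun x => (f x)^*%C) = (cint f)^*%C.
move=> hf; apply: ceqP; rewrite ReImE /cint /=; under eq_Rintegral do rewrite ReImE.
 by [].
under eq_Rintegral do rewrite -mulN1r.
by rewrite RintegralZl ?mulN1r//; exact: cintegrable_Im.
Qed.
Lemma cintegrable_conj f : cintegrable f -> cintegrable (fun x => (f x)^*%C).
by move=> [mf hf]; split; [exact: mC_conj|under eq_integral do rewrite nrm_conj].
Qed.
Lemma cint0 : cint (fun=> 0) = 0.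
by apply: ceqP; rewrite /cint /= /Rintegral /= integral0_eq.
Qed.
Lemma cintegrable0 : cintegrable (fun=> 0).
split; first exact: mC_cst.
by rewrite integral0_eq// => x _; rewrite nrm0.
Qed.
Lemma cint_sum I (r : seq I) (F : I -> T -> R[i]) : (forall i, cintegrable (F i)) ->
 cintegrable (fun x => \sum_(i <- r) F i x) /\
 cint (fun x => \sum_(i <- r) F i x) = \sum_(i <- r) cint (F i).
move=> h; elim: r => [|i r [IH1 IH2]].
 under eq_fun do rewrite big_nil; rewrite big_nil cint0; split => //; exact: cintegrable0.
under eq_fun do rewrite big_cons; rewrite big_cons -IH2 cintD//; split => //.
exact: cintegrableD.
Qed.

Lemma cint_le_nrm f : mC f -> ((nrm (cint f))%:E <= \int[mu]_x (nrm (f x))%:E)%E.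
move=> mf; have [hf|] := ltP (\int[mu]_x (nrm (f x))%:E)%E +oo%E; last first.
 by rewrite leye_eq => /eqP ->; rewrite leey.
have If : cintegrable f by [].
have [->|I0] := eqVneq (cint f) 0.
 by rewrite nrm0 integral_ge0// => x _; rewrite lee_fin nge0.
set I := cint f in I0 *.
have mI0 : nrm I != 0 by apply: contra I0 => /eqP/ComplexField.Normc.eq0_normc ->.
(* [c] is the unimodular factor that rotates the integral onto the positive real axis, where its
   modulus is the integral of a real part. *)
pose c := (nrm I)^-1%:C * I^*%C.
have mc : nrm c = 1 by rewrite nrmM nrm_real nrm_conj ger0_norm ?invr_ge0 ?nge0// mulVf.
have e : nrm I = Re (cint (fun x => c * f x)).
 rewrite cintZ// -/I; have -> : c * I = (nrm I)%:C; last by [].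
 rewrite /c -mulrA; have -> : I^*%C * I = (nrm I ^+ 2)%:C.
  by rewrite nrm_sqr; apply: ceqP; rewrite !ReImE /=; ring.
 by rewrite -rmorphM expr2 mulKf.
rewrite e /cint /= /Rintegral.
have Ic := cintegrable_Re (cintegrableZ c If).
rewrite fineK; last exact: integrable_fin_num.
apply: (via (\int[mu]_x `|(Re (c * f x))%:E|)%E).
 apply: le_trans (le_abse_integral _ _ _) => //; last exact: measurable_int Ic.
 exact: lee_abs.
apply: le_nnint.
- by apply: mR_norm; exact: (proj1 (mC_M (mC_cst c) mf)).
- exact: mC_nrm.
- by move=> x; rewrite normr_ge0.
- by move=> x; rewrite (le_trans (Re_le_nrm _))// nrmM mc mul1r.
Qed.

Lemma cint_le f (g : T -> R) (M : R) : mC f -> mR g -> (forall x, nrm (f x) <= g x) ->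
 (\int[mu]_x (g x)%:E <= M%:E)%E -> nrm (cint f) <= M.
move=> mf mg fg gM; rewrite -lee_fin; apply: le_trans gM; apply: le_trans (cint_le_nrm mf) _.
by apply: le_nnint => //; [exact: mC_nrm|move=> x; exact: nge0].
Qed.

Lemma eq_cint_ae f g : mC f -> mC g -> {ae mu, forall x, f x = g x} -> cint f = cint g.
move=> [f1 f2] [g1 g2] fg; apply: ceqP; rewrite /cint /= /Rintegral; congr fine;
 apply: ae_eq_integral => //; do ?exact: mE_EFin; by apply: filterS fg => x /= ->.
Qed.

Lemma mC_lim (f_ : nat -> T -> R[i]) f : (forall n, mC (f_ n)) ->
 (forall x, ccvg (f_ ^~ x) (f x)) -> mC f.
move=> mf h; split.
 apply: (measurable_fun_cvg (h := fun n x => Re (f_ n x))) => [n|x _].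
  exact: (mf n).1.
 exact: (h x).1.
apply: (measurable_fun_cvg (h := fun n x => Im (f_ n x))) => [n|x _].
 exact: (mf n).2.
exact: (h x).2.
Qed.

Lemma Rint_dct (f_ : nat -> T -> R) (f g : T -> R) : (forall n, mR (f_ n)) ->
 (forall x, f_ ^~ x @ \oo --> f x) -> mR g -> (\int[mu]_x (g x)%:E < +oo)%E ->
 (forall n x, `|f_ n x| <= g x) ->
 (fun n => \int[mu]_x f_ n x) @ \oo --> \int[mu]_x f x.
move=> mf_ hf mg ig fg.
have g0 x : 0 <= g x by apply: le_trans (fg 0%N x).
have mf : mR f by apply: (measurable_fun_cvg (h := f_)) => // x _; exact: hf.
have [] := @dominated_convergence _ _ _ mu setT measurableT (fun n x => (f_ n x)%:E) (EFin \o f) (EFin \o g).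
- by move=> n; exact: mE_EFin.
- exact: mE_EFin.
- by apply: aeW => x _; apply: cvg_EFin; [near=> n|exact: hf].
- by apply: integrable_nn => //; under eq_integral do rewrite ger0_norm//.
- by apply: aeW => x n _ /=; rewrite lee_fin.
move=> If _ h; apply: fine_cvg; rewrite fineK; first exact: h.
exact: integrable_fin_num.
Unshelve. all: by end_near.
Qed.

Lemma cint_dct (f_ : nat -> T -> R[i]) f (g : T -> R) : (forall n, mC (f_ n)) ->
 (forall x, ccvg (f_ ^~ x) (f x)) -> mR g -> (\int[mu]_x (g x)%:E < +oo)%E ->
 (forall n x, nrm (f_ n x) <= g x) ->
 ccvg (fun n => cint (f_ n)) (cint f).
move=> mf hf mg ig fg; split; apply: (@Rint_dct _ _ g) => //.
- by move=> n; exact: (mf n).1.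
- by move=> x; exact: (hf x).1.
- by move=> n x; rewrite (le_trans (Re_le_nrm _)).
- by move=> n; exact: (mf n).2.
- by move=> x; exact: (hf x).2.
- by move=> n x; rewrite (le_trans (Im_le_nrm _)).
Qed.

End ComplexIntegral.

(** * Tonelli and Fubini for real and complex integrands *)

Section Fubini.
Context {R : realType} {d1 d2 : measure_display} {T1 : measurableType d1} {T2 : measurableType d2}.
Variables (m1 : {sigma_finite_measure set T1 -> \bar R}) (m2 : {sigma_finite_measure set T2 -> \bar R}).

Lemma mE_nnint (f : T1 -> T2 -> R) : mR (fun p => f p.1 p.2) -> (forall x y, 0 <= f x y) ->
 mE (fun x => \int[m2]_y (f x y)%:E)%E.
move=> mf f0; apply: (@measurable_fun_fubini_tonelli_F _ _ _ _ _ m2 (fun p => (f p.1 p.2)%:E)).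
 exact: mE_EFin.
by move=> p; rewrite lee_fin.
Qed.

(** Integrability plays no part in measurability: the integral is [fine] of a difference of two
    nonnegative integrals, each measurable in x by Tonelli. *)
Lemma mR_Rint (f : T1 -> T2 -> R) : mR (fun p => f p.1 p.2) -> mR (fun x => \int[m2]_y f x y).
move=> mf; apply: mR_fine.
have -> : (fun x => \int[m2]_y (f x y)%:E)%E = (fun x => \int[m2]_y (Num.max (f x y) 0)%:E -
  \int[m2]_y (Num.max (- f x y) 0)%:E)%E.
 fext => x; rewrite integralE; congr (_ - _)%E; apply: eq_integral => y _;
 by rewrite ?funeposE ?funenegE /= -?EFinN EFin_max.
apply: emeasurable_funB.
 apply: mE_nnint; first by apply: mR_max => //; exact: mR_cst.
 by move=> x y; rewrite le_max lexx orbT.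
apply: mE_nnint; first by apply: mR_max => //; [exact: mR_N|exact: mR_cst].
by move=> x y; rewrite le_max lexx orbT.
Qed.

Lemma mC_cint (f : T1 -> T2 -> R[i]) : mC (fun p => f p.1 p.2) -> mC (fun x => cint m2 (f x)).
by move=> [h1 h2]; split; apply: mR_Rint. Qed.

Lemma nn_tonelli (f : T1 -> T2 -> R) : mR (fun p => f p.1 p.2) -> (forall x y, 0 <= f x y) ->
 (\int[m1]_x \int[m2]_y (f x y)%:E = \int[m2]_y \int[m1]_x (f x y)%:E)%E.
move=> mf f0; apply: (@fubini_tonelli _ _ _ _ _ m1 m2 (fun p => (f p.1 p.2)%:E)).
 exact: mE_EFin.
by move=> p; rewrite lee_fin.
Qed.

Lemma nn_prod (f : T1 -> T2 -> R) : mR (fun p => f p.1 p.2) -> (forall x y, 0 <= f x y) ->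
 (\int[m1 \x m2]_p (f p.1 p.2)%:E = \int[m1]_x \int[m2]_y (f x y)%:E)%E.
move=> mf f0; apply: (@fubini_tonelli1 _ _ _ _ _ m1 m2 (fun p => (f p.1 p.2)%:E)).
 exact: mE_EFin.
by move=> p; rewrite lee_fin.
Qed.

Lemma Rint_fubini (f : T1 -> T2 -> R) : mR (fun p => f p.1 p.2) ->
 (\int[m1]_x \int[m2]_y (`|f x y|)%:E < +oo)%E ->
 \int[m1]_x \int[m2]_y f x y = \int[m2]_y \int[m1]_x f x y.
move=> mf h.
have If : (m1 \x m2)%E.-integrable setT (EFin \o (fun p => f p.1 p.2)).
 apply: integrable_nn => //; rewrite (nn_prod (f := fun x y => `|f x y|))//.
 by apply: mR_norm.
rewrite /Rintegral.
(* Iterated real integrals truncate with [fine]; by integrability almost every section has a finite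
   integral, where [fine] changes nothing. *)
have e1 : (\int[m1]_x (fine (\int[m2]_y (f x y)%:E))%:E = \int[m1]_x \int[m2]_y (f x y)%:E)%E.
 apply: ae_eq_integral => //.
 - exact: mE_EFin (mR_Rint mf).
 - exact: measurable_fubini_F If.
 - have := ae_integrable1 If; apply: filterS => x /= hx _; rewrite fineK//.
  exact: integrable_fin_num.
have e2 : (\int[m2]_y (fine (\int[m1]_x (f x y)%:E))%:E = \int[m2]_y \int[m1]_x (f x y)%:E)%E.
 apply: ae_eq_integral => //.
 - have /mR_fine/mE_EFin := measurable_fubini_G If; exact.
 - exact: measurable_fubini_G If.
 - have := ae_integrable2 If; apply: filterS => x /= hx _; rewrite fineK//.
  exact: integrable_fin_num.
by rewrite e1 e2; congr fine; exact: (Fubini If).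
Qed.

Lemma cint_fubini (f : T1 -> T2 -> R[i]) : mC (fun p => f p.1 p.2) ->
 (\int[m1]_x \int[m2]_y (nrm (f x y))%:E < +oo)%E ->
 cint m1 (fun x => cint m2 (f x)) = cint m2 (fun y => cint m1 (f ^~ y)).
move=> [mf1 mf2] h.
have k (g : T1 -> T2 -> R) : mR (fun p => g p.1 p.2) -> (forall x y, `|g x y| <= nrm (f x y)) ->
  (\int[m1]_x \int[m2]_y (`|g x y|)%:E < +oo)%E.
 move=> mg gf; apply: lelt h.
 have mg' : mR (fun p : T1 * T2 => `|g p.1 p.2|) by exact: mR_norm.
 have mf' : mR (fun p : T1 * T2 => nrm (f p.1 p.2)) by apply: mC_nrm; split.
 rewrite -(nn_prod (f := fun x y => `|g x y|) mg' (fun x y => normr_ge0 _)).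
 rewrite -(nn_prod (f := fun x y => nrm (f x y)) mf' (fun x y => nge0 _)).
 exact: (le_nnint _ mg' mf').
apply: ceqP.
 exact: (Rint_fubini mf1 (k (fun x y => Re (f x y)) mf1 (fun x y => Re_le_nrm _))).
exact: (Rint_fubini mf2 (k (fun x y => Im (f x y)) mf2 (fun x y => Im_le_nrm _))).
Qed.
End Fubini.

(** * Lebesgue measure on R^3: sigma-finiteness and affine changes of variables *)

Section Leb3.
Context {R : realType}.
Notation X := (measurable_R3 R).
Let L : {sigma_finite_measure set (mTR R) -> \bar R} := @lebesgue_measure R.

Lemma leb3_box (A B C : set (mTR R)) : measurable A -> measurable B -> measurable C ->
 (@leb3 R (A `*` B `*` C) = L A * L B * L C)%E.
move=> mA mB mC; rewrite -(product_measure1E L L mA mB).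
by apply: (product_measure1E (L \x L)%E L) => //; exact: measurableX.
Qed.

Lemma big_itv (a : R) (n : nat) : `|a| < n%:R -> `[- n%:R, n%:R]%classic a.
by rewrite /= in_itv /= -ler_norml; exact: ltW. Qed.

Lemma leb1_itv_lty (n : nat) : (L [set` `[(- n%:R)%R, (n%:R : R)%R]] < +oo)%E.
have := lebesgue_measure_itv (`[(- n%:R)%R, (n%:R : R)%R]); rewrite /L /= => ->.
by case: ifPn => _; rewrite -?EFinD ltry.
Qed.

Lemma leb2_sigma_finite : sigma_finite setT (L \x L)%E.
pose I (n : nat) : set (mTR R) := `[- n%:R, n%:R]%classic.
exists (fun n => I n `*` I n).
 apply/esym/seteqP; split => // -[a b] _.
 have hn := truncnS_gt (`|a| + `|b|).
 exists (Num.truncn (`|a| + `|b|)).+1 => //=.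
 have := normr_ge0 a; have := normr_ge0 b.
 by move=> ? ?; split; apply: big_itv => /=; lra.
move=> n; have mI : measurable (I n) by exact: measurable_itv.
split; first exact: measurableX.
have h := leb1_itv_lty n; have h' : L (I n) \is a fin_num by rewrite ge0_fin_numE.
by rewrite (product_measure1E L L mI mI) ltyM.
Qed.

Lemma leb3_sigma_finite : sigma_finite setT (@leb3 R).
pose I (n : nat) : set (mTR R) := `[- n%:R, n%:R]%classic.
exists (fun n => I n `*` I n `*` I n).
 apply/esym/seteqP; split => // -[[a b] c] _.
 have hn := truncnS_gt (`|a| + `|b| + `|c|).
 exists (Num.truncn (`|a| + `|b| + `|c|)).+1 => //=.
 have := normr_ge0 a; have := normr_ge0 b; have := normr_ge0 c.
 by move=> ? ? ?; split; [split|]; apply: big_itv => /=; lra.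
move=> n; have mI : measurable (I n) by exact: measurable_itv.
split; first by apply: measurableX => //; exact: measurableX.
have h := leb1_itv_lty n; have h' : L (I n) \is a fin_num by rewrite ge0_fin_numE.
by rewrite leb3_box// ltyM// ?mule_ge0// fin_numM.
Qed.
Definition leb2 : {sigma_finite_measure set (mTR R * mTR R)%type -> \bar R} :=
 HB.pack (L \x L)%E (Measure.on (L \x L)%E) (@Measure_isSigmaFinite.Build _ (mTR R * mTR R)%type R (L \x L)%E leb2_sigma_finite).
Fact mu3_key : unit. Proof. by []. Qed.
Definition mu3_unlocked : {sigma_finite_measure set X -> \bar R} :=
 (HB.pack (@leb3 R : set X -> \bar R) (Measure.on (@leb3 R)) (@Measure_isSigmaFinite.Build _ X R (@leb3 R) leb3_sigma_finite)).
(** The measure [leb3] packed with the sigma-finiteness that Tonelli and Fubini ask for; locked so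
    that the product structure stays folded. *)
Definition mu3 := locked_with mu3_key mu3_unlocked.
Lemma mu3E : (mu3 : set X -> \bar R) = leb3. Proof. by rewrite /mu3 unlock. Qed.
Lemma leb3E (f : X -> \bar R) : (\int[leb3]_x f x = \int[mu3]_x f x)%E. Proof. by rewrite mu3E. Qed.
Lemma cintegralE f : cintegral f = cint mu3 f.
by rewrite /cintegral /cint /mu3 unlock. Qed.

Lemma nnint3E (f : X -> R) : mR f -> nneg f ->
 (\int[mu3]_x (f x)%:E = \int[L]_a \int[L]_b \int[L]_c (f (a, b, c))%:E)%E.
move=> mf f0.
have e1 := @fubini_tonelli1 _ _ _ _ R leb2 L (fun x => (f x)%:E) (mE_EFin mf) (fun x => f0 x).
rewrite -leb3E [LHS]e1.
have mF : mE (fubini_F L (fun x => (f x)%:E)).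
 by apply: measurable_fun_fubini_tonelli_F => //; exact: mE_EFin.
have F0 p : (0 <= fubini_F L (fun x => (f x)%:E) p)%E by apply: integral_ge0 => x _; rewrite lee_fin.
exact: (@fubini_tonelli1 _ _ _ _ R L L _ mF F0).
Qed.

(** The image of Lebesgue measure under the affine map, multiplied by [al], gives each half-open
    interval its length, so it is Lebesgue measure by uniqueness. *)
Lemma nnint_affine1 (al be : R) (f : mTR R -> \bar R) : 0 < al -> measurable_fun setT f -> (forall x, (0 <= f x)%E) ->
 (\int[L]_x f x = al%:E * \int[L]_x f (al * x + be)%R)%E.
move=> al0 mf f0.
pose h (x : mTR R) : mTR R := al * x + be.
have mh : measurable_fun setT h by apply: measurable_funD => //; exact: measurable_funM.
pose H : {mfun (mTR R) >-> (mTR R)} := HB.pack h (isMeasurableFun.Build _ _ _ _ h mh).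
have e1 : (\int[pushforward L H]_x f x = \int[L]_x f (al * x + be)%R)%E.
 by rewrite ge0_integral_pushforward//.
rewrite -e1 -[X in (X * _)%E]/((NngNum (ltW al0))%:num%:E).
rewrite -(ge0_integral_mscale _ measurableT)//.
apply: eq_measure_integral => A mA _.
apply: lebesgue_measure_unique => // _ [[a b]] _ <-.
have e : h @^-1` `]a, b]%classic = `](a - be) / al, (b - be) / al]%classic.
 apply/seteqP; split => x; rewrite /= /h !in_itv /= => /andP[h1 h2]; apply/andP.
  by rewrite ltr_pdivrMr// ler_pdivlMr// mulrC ltrBlDr lerBrDr.
 by move: h1 h2; rewrite ltr_pdivrMr// ler_pdivlMr// mulrC ltrBlDr lerBrDr.
transitivity (al%:E * lebesgue_measure [set` `]((a - be) / al)%R, ((b - be) / al)%R]])%E; last first.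
 by rewrite -e.
rewrite !lebesgue_measure_itv /= !lte_fin ltr_pM2r ?invr_gt0// ltrD2r.
case: ifPn => _; rewrite ?mule0//.
by rewrite -!EFinD -EFinM -mulrBl mulrC mulfVK ?gt_eqF//; congr (_%:E); ring.
Qed.

Lemma nnint3_affine (al : R) (be : R3 R) (f : R3 R -> R) : 0 < al -> @mR R _ X f -> nneg f ->
 (\int[mu3]_x (f x)%:E = (al ^+ 3)%:E * \int[mu3]_x (f (al *: x + be)%R)%:E)%E.
move=> al0 mf f0.
have mg : mR (fun x : X => f (al *: x + be)).
 by apply: mR_of3 => //; apply: m3_D; [apply: m3_Z; exact: m3_id|exact: m3_cst].
rewrite nnint3E// [in RHS]nnint3E//.
have al0' : 0 <= al by exact: ltW.
pose G1 (p : mTR R * mTR R) := (\int[L]_c (f (p.1, p.2, c))%:E)%E.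
have mG1 : mE G1.
 have := @measurable_fun_fubini_tonelli_F _ _ _ _ _ L (fun x : X => (f x)%:E) (mE_EFin mf) (fun x => f0 x).
 by congr mE; fext => -[a b].
have G10 p : (0 <= G1 p)%E by apply: integral_ge0 => x _; rewrite lee_fin.
pose G2 (a : mTR R) := (\int[L]_b G1 (a, b))%E.
have mG2 : mE G2 by exact: (@measurable_fun_fubini_tonelli_F _ _ _ _ _ L G1 mG1 G10).
have G20 p : (0 <= G2 p)%E by apply: integral_ge0.
have maff (d : R) : measurable_fun setT (fun x : mTR R => al * x + d : mTR R).
 by apply: measurable_funD => //; exact: measurable_funM.
transitivity (\int[L]_a G2 a)%E; first by [].
rewrite (nnint_affine1 be.1.1 al0 mG2 G20).
have e2 a : G2 a = (al%:E * \int[L]_b G1 (a, (al * b + be.1.2)%R))%E.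
 rewrite /G2 (nnint_affine1 be.1.2 al0)//.
 exact: (mE_c mG1 (pair1_measurable _)).
have e1 p : G1 p = (al%:E * \int[L]_c (f (p.1, p.2, (al * c + be.2)%R))%:E)%E.
 rewrite /G1 (nnint_affine1 be.2 al0)//; last by move=> x; rewrite lee_fin.
 apply: mE_EFin; apply: (mR_c mf); exact: (pair1_measurable (p.1, p.2)).
have mH1 : mE (fun p : mTR R * mTR R => \int[L]_c (f (p.1, p.2, (al * c + be.2)%R))%:E)%E.
 apply: (@mE_nnint _ _ _ _ _ L (fun p c => f (p.1, p.2, (al * c + be.2)%R))) => //.
 apply: (mR_c mf); apply: m3_pair => /=.
 - by apply: mcomp.
 - by apply: mcomp.
 - by apply: measurable_funD => //; apply: measurable_funM.
have H10 p : (0 <= \int[L]_c (f (p.1, p.2, (al * c + be.2)%R))%:E)%E by apply: integral_ge0 => x _; rewrite lee_fin.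
have mH1' a : mE (fun b : mTR R => \int[L]_c (f ((a, (al * b + be.1.2)%R), (al * c + be.2)%R))%:E)%E.
 exact: (mE_c mH1 (mcomp (pair1_measurable a) (maff _))).
have mH2 : mE (fun a : mTR R => \int[L]_b \int[L]_c (f (((al * a + be.1.1)%R, (al * b + be.1.2)%R), (al * c + be.2)%R))%:E)%E.
 apply: (@measurable_fun_fubini_tonelli_F _ _ _ _ _ L (fun p => \int[L]_c (f (((al * p.1 + be.1.1)%R, (al * p.2 + be.1.2)%R), (al * c + be.2)%R))%:E)%E) => //.
  apply: (mE_c mH1 (h := fun p : mTR R * mTR R => ((al * p.1 + be.1.1)%R : mTR R, (al * p.2 + be.1.2)%R : mTR R))).
  apply: measurable_fun_pair; apply: measurable_funD => //; exact: measurable_funM.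
 by move=> p; exact: (H10 (_, _)).
transitivity (al%:E * \int[L]_a (al%:E * (al%:E * \int[L]_b \int[L]_c (f (((al * a + be.1.1)%R, (al * b + be.1.2)%R), (al * c + be.2)%R))%:E)))%E.
 congr (_ * _)%E; apply: eq_integral => a _; rewrite e2; congr (_ * _)%E.
 rewrite -(ge0_integralZl_EFin _ _ _ (mH1' _))//; last by move=> b _; exact: (H10 (_, _)).
 by apply: eq_integral => b _; rewrite e1.
rewrite ge0_integralZl_EFin//; last 2 first.
- by move=> a _; apply: mule_ge0; rewrite ?lee_fin//; apply: integral_ge0 => b _; exact: (H10 (_, _)).
- exact: emeasurable_funM.
rewrite ge0_integralZl_EFin//; last by move=> a _; apply: integral_ge0 => b _; exact: (H10 (_, _)).
by rewrite !muleA -!EFinM -expr2 -exprSr.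
Qed.
End Leb3.

(** * Translations, balls, and integrals of inverse powers by dyadic shells *)

Section Leb3b.
Context {R : realType}.
Notation X := (measurable_R3 R).
Notation mu := (@mu3 R).
Notation mRX := (@mR R _ X).
Notation mCX := (@mC R _ X).

Lemma nnint_shift (a : R3 R) (f : R3 R -> R) : mRX f -> nneg f ->
 (\int[mu]_x (f (x + a)%R)%:E = \int[mu]_x (f x)%:E)%E.
move=> mf f0; rewrite [RHS](@nnint3_affine _ 1 a)//.
by rewrite expr1n mul1e; apply: eq_integral => x _; rewrite scale1r.
Qed.

Lemma mR_shift (a : R3 R) (f : R3 R -> R) : mRX f -> mRX (fun x : R3 R => f (x + a)).
by move=> mf; apply: mR_of3 => //; apply: m3_D; [exact: m3_id|exact: m3_cst]. Qed.
Lemma mC_shift (a : R3 R) (f : R3 R -> R[i]) : mCX f -> mCX (fun x : R3 R => f (x + a)).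
by move=> [mf mg]; split; [exact: (mR_shift a mf)|exact: (mR_shift a mg)]. Qed.

Lemma Rint_shift (a : R3 R) (f : R3 R -> R) : mRX f ->
 \int[mu]_x (f (x + a)) = \int[mu]_x f x.
move=> mf; rewrite /Rintegral; congr fine; rewrite integralE [RHS]integralE.
have mp : mRX (fun x : R3 R => Num.max (f x) 0) by apply: mR_max => //; exact: mR_cst.
have mn : mRX (fun x : R3 R => Num.max (- f x) 0) by apply: mR_max; [exact: mR_N|exact: mR_cst].
have p0 (x : X) : 0 <= Num.max (f x) 0 by rewrite le_max lexx orbT.
have n0 (x : X) : 0 <= Num.max (- f x) 0 by rewrite le_max lexx orbT.
have h1 := nnint_shift a mp p0; have h2 := nnint_shift a mn n0.
congr (_ - _)%E.
 transitivity (\int[mu]_x (Num.max (f (x + a)%R) 0)%:E)%E; [|rewrite h1];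
 by apply: eq_integral => x _; rewrite funeposE EFin_max.
transitivity (\int[mu]_x (Num.max (- f (x + a)%R)%R 0)%:E)%E; [|rewrite h2];
by apply: eq_integral => x _; rewrite funenegE EFin_max EFinN.
Qed.

Lemma cint_shift (a : R3 R) (f : R3 R -> R[i]) : mCX f ->
 cint mu (fun x => f (x + a)) = cint mu f.
by move=> [m1 m2]; apply: ceqP; [exact: (Rint_shift a m1)|exact: (Rint_shift a m2)]. Qed.

Definition ballf (y : R3 R) (r : R) (x : R3 R) : R := if dist x y <= r then 1 else 0.
Lemma ballf_ge0 y r x : 0 <= ballf y r x.
by rewrite /ballf; case: ifP. Qed.
Lemma mR_dist (y : R3 R) : mRX (fun x : R3 R => dist x y).
by apply: mR_enorm; apply: m3_D; [exact: m3_id|apply: m3_N; exact: m3_cst]. Qed.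
Lemma mR_ballf y r : mRX (ballf y r).
by apply: mR_leif; try exact: mR_cst; exact: mR_dist. Qed.

(** The ball lies in a cube of side [2 * r]. *)
Lemma nnballf (y : R3 R) (r : R) : 0 <= r -> (\int[mu]_x (ballf y r x)%:E <= (8 * r ^+ 3)%:E)%E.
move=> r0.
pose I (a : R) : set (mTR R) := [set` `[a - r, a + r]].
have mI a : measurable (I a) by exact: measurable_itv.
pose B : set X := I y.1.1 `*` I y.1.2 `*` I y.2.
have mB : measurable B by do 2 (apply: measurableX => //).
have LI a : lebesgue_measure (I a) = (2 * r)%:E.
 rewrite /I lebesgue_measure_itv /= lte_fin.
 by case: ifPn => h; rewrite -?EFinD; congr (_%:E); lra.
apply: (via (\int[mu]_x (\1_B x)%:E)%E); last first.
 rewrite integral_indic// setIT.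
 have e := leb3_box (mI y.1.1) (mI y.1.2) (mI y.2); rewrite -mu3E in e.
 rewrite [X in (X <= _)%E]e.
 apply: (via ((2 * r)%:E * (2 * r)%:E * (2 * r)%:E)%E).
  by apply: eqle; congr (_ * _ * _)%E; exact: LI.
 by rewrite -!EFinM lee_fin; lra.
apply: le_nnint.
- exact: mR_ballf.
- exact: measurable_indic.
- exact: ballf_ge0.
- move=> x; rewrite /ballf; case: ifPn => // h; rewrite indicE mem_set//.
 have h1 := le_trans (ler_coord1 _) h; have h2 := le_trans (ler_coord2 _) h; have h3 := le_trans (ler_coord3 _) h.
 move: h1 h2 h3 => /=; rewrite !ler_norml => /andP[? ?] /andP[? ?] /andP[? ?].
 by split; [split|]; rewrite /I /= in_itv /=; apply/andP; split; lra.
Qed.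

(** At each point f is at most the sum over j of [c j] times the indicator of the j-th ball, and
    that ball has volume at most [8 * rho j ^+ 3]. *)
Lemma dyadic_bound (y : R3 R) (f : R3 R -> R) (c rho : nat -> R) (M : R) : mRX f -> nneg f ->
 nneg c -> nneg rho ->
 (forall x, f x = 0 \/ exists2 j, f x <= c j & dist x y <= rho j) ->
 (forall n, \sum_(0 <= j < n) c j * (8 * rho j ^+ 3) <= M) ->
 (\int[mu]_x (f x)%:E <= M%:E)%E.
move=> mf f0 c0 r0 hf hM.
have g0 j x : 0 <= c j * ballf y (rho j) x by rewrite mge0 ?ballf_ge0.
have mg j : mE (fun x : X => (c j * ballf y (rho j) x)%:E).
 by apply: mE_EFin; apply: mR_M; [exact: mR_cst|exact: mR_ballf].
apply: (via (\int[mu]_x \sum_(j <oo) (c j * ballf y (rho j) x)%:E)%E).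
 apply: ge0_le_integral => //.
 - by move=> x _; rewrite lee_fin.
 - exact: mE_EFin.
 - exact: (ge0_emeasurable_sum (P := xpredT) (h := fun k (x : X) => (c k * ballf y (rho k) x)%:E) (fun k (x : X) _ _ => g0 k x) (fun k _ => mg k)).
 - move=> x _; have [->|[j fj xj]] := hf x.
   by apply: nneseries_ge0 => n _ _; rewrite lee_fin.
  have h := @nneseries_lim_ge _ (fun j => (c j * ballf y (rho j) x)%:E) xpredT 0%N j.+1.
  apply: le_trans (h _); last by move=> n _ _; rewrite lee_fin.
  rewrite big_nat_recr//= -[leLHS]add0e; apply: leeD.
   by apply: sume_ge0 => i _; rewrite lee_fin.
  by rewrite lee_fin /ballf xj mulr1.
rewrite integral_nneseries//; last by move=> n x _; rewrite lee_fin.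
apply: lime_le.
 by apply: is_cvg_nneseries => n _ _; apply: integral_ge0 => x _; rewrite lee_fin.
apply: nearW => n; apply: (via (\sum_(0 <= j < n) c j * (8 * rho j ^+ 3))%:E); last by rewrite lee_fin.
rewrite -sumEFin; apply: lee_sum => j _.
rewrite nnintZ ?ballf_ge0//; last 2 first.
- exact: mR_ballf.
- by move=> x; exact: ballf_ge0.
by rewrite [leRHS]EFinM; apply: leewl; [rewrite lee_fin|exact: nnballf].
Qed.

Lemma geo_half_sum (n : nat) : \sum_(0 <= j < n) (2^-1 : R) ^+ j <= 2.
have -> : \sum_(0 <= j < n) (2^-1 : R) ^+ j = 2 - 2 * 2^-1 ^+ n.
 elim: n => [|n IH]; first by rewrite big_geq// expr0 mulr1 subrr.
 by rewrite big_nat_recr//= IH exprS; field.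
by rewrite lerBlDr lerDl mge0// exprn_ge0.
Qed.

Lemma half_pow_lt (e : R) : 0 < e -> exists n : nat, 2^-1 ^+ n < e.
move=> e0; have [n hn] : exists n : nat, e^-1 < n%:R.
 by exists (Num.truncn e^-1).+1; exact: truncnS_gt.
exists n; rewrite exprVn invf_plt ?posrE ?exprn_gt0//.
apply: lt_le_trans hn _; rewrite -natrX ler_nat; exact/ltnW/ltn_expl.
Qed.

(** Prepared for the composition of two kernels $|x-y|^{-2}$: the inverse square is integrable near
    its pole, the inverse fourth power ([far4]) away from it. *)
Definition near2 (y : R3 R) (r : R) (x : R3 R) : R :=
 if dist x y < r then (dist x y ^+ 2)^-1 else 0.
Definition far4 (y : R3 R) (r : R) (x : R3 R) : R :=
 if dist x y < r then 0 else (dist x y ^+ 4)^-1.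
Lemma near2_ge0 y r x : 0 <= near2 y r x.
by rewrite /near2; case: ifP => // _; rewrite invr_ge0 sqr_ge0. Qed.
Lemma far4_ge0 y r x : 0 <= far4 y r x.
by rewrite /far4; case: ifP => // _; rewrite invr_ge0 exprn_even_ge0. Qed.
Lemma mR_near2 y r : mRX (near2 y r).
apply: mR_ltif; try exact: mR_cst; try exact: mR_dist. by apply: mR_inv; apply: mR_X; exact: mR_dist. Qed.
Lemma mR_far4 y r : mRX (far4 y r).
apply: mR_ltif; try exact: mR_cst; try exact: mR_dist. by apply: mR_inv; apply: mR_X; exact: mR_dist. Qed.

Lemma nnint_near2 (y : R3 R) (r : R) : 0 < r -> (\int[mu]_x (near2 y r x)%:E <= (64 * r)%:E)%E.
move=> r0; have r1 : 0 <= r by exact: ltW.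
(* On the shell between radii $r2^{-j-1}$ and $r2^{-j}$ the contribution is
   $4^{j+1}r^{-2}\cdot8r^38^{-j}=32r2^{-j}$; the sum is at most [64 * r]. *)
apply: (@dyadic_bound y _ (fun j => (r * 2^-1 ^+ j.+1) ^- 2) (fun j => r * 2^-1 ^+ j)).
- exact: mR_near2.
- exact: near2_ge0.
- by move=> n; rewrite invr_ge0 sqr_ge0.
- by move=> n; rewrite mge0// exprn_ge0.
- move=> x; rewrite /near2; case: ifPn => hr; last by left.
 set a := enorm _ in hr *.
 have [a0|a0] := leP a 0.
  left; have -> : a = 0 by apply/eqP; rewrite eq_le a0 enge0.
  by rewrite expr0n invr0.
 right; have ex : exists n, r * 2^-1 ^+ n.+1 <= a.
  have [n hn] := half_pow_lt (divr_gt0 a0 r0); exists n.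
  rewrite exprS; move: hn; rewrite ltr_pdivlMr// => hn.
  have : 0 <= 2^-1 ^+ n :> R by rewrite exprn_ge0.
  by nra.
 case: (ex_minnP ex) => j hj jmin; exists j.
  have p0 : 0 < r * 2^-1 ^+ j.+1 by rewrite mulr_gt0// exprn_gt0// invr_gt0.
  by rewrite lef_pV2 ?posrE ?exprn_gt0// lerXn2r// nnegrE ltW.
 case: j hj jmin => [|j] hj jmin; first by rewrite expr0 mulr1 ltW.
 rewrite leNgt; apply/negP => h.
 by have := jmin j (ltW h); rewrite ltnn.
- move=> n; rewrite (eq_bigr (fun j => (32 * r) * 2^-1 ^+ j)); last first.
  move=> j _; have h : 2^-1 ^+ j != 0 :> R by rewrite expf_neq0// invr_neq0.
  by rewrite [2^-1 ^+ j.+1]exprS; move: (2^-1 ^+ j) h => p h; field; rewrite h gt_eqF.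
 rewrite -mulr_sumr; have := geo_half_sum n; nra.
Qed.

Lemma nnint_far4 (y : R3 R) (r : R) : 0 < r -> (\int[mu]_x (far4 y r x)%:E <= (128 / r)%:E)%E.
move=> r0; have r1 : 0 <= r by exact: ltW.
(* Between radii $r2^j$ and $r2^{j+1}$ the contribution is
   $r^{-4}16^{-j}\cdot64r^38^j=64r^{-1}2^{-j}$. *)
apply: (@dyadic_bound y _ (fun j => (r * 2 ^+ j) ^- 4) (fun j => r * 2 ^+ j.+1)).
- exact: mR_far4.
- exact: far4_ge0.
- by move=> n; rewrite invr_ge0 exprn_even_ge0.
- by move=> n; rewrite mge0// exprn_ge0.
- move=> x; rewrite /far4; case: ifPn => hr; first by left.
 set a := enorm _ in hr *; rewrite -leNgt in hr.
 right; have ex : exists n, a <= r * 2 ^+ n.+1.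
  have a0 : 0 < a by exact: lt_le_trans hr.
  have [n hn] := half_pow_lt (divr_gt0 r0 a0); exists n.
  move: hn; rewrite exprVn invf_plt ?posrE ?exprn_gt0 ?divr_gt0// invf_div.
  rewrite ltr_pdivrMr// exprS => hn; have : 0 <= 2 ^+ n :> R by rewrite exprn_ge0.
  nra.
 case: (ex_minnP ex) => j hj jmin; exists j => //.
 have pj : 0 < r * 2 ^+ j by rewrite mulr_gt0// exprn_gt0.
 have : r * 2 ^+ j <= a.
  case: j hj jmin pj => [|j] hj jmin pj; first by rewrite expr0 mulr1.
  rewrite leNgt; apply/negP => h.
  by have := jmin j (ltW h); rewrite ltnn.
 move=> h; rewrite lef_pV2 ?posrE ?exprn_gt0//; last exact: lt_le_trans h.
 by rewrite lerXn2r ?nnegrE ?(ltW pj)// enge0.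
- move=> n; rewrite (eq_bigr (fun j => (64 / r) * 2^-1 ^+ j)); last first.
  move=> j _; have h : 2 ^+ j != 0 :> R by rewrite expf_neq0.
  by rewrite [2 ^+ j.+1]exprS exprVn; move: (2 ^+ j) h => p h; field; rewrite h gt_eqF.
 have -> : 128 / r = 64 / r * 2 by rewrite mulrAC -natrM.
 rewrite -mulr_sumr; apply: lewl; first by rewrite divr_ge0.
 exact: geo_half_sum.
Qed.
End Leb3b.

Opaque measurable_fun integral Rintegral.

(** * Integral inequalities with values in the extended reals *)

Section ErealInt.
Context {R : realType} {d : measure_display} {T : measurableType d}.
Variable mu : {sigma_finite_measure set T -> \bar R}.

Lemma nnint_ge0 (f : T -> R) : nneg f -> (0 <= \int[mu]_x (f x)%:E)%E.
by move=> f0; apply: integral_ge0 => x _; rewrite lee_fin. Qed.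

Lemma nnint_mul (f g : T -> R) : mR f -> mR g -> nneg f -> nneg g ->
 ((\int[mu]_x (f x)%:E) * (\int[mu]_y (g y)%:E) = \int[mu]_x \int[mu]_y (f x * g y)%:E)%E.
move=> mf mg f0 g0; rewrite -ge0_integralZr//; last 3 first.
- exact: mE_EFin.
- by move=> x _; rewrite lee_fin.
- exact: nnint_ge0.
by apply: eq_integral => x _; rewrite nnintZ//.
Qed.

Lemma le_eint (f g : T -> \bar R) : mE f -> mE g -> (forall x, 0 <= f x)%E -> (forall x, f x <= g x)%E ->
 (\int[mu]_x f x <= \int[mu]_x g x)%E.
by move=> mf mg f0 fg; apply: ge0_le_integral => //. Qed.

Lemma eintZ (c : R) (f : T -> \bar R) : mE f -> 0 <= c -> (forall x, 0 <= f x)%E ->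
 (\int[mu]_x (c%:E * f x) = c%:E * \int[mu]_x f x)%E.
by move=> mf c0 f0; rewrite ge0_integralZl. Qed.

(* Expand the square of [\int k a] as a double integral and use
 [2 k k' <= k^2 + k'^2]. *)
Lemma nnint_cauchy (k a : T -> R) : mR k -> mR a -> nneg k -> nneg a ->
 ((\int[mu]_x (k x * a x)%:E) * (\int[mu]_x (k x * a x)%:E) <=
 (\int[mu]_x (a x)%:E) * (\int[mu]_x (k x ^+ 2 * a x)%:E))%E.
move=> mk ma k0 a0.
have mka : mR (fun x => k x * a x) by exact: mR_M.
have mk2 : mR (fun x => k x ^+ 2 * a x) by apply: mR_M => //; exact: mR_X.
have ka0 x : 0 <= k x * a x by exact: mge0.
have k20 x : 0 <= k x ^+ 2 * a x by rewrite mge0// sqr_ge0.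
have m1 (f : T -> R) : mR f -> mR (fun p : T * T => f p.1) by move=> mf; apply: (mR_c mf).
have m2 (f : T -> R) : mR f -> mR (fun p : T * T => f p.2) by move=> mf; apply: (mR_c mf).
rewrite nnint_mul//.
set A := (\int[mu]_x (a x)%:E)%E; set B := (\int[mu]_x (k x ^+ 2 * a x)%:E)%E.
have F0 x y : 0 <= 2^-1 * (a x * (k y ^+ 2 * a y)) by rewrite !mge0// sqr_ge0.
have G0 x y : 0 <= 2^-1 * ((k x ^+ 2 * a x) * a y) by rewrite !mge0// sqr_ge0.
have mF : mR (fun p : T * T => 2^-1 * (a p.1 * (k p.2 ^+ 2 * a p.2))).
 by apply: mR_M; [exact: mR_cst|apply: mR_M; [exact: m1|exact: (m2 _ mk2)]].
have mG : mR (fun p : T * T => 2^-1 * ((k p.1 ^+ 2 * a p.1) * a p.2)).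
 by apply: mR_M; [exact: mR_cst|apply: mR_M; [exact: (m1 _ mk2)|exact: m2]].
apply: (via (\int[mu]_x (\int[mu]_y (2^-1 * (a x * (k y ^+ 2 * a y)))%:E +
 \int[mu]_y (2^-1 * ((k x ^+ 2 * a x) * a y))%:E))%E).
 apply: le_eint.
 - apply: (mE_nnint _ (f := fun x y => k x * a x * (k y * a y))) => [|x y]; last exact: mge0.
  by apply: mR_M; [exact: (m1 _ mka)|exact: (m2 _ mka)].
 - apply: mE_D; first exact: (mE_nnint mu mF F0).
  exact: (mE_nnint mu mG G0).
 - by move=> x; apply: nnint_ge0 => y; exact: mge0.
 - move=> x; rewrite -nnintD//; last 2 first.
  + exact: (mR_c mF (pair1_measurable x)).
  + exact: (mR_c mG (pair1_measurable x)).
  apply: le_nnint.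
  + by apply: mR_M => //; exact: mR_cst.
  + by apply: mR_D; [exact: (mR_c mF (pair1_measurable x))|exact: (mR_c mG (pair1_measurable x))].
  + by move=> y; exact: mge0.
  + move=> y; have h : 0 <= a x * a y by exact: mge0.
   rewrite -subr_ge0; have -> : 2^-1 * (a x * (k y ^+ 2 * a y)) + 2^-1 * (k x ^+ 2 * a x * a y) - k x * a x * (k y * a y) = 2^-1 * (a x * a y) * (k x - k y) ^+ 2 by field.
   by rewrite mge0 ?sqr_ge0// mge0.
rewrite ge0_integralD//; last 4 first.
- by move=> x _; exact: nnint_ge0.
- exact: (mE_nnint mu mF F0).
- by move=> x _; exact: nnint_ge0.
- exact: (mE_nnint mu mG G0).
have half (f g : T -> R) : mR f -> mR g -> nneg f -> nneg g ->
 (\int[mu]_x \int[mu]_y (2^-1 * (f x * g y))%:E = (2^-1)%:E * ((\int[mu]_x (f x)%:E) * (\int[mu]_y (g y)%:E)))%E.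
 move=> mf mg f0 g0; rewrite nnint_mul// -ge0_integralZl//; last 2 first.
 - apply: (mE_nnint _ (f := fun x y => f x * g y)) => [|x y]; last exact: mge0.
  by apply: mR_M; [exact: m1|exact: m2].
 - by move=> x _; apply: nnint_ge0 => y; exact: mge0.
 apply: eq_integral => x _; rewrite nnintZ//.
  by apply: mR_M => //; exact: mR_cst.
 by move=> y; exact: mge0.
rewrite half// half// -/A -/B [(B * A)%E]muleC.
have AB0 : (0 <= A * B)%E by apply: mule_ge0; exact: nnint_ge0.
rewrite -ge0_muleDl ?lee_fin// -EFinD.
by rewrite (_ : 2^-1 + 2^-1 = 1 :> R) ?mul1e//; field.
Qed.
End ErealInt.

Section Main.
Context {R : realType}.
Notation X := (measurable_R3 R).
Notation mu := (@mu3 R).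
Notation e_ := (@unit_vec R).
Notation RF := (R3 R -> R).
Notation CF := (R3 R -> R[i]).
Notation KF := (R3 R -> R3 R -> R[i]).
Notation TF := (R3 R -> R3 R -> R3 R -> R[i]).
Local Notation "\I_ x F" := (\int[mu3]_x F%R%:E)%E (at level 36, F at level 36, x at level 0).
Local Notation aeS := (@filterS _ _ (ae_filter_ringOfSetsType mu3) _ _ _).

(** * The same tools specialised to R^3 *)

Section IntR3.
Implicit Types (f g : RF) (F : R3 R -> RF) (h k : R3 R -> \bar R).

Definition mRX f := @mR R _ X f.
Definition mCX (f : CF) := @mC R _ X f.
Definition mEX h := @mE R _ X h.
Definition mR2 F := @mR R _ (X * X)%type (fun p => F p.1 p.2).
Definition mC2 (F : KF) := @mC R _ (X * X)%type (fun p => F p.1 p.2).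

Lemma mR2_l F y : mR2 F -> mRX (fun x => F x y).
by move=> h; exact: (mR_c h (pair2_measurable (y : X))). Qed.
Lemma mR2_r F x : mR2 F -> mRX (F x).
by move=> h; exact: (mR_c h (pair1_measurable (x : X))). Qed.
Lemma mC2_l (F : KF) y : mC2 F -> mCX (fun x => F x y).
by move=> h; exact: (mC_c h (pair2_measurable (y : X))). Qed.
Lemma mC2_r (F : KF) x : mC2 F -> mCX (F x).
by move=> h; exact: (mC_c h (pair1_measurable (x : X))). Qed.
Lemma mR2_swap F : mR2 F -> mR2 (fun x y => F y x).
by move=> h; exact: (mR_c h (@measurable_swap _ _ X X)). Qed.
Lemma n3ge0 f : nneg f -> (0 <= \I_x (f x))%E.
by move=> f0; apply: integral_ge0 => x _; rewrite lee_fin. Qed.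
Lemma n3le f g : mRX f -> mRX g -> nneg f -> (forall x, f x <= g x) ->
 (\I_x (f x) <= \I_x (g x))%E.
exact: le_nnint. Qed.
Lemma n3D f g : mRX f -> mRX g -> nneg f -> nneg g ->
 (\I_x (f x + g x) = \I_x (f x) + \I_x (g x))%E.
exact: nnintD. Qed.
Lemma n3Z (c : R) f : mRX f -> 0 <= c -> nneg f ->
 (\I_x (c * f x) = c%:E * \I_x (f x))%E.
exact: nnintZ. Qed.
Lemma e3Z (c : R) h : mEX h -> 0 <= c -> (forall x, 0 <= h x)%E ->
 (\int[mu]_x (c%:E * h x) = c%:E * \int[mu]_x h x)%E.
exact: eintZ. Qed.
Lemma e3le h k : mEX h -> mEX k -> (forall x, 0 <= h x)%E -> (forall x, h x <= k x)%E ->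
 (\int[mu]_x h x <= \int[mu]_x k x)%E.
exact: le_eint. Qed.
Lemma e3D h k : mEX h -> mEX k -> (forall x, 0 <= h x)%E -> (forall x, 0 <= k x)%E ->
 (\int[mu]_x (h x + k x) = \int[mu]_x h x + \int[mu]_x k x)%E.
by move=> mh mk h0 k0; rewrite ge0_integralD. Qed.
Lemma n3mul f g : mRX f -> mRX g -> nneg f -> nneg g ->
 ((\I_x (f x)) * (\I_y (g y)) = \int[mu]_x \I_y (f x * g y))%E.
exact: nnint_mul. Qed.
Lemma n3mE F : mR2 F -> (forall x y, 0 <= F x y) -> mEX (fun x => \I_y (F x y))%E.
exact: mE_nnint. Qed.
Lemma n3tonelli F : mR2 F -> (forall x y, 0 <= F x y) ->
 (\int[mu]_x \I_y (F x y) = \int[mu]_y \I_x (F x y))%E.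
exact: nn_tonelli. Qed.
Lemma n3cauchy f g : mRX f -> mRX g -> nneg f -> nneg g ->
 ((\I_x (f x * g x)) * (\I_x (f x * g x)) <=
 (\I_x (g x)) * (\I_x (f x ^+ 2 * g x)))%E.
exact: nnint_cauchy. Qed.
Lemma n3ae_le f g : mRX f -> mRX g -> nneg f -> nneg g ->
 {ae mu, forall x : R3 R, f x <= g x} ->
 (\I_x (f x) <= \I_x (g x))%E.
move=> mf mg f0 g0 h; apply: ae_ge0_le_integral => //.
- by move=> x _; rewrite lee_fin.
- exact: mE_EFin.
- by move=> x _; rewrite lee_fin.
- exact: mE_EFin.
- by apply: (aeS h) => x + _; rewrite lee_fin.
Qed.
Lemma e3ae_le h k : mEX h -> mEX k -> (forall x, 0 <= h x)%E -> (forall x, 0 <= k x)%E ->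
 {ae mu, forall x : R3 R, (h x <= k x)%E} -> (\int[mu]_x h x <= \int[mu]_x k x)%E.
move=> mf mg f0 g0 hk; apply: ae_ge0_le_integral => //.
by apply: (aeS hk) => x + _.
Qed.
Lemma mEX_EFin f : mRX f -> mEX (fun x => (f x)%:E).
exact: mE_EFin. Qed.
Lemma mEX_M h k : mEX h -> mEX k -> mEX (fun x => h x * k x)%E.
exact: mE_M. Qed.
Lemma mEX_cst c : mEX (fun=> c).
exact: mE_cst. Qed.
(* Tonelli for a nonnegative function of three variables, moving the first
 integral to the innermost position. *)
Lemma n3tonelli3 (F : R3 R -> R3 R -> RF) :
 @mR R _ ((X * X) * X)%type (fun p => F p.1.1 p.1.2 p.2) -> (forall x y z, 0 <= F x y z) ->
 (\int[mu]_x \int[mu]_y \I_z (F x y z) = \int[mu]_y \int[mu]_z \I_x (F x y z))%E /\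
 mEX (fun y => \int[mu]_z \I_x (F x y z))%E /\
 (forall y, mEX (fun z => \I_x (F x y z))%E).
move=> mF F0.
have mF1 : @mE R _ (X * X)%type (fun p => \I_z (F p.1 p.2 z))%E.
 exact: (mE_nnint mu (f := fun (p : X * X) z => F p.1 p.2 z) mF (fun p z => F0 _ _ _)).
have F10 (p : X * X) : (0 <= \I_z (F p.1 p.2 z))%E by exact: (n3ge0 (F0 p.1 p.2)).
have e1 := @fubini_tonelli _ _ X X R mu mu (fun p => \I_z (F p.1 p.2 z))%E mF1 F10.
have mF2 : @mR R _ ((X * X) * X)%type (fun p => F p.2 p.1.1 p.1.2).
 have hp : measurable_fun setT (fun p : (X * X) * X => ((p.2, p.1.1), p.1.2) : (X * X) * X).
  apply: measurable_fun_pair; [apply: measurable_fun_pair|].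
  - exact: measurable_snd.
  - exact: (mcomp measurable_fst measurable_fst).
  - exact: (mcomp measurable_snd measurable_fst).
 exact: (mR_c mF hp).
have mF3 : @mE R _ (X * X)%type (fun p => \I_x (F x p.1 p.2))%E.
 exact: (mE_nnint mu (f := fun (p : X * X) x => F x p.1 p.2) mF2 (fun p x => F0 _ _ _)).
have F30 (p : X * X) : (0 <= \I_x (F x p.1 p.2))%E by exact: (n3ge0 (fun x => F0 x p.1 p.2)).
split; last split.
- rewrite [LHS]e1; apply: eq_integral => y _; apply: (@n3tonelli (fun x z => F x y z)) => //.
 have hp : measurable_fun setT (fun p : X * X => ((p.1, y : X), p.2) : (X * X) * X).
  by apply: measurable_fun_pair; [apply: measurable_fun_pair; [exact: measurable_fst|exact: measurable_cst]|exact: measurable_snd].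
 exact: (mR_c mF hp).
- exact: (@measurable_fun_fubini_tonelli_F _ _ X X R mu (fun p => \I_x (F x p.1 p.2))%E mF3 F30).
- by move=> y; exact: (mE_c mF3 (pair1_measurable (y : X))).
Qed.
End IntR3.

Ltac mproj := lazymatch goal with
 | |- @measurable_fun _ _ _ _ _ (fun x => x) => exact: measurable_id
 | |- @measurable_fun _ _ _ _ _ id => exact: measurable_id
 | |- @measurable_fun _ _ _ _ _ fst => exact: measurable_fst
 | |- @measurable_fun _ _ _ _ _ snd => exact: measurable_snd
 | |- @measurable_fun _ _ _ _ _ (fun p => (@?f p).1) => refine (mcomp measurable_fst _); mproj
 | |- @measurable_fun _ _ _ _ _ (fun p => (@?f p).2) => refine (mcomp measurable_snd _); mproj
 | |- @measurable_fun _ _ _ _ _ (fun p => (@?f p, @?g p)) => apply: (measurable_fun_pair (f := f) (g := g)); mproj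
 | |- @measurable_fun _ _ _ _ _ (fun p => @?f p + @?g p) => apply: (@m3_D _ _ _ f g); mproj
 | |- @measurable_fun _ _ _ _ _ (fun p => - @?f p) => apply: (@m3_N _ _ _ f); mproj
 | |- @measurable_fun _ _ _ _ _ (fun p => _) => first [exact: measurable_cst | assumption ]
 | |- @measurable_fun _ _ _ _ _ _ => first [assumption | exact: measurable_cst]
 | |- m3 _ => rewrite /m3; mproj
 end.

Ltac meas := lazymatch goal with
 | |- mRX _ => rewrite /mRX; meas
 | |- mCX _ => rewrite /mCX; meas
 | |- mR2 _ => rewrite /mR2 /=; meas
 | |- mC2 _ => rewrite /mC2 /=; meas
 | |- mR (fun x => @?f x + @?g x) => apply: (@mR_D _ _ _ f g); meas
 | |- mR (fun x => @?f x * @?g x) => apply: (@mR_M _ _ _ f g); meas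
 | |- mR (fun x => - @?f x) => apply: (@mR_N _ _ _ f); meas
 | |- mR (fun x => @?f x ^+ ?n) => apply: (@mR_X _ _ _ f n); meas
 | |- mR (fun x => (@?f x)^-1) => apply: (@mR_inv _ _ _ f); meas
 | |- mR (fun x => `|@?f x|) => apply: (@mR_norm _ _ _ f); meas
 | |- mR (fun x => expR (@?f x)) => apply: (@mR_exp _ _ _ f); meas
 | |- mR (fun x => cos (@?f x)) => apply: (@mR_cos _ _ _ f); meas
 | |- mR (fun x => sin (@?f x)) => apply: (@mR_sin _ _ _ f); meas
 | |- mR (fun x => enorm (@?f x)) => apply: (@mR_enorm _ _ _ f); mproj
 | |- mR (fun x => nrm (@?f x)) => apply: (@mC_nrm _ _ _ f); meas
 | |- mR (fun x => Re (@?f x)) => apply: (proj1 (_ : mC f)); meas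
 | |- mR (fun x => Im (@?f x)) => apply: (proj2 (_ : mC f)); meas
 | |- mC (fun x => @?f x + @?g x) => apply: (@mC_D _ _ _ f g); meas
 | |- mC (fun x => @?f x * @?g x) => apply: (@mC_M _ _ _ f g); meas
 | |- mC (fun x => - @?f x) => apply: (@mC_N _ _ _ f); meas
 | |- mC (fun x => (@?f x)^*%C) => apply: (@mC_conj _ _ _ f); meas
 | |- mC (fun x => (@?f x)%:C) => apply: (@mC_real _ _ _ f); meas
 | |- _ => first [assumption | exact: mR_cst | exact: mC_cst |
   match goal with
   | H : mR ?F |- mR (fun x => ?F (@?h x)) => apply: (mR_c H (h := h)); mproj
   | H : mC ?F |- mC (fun x => ?F (@?h x)) => apply: (mC_c H (h := h)); mproj
   | H : mRX ?F |- mR (fun x => ?F (@?h x)) => apply: (mR_c H (h := h)); mproj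
   | H : mCX ?F |- mC (fun x => ?F (@?h x)) => apply: (mC_c H (h := h)); mproj
   | H : mR2 ?F |- mR (fun x => ?F (@?h x) (@?k x)) => apply: (mR_c H (h := fun x => (h x, k x))); mproj
   | H : mC2 ?F |- mC (fun x => ?F (@?h x) (@?k x)) => apply: (mC_c H (h := fun x => (h x, k x))); mproj
   end ]
 end.

(** * Kato bounds, the weight omega and Riesz kernels *)

Section Potential.
Implicit Types (x y w : R3 R) (W s m : RF).

Definition omega x : R := (1 + enorm x)^-1.
Lemma omega_gt0 x : 0 < omega x.
by rewrite invr_gt0 ltr_wpDr ?enge0. Qed.
Lemma omega_ge0 x : 0 <= omega x.
exact/ltW/omega_gt0. Qed.

(** The three-point inequality behind the weighted bounds below. It survives the convention
    [0^-1 = 0]: if [a] or [b] is 0, so is the left-hand side. *)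
Lemma inv_tri (a b c : R) : 0 <= a -> 0 <= b -> 0 < c -> c <= a + b ->
 a^-1 * b^-1 <= c^-1 * (a^-1 + b^-1).
move=> a0 b0 c0 h; have r0 : 0 <= c^-1 * (a^-1 + b^-1).
 by rewrite mge0 ?addr_ge0 ?invr_ge0// ltW.
move: a0; rewrite le_eqVlt => /predU1P[<-|a0]; first by rewrite invr0 mul0r mge0 ?addr_ge0 ?invr_ge0// ltW.
move: b0; rewrite le_eqVlt => /predU1P[<-|b0]; first by rewrite invr0 mulr0 mge0 ?addr_ge0 ?invr_ge0// ltW.
have -> : c^-1 * (a^-1 + b^-1) = (a + b) / c * (a^-1 * b^-1) by field; rewrite !gt_eqF.
by rewrite ler_peMl ?mge0 ?invr_ge0 ?(ltW a0) ?(ltW b0)// ler_pdivlMr// mul1r.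
Qed.

Definition katob W (A : R) := [/\ mRX W, forall x, 0 <= W x &
 forall y, (\I_x (W x * (dist x y)^-1) <= A%:E)%E].

Lemma kato_weight_dist W A x y : katob W A -> x <> y ->
 (\I_w (W w * ((dist x w)^-1 * (dist w y)^-1)) <= (2 * A / dist x y)%:E)%E.
move=> [mW W0 hW] xy; have d0 := enorm_gt0 xy.
have i0 (z : R3 R) : 0 <= (enorm z)^-1 :> R by rewrite invr_ge0 enge0.
apply: (via (\I_w ((dist x y)^-1 * (W w * (dist w x)^-1 + W w * (dist w y)^-1)))%E).
 apply: n3le; [meas|meas|by move=> w; rewrite !mge0|move=> w].
 rewrite (enormBC w x) -mulrDr [leRHS]mulrCA lewl//.
 by apply: inv_tri => //; rewrite ?enge0//; exact: ler_dist.
rewrite n3Z//; [|meas|by move=> w; rewrite addr_ge0 ?mge0].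
rewrite n3D//; [|meas|meas|by move=> w; rewrite mge0|by move=> w; rewrite mge0].
rewrite [leRHS](_ : _ = ((dist x y)^-1)%:E * (A%:E + A%:E))%E; last first.
 by rewrite -EFinD -EFinM; congr (_%:E); ring.
by apply: leewl; [rewrite lee_fin|apply: leeD].
Qed.

(** One centre would do except at [w = 0], where [0^-1 = 0] spoils the bound; the second centre, at
    distance 1 from the origin, repairs that point at the price of a factor 2 in
    [kato_omega_int]. *)
Lemma omega_le_two (w : R3 R) : omega w <= (enorm (w - 0))^-1 + (enorm (w - (1, 0, 0)))^-1.
have [->|w0] := eqVneq w 0.
 rewrite /omega enorm0 addr0 invr1 subr0 enorm0 invr0 add0r /enorm /=.
 by rewrite !sub0r !oppr0 sqrrN expr1n expr0n/= !addr0 sqrtr1 invr1.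
rewrite subr0 -[leLHS]addr0; apply: lerD; last by rewrite invr_ge0 enge0.
have h : 0 < enorm w by have := @enorm_gt0 R w 0; rewrite subr0; apply; apply/eqP.
by rewrite /omega lef_pV2 ?posrE ?ltr_wpDr ?enge0// lerDr.
Qed.

Lemma kato_omega_int W A : katob W A -> (\I_w (W w * omega w) <= (2 * A)%:E)%E.
move=> [mW W0 hW].
have i0 (z : R3 R) : 0 <= (enorm z)^-1 :> R by rewrite invr_ge0 enge0.
apply: (via (\I_w (W w * (enorm (w - 0))^-1 + W w * (enorm (w - (1, 0, 0)))^-1))%E).
 apply: n3le; [rewrite /omega; meas|meas|by move=> w; rewrite mge0 ?omega_ge0|move=> w].
 by rewrite -mulrDr lewl// omega_le_two.
rewrite n3D//; [|meas|meas|by move=> w; rewrite mge0|by move=> w; rewrite mge0].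
by rewrite (_ : 2 * A = A + A) ?EFinD ?leeD//; ring.
Qed.

Lemma omega_tri x w : (dist x w)^-1 * omega w <= omega x * ((dist x w)^-1 + omega w).
apply: inv_tri; rewrite ?enge0 ?addr_ge0 ?enge0//.
 by rewrite ltr_wpDr// enge0.
by have := enorm_le_add x w; lra.
Qed.

(** Why $R_0V$ preserves [omega]: the three-point inequality for $1+|x|\le|x-w|+(1+|w|)$ leaves one
    integral bounded by [A] and one by [2 * A]. *)
Lemma kato_weight_omega W A x : katob W A ->
 (\I_w (W w * ((dist x w)^-1 * omega w)) <= (3 * A * omega x)%:E)%E.
move=> kW; have [mW W0 hW] := kW; have o0 := @omega_ge0; have hO := kato_omega_int kW.
have i0 (z : R3 R) : 0 <= (enorm z)^-1 :> R by rewrite invr_ge0 enge0.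
apply: (via (\I_w (omega x * (W w * (dist w x)^-1 + W w * omega w)))%E).
 apply: n3le; [rewrite /omega; meas|rewrite /omega; meas|by move=> w; rewrite !mge0|move=> w].
 by rewrite (enormBC w x) -mulrDr [leRHS]mulrCA lewl// omega_tri.
rewrite n3Z//; [|rewrite /omega; meas|by move=> w; rewrite addr_ge0 ?mge0].
rewrite n3D//; [|rewrite /omega; meas|rewrite /omega; meas|by move=> w; rewrite mge0|by move=> w; rewrite mge0].
rewrite [leRHS](_ : _ = (omega x)%:E * (A%:E + (2 * A)%:E))%E; last first.
 by rewrite -EFinD -EFinM; congr (_%:E); ring.
by apply: leewl; [rewrite lee_fin|apply: leeD].
Qed.

Lemma ae_neq (y : R3 R) : {ae mu, forall x : R3 R, x <> y}.
exists ([set y.1.1] `*` [set y.1.2] `*` [set y.2]); split.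
- by do 2 (apply: measurableX => //).
- have e := leb3_box (R := R) (A := [set y.1.1]) (B := [set y.1.2]) (C := [set y.2]).
 rewrite -mu3E in e; rewrite [LHS]e//.
 by rewrite [X in (_ * X)%E](lebesgue_measure_set1 y.2) mule0.
- move=> x /= /contrapT ->; by case: y => -[].
Qed.

Definition riesz x y : R := (dist x y ^+ 2)^-1.
Lemma riesz_ge0 x y : 0 <= riesz x y.
by rewrite invr_ge0 sqr_ge0. Qed.
Lemma rieszC x y : riesz x y = riesz y x.
by rewrite /riesz enormBC. Qed.

Lemma riesz_comp x y : x <> y ->
 (\I_w (riesz w x * riesz w y) <= (768 / dist x y)%:E)%E.
(* With r half the distance, no w is within r of both poles. Within r of one pole the other factor
   is at most $r^{-2}$; far from both, $a^{-2}b^{-2}\le a^{-4}+b^{-4}$. The total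
   $r^{-2}\cdot128r+256/r$ equals $768/|x-y|$. *)
move=> xy; have d0 := enorm_gt0 xy; set r := dist x y / 2.
have r0 : 0 < r by rewrite divr_gt0.
apply: (via (\I_w (r ^- 2 * (near2 x r w + near2 y r w) + (far4 x r w + far4 y r w)))%E).
 have mnx := mR_near2 x r; have mny := mR_near2 y r; have mfx := mR_far4 x r; have mfy := mR_far4 y r.
 apply: n3le; [rewrite /riesz; meas|meas|by move=> w; rewrite mge0 ?riesz_ge0|move=> w].
 have := near2_ge0 x r w; have := near2_ge0 y r w; have := far4_ge0 x r w; have := far4_ge0 y r w.
 have t : dist x y <= dist w x + dist w y by rewrite (enormBC w x); exact: ler_dist.
 rewrite /near2 /far4 /riesz; set a := dist w x in t *; set b := dist w y in t *.
 have a0 : 0 <= a := enge0 _; have b0 : 0 <= b := enge0 _.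
 have e : dist x y = r + r by rewrite /r; field.
 have p0 : 0 <= (r ^+ 2)^-1 by rewrite invr_ge0 sqr_ge0.
 case: (ltP a r) => ar; case: (ltP b r) => br; rewrite ?addr0 ?add0r => h1 h2 h3 h4.
 - by exfalso; clear xy; lra.
 - rewrite -[leLHS]addr0 lerD// mulrC lewr//.
  by rewrite lef_pV2 ?posrE ?exprn_gt0// ?(lt_le_trans r0)// lerXn2r ?nnegrE// ltW.
 - rewrite -[leLHS]addr0 lerD// lewr//.
  by rewrite lef_pV2 ?posrE ?exprn_gt0// ?(lt_le_trans r0)// lerXn2r ?nnegrE// ltW.
 - rewrite mulr0 add0r -[4%N]/(2 * 2)%N !exprM -![(_ ^+ 2)^-1 in leRHS]exprVn.
  have := sqr_ge0 ((a ^+ 2)^-1 - (b ^+ 2)^-1); have := sqr_ge0 ((a ^+ 2)^-1); have := sqr_ge0 ((b ^+ 2)^-1).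
  nra.
have mnx := mR_near2 x r; have mny := mR_near2 y r; have mfx := mR_far4 x r; have mfy := mR_far4 y r.
have p0 : 0 <= (r ^+ 2)^-1 by rewrite invr_ge0 sqr_ge0.
have nx0 := near2_ge0 x r; have ny0 := near2_ge0 y r; have fx0 := far4_ge0 x r; have fy0 := far4_ge0 y r.
rewrite n3D; [|meas|meas|by move=> w; rewrite mge0// addr_ge0|by move=> w; rewrite addr_ge0].
rewrite n3Z; [|meas|by []|by move=> w; rewrite addr_ge0].
rewrite !n3D//.
rewrite [leRHS](_ : _ = ((r ^+ 2)^-1)%:E * ((64 * r)%:E + (64 * r)%:E) + ((128 / r)%:E + (128 / r)%:E))%E; last first.
 rewrite -(EFinD (64 * r)) -(EFinD (128 / r)) -EFinM -EFinD /r; congr (_%:E); clear -d0.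
 by field; rewrite gt_eqF.
apply: leeD; last by apply: leeD; exact: nnint_far4.
by apply: leewl; [rewrite lee_fin|apply: leeD; exact: nnint_near2].
Qed.

(** Up to a constant the Coulomb energy, that is the squared homogeneous $H^{-1}$ norm of s. *)
Definition energy s : \bar R := (\int[mu]_x \I_y (s x * s y * (dist x y)^-1))%E.

(** Integrating the expanded square in x first produces the composition of two Riesz kernels, for
    which [riesz_comp] gives the Coulomb kernel. *)
Lemma riesz_energy s : mRX s -> nneg s ->
 (\int[mu]_x ((\I_y (s y * riesz x y)) * (\I_y (s y * riesz x y))) <= 768%:E * energy s)%E.
move=> ms s0; have r0 := riesz_ge0.
pose F x y z := (s y * riesz x y) * (s z * riesz x z).
have F0 x y z : 0 <= F x y z by rewrite !mge0.
have mF : @mR R _ ((X * X) * X)%type (fun p => F p.1.1 p.1.2 p.2) by rewrite /F /riesz; meas.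
have mr x : mRX (fun y => s y * riesz x y) by rewrite /riesz; meas.
have e1 : (\int[mu]_x ((\I_y (s y * riesz x y)) * (\I_y (s y * riesz x y))) =
 \int[mu]_x \int[mu]_y \I_z (F x y z))%E.
 by apply: eq_integral => x _; apply: n3mul; [exact: mr|exact: mr| |] => y; rewrite mge0.
have [e2 [mF2 mF3]] := n3tonelli3 mF F0; rewrite e1 e2.
pose G y z := s y * s z * (dist y z)^-1.
have mG : mR2 G by rewrite /mR2 /G; meas.
have G0 y z : 0 <= G y z by rewrite !mge0// invr_ge0 enge0.
have h768 : 0 <= 768 :> R := ler0n R 768.
rewrite /energy -(e3Z (n3mE mG G0) h768 (fun x => n3ge0 (G0 x))).
apply: e3le.
- exact: mF2.
- exact: (mEX_M (mEX_cst _) (n3mE mG G0)).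
- by move=> y; apply: integral_ge0 => z _; exact: n3ge0.
move=> y; rewrite -(n3Z (mR2_r y mG) h768 (G0 y)).
apply: e3ae_le.
- exact: mF3.
- by apply: mEX_EFin; rewrite /G; meas.
- by move=> z; exact: n3ge0.
- by move=> z; rewrite lee_fin mge0.
apply: (aeS (ae_neq y)) => z zy.
have -> : (\I_x (F x y z) = (s y * s z)%:E * \I_x (riesz x y * riesz x z))%E.
 rewrite -n3Z ?mge0//; [|by rewrite /riesz; meas|by move=> x; rewrite mge0].
 by apply: eq_integral => x _; congr (_%:E); rewrite /F; ring.
apply: le_trans (leewl _ (riesz_comp _)) _; [by rewrite lee_fin mge0|exact: nesym|].
by rewrite -EFinM lee_fin le_eqVlt; apply/orP; left; apply/eqP; rewrite /G; ring.
Qed.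
End Potential.

#[local] Hint Extern 0 (is_true _) => exact: omega_ge0 : pos.
#[local] Hint Extern 0 (is_true _) => exact: omega_gt0 : pos.
#[local] Hint Extern 0 (is_true _) => exact: ballf_ge0 : pos.

(** * Schur's test, energy estimates and the form bound *)

Section Potential2.
Implicit Types (x y w : R3 R) (W s m h : RF) (E : R3 R -> RF).

Lemma sqe_ge0 (a : \bar R) : (0 <= a * a)%E.
by case: a => [a| |] //; rewrite -EFinM lee_fin -expr2 sqr_ge0. Qed.

Lemma mEX_conv E s : mR2 E -> (forall x y, 0 <= E x y) -> mRX s -> nneg s ->
 mR2 (fun x y => s y * E x y) /\ mEX (fun x => \I_y (s y * E x y))%E.
move=> mE' E0 ms s0; have h : mR2 (fun x y => s y * E x y) by meas.
by split => //; apply: n3mE => // x y; pos.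
Qed.

(** Schur's test: Cauchy-Schwarz with respect to the measure [E x y] dy, then Tonelli. *)
Lemma schur E m (A : R) : mR2 E -> (forall x y, 0 <= E x y) -> 0 <= A ->
 (forall x, \I_y (E x y) <= A%:E)%E -> (forall y, \I_x (E x y) <= A%:E)%E ->
 mRX m -> nneg m ->
 (\int[mu]_x ((\I_y (m y * E x y)) * (\I_y (m y * E x y))) <=
 (A * A)%:E * \I_y (m y ^+ 2))%E.
move=> mE' E0 A0 E1 E2 mm m0.
have [_ mc] := mEX_conv mE' E0 mm m0.
have m20 x : 0 <= m x ^+ 2 by pos.
have mm2 : mRX (fun x => m x ^+ 2) by meas.
have [mF mc2] := mEX_conv mE' E0 mm2 m20.
have F0 x y : 0 <= m y ^+ 2 * E x y by pos.
apply: (via (\int[mu]_x (A%:E * \I_y (m y ^+ 2 * E x y)))%E).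
 apply: e3le => [| |x|x].
 - exact: mEX_M.
 - exact: (mEX_M (mEX_cst _)).
 - exact: sqe_ge0.
 - apply: le_trans (n3cauchy mm (mR2_r x mE') m0 (E0 x)) _.
  apply: lee_wpmul2r; first exact: n3ge0.
  exact: E1.
rewrite e3Z//; last by move=> x; exact: n3ge0.
rewrite EFinM -muleA; apply: leewl => //.
rewrite n3tonelli// -e3Z//; last exact: mEX_EFin.
apply: e3le => [| |y|y].
- by apply: n3mE => //; exact: mR2_swap.
- exact: (mEX_M (mEX_cst _) (mEX_EFin mm2)).
- exact: n3ge0.
- rewrite n3Z//; last exact: mR2_l.
 by rewrite muleC; apply: lee_wpmul2r; rewrite ?lee_fin.
Qed.

(** Cauchy-Schwarz with respect to the measure [s y] dy. It shows that $\|\int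
    s(y)E(\cdot,y)\,dy\|_2\le\sqrt B\,\|s\|_1$. *)
Lemma conv_L1_L2 E s (B S : R) : mR2 E -> (forall x y, 0 <= E x y) -> 0 <= S -> 0 <= B ->
 (forall y, \I_x (E x y ^+ 2) <= B%:E)%E ->
 mRX s -> nneg s -> (\I_x (s x) <= S%:E)%E ->
 (\int[mu]_x ((\I_y (s y * E x y)) * (\I_y (s y * E x y))) <= (S * (B * S))%:E)%E.
move=> mE' E0 S0 B0 EB ms s0 sS.
have [_ mc] := mEX_conv mE' E0 ms s0.
have mE2 : mR2 (fun x y => E x y ^+ 2) by meas.
have E20 x y : 0 <= E x y ^+ 2 by pos.
have [mF mc2] := mEX_conv mE2 E20 ms s0.
have F0 x y : 0 <= s y * E x y ^+ 2 by pos.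
have sw x : (\I_y (s y * E x y) = \I_y (E x y * s y))%E.
 by apply: eq_integral => y _; rewrite mulrC.
have sw2 x : (\I_y (s y * E x y ^+ 2) = \I_y (E x y ^+ 2 * s y))%E.
 by apply: eq_integral => y _; rewrite mulrC.
apply: (via (\int[mu]_x (S%:E * \I_y (s y * E x y ^+ 2)))%E).
 apply: e3le => [| |x|x].
 - exact: mEX_M.
 - exact: (mEX_M (mEX_cst _)).
 - exact: sqe_ge0.
 - rewrite sw sw2; apply: le_trans (n3cauchy (mR2_r x mE') ms (E0 x) s0) _.
  apply: lee_wpmul2r; last exact: sS.
  by apply: n3ge0 => y; pos.
rewrite e3Z//; last by move=> x; exact: n3ge0.
rewrite EFinM; apply: leewl => //.
rewrite n3tonelli//; apply: (via (\int[mu]_y (B%:E * (s y)%:E))%E).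
 apply: e3le => [| |y|y].
 - by apply: n3mE => //; exact: mR2_swap.
 - exact: (mEX_M (mEX_cst _) (mEX_EFin ms)).
 - exact: n3ge0.
 - rewrite n3Z//; last exact: (mR2_l y mE2).
  by rewrite muleC; apply: lee_wpmul2r; rewrite ?lee_fin.
rewrite e3Z//; last exact: mEX_EFin.
by rewrite EFinM; apply: leewl => //.
Qed.

(** Since $h(x)h(y)\le(h(x)^2+h(y)^2)/2$, each half is, after exchanging the variables if necessary,
    a Kato integral in the variable where h does not occur. *)
Lemma kato_energy W A h : katob W A -> 0 <= A -> mRX h -> nneg h ->
 (energy (fun x => (W x * h x)%R) <= A%:E * \I_x (W x * h x ^+ 2))%E.
move=> [mW W0 hW] A0 mh h0; rewrite /energy.
pose F x y := 2^-1 * (W x * h x ^+ 2 * (W y * (dist y x)^-1)).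
have i0 x : 0 <= (enorm x)^-1 by pos.
have h20 x : 0 <= W x * h x ^+ 2 by pos.
have F0 x y : 0 <= F x y by rewrite /F !mge0// sqr_ge0.
have mF : mR2 F by rewrite /F; meas.
have mF' := mR2_swap mF.
have key : (\int[mu]_x \I_y (F x y) <= (2^-1 * A)%:E * \I_x (W x * h x ^+ 2))%E.
 have mWh : mRX (fun x => W x * h x ^+ 2) by meas.
 rewrite -e3Z ?mge0//; last exact: mEX_EFin.
 apply: e3le => [| |x|x].
 - exact: n3mE.
 - exact: (mEX_M (mEX_cst _) (mEX_EFin mWh)).
 - exact: n3ge0.
 - have -> : (\I_y (F x y) = \I_y ((2^-1 * (W x * h x ^+ 2)) * (W y * (dist y x)^-1)))%E.
   by apply: eq_integral => y _; congr (_%:E); rewrite /F; ring.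
  rewrite n3Z ?mge0//; [|by meas|pos].
  apply: (via ((2^-1 * (W x * h x ^+ 2))%:E * A%:E)%E).
   by apply: leewl => //; pos.
  by rewrite -!EFinM lee_fin le_eqVlt; apply/orP; left; apply/eqP; ring.
apply: (via (\int[mu]_x (\I_y (F x y) + \I_y (F y x)))%E).
 apply: e3le => [| |x|x].
 - by apply: n3mE => [|x y]; [meas|pos].
 - by apply: mE_D; exact: n3mE.
 - by apply: n3ge0 => y; pos.
 - rewrite -n3D//; [|exact: mR2_r|exact: (mR2_r x mF')].
  apply: n3le => [| |y|y].
  + by meas.
  + by rewrite /F; meas.
  + pos.
  + rewrite /F (enormBC x y) -subr_ge0.
   rewrite [leRHS](_ : _ = 2^-1 * (W x * (W y * (dist y x)^-1)) * (h x - h y) ^+ 2); last first.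
    by move: (dist y x)^-1 => r; field.
   pos.
rewrite e3D; [|exact: n3mE|exact: n3mE|by move=> x; exact: n3ge0|by move=> x; exact: n3ge0].
have sw : (\int[mu]_x \I_y (F y x) = \int[mu]_x \I_y (F x y))%E by rewrite n3tonelli.
rewrite sw {sw}; set J := (\int[mu]_x \I_y (F x y))%E in key *.
set M := (\I_x (W x * h x ^+ 2))%E in key *.
apply: le_trans (leeD key key) _.
have M0 : (0 <= M)%E by exact: n3ge0.
rewrite -ge0_muleDl ?lee_fin ?mge0// -EFinD.
by rewrite (_ : 2^-1 * A + 2^-1 * A = A)//; field.
Qed.

Lemma n3fatou (f_ : nat -> RF) (f : RF) (M : \bar R) : (forall n, mRX (f_ n)) ->
 (forall n x, 0 <= f_ n x) -> (forall x, f_ ^~ x @ \oo --> f x) ->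
 (forall n, \I_x (f_ n x) <= M)%E -> (\I_x (f x) <= M)%E.
move=> mf f0 ff fM.
have e x : limn_einf (fun n => (f_ n x)%:E) = (f x)%:E.
 have h : (fun n => (f_ n x)%:E) @ \oo --> (f x)%:E.
  by apply: cvg_EFin; [exact: nearW|exact: ff].
 by rewrite is_cvg_limn_einfE ?(cvg_lim _ h)//; apply/cvg_ex; exists (f x)%:E.
have -> : (\I_x (f x) = \int[mu]_x limn_einf ((fun n y => (f_ n y)%:E)^~ x))%E.
 by apply: eq_integral => x _; rewrite e.
apply: (via (limn_einf (fun n => \I_x (f_ n x))%E)).
 apply: (@fatou _ _ _ mu setT measurableT (fun n x => (f_ n x)%:E)) => //.
 - by move=> n; apply: mE_EFin; exact: mf.
 - pos.
rewrite limn_einf_lim; apply: lime_le; first exact: is_cvg_einfs.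
apply: nearW => n; apply: (le_trans _ (fM n)).
by apply: ereal_inf_lbound; exists n => /=.
Qed.

Lemma amgm_ereal (a : R) (b : \bar R) (t : R) : 0 <= a -> (0 <= b)%E -> 0 < t ->
 (a%:E * b <= (t / 2)%:E * (a ^+ 2)%:E + (2 * t)^-1%:E * (b * b))%E.
move=> a0; case: b => [b| |]; rewrite ?lee_fin => b0 t0; last by move: b0; rewrite leeNy_eq => /eqP b0; discriminate b0.
 rewrite -subr_ge0.
 rewrite [leRHS](_ : _ = (2 * t)^-1 * (t * a - b) ^+ 2); last by field; rewrite gt_eqF.
 pos.
rewrite mulyy (_ : (_^-1%:E * +oo)%E = +oo%E); last by rewrite gt0_muley// lte_fin invr_gt0 mulr_gt0.
by rewrite addey ?leey// -EFinM.
Qed.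

(* With [s = W t_n], where [t_n] truncates [h], the bound [h <= I * m] gives
 [X := int W t_n^2 <= int m (I * s)]; since
 [|| I * s ||_2^2 <= 768 energy s <= 768 A X], the weighted AM-GM inequality
 absorbs [X], which is finite because of the truncation. *)
Lemma form_bound W A h m : katob W A -> 0 < A -> mRX h -> nneg h ->
 mRX m -> nneg m ->
 {ae mu, forall x : R3 R, ((h x)%:E <= \I_y (m y * riesz x y))%E} ->
 (\I_x (W x * h x ^+ 2) <= (768 * A)%:E * \I_x (m x ^+ 2))%E.
move=> kW A0 mh h0 mm m0 hae; have [mW W0 hW] := kW.
have h768 : 0 < 768 :> R by rewrite ltr0n.
have c0 : 0 < 768 * A := mulr_gt0 h768 A0.
pose c := 768 * A; rewrite -/c in c0 *.
pose t (N : nat) x := if enorm x <= N%:R then if W x <= N%:R then Num.min (h x) N%:R else 0 else 0.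
have mt N : mRX (t N).
 apply: mR_leif; [by apply: mR_enorm; exact: m3_id|meas| |meas].
 apply: mR_leif; [exact: mW|meas| |exact: mR_cst].
 by apply: measurable_minr => //; exact: measurable_cst.
have t0 N x : 0 <= t N x by rewrite /t; case: ifP => // _; case: ifP => // _; rewrite le_min h0 ler0n.
have th N x : t N x <= h x by rewrite /t; case: ifP => // _; case: ifP => // _; rewrite ge_min lexx.
have mWt N : mRX (fun x => W x * t N x ^+ 2) by have := mt N; move=> ?; meas.
have Wt0 N x : 0 <= W x * t N x ^+ 2 by pos.
apply: (n3fatou (f_ := fun N x => W x * t N x ^+ 2)) => //.
 move=> x; apply: cvg_near_cst.
 have := truncnS_gt (enorm x + W x + h x); set n := (Num.truncn _).+1 => hn.
 exists n => // N /= nN; have nN' : n%:R <= N%:R :> R by rewrite ler_nat.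
 have e0 := enge0 x; have w0 := W0 x; have k0 := h0 x.
 have -> // : t N x = h x.
 rewrite /t; case: ifPn => [_|]; last by rewrite -ltNge => ?; lra.
 case: ifPn => [_|]; last by rewrite -ltNge => ?; lra.
 by apply/min_idPl; lra.
move=> N; have mt' := mt N; pose s x := W x * t N x.
have ms : mRX s by rewrite /s; meas.
have s0 x : 0 <= s x by rewrite mge0.
set X := (\I_x (W x * t N x ^+ 2))%E.
set M := (\I_x (m x ^+ 2))%E.
have Xfin : (X < +oo)%E.
 apply: (vialt (\I_x (N%:R ^+ 3 * ballf 0 N%:R x))%E).
  apply: n3le => //.
   by apply: mR_M; [meas|exact: mR_ballf].
  move=> x; rewrite /ballf subr0 /t; case: ifP => _; last by rewrite expr0n /= mulr0 mulr0.
  case: ifP => WN; last by rewrite expr0n /= mulr0 mulr1 exprn_ge0.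
  rewrite mulr1 exprS; apply: ler_pM => //; first exact: sqr_ge0.
  by rewrite expr1; apply: ler_pM; rewrite ?le_min ?h0 ?ler0n// ge_min lexx orbT.
 rewrite n3Z ?exprn_ge0//; [|exact: mR_ballf|by move=> x; pos].
 rewrite ltyM ?lee_fin ?exprn_ge0//.
 by apply: lelt (nnballf _ _) _ => //; rewrite ltry.
have X0 : (0 <= X)%E by exact: n3ge0.
have M0 : (0 <= M)%E by apply: n3ge0 => x; pos.
have [Mfin|] := ltP M +oo%E; last first.
 by rewrite leye_eq => /eqP ->; rewrite gt0_muley; [exact: leey|rewrite lte_fin].
have mr2 : mR2 (@riesz) by rewrite /riesz; meas.
pose J y := (\I_x (s x * riesz y x))%E.
have [_ mJ] := mEX_conv mr2 (@riesz_ge0) ms s0.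
have J0 y : (0 <= J y)%E by apply: n3ge0 => x; rewrite mge0 ?riesz_ge0.
have mm2 : mRX (fun x => m x ^+ 2) by meas.
have JJ : (\int[mu]_y (J y * J y) <= 768%:E * (A%:E * X))%E.
 apply: le_trans (riesz_energy ms s0) _; apply: leewl; first pos.
 by apply: kato_energy => //; pos.
have h1 : (X <= \int[mu]_y ((m y)%:E * J y))%E.
 apply: (via (\int[mu]_x \I_y (s x * (m y * riesz x y)))%E).
  apply: e3ae_le.
  - exact: mEX_EFin.
  - by apply: n3mE => [|x y]; [rewrite /riesz; meas|rewrite !mge0 ?riesz_ge0].
  - pos.
  - by move=> x; apply: n3ge0 => y; rewrite !mge0 ?riesz_ge0.
  apply: (aeS hae) => x hx.
  rewrite n3Z//; [|by rewrite /riesz; meas|by move=> y; rewrite mge0 ?riesz_ge0].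
  apply: (via ((s x)%:E * (h x)%:E)%E); last by apply: leewl; rewrite ?lee_fin.
  by rewrite -EFinM lee_fin expr2 mulrA lewl// s0.
 rewrite n3tonelli; [|by rewrite /riesz; meas|by move=> x y; rewrite !mge0 ?riesz_ge0].
 apply: e3le => [| |y|y].
 - by apply: n3mE => [|x y]; [rewrite /riesz; meas|rewrite !mge0 ?riesz_ge0].
 - exact: (mEX_M (mEX_EFin mm) mJ).
 - by apply: n3ge0 => x; rewrite !mge0 ?riesz_ge0.
 - rewrite -n3Z//; [|by rewrite /riesz; meas|by move=> x; rewrite mge0 ?riesz_ge0].
  apply: n3le => [| |x|x].
  + by rewrite /riesz; meas.
  + by rewrite /riesz; meas.
  + by rewrite !mge0 ?riesz_ge0.
  + by rewrite (rieszC y x) mulrCA.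
(* The parameter [c = 768 * A] makes the energy term exactly [X / 2], which is absorbed by the
   left-hand side. *)
have h2 : (X <= (c / 2)%:E * M + (2 * c)^-1%:E * (768%:E * (A%:E * X)))%E.
 apply: le_trans h1 _.
 apply: (via (\int[mu]_y ((c / 2)%:E * (m y ^+ 2)%:E + (2 * c)^-1%:E * (J y * J y)))%E).
  apply: e3le => [| |y|y].
  - exact: (mEX_M (mEX_EFin mm) mJ).
  - by apply: mE_D; [exact: (mEX_M (mEX_cst _) (mEX_EFin mm2))|exact: (mEX_M (mEX_cst _) (mEX_M mJ mJ))].
  - by rewrite mule_ge0// lee_fin.
  - exact: amgm_ereal.
 have c20 : 0 <= c / 2 by rewrite divr_ge0// ltW.
 have c2i : 0 <= (2 * c)^-1 by pos.
 rewrite e3D; last 4 first.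
 - exact: (mEX_M (mEX_cst _) (mEX_EFin mm2)).
 - exact: (mEX_M (mEX_cst _) (mEX_M mJ mJ)).
 - by move=> y; rewrite -EFinM lee_fin mge0// sqr_ge0.
 - by move=> y; rewrite mule_ge0 ?lee_fin// sqe_ge0.
 rewrite e3Z//; last 2 first.
 - exact: mEX_EFin.
 - pos.
 rewrite e3Z//; last 2 first.
 - exact: (mEX_M mJ mJ).
 - by move=> y; exact: sqe_ge0.
 by apply: leeD => //; apply: leewl.
have Mf : M \is a fin_num by rewrite ge0_fin_numE.
have Xf : X \is a fin_num by rewrite ge0_fin_numE.
move: h2; rewrite -(fineK Mf) -(fineK Xf) -!EFinM -EFinD !lee_fin.
set x := fine X; set q := fine M; clear -c0 A0; rewrite /c => h2.
have : (2 * (768 * A))^-1 * (768 * (A * x)) = x / 2 by field; rewrite gt_eqF.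
by lra.
Qed.

End Potential2.

(** * Geometrically dominated complex series *)

Section ComplexSeries.
Implicit Types (u v a : nat -> R[i]) (l : R[i]).

Definition clim u : R[i] :=
 lim ((fun n => Re (u n)) @ \oo) +i* lim ((fun n => Im (u n)) @ \oo).

Lemma clim_eq u l : ccvg u l -> clim u = l.
by case: l => a b [h1 h2]; rewrite /clim (cvg_lim _ h1)// (cvg_lim _ h2). Qed.

Lemma ccvg_shift (k : nat) u l : ccvg u l -> ccvg (fun n => u (n + k)%N) l.
by case=> h1 h2; split; [move: h1|move: h2]; rewrite -(cvg_shiftn k). Qed.

Lemma geo_sum_le (rho : R) n : 0 <= rho -> rho < 1 -> \sum_(k < n) rho ^+ k <= (1 - rho)^-1.
move=> r0 r1; have h : 0 < 1 - rho by lra.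
have -> : \sum_(k < n) rho ^+ k = (1 - rho ^+ n) / (1 - rho).
 elim: n => [|n ih]; first by rewrite big_ord0 expr0 subrr mul0r.
 by rewrite big_ord_recr /= ih exprS; field; rewrite gt_eqF.
by rewrite ler_pdivrMr// mulVf ?gt_eqF// gerBl exprn_ge0.
Qed.

Lemma csum_tail a (C rho : R) (n m : nat) : 0 <= rho -> rho < 1 ->
 (forall k, nrm (a k) <= C * rho ^+ k) ->
 nrm (\sum_(k < m + n) a k - \sum_(k < n) a k) <= C * rho ^+ n / (1 - rho).
move=> r0 r1 ha.
have C0 : 0 <= C by have := ha 0%N; rewrite expr0 mulr1; apply: le_trans; pos.
rewrite addnC big_split_ord /= addrAC subrr add0r; apply: le_trans (nrm_sum _ _) _.
apply: (via (\sum_(k < m) C * rho ^+ n * rho ^+ k)).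
 by apply: ler_sum => k _; rewrite -mulrA -exprD; exact: ha.
rewrite -mulr_sumr; apply: lewl; last exact: geo_sum_le.
pos.
Qed.

Lemma csum_cvg a (C rho : R) : 0 <= rho -> rho < 1 -> (forall k, nrm (a k) <= C * rho ^+ k) ->
 exists2 l, ccvg (fun n => \sum_(k < n) a k) l &
  forall n, nrm (l - \sum_(k < n) a k) <= C * rho ^+ n / (1 - rho).
move=> r0 r1 ha.
have real (f : nat -> R) : (forall k, `|f k| <= C * rho ^+ k) -> cvgn (fun n => \sum_(k < n) f k).
 move=> hf; have hc : cvgn (series f).
  apply: normed_cvg; apply: (@series_le_cvg _ _ (geometric C rho)).
  - by move=> n; pos.
  - by move=> n /=; apply: le_trans (hf n); pos.
  - by move=> n /=; exact: hf.
  - by apply: is_cvg_geometric_series; rewrite ger0_norm.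
 have -> // : (fun n => \sum_(k < n) f k) = series f.
 by fext => n; rewrite /series /= big_mkord.
have sRe n : Re (\sum_(k < n) a k) = \sum_(k < n) Re (a k).
 by elim/big_rec2: _ => // k x y _ <-; rewrite ReD.
have sIm n : Im (\sum_(k < n) a k) = \sum_(k < n) Im (a k).
 by elim/big_rec2: _ => // k x y _ <-; rewrite ImD.
have c1 := real _ (fun k => le_trans (Re_le_nrm (a k)) (ha k)).
have c2 := real _ (fun k => le_trans (Im_le_nrm (a k)) (ha k)).
exists (lim ((fun n => \sum_(k < n) Re (a k)) @ \oo) +i*
    lim ((fun n => \sum_(k < n) Im (a k)) @ \oo)).
 split => /=.
  by under eq_fun do rewrite sRe.
 by under eq_fun do rewrite sIm.
set l := _ +i* _ => n.
have hl : ccvg (fun n => \sum_(k < n) a k) l.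
 split => /=.
  by under eq_fun do rewrite sRe.
 by under eq_fun do rewrite sIm.
apply: (ccvg_le (ccvgB (ccvg_shift n hl) (ccvg_cst (\sum_(k < n) a k)))) => m.
exact: csum_tail.
Qed.

(** Tannery's theorem: one geometric majorant makes all tails small at once, which leaves finitely
    many columns to pass to the limit. *)
Lemma ccvg_tannery (a : nat -> nat -> R[i]) (b : nat -> R[i]) (s : nat -> R[i]) l (C rho : R) :
 0 <= rho -> rho < 1 -> (forall n k, nrm (a n k) <= C * rho ^+ k) ->
 (forall k, ccvg (a ^~ k) (b k)) ->
 (forall n, ccvg (fun m => \sum_(k < m) a n k) (s n)) ->
 ccvg (fun m => \sum_(k < m) b k) l -> ccvg s l.
move=> r0 r1 ha hab hs hl.
have hb k : nrm (b k) <= C * rho ^+ k by apply: (ccvg_le (hab k)) => n; exact: ha.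
have C0 : 0 <= C by have := ha 0%N 0%N; rewrite expr0 mulr1; apply: le_trans; pos.
have [l' hl' tl] := csum_cvg r0 r1 hb; rewrite (ccvg_unique hl' hl) in tl.
have ts n m : nrm (s n - \sum_(k < m) a n k) <= C * rho ^+ m / (1 - rho).
 by have [s' hs' ts] := csum_cvg r0 r1 (ha n); rewrite (ccvg_unique hs' (hs n)) in ts.
apply/ccvgP; apply/cvgrPdist_lt => e e0.
have [m hm] : exists m : nat, C * rho ^+ m / (1 - rho) < e / 4.
 have : (fun m => C / (1 - rho) * rho ^+ m) @ \oo --> C / (1 - rho) * 0.
  by apply: cvgMr; apply: cvg_expr; rewrite ger0_norm.
 rewrite mulr0 => /cvgrPdist_lt/(_ (e / 4)); rewrite divr_gt0// => /(_ isT)[m _ /(_ m (leqnn _))].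
 rewrite sub0r normrN => /(lelt (ler_norm _)) h; exists m.
 by rewrite mulrAC.
have /ccvgP/cvgrPdist_lt/(_ (e / 4)) := ccvg_sum (index_enum 'I_m) (fun k : 'I_m => hab k).
rewrite divr_gt0// => /(_ isT); apply: filterS => n.
rewrite !sub0r !normrN !ger0_norm ?nge0// => h.
have := nrmD (s n - \sum_(k < m) a n k) (\sum_(k < m) a n k - \sum_(k < m) b k).
have := nrmD (s n - \sum_(k < m) b k) (\sum_(k < m) b k - l).
rewrite !addrA !subrK => h1 h2; have := ts n m; have := tl m; rewrite nrmBC.
by lra.
Qed.

Lemma nrm_inv (z : R[i]) : nrm z^-1 = (nrm z)^-1.
have [->|z0] := eqVneq z 0; first by rewrite invr0 nrm0 invr0.
have h : nrm z^-1 * nrm z = 1 by rewrite -nrmM mulVf// /= expr1n expr0n addr0 sqrtr1.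
have n0 : nrm z != 0.
 by apply/eqP => h0; move: h; rewrite h0 mulr0 => /eqP; rewrite eq_sym oner_eq0.
by apply: (mulIf n0); rewrite h mulVf.
Qed.

Lemma nrm_eq0 (z : R[i]) : nrm z = 0 -> z = 0.
exact: ComplexField.Normc.eq0_normc. Qed.

Lemma ccvg_conj u l : ccvg u l -> ccvg (fun n => (u n)^*%C) (l^*%C).
move=> [h1 h2]; split; first by under eq_fun do rewrite ReJ; rewrite ReJ.
by under eq_fun do rewrite ImJ; rewrite ImJ; exact: cvgN.
Qed.

Lemma ccvg_inv u l : l != 0 -> ccvg u l -> ccvg (fun n => (u n)^-1) l^-1.
move=> l0 h.
have inv (z : R[i]) : z^-1 = ((nrm z ^+ 2)^-1)%:C * z^*%C.
 have [->|z0] := eqVneq z 0; first by rewrite invr0 rmorph0 mulr0.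
 apply: (mulfI z0); rewrite mulfV// mulrCA.
 have -> : z * z^*%C = (nrm z ^+ 2)%:C.
  by rewrite nrm_sqr; apply: ceqP; rewrite !ReImE /=; ring.
 rewrite -rmorphM /= mulVf// expf_eq0 /=; apply/eqP => /nrm_eq0 z1.
 by move/eqP: z0 => /(_ z1).
have m0 : nrm l ^+ 2 != 0.
 by rewrite expf_eq0 /=; apply/eqP => /nrm_eq0 z1; move/eqP: l0 => /(_ z1).
rewrite inv; under eq_fun do rewrite inv.
apply: ccvgM; last exact: ccvg_conj.
apply: ccvg_real; apply: cvgV => //.
rewrite nrm_sqr; under eq_fun do rewrite nrm_sqr !expr2.
by rewrite !expr2; case: h => h1 h2; apply: cvgD; exact: cvgM.
Qed.

End ComplexSeries.

(** * Complex integrals over R^3 *)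

Section Integrals3.
Implicit Types (f : CF) (g : RF) (F : KF).

Definition cI f := cint mu f.
Definition cL1 f := mCX f /\ (\I_x (nrm (f x)) < +oo)%E.

Lemma cL1_le f g : mCX f -> mRX g -> (forall x, nrm (f x) <= g x) ->
 (\I_x (g x) < +oo)%E -> cL1 f.
exact: cintegrable_le. Qed.

Lemma cI_le f g (M : R) : mCX f -> mRX g -> (forall x, nrm (f x) <= g x) ->
 (\I_x (g x) <= M%:E)%E -> nrm (cI f) <= M.
exact: cint_le. Qed.

Lemma cI_dct (f_ : nat -> CF) f g : (forall n, mCX (f_ n)) ->
 (forall x, ccvg (f_ ^~ x) (f x)) -> mRX g -> (\I_x (g x) < +oo)%E ->
 (forall n x, nrm (f_ n x) <= g x) -> ccvg (fun n => cI (f_ n)) (cI f).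
exact: cint_dct. Qed.

Lemma cI_fubini F : mC2 F -> (\int[mu]_x \I_y (nrm (F x y)) < +oo)%E ->
 cI (fun x => cI (F x)) = cI (fun y => cI (F ^~ y)).
exact: cint_fubini. Qed.

Lemma cI_D f1 f2 : cL1 f1 -> cL1 f2 -> cI (fun x => f1 x + f2 x) = cI f1 + cI f2.
exact: cintD. Qed.
Lemma cI_B f1 f2 : cL1 f1 -> cL1 f2 -> cI (fun x => f1 x - f2 x) = cI f1 - cI f2.
exact: cintB. Qed.
Lemma cI_Z (c : R[i]) f : cL1 f -> cI (fun x => c * f x) = c * cI f.
exact: cintZ. Qed.
Lemma cI_N f : cL1 f -> cI (fun x => - f x) = - cI f.
exact: cintN. Qed.
Lemma cI_conj f : cL1 f -> cI (fun x => (f x)^*%C) = (cI f)^*%C.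
exact: cint_conj. Qed.
Lemma cI_sum I (r : seq I) (F : I -> CF) : (forall i, cL1 (F i)) ->
 cI (fun x => \sum_(i <- r) F i x) = \sum_(i <- r) cI (F i).
by move=> h; have [] := cint_sum r h. Qed.
Lemma cL1_sum I (r : seq I) (F : I -> CF) : (forall i, cL1 (F i)) ->
 cL1 (fun x => \sum_(i <- r) F i x).
by move=> h; have [] := cint_sum r h. Qed.
Lemma cL1_D f1 f2 : cL1 f1 -> cL1 f2 -> cL1 (fun x => f1 x + f2 x).
exact: cintegrableD. Qed.
Lemma cL1_B f1 f2 : cL1 f1 -> cL1 f2 -> cL1 (fun x => f1 x - f2 x).
exact: cintegrableB. Qed.
Lemma cL1_Z (c : R[i]) f : cL1 f -> cL1 (fun x => c * f x).
exact: cintegrableZ. Qed.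
Lemma cI_ae f1 f2 : mCX f1 -> mCX f2 -> {ae mu, forall x : R3 R, f1 x = f2 x} -> cI f1 = cI f2.
exact: eq_cint_ae. Qed.
Lemma cI_cI F : mC2 F -> mCX (fun x => cI (F x)).
exact: mC_cint. Qed.
Lemma cI_shift (a : R3 R) f : mCX f -> cI (fun x => f (x + a)) = cI f.
exact: cint_shift. Qed.
Lemma eq_cI f1 f2 : f1 =1 f2 -> cI f1 = cI f2.
by move=> h; congr (cI _); fext. Qed.
Lemma eq_n3 g1 g2 : g1 =1 g2 -> (\I_x (g1 x) = \I_x (g2 x))%E.
by move=> h; apply: eq_integral => x _; rewrite h. Qed.

End Integrals3.

(** * Neumann series on weighted spaces *)

Section Neumann.
Implicit Types (D : TF) (f : KF).
Implicit Types (q : R3 R -> RF) (y x w : R3 R).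

(* The first variable [y] is a parameter: the operator acts on [x]. *)
Definition app D f y x : R[i] := cI (fun w => D y x w * f y w).

Definition mC3 D := @mC R _ ((X * X) * X)%type (fun p => D p.1.1 p.1.2 p.2).
Definition mR3 (F : R3 R -> R3 R -> RF) := @mR R _ ((X * X) * X)%type (fun p => F p.1.1 p.1.2 p.2).

Lemma mC3_r D y x : mC3 D -> mCX (D y x).
by move=> h; rewrite /mCX; apply: (mC_c h (h := fun w : X => ((y, x) : (X * X)%type, w))); mproj.
Qed.

Lemma mR3_r (F : R3 R -> R3 R -> RF) y x : mR3 F -> mRX (F y x).
by move=> h; rewrite /mRX; apply: (mR_c h (h := fun w : X => ((y, x) : (X * X)%type, w))); mproj.
Qed.

Lemma mC_app D f : mC3 D -> mC2 f -> mC2 (app D f).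
move=> mD mf; rewrite /mC2 /app /cI.
apply: (@mC_cint _ _ _ (X * X)%type X mu (fun p w => D p.1 p.2 w * f p.1 w)).
apply: mC_M; first exact: mD.
by apply: (mC_c mf (h := fun p : (X * X * X)%type => ((p.1.1, p.2) : (X * X)%type))); mproj.
Qed.

(** An operator norm bound: on functions bounded by a multiple of q, every kernel dominated by E has
    norm at most B. Both E and q may depend on the parameter y, as the weight [q2] does. *)
Definition kbd (E : R3 R -> R3 R -> RF) q (B : R) := [/\ mR3 E, forall y x w, 0 <= E y x w &
 forall y x, (\I_w (E y x w * q y w) <= (B * q y x)%:E)%E].

Variables (E : R3 R -> R3 R -> RF) (q : R3 R -> RF) (B : R).
Hypotheses (mq : mR2 q) (q0 : forall y x, 0 <= q y x) (kE : kbd E q B).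

Definition dom D := mC3 D /\ forall y x w, nrm (D y x w) <= E y x w.
Definition bdd f (M : R) := mC2 f /\ forall y x, nrm (f y x) <= M * q y x.

Lemma app_dominated (M : R) y x : 0 <= M ->
 mRX (fun w => M * (E y x w * q y w)) /\
 (\I_w (M * (E y x w * q y w)) <= (B * M * q y x)%:E)%E.
case: kE => mE' E0 hE M0; have m1 := mR3_r y x mE'; have m2 := mR2_r y mq.
have m3 : mRX (fun w => E y x w * q y w) by meas.
split; first by meas.
rewrite n3Z//; last pos.
apply: le_trans (_ : M%:E * (B * q y x)%:E <= _)%E; first exact: leewl.
by rewrite -EFinM lee_fin le_eqVlt; apply/orP; left; apply/eqP; ring.
Qed.

Lemma app_integrable D f M y x : dom D -> bdd f M -> 0 <= M ->
 cL1 (fun w => D y x w * f y w).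
move=> [mD hD] [mf hf] M0; have [m i] := app_dominated y x M0; have [_ E0 _] := kE.
have m1 := mC3_r y x mD; have m2 := mC2_r y mf.
apply: (cL1_le (g := fun w => M * (E y x w * q y w))).
- by meas.
- exact: m.
- by move=> w; rewrite nrmM mulrCA; apply: ler_pM => //; pos.
- by apply: lelt i _; rewrite ltry.
Qed.

Lemma app_bdd D f M : dom D -> bdd f M -> 0 <= M -> bdd (app D f) (B * M).
move=> [mD hD] [mf hf] M0; split; first exact: mC_app.
move=> y x; have [m i] := app_dominated y x M0; have [_ E0 _] := kE.
have m1 := mC3_r y x mD; have m2 := mC2_r y mf.
apply: (cI_le (g := fun w => M * (E y x w * q y w))).
- by meas.
- exact: m.
- by move=> w; rewrite nrmM mulrCA; apply: ler_pM => //; pos.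
- exact: i.
Qed.

Lemma app_cvg (D_ : nat -> _) D (f_ : nat -> _) f (M : R) y : 0 <= M ->
 (forall n, dom (D_ n)) -> (forall n, bdd (f_ n) M) ->
 (forall x w, ccvg (fun n => D_ n y x w) (D y x w)) ->
 (forall x, ccvg (fun n => f_ n y x) (f y x)) ->
 forall x, ccvg (fun n => app (D_ n) (f_ n) y x) (app D f y x).
move=> M0 hD hf cD cf x; have [m i] := app_dominated y x M0; have [_ E0 _] := kE.
apply: (cI_dct (g := fun w => M * (E y x w * q y w))).
- by move=> n; have m1 := mC3_r y x (hD n).1; have m2 := mC2_r y (hf n).1; meas.
- by move=> w; exact: ccvgM.
- exact: m.
- by apply: lelt i _; rewrite ltry.
- move=> n w; rewrite nrmM mulrCA; apply: ler_pM; [pos..| |].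
  exact: (hD n).2.
 exact: (hf n).2.
Qed.

Lemma bddD f g M N : bdd f M -> bdd g N -> bdd (fun y x => f y x + g y x) (M + N).
move=> [mf hf] [mg hg]; split; first by meas.
by move=> y x; rewrite mulrDl; apply: le_trans (nrmD _ _) _; exact: lerD.
Qed.

Lemma bddN f M : bdd f M -> bdd (fun y x => - f y x) M.
by move=> [mf hf]; split; [meas|move=> y x; rewrite nrmN]. Qed.

Lemma bddZ (c : CF) f M N : 0 <= N -> mCX c -> (forall y, nrm (c y) <= N) -> bdd f M ->
 bdd (fun y x => c y * f y x) (N * M).
move=> N0 mc hc [mf hf]; split; first by meas.
by move=> y x; rewrite nrmM -mulrA; apply: ler_pM => //; pos.
Qed.

Lemma bdd_le f M N : bdd f M -> M <= N -> bdd f N.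
by move=> [mf hf] MN; split => // y x; apply: le_trans (hf y x) _; exact: lewr. Qed.

Lemma bdd0 : bdd (fun _ _ => 0) 0.
by split; [meas|move=> y x; rewrite nrm0 mul0r]. Qed.

Lemma bdd_sum I (r : seq I) (F : I -> KF) (M : I -> R) :
 (forall i, bdd (F i) (M i)) -> bdd (fun y x => \sum_(i <- r) F i y x) (\sum_(i <- r) M i).
move=> h; elim: r => [|a r ih].
 rewrite big_nil; have -> // : (fun y x => \sum_(i <- [::]) F i y x) = fun _ _ => 0; last exact: bdd0.
 by fext => y; fext => x; rewrite big_nil.
rewrite big_cons.
have -> : (fun y x => \sum_(i <- (a :: r)) F i y x) = fun y x => F a y x + \sum_(i <- r) F i y x.
 by fext => y; fext => x; rewrite big_cons.
exact: bddD.
Qed.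

Fixpoint npow D f k : KF :=
 if k is k'.+1 then fun y x => - app D (npow D f k') y x else f.

Definition neumann D f y x : R[i] := clim (fun n => \sum_(k < n) npow D f k y x).

(** What the series needs is decay of the iterates. Asking for this instead of a small norm lets [A]
    exceed 1 and so covers operators of which only the square is small. *)
Definition geomp D (A rho : R) := forall f M, bdd f M -> 0 <= M ->
 forall k, bdd (npow D f k) (A * M * rho ^+ k).

Variables (A rho : R).
Hypotheses (A0 : 0 <= A) (rho0 : 0 <= rho) (rho1 : rho < 1).

Lemma neumann_cvg D f M : dom D -> geomp D A rho -> bdd f M -> 0 <= M -> forall y x,
 ccvg (fun n => \sum_(k < n) npow D f k y x) (neumann D f y x).
move=> hD gD hf M0 y x.
have h k : nrm (npow D f k y x) <= A * M * q y x * rho ^+ k.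
 by rewrite mulrAC; exact: (gD f M hf M0 k).2.
by have [l hl _] := csum_cvg rho0 rho1 h; rewrite /neumann (clim_eq hl).
Qed.

Lemma partial_bdd D f M : geomp D A rho -> bdd f M -> 0 <= M -> forall n,
 bdd (fun y x => \sum_(k < n) npow D f k y x) (A / (1 - rho) * M).
move=> gD hf M0 n; apply: bdd_le; first exact: (bdd_sum _ (fun k : 'I_n => gD f M hf M0 k)).
rewrite -mulr_sumr; have := geo_sum_le n rho0 rho1.
rewrite [A / _ * M]mulrAC => h; apply: lewl => //.
pos.
Qed.

Lemma neumann_bdd D f M : dom D -> geomp D A rho -> bdd f M -> 0 <= M ->
 bdd (neumann D f) (A / (1 - rho) * M).
move=> hD gD hf M0; have c := neumann_cvg hD gD hf M0; have p := partial_bdd gD hf M0.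
split.
 rewrite /mC2; apply: (mC_lim (f_ := fun n (z : (X * X)%type) => \sum_(k < n) npow D f k z.1 z.2)).
  by move=> n; exact: (p n).1.
 by move=> [y x] /=; exact: c.
by move=> y x; apply: (ccvg_le (c y x)) => n; exact: (p n).2.
Qed.

Lemma app_sum D f M : dom D -> geomp D A rho -> bdd f M -> 0 <= M -> forall n y x,
 \sum_(k < n.+1) npow D f k y x = f y x - app D (fun y x => \sum_(k < n) npow D f k y x) y x.
move=> hD gD hf M0 n y x; rewrite big_ord_recl /=; congr (_ + _).
rewrite sumrN; congr (- _); rewrite /app.
have i k : cL1 (fun w => D y x w * npow D f k y w).
 apply: (app_integrable _ _ hD (gD f M hf M0 k)).
 pos.
rewrite -(cI_sum (index_enum 'I_n) (fun k : 'I_n => i k)).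
by apply: eq_cI => w; rewrite mulr_sumr.
Qed.

Lemma neumannP D f M : dom D -> geomp D A rho -> bdd f M -> 0 <= M -> forall y x,
 neumann D f y x + app D (neumann D f) y x = f y x.
move=> hD gD hf M0 y x; have c := neumann_cvg hD gD hf M0; have p := partial_bdd gD hf M0.
have hl : ccvg (fun n => \sum_(k < n.+1) npow D f k y x) (f y x - app D (neumann D f) y x).
 under eq_fun do rewrite (app_sum hD gD hf M0); apply: ccvgB; first exact: ccvg_cst.
 apply: (app_cvg (D_ := fun=> D) (f_ := fun n y x => \sum_(k < n) npow D f k y x)
  (M := A / (1 - rho) * M)) => //.
 - by rewrite !mge0// invr_ge0 subr_ge0 ltW.
 by move=> *; exact: ccvg_cst.
have h2 : ccvg (fun n => \sum_(k < n.+1) npow D f k y x) (neumann D f y x).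
 by have := ccvg_shift 1 (c y x); under eq_fun do rewrite addn1.
by rewrite -(ccvg_unique hl h2) subrK.
Qed.

(** Each iterate converges by dominated convergence under the common majorant E; Tannery's theorem
    then sums the iterates. *)
Lemma neumann_continuous (D_ : nat -> _) D (f_ : nat -> _) f (M : R) y : 0 <= M ->
 (forall n, dom (D_ n)) -> dom D -> (forall n, geomp (D_ n) A rho) ->
 geomp D A rho -> (forall n, bdd (f_ n) M) -> bdd f M ->
 (forall x w, ccvg (fun n => D_ n y x w) (D y x w)) ->
 (forall x, ccvg (fun n => f_ n y x) (f y x)) ->
 forall x, ccvg (fun n => neumann (D_ n) (f_ n) y x) (neumann D f y x).
move=> M0 hD_ hD gD_ gD hf_ hf cD cf x.
apply: (ccvg_tannery (a := fun n k => npow (D_ n) (f_ n) k y x) (b := fun k => npow D f k y x)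
 (C := A * M * q y x) rho0 rho1) => [n k|k|n|].
- by rewrite mulrAC; exact: (gD_ n _ _ (hf_ n) M0 k).2.
- elim: k x => [//|k ih] x /=; apply: ccvgN; apply: (app_cvg (M := A * M * rho ^+ k)) => //.
 - pos.
 - by move=> n; exact: gD_.
- exact: (neumann_cvg (hD_ n) (gD_ n) (hf_ n)).
- exact: (neumann_cvg hD gD hf).
Qed.

End Neumann.

(** * Bounds and limits for determinants and adjugates *)

Lemma nrm_prod I (r : seq I) (F : I -> R[i]) :
 nrm (\prod_(i <- r) F i) = \prod_(i <- r) nrm (F i).
elim/big_rec2: _ => [|i a b _ <-]; last by rewrite nrmM.
by rewrite -[1]/(1%:C) nrm_real normr1.
Qed.

Lemma nrm_sign (b : nat) : nrm ((-1) ^+ b : R[i]) = 1.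
elim: b => [|b ih]; first by rewrite expr0 -[1]/(1%:C) nrm_real normr1.
by rewrite exprS mulN1r nrmN.
Qed.

Lemma nrm_det n (M : 'M[R[i]]_n) (b : R) : (forall i j, nrm (M i j) <= b) ->
 nrm (\det M) <= n`!%:R * b ^+ n.
move=> h; apply: le_trans (nrm_sum _ _) _.
apply: (via (\sum_(s : {perm 'I_n}) b ^+ n)); last first.
 by rewrite sumr_const card_Sn mulr_natl.
apply: ler_sum => s _; rewrite nrmM nrm_sign mul1r nrm_prod.
apply: (via (\prod_(i < n) b)); last by rewrite prodr_const card_ord.
by apply: ler_prod => i _; rewrite nge0 h.
Qed.

Lemma nrm_adj n (M : 'M[R[i]]_n) (b : R) : (forall i j, nrm (M i j) <= b) ->
 forall i j, nrm ((\adj M) i j) <= n.-1`!%:R * b ^+ n.-1.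
by move=> h i j; rewrite !mxE /cofactor nrmM nrm_sign mul1r; apply: nrm_det => k l; rewrite !mxE.
Qed.

Lemma ccvg_det n (M_ : nat -> 'M[R[i]]_n) (M : 'M[R[i]]_n) : (forall i j, ccvg (fun k => M_ k i j) (M i j)) ->
 ccvg (fun k => \det (M_ k)) (\det M).
move=> h; apply: ccvg_sum => s; apply: ccvgM; first exact: ccvg_cst.
by apply: ccvg_prod => i.
Qed.

Lemma ccvg_adj n (M_ : nat -> 'M[R[i]]_n) (M : 'M[R[i]]_n) : (forall i j, ccvg (fun k => M_ k i j) (M i j)) ->
 forall i j, ccvg (fun k => (\adj (M_ k)) i j) ((\adj M) i j).
move=> h i j; under eq_fun do rewrite !mxE /cofactor; rewrite !mxE /cofactor.
apply: ccvgM; first exact: ccvg_cst.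
by apply: ccvg_det => k l; under eq_fun do rewrite !mxE; rewrite !mxE.
Qed.

(** * Inverting a contraction plus a finite-rank operator *)

Section FiniteRank.
Implicit Types (u v r l : CF) (T : KF) (y x w : R3 R).

Definition om (_ x : R3 R) : R := omega x.

Lemma mR2_om : mR2 om.
by rewrite /om /omega; meas. Qed.

Lemma om_ge0 y x : 0 <= om y x.
pos. Qed.

(** Here the kernel does not depend on the parameter y, which survives only in the right-hand
    side. *)
Definition cst2 T : TF := fun=> T.

Lemma npow_cst T (f : CF) k y : npow (cst2 T) (fun=> f) k y = npow (cst2 T) (fun=> f) k 0.
by elim: k => [//|k ih] /=; fext => x; rewrite /app /cst2 ih. Qed.

Lemma neumann_cst T (f : CF) y : neumann (cst2 T) (fun=> f) y = neumann (cst2 T) (fun=> f) 0.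
fext => x; rewrite /neumann; congr clim; fext => n.
by apply: eq_bigr => k _; rewrite npow_cst.
Qed.

Variables (E : R3 R -> R3 R -> RF) (B A rho : R).
Hypotheses (kE : kbd E om B) (A0 : 0 <= A) (rho0 : 0 <= rho) (rho1 : rho < 1).
Variables (n : nat) (l : 'I_n -> CF) (Bl Mr : R).
Hypotheses (ml : forall i, mCX (l i)) (Bl0 : 0 <= Bl) (Mr0 : 0 <= Mr).
Hypothesis (hl : forall i, (\I_w (nrm (l i w) * omega w) <= Bl%:E)%E).

Definition ell (i : 'I_n) u : R[i] := cI (fun w => l i w * u w).

Notation bdo f M := (bdd om f M).

Lemma ell_dom (i : 'I_n) (M : R) : 0 <= M -> mRX (fun w => M * (nrm (l i w) * omega w)) /\
 (\I_w (M * (nrm (l i w) * omega w)) <= (Bl * M)%:E)%E.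
move=> M0; have m1 := ml i.
have m2 : mRX (fun w => nrm (l i w) * omega w) by rewrite /omega; meas.
split; first by apply: mR_M; [meas|exact: m2].
rewrite n3Z//; last pos.
by rewrite [(Bl * M)%R]mulrC EFinM; apply: leewl.
Qed.

Lemma ell_integrable i (f : KF) M y : bdo f M -> 0 <= M -> cL1 (fun w => l i w * f y w).
move=> [mf hf] M0; have m1 := ml i; have m2 := mC2_r y mf; have [m3 h3] := ell_dom i M0.
apply: (cL1_le (g := fun w => M * (nrm (l i w) * omega w))) => //; first by meas.
 by move=> w; rewrite nrmM mulrCA; apply: lewl; [pos|exact: hf].
by apply: lelt h3 _; rewrite ltry.
Qed.

Lemma ell_le i (f : KF) M y : bdo f M -> 0 <= M -> nrm (ell i (f y)) <= Bl * M.
move=> [mf hf] M0; have m1 := ml i; have m2 := mC2_r y mf; have [m3 h3] := ell_dom i M0.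
apply: (cI_le (g := fun w => M * (nrm (l i w) * omega w))) => //; first by meas.
by move=> w; rewrite nrmM mulrCA; apply: lewl; [pos|exact: hf].
Qed.

Lemma mC_ell i (f : KF) M : bdo f M -> mCX (fun y => ell i (f y)).
move=> [mf hf]; have m1 := ml i; apply: (cI_cI (F := fun y w => l i w * f y w)).
by meas.
Qed.

Lemma ell_cvg i (f_ : nat -> KF) f (M : R) y : 0 <= M -> (forall k, bdo (f_ k) M) ->
 (forall x, ccvg (fun k => f_ k y x) (f y x)) -> ccvg (fun k => ell i (f_ k y)) (ell i (f y)).
move=> M0 hf cf; have m1 := ml i; have [m3 h3] := ell_dom i M0.
apply: (cI_dct (g := fun w => M * (nrm (l i w) * omega w))).
- by move=> k; have m2 := mC2_r y (hf k).1; meas.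
- by move=> w; apply: ccvgM => //; exact: ccvg_cst.
- exact: m3.
- by apply: lelt h3 _; rewrite ltry.
- by move=> k w; rewrite nrmM mulrCA; apply: lewl; [pos|exact: (hf k).2].
Qed.

Section Solve.
Variables (T : KF) (r : 'I_n -> CF).
Let D := cst2 T.
Hypotheses (hD : dom E D) (gD : geomp om D A rho).
Hypothesis (hr : forall i, bdo (fun=> r i) Mr).

Definition srange (i : 'I_n) x : R[i] := neumann D (fun=> r i) 0 x.
(** The matrix of $\delta_{ij}+\ell_i((1+T)^{-1}r_j)$. Its determinant is that of
    $1+(1+T)^{-1}\sum_i r_i\otimes\ell_i$, so it decides whether $1+T+\sum_i r_i\otimes\ell_i$ is
    invertible. *)
Definition fmx : 'M[R[i]]_n := 1%:M + \matrix_(i, j) ell i (srange j).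
(** The matrix inverse is written as adjugate over determinant, so that bounds stay uniform as long
    as the determinant stays away from 0. With [solve] this is the Sherman-Morrison-Woodbury
    formula. *)
Definition coef (H : KF) y (i : 'I_n) : R[i] :=
 (\det fmx)^-1 * \sum_j (\adj fmx) i j * ell j (neumann D H y).
Definition solve H y x : R[i] := neumann D H y x - \sum_i coef H y i * srange i x.
Definition fullT x w : R[i] := T x w + \sum_i r i x * l i w.

Let S := A / (1 - rho).
Let S0 : 0 <= S. Proof. by rewrite divr_ge0// subr_ge0 ltW. Qed.

Lemma srange_bdd i : bdo (fun=> srange i) (S * Mr).
have h : neumann D (fun=> r i) = fun=> srange i.
 by fext => y; rewrite /srange /D neumann_cst.
by rewrite -h; exact: (neumann_bdd om_ge0 A0 rho0 rho1 hD gD (hr i) Mr0).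
Qed.

Let b := 1 + Bl * (S * Mr).
Lemma fmx_le i j : nrm (fmx i j) <= b.
rewrite !mxE; apply: le_trans (nrmD _ _) _; apply: lerD; last first.
 by apply: (ell_le _ (0 : R3 R) (srange_bdd j)); pos.
case: (i == j); first by rewrite -[1%:R]/(1%:C) nrm_real normr1.
by rewrite nrm0.
Qed.

Definition solve_const (d : R) := S + d^-1 * (n%:R * (n.-1`!%:R * b ^+ n.-1 * (Bl * S))) *
 (n%:R * (S * Mr)).

Lemma coef_bdd H M : bdo H M -> 0 <= M -> forall i, mCX (fun y => coef H y i) /\
 forall y, nrm (coef H y i) <=
  (nrm (\det fmx))^-1 * (n%:R * (n.-1`!%:R * b ^+ n.-1 * (Bl * S))) * M.
move=> hH M0 i; have hN := neumann_bdd om_ge0 A0 rho0 rho1 hD gD hH M0.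
split.
 apply: mC_M; first meas.
 apply: mC_sum => j; apply: mC_M; first meas.
 exact: mC_ell hN.
move=> y; rewrite nrmM nrm_inv -mulrA; apply: lewl.
 pos.
apply: le_trans (nrm_sum _ _) _.
apply: (via (\sum_(j < n) (n.-1`!%:R * b ^+ n.-1 * (Bl * S)) * M)); last first.
 by rewrite sumr_const card_ord -[leLHS]mulr_natl le_eqVlt; apply/orP; left; apply/eqP; ring.
apply: ler_sum => j _; rewrite nrmM -[leRHS]mulrA; apply: ler_pM; [pos..| |].
 exact: (nrm_adj fmx_le).
by apply: le_trans (ell_le _ _ hN _) _; rewrite ?mulrA// mge0.
Qed.

Lemma solve_bdd H M : bdo H M -> 0 <= M -> bdo (solve H) (solve_const (nrm (\det fmx)) * M).
move=> hH M0; have hN := neumann_bdd om_ge0 A0 rho0 rho1 hD gD hH M0.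
pose c := (nrm (\det fmx))^-1 * (n%:R * (n.-1`!%:R * b ^+ n.-1 * (Bl * S))) * M.
have b0 : 0 <= b := addr_ge0 ler01 (mge0 Bl0 (mge0 S0 Mr0)).
have c0 : 0 <= c.
 have i0 : 0 <= (nrm (\det fmx))^-1 by pos.
 have k0 : 0 <= n.-1`!%:R * b ^+ n.-1 := mge0 (ler0n _ _) (exprn_ge0 _ b0).
 exact: (mge0 (mge0 i0 (mge0 (ler0n _ _) (mge0 k0 (mge0 Bl0 S0)))) M0).
have hs i : bdo (fun y x => coef H y i * srange i x) (c * (S * Mr)).
 have [m h] := coef_bdd hH M0 i.
 exact: (bddZ c0 m h (srange_bdd i)).
have := bddD hN (bddN (bdd_sum (index_enum 'I_n) hs)).
rewrite sumr_const card_ord => h; apply: (bdd_le om_ge0 h).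
apply: eqle; rewrite /solve_const /c -mulr_natl -/S.
by ring.
Qed.

Lemma app_fullT (u : KF) M y x : bdo u M -> 0 <= M ->
 app (cst2 fullT) u y x = app D u y x + \sum_i r i x * ell i (u y).
move=> hu M0; rewrite /app /cst2 /fullT.
have i1 := app_integrable mR2_om om_ge0 kE y x hD hu M0.
have i2 i := cL1_Z (r i x) (ell_integrable i y hu M0).
have -> : \sum_i r i x * ell i (u y) = \sum_i cI (fun w => r i x * (l i w * u y w)).
 by apply: eq_bigr => i _; rewrite cI_Z//; exact: (ell_integrable i y hu M0).
rewrite -cI_sum// -cI_D//; last exact: cL1_sum.
apply: eq_cI => w; rewrite mulrDl mulr_suml; congr (_ + _).
by apply: eq_bigr => i _; rewrite mulrA.
Qed.

Lemma srangeP i y x : srange i x + app D (fun=> srange i) y x = r i x.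
have := neumannP mR2_om om_ge0 kE A0 rho0 rho1 hD gD (hr i) Mr0 y x.
by rewrite /srange /app /D neumann_cst.
Qed.

Lemma solveP H M : \det fmx != 0 -> bdo H M -> 0 <= M -> forall y x,
 solve H y x + app (cst2 fullT) (solve H) y x = H y x.
move=> d0 hH M0 y x; have hN := neumann_bdd om_ge0 A0 rho0 rho1 hD gD hH M0.
have hS := solve_bdd hH M0; set C := (solve_const _ * M) in hS.
have hS' : bdo (solve H) `|C| by apply: (bdd_le om_ge0 hS); exact: ler_norm.
have SM0 : 0 <= S * Mr by pos.
have SM0' : 0 <= S * M by pos.
rewrite (app_fullT _ _ hS')//.
have i1 z := app_integrable mR2_om om_ge0 kE z x hD hN SM0'.
have i2 i := cL1_Z (coef H y i) (app_integrable mR2_om om_ge0 kE y x hD (srange_bdd i) SM0).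
have e1 : app D (solve H) y x = app D (neumann D H) y x - \sum_i coef H y i * app D (fun=> srange i) y x.
 rewrite /app; have -> : \sum_i coef H y i * cI (fun w => D y x w * srange i w) =
  \sum_i cI (fun w => coef H y i * (D y x w * srange i w)).
  by apply: eq_bigr => i _; rewrite cI_Z//; exact: (app_integrable mR2_om om_ge0 kE y x hD (srange_bdd i) SM0).
 rewrite -cI_sum// -cI_B//; last exact: cL1_sum.
 apply: eq_cI => w; rewrite mulrBr mulr_sumr; congr (_ - _).
 by apply: eq_bigr => i _; rewrite mulrCA.
have e2 i : ell i (solve H y) = ell i (neumann D H y) - \sum_j coef H y j * ell i (srange j).
 have i3 := ell_integrable i y hN SM0'.
 have i4 j := ell_integrable i y (srange_bdd j) SM0.
 rewrite /ell; have -> : \sum_j coef H y j * cI (fun w => l i w * srange j w) =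
  \sum_j cI (fun w => coef H y j * (l i w * srange j w)).
  by apply: eq_bigr => j _; rewrite cI_Z.
 rewrite -cI_sum; last by move=> j; exact: cL1_Z.
 rewrite -cI_B//; last by apply: cL1_sum => j; exact: cL1_Z.
 apply: eq_cI => w; rewrite mulrBr mulr_sumr; congr (_ - _).
 by apply: eq_bigr => j _; rewrite mulrCA.
(* The coefficients solve [fmx *m c = h], which says precisely that [ell i] takes the value
   [coef H y i] on the solution; the finite-rank contributions then cancel. *)
have e3 i : ell i (solve H y) = coef H y i.
 pose c := \col_i coef H y i; pose h := \col_i ell i (neumann D H y).
 have hc : fmx *m c = h.
  have -> : c = (\det fmx)^-1 *: (\adj fmx *m h).
   apply/matrixP => j k; rewrite !mxE /coef; congr (_ * _).
   by apply: eq_bigr => i' _; rewrite !mxE.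
  by rewrite -scalemxAr mulmxA mul_mx_adj mul_scalar_mx scalerA mulVf// scale1r.
 have := congr1 (fun Z : 'cV_n => Z i ord0) hc; rewrite mulmxDl mul1mx !mxE => h1.
 rewrite e2 -h1; apply/eqP; rewrite subr_eq; apply/eqP; congr (_ + _).
 by apply: eq_bigr => j _; rewrite !mxE mulrC.
rewrite e1 -(neumannP mR2_om om_ge0 kE A0 rho0 rho1 hD gD hH M0 y x) /solve.
have -> : \sum_i r i x * ell i (solve H y) =
  \sum_i (coef H y i * srange i x + coef H y i * app D (fun=> srange i) y x).
 by apply: eq_bigr => i _; rewrite e3 -mulrDr srangeP mulrC.
rewrite big_split /=; ring.
Qed.

(** A null vector a of [fmx] gives $u=\sum_j a_j(1+T)^{-1}r_j$ with $\ell_i(u)=-a_i$: the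
    finite-rank part cancels $(1+T)u$, and u is nonzero because a is. *)
Lemma singular_kernel : \det fmx = 0 -> exists2 u : CF,
 (exists2 M : R, 0 <= M & bdo (fun=> u) M) &
 (forall y x, u x + app (cst2 fullT) (fun=> u) y x = 0) /\ ~ (forall x, u x = 0).
move=> d0; have SM0 : 0 <= S * Mr by pos.
(* [det0P] provides a null row vector, hence the transpose. *)
have /eqP/det0P[v v0 vM] : \det fmx^T = 0 by rewrite det_tr.
pose a j : R[i] := v ord0 j.
pose u x : R[i] := \sum_j a j * srange j x.
have hj j : bdo (fun _ x => a j * srange j x) (nrm (a j) * (S * Mr)).
 have mc : mCX (fun=> a j) by meas.
 have hc (y : R3 R) : nrm ((fun=> a j) y) <= nrm (a j) by exact: lexx.
 exact: (bddZ (nge0 (a j)) mc hc (srange_bdd j)).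
have hu := bdd_sum (index_enum 'I_n) hj; set M := (\sum_i _) in hu.
have M0 : 0 <= M by apply: sumr_ge0 => j _; pos.
exists u; first by exists M.
have eu i : ell i u = - a i.
 have i4 j := ell_integrable i 0 (srange_bdd j) SM0.
 have e : ell i u = \sum_j a j * ell i (srange j).
  have -> : \sum_j a j * ell i (srange j) = \sum_j cI (fun w => a j * (l i w * srange j w)).
   by apply: eq_bigr => j _; rewrite cI_Z.
  rewrite -cI_sum; last by move=> j; exact: cL1_Z.
  by apply: eq_cI => w; rewrite mulr_sumr; apply: eq_bigr => j _; rewrite mulrCA.
 have := congr1 (fun Z : 'rV_n => Z ord0 i) vM; rewrite linearD /= mulmxDr trmx1 mulmx1 !mxE => h.
 rewrite e; apply/eqP; rewrite -addr_eq0 addrC; apply/eqP; rewrite -[RHS]h; congr (_ + _).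
 by apply: eq_bigr => j _; rewrite !mxE.
split; last first.
 move=> u0; case/negP: v0; apply/eqP/matrixP => i j; rewrite (ord1 i) mxE.
 apply/eqP; rewrite -oppr_eq0 -eu /ell; apply/eqP.
 have -> : (fun w => l j w * u w) = fun=> 0 by fext => w; rewrite u0 mulr0.
 exact: cint0.
move=> y x; rewrite (app_fullT _ _ hu)//.
have e1 : app D (fun=> u) y x = \sum_j a j * app D (fun=> srange j) y x.
 have i2 i := app_integrable mR2_om om_ge0 kE y x hD (srange_bdd i) SM0.
 rewrite /app; have -> : \sum_i a i * cI (fun w => D y x w * srange i w) =
  \sum_i cI (fun w => a i * (D y x w * srange i w)).
  by apply: eq_bigr => i _; rewrite cI_Z//; exact: i2.
 rewrite -cI_sum; last by move=> i; exact: (cL1_Z _ (i2 i)).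
 by apply: eq_cI => w; rewrite mulr_sumr; apply: eq_bigr => i _; rewrite mulrCA.
rewrite e1 addrA -big_split -big_split /=; apply: big1 => i _.
by rewrite eu mulrN -mulrDr srangeP mulrC subrr.
Qed.

End Solve.

Lemma fmx_cvg (T_ : nat -> KF) T (r_ : nat -> 'I_n -> CF) (r : 'I_n -> CF) :
 (forall k, dom E (cst2 (T_ k))) -> dom E (cst2 T) ->
 (forall k, geomp om (cst2 (T_ k)) A rho) -> geomp om (cst2 T) A rho ->
 (forall k i, bdo (fun=> r_ k i) Mr) -> (forall i, bdo (fun=> r i) Mr) ->
 (forall x w, ccvg (fun k => T_ k x w) (T x w)) -> (forall i x, ccvg (fun k => r_ k i x) (r i x)) ->
 (forall i x, ccvg (fun k => srange (T_ k) (r_ k) i x) (srange T r i x)) /\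
 (forall i j, ccvg (fun k => fmx (T_ k) (r_ k) i j) (fmx T r i j)).
move=> hD_ hD gD_ gD hr_ hr cT cr.
have cs i x : ccvg (fun k => srange (T_ k) (r_ k) i x) (srange T r i x).
 exact: (neumann_continuous mR2_om om_ge0 kE A0 rho0 rho1 Mr0 hD_ hD gD_ gD
  (fun k => hr_ k i) (hr i) (y := 0)).
split => // i j; under eq_fun do rewrite !mxE; rewrite !mxE.
apply: ccvgD; first exact: ccvg_cst.
apply: (@ell_cvg i (fun k _ => srange (T_ k) (r_ k) j) (fun=> srange T r j) (A / (1 - rho) * Mr) 0) => //.
- by rewrite mge0// divr_ge0// subr_ge0 ltW.
- by move=> k; apply: srange_bdd.
Qed.

Lemma solve_cvg (T_ : nat -> KF) T (r_ : nat -> 'I_n -> CF) (r : 'I_n -> CF)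
  (H_ : nat -> KF) H (M : R) y : 0 <= M ->
 (forall k, dom E (cst2 (T_ k))) -> dom E (cst2 T) ->
 (forall k, geomp om (cst2 (T_ k)) A rho) -> geomp om (cst2 T) A rho ->
 (forall k i, bdo (fun=> r_ k i) Mr) -> (forall i, bdo (fun=> r i) Mr) ->
 (forall x w, ccvg (fun k => T_ k x w) (T x w)) -> (forall i x, ccvg (fun k => r_ k i x) (r i x)) ->
 (forall k, bdo (H_ k) M) -> bdo H M -> (forall x, ccvg (fun k => H_ k y x) (H y x)) ->
 \det (fmx T r) != 0 ->
 forall x, ccvg (fun k => solve (T_ k) (r_ k) (H_ k) y x) (solve T r H y x).
move=> M0 hD_ hD gD_ gD hr_ hr cT cr hH_ hH cH d0 x.
have [cs cm] := fmx_cvg hD_ hD gD_ gD hr_ hr cT cr.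
have cN z : ccvg (fun k => neumann (cst2 (T_ k)) (H_ k) y z) (neumann (cst2 T) H y z).
 exact: (neumann_continuous mR2_om om_ge0 kE A0 rho0 rho1 M0 hD_ hD gD_ gD hH_ hH).
apply: ccvgB => //; apply: ccvg_sum => i; apply: ccvgM => //.
apply: ccvgM; first by apply: ccvg_inv => //; exact: ccvg_det.
apply: ccvg_sum => j; apply: ccvgM; first exact: ccvg_adj.
apply: (@ell_cvg j (fun k => neumann (cst2 (T_ k)) (H_ k)) _ (A / (1 - rho) * M)) => //.
- by rewrite mge0// divr_ge0// subr_ge0 ltW.
- by move=> k; apply: neumann_bdd => //; pos.
Qed.

End FiniteRank.

(** * Topology of R^3 against its product sigma-algebra *)

Section Continuous3.
Implicit Types (x y : R3 R) (f : RF).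

Lemma near_R3 (P : R3 R -> Prop) x : (\forall y \near x, P y) <->
 exists2 e : R, 0 < e & forall y, `|x.1.1 - y.1.1| < e -> `|x.1.2 - y.1.2| < e ->
  `|x.2 - y.2| < e -> P y.
split.
 move=> /nbhs_ballP[e /= e0 h]; exists e => // y h1 h2 h3; apply: h.
 by split; [split|].
move=> [e e0 h]; apply/nbhs_ballP; exists e => //= y [[h1 h2] h3].
exact: h.
Qed.

Lemma rat_near (a d : R) : 0 < d -> exists q : rat, `|ratr q - a| < d.
move=> d0; have /rat_in_itvoo[q] : a - d < a + d by lra.
by rewrite in_itv /= => /andP[h1 h2]; exists q; rewrite ltr_distl; apply/andP; split; lra.
Qed.

(** An open set is the union of the boxes with rational centre and radius 1/(n+1) that it contains;
    these are countably many and measurable. *)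
Lemma open_measurable3 (U : set (R3 R)) : (forall x, U x -> \forall y \near x, U y) ->
 measurable (U : set X).
move=> oU.
pose box (q : rat * rat * rat * nat) : set X := [set y : X |
 [/\ `|ratr q.1.1.1 - y.1.1| < q.2.+1%:R^-1, `|ratr q.1.1.2 - y.1.2| < q.2.+1%:R^-1 &
   `|ratr q.1.2 - y.2| < q.2.+1%:R^-1]].
have mbox q : measurable (box q).
 have h (f : X -> R) (a b : R) : mR f -> measurable ([set y | `|a - f y| < b] : set X).
  move=> mf; have m : mR (fun y => `|a - f y|).
   meas.
  have := m measurableT _ (measurable_itv `]-oo, b[); rewrite setTI => m2.
  by rewrite (_ : [set y | _] = (fun y => `|a - f y|) @^-1` `]-oo, b[)//; apply/seteqP; split => y /=; rewrite in_itv.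
 have -> : box q = [set y : X | `|ratr q.1.1.1 - y.1.1| < q.2.+1%:R^-1] `&`
  [set y : X | `|ratr q.1.1.2 - y.1.2| < q.2.+1%:R^-1] `&` [set y : X | `|ratr q.1.2 - y.2| < q.2.+1%:R^-1].
  by apply/seteqP; split => y [] => [? ? ?|[? ?] ?].
 apply: measurableI; first apply: measurableI.
 - by apply: (h (fun y => y.1.1)); exact: (m3_1 (@m3_id R)).
 - by apply: (h (fun y => y.1.2)); exact: (m3_2 (@m3_id R)).
 - by apply: (h (fun y => y.2)); exact: (m3_3 (@m3_id R)).
have -> : (U : set X) = \bigcup_(q in [set q | box q `<=` U]) box q.
 apply/seteqP; split => [x Ux|x [q qU bx]]; last exact: qU.
 have /near_R3[e e0 he] := oU x Ux.
 have [n hn] : exists n : nat, n.+1%:R^-1 < e / 2.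
  have := truncnS_gt (e / 2)^-1; set k := (Num.truncn _) => hk; exists k.
  rewrite -[ltRHS]invrK ltf_pV2 ?posrE ?invr_gt0 ?divr_gt0//.
 have d0 : 0 < n.+1%:R^-1 :> R by pos.
 have [q1 h1] := rat_near x.1.1 d0; have [q2 h2] := rat_near x.1.2 d0; have [q3 h3] := rat_near x.2 d0.
 exists (q1, q2, q3, n); last by split.
 have tri (q a b : R) : `|q - a| < n.+1%:R^-1 -> `|q - b| < n.+1%:R^-1 -> `|a - b| < e.
  move=> k1 k2; apply: lelt (ler_distD q _ _) _; rewrite [`|a - q|]distrC (splitr e).
  by apply: ltrD; apply: lt_trans hn.
 by move=> y [/= k1 k2 k3]; apply: he; apply: tri; eauto.
rewrite bigcup_mkcond; apply: countable_bigcupT_measurable => // q.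
by case: ifP => _; [exact: mbox|exact: measurable0].
Qed.

Lemma continuous_mR f : continuous f -> mRX f.
move=> cf; apply: (measurability _ (RGenOInfty.measurableE R)) => _ [_ [a ->] <-].
rewrite setTI; apply: open_measurable3 => x /=; rewrite in_itv /= andbT => ax.
have := cf x; move/cvgr_gt => /(_ a ax); apply: filterS => y ay.
by rewrite /= in_itv /= andbT.
Qed.

Lemma enorm_near x (e : R) : 0 < e -> \forall y \near x, dist x y < e.
move=> e0; apply/near_R3; exists (e / 3); first pos.
move=> y h1 h2 h3; apply: lelt (enorm_le_coord _) _.
rewrite !raddfB /=.
by lra.
Qed.

Lemma continuous_ccvg f x (u : nat -> R3 R) : continuous f ->
 (fun n => enorm (u n - x)) @ \oo --> (0 : R) -> (fun n => f (u n)) @ \oo --> f x.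
move=> cf hu; apply/cvgrPdist_lt => e e0.
have := cf x; move/cvgrPdist_lt => /(_ e e0) /near_R3[d d0 hd].
move/cvgrPdist_lt : hu => /(_ d d0); apply: filterS => n.
rewrite sub0r normrN ger0_norm ?enge0// => hn; apply: hd.
- by rewrite distrC; apply: lelt hn; exact: (ler_coord1 (u n - x)).
- by rewrite distrC; apply: lelt hn; exact: (ler_coord2 (u n - x)).
- by rewrite distrC; apply: lelt hn; exact: (ler_coord3 (u n - x)).
Qed.

(** Dominated convergence produces limits along sequences; this turns them into continuity. *)
Lemma seq_continuous f x : (forall u : nat -> R3 R, (fun n => enorm (u n - x)) @ \oo --> (0 : R) ->
 (fun n => f (u n)) @ \oo --> f x) -> {for x, continuous f}.
move=> h; apply: contrapT => nc.
have [e e0 he] : exists2 e : R, 0 < e & forall n : nat, exists y, dist y x <= n.+1%:R^-1 /\ e <= `|f x - f y|.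
 apply: contrapT => h2; apply: nc; apply/cvgrPdist_lt => e e0.
 apply: contrapT => h3; apply: h2; exists e => // n; apply: contrapT => h4; apply: h3.
 have d0 : 0 < n.+1%:R^-1 :> R by pos.
 apply: filterS (enorm_near x d0) => y; rewrite enormBC => hy; rewrite ltNge; apply/negP => h5.
 by apply: h4; exists y; split => //; exact: ltW.
have [u hu] := choice he.
have : (fun n => enorm (u n - x)) @ \oo --> (0 : R).
 apply: (@squeeze_cvgr _ _ _ _ (fun=> 0) (fun n => n.+1%:R^-1)).
 - by apply: nearW => n; rewrite enge0 (hu n).1.
 - exact: cvg_cst.
 - exact: cvg_harmonic.
move/h => /cvgrPdist_lt/(_ e e0) [n _ /(_ n (leqnn n))] /= hn.
by have := lt_le_trans hn (hu n).2; rewrite ltxx.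
Qed.

End Continuous3.

(** * Integrable powers of the weight and the Newton constant *)

Section Weights.
Implicit Types (x y : R3 R) (f : RF).

Lemma dyadic_shell (t : R) : 1 <= t -> exists j : nat, 2 ^+ j <= t < 2 ^+ j.+1.
move=> t1; have ex : exists j : nat, t < 2 ^+ j.+1.
 exists (Num.truncn t); have h := truncnS_gt t; apply: lt_trans h _.
 by rewrite -natrX ltr_nat; exact: ltn_expl.
case: (ex_minnP ex) => j hj jmin; exists j; rewrite hj andbT.
case: j hj jmin => [|j] hj jmin; first by rewrite expr0.
by rewrite leNgt; apply/negP => /jmin; rewrite ltnn.
Qed.

(** On the shell $2^j\le1+|x|<2^{j+1}$ the function is at most $t^j$ with $t=2^{-p}$ and the volume
    at most $64\cdot8^j$; the hypothesis on p is $8t<1$. *)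
Lemma omega_powR_int (p : R) : 3 < p -> (\I_x ((1 + enorm x) `^ (- p)) < +oo)%E.
move=> p3; pose t : R := 2 `^ (- p).
have t0 : 0 <= t by exact: powR_ge0.
have t8 : 8 * t < 1.
 have -> : 8 = 2 `^ 3 :> R by rewrite powR_mulrn// -natrX.
 by rewrite /t -powRD ?pnatr_eq0 ?implybT// /powR pnatr_eq0 /= expR_lt1 pmulr_llt0 ?ln_gt0 ?ltr1n//; lra.
have e0 x : 0 < 1 + enorm x by have := enge0 x; lra.
apply: (vialt (64 * (1 - 8 * t)^-1)%:E); last exact: ltry.
apply: (dyadic_bound (y := 0) (c := fun j => t ^+ j) (rho := fun j => 2 ^+ j.+1)).
- have -> : (fun x => (1 + enorm x) `^ (- p)) = fun x => expR (- p * ln (1 + enorm x)).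
  by fext => x; rewrite /powR gt_eqF.
 apply: mR_exp; apply: mR_M; first meas.
 apply: (mR_comp (h := @ln R)); first exact: measurable_ln.
 meas.
- by move=> x; exact: powR_ge0.
- by move=> j; pos.
- by move=> j; pos.
- move=> x; right; have [|j /andP[h1 h2]] := @dyadic_shell (1 + enorm x).
  by rewrite lerDl enge0.
 exists j; last by rewrite subr0; have := enge0 x; lra.
 rewrite /t -powR_mulrn ?powR_ge0// -powRrM mulrC powRrM powR_mulrn// !powRN lef_pV2 ?posrE ?powR_gt0 ?exprn_gt0//.
 by apply: ge0_ler_powR => //; rewrite ?nnegrE ?exprn_ge0 ?(ltW (e0 x))//; lra.
- move=> n; have := geo_sum_le n (mge0 (ler0n R 8) t0) t8.
 rewrite big_mkord => h.
 have -> : \sum_(i < n) t ^+ i * (8 * (2 ^+ i.+1) ^+ 3) = 64 * \sum_(i < n) (8 * t) ^+ i.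
  have e8 : 2 ^+ 3 = 8 :> R by rewrite -natrX.
  rewrite mulr_sumr; apply: eq_bigr => i _; rewrite -exprM mulnC exprM e8 exprS exprMn.
  by ring.
 by apply: lewl.
Qed.

(** The profile of the regularised distance [rad e y]: after rescaling by e about y, that distance
    is e times [japan]. *)
Definition japan x : R := Num.sqrt (1 + enorm x ^+ 2).

Lemma japan_gt0 x : 0 < japan x.
by rewrite sqrtr_gt0 ltr_wpDr// sqr_ge0. Qed.

Lemma japan_ge x : enorm x <= japan x /\ 1 <= japan x.
have h : 0 <= 1 + enorm x ^+ 2 by pos.
split; rewrite -ler_sqr ?nnegrE ?sqrtr_ge0 ?enge0// [japan x ^+ 2]sqr_sqrtr//; last rewrite expr1n.
 by rewrite lerDr.
by rewrite lerDl sqr_ge0.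
Qed.

Lemma mR_japan : mRX japan.
apply: mR_sqrt; apply: mR_D; first meas.
meas; meas; exact: m3_id.
Qed.

Lemma japan_int (k : nat) : (4 <= k)%N -> (\I_x (japan x ^- k) < +oo)%E.
move=> k4; have m1 : mRX (fun x => japan x ^- k).
 by apply: mR_inv; apply: mR_X; exact: mR_japan.
apply: (vialt (\I_x (ballf 0 1 x + far4 0 1 x))%E).
 apply: n3le => //.
 - by apply: mR_D; [exact: mR_ballf|exact: mR_far4].
 - by move=> x; rewrite invr_ge0 exprn_ge0// ltW// japan_gt0.
 - move=> x; have [h1 h2] := japan_ge x; have h3 := japan_gt0 x.
  rewrite /ballf /far4 subr0; case: ltP => h.
   rewrite (ltW h) addr0 invf_le1 ?exprn_gt0//.
   exact: exprn_ege1.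
  rewrite -[leLHS]add0r; apply: lerD; first by case: ifP.
  rewrite lef_pV2 ?posrE ?exprn_gt0//; last by apply: lt_le_trans h.
  apply: (via (japan x ^+ 4)); first by apply: lerXn2r => //; rewrite nnegrE ?enge0// ltW.
  exact: ler_weXn2l.
rewrite n3D; [|exact: mR_ballf|exact: mR_far4|by move=> x; pos|by move=> x; exact: far4_ge0].
rewrite lte_add_pinfty//.
 by apply: lelt (nnballf 0 ler01) _; exact: ltry.
by apply: lelt (nnint_far4 0 ltr01) _; exact: ltry.
Qed.

(* Equal to [4 * pi]; only positivity is used. *)
Definition newton : R := fine (\I_x (3 * japan x ^- 5))%E.

Lemma newtonE : (\I_x (3 * japan x ^- 5) = newton%:E)%E.
have m1 : mRX (fun x => japan x ^- 5) by apply: mR_inv; apply: mR_X; exact: mR_japan.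
have g x : 0 <= japan x ^- 5 by rewrite invr_ge0 exprn_ge0// ltW// japan_gt0.
rewrite /newton fineK// ge0_fin_numE; last by apply: n3ge0 => x; rewrite mge0.
rewrite n3Z// ltyM//; exact: japan_int.
Qed.

(** On the cube $[0,1]^3$, of measure 1, [japan] is at most 2, so the integrand is at least
    $3\cdot2^{-5}$. *)
Lemma newton_gt0 : 0 < newton.
pose I : set R := `[0, 1]%classic.
have LI : lebesgue_measure I = 1%:E by rewrite /I lebesgue_measure_itv /= lte_fin ltr01 oppr0 adde0.
pose Q : set X := I `*` I `*` I.
have mI : measurable (I : set (mTR R)) by exact: measurable_itv.
have mQ : measurable Q by apply: measurableX => //; exact: measurableX.
have vQ : mu Q = 1%:E.
 have e := leb3_box mI mI mI; rewrite -mu3E in e; rewrite [LHS]e.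
 by transitivity (1 * 1 * 1 : \bar R)%E; [congr (_ * _ * _)%E; exact: LI|rewrite !mule1].
rewrite -lte_fin -newtonE.
have k0 : 0 < 3 * 2^-1 ^+ 5 :> R by pos.
have mi : mRX (fun x => \1_Q x).
 by rewrite /mRX /mR; exact: measurable_indic.
apply: (@lt_le_trans _ _ (\I_x ((3 * 2^-1 ^+ 5) * \1_Q x))%E).
 rewrite n3Z ?(ltW k0)//.
 have -> : (\I_x (\1_Q x) = 1%:E)%E by rewrite integral_indic// setIT; exact: vQ.
 by rewrite mule1 lte_fin.
apply: n3le.
- meas.
- by apply: mR_M; [meas|apply: mR_inv; apply: mR_X; exact: mR_japan].
- pos.
- move=> x; rewrite -mulrA; apply: lewl => //; rewrite indicE.
 have j0 := japan_gt0 x; have [|nQ] := boolP (x \in Q); last first.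
  by rewrite mulr0 invr_ge0 exprn_ge0// ltW.
 rewrite inE => -[[/= h1 h2] h3]; rewrite mulr1 exprVn lef_pV2 ?posrE ?exprn_gt0//.
 apply: lerXn2r; rewrite ?nnegrE ?(ltW j0)// -ler_sqr ?nnegrE ?(ltW j0)//.
 rewrite sqr_sqrtr ?addr_ge0 ?sqr_ge0// enorm_sqr.
 move: h1 h2 h3; rewrite /I /= !in_itv /= => /andP[a1 a2] /andP[b1 b2] /andP[c1 c2].
 by nra.
Qed.

End Weights.

Notation nc := newton.
#[local] Hint Extern 0 (is_true _) => exact: newton_gt0 : pos.

(** * The complex exponential and its Lipschitz bounds *)

Section Exponential.
Implicit Types (m : R[i]) (r s t : R).

(** This is $e^{-mr}$. The spectral parameter is $z=-m^2$: absorption means [0 < Re m], and $m=\mp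
    i\sqrt\lambda$ gives the boundary values $e^{\pm i\sqrt\lambda r}$. *)
Definition cexp m r : R[i] :=
 (expR (- (Re m * r)))%:C * (cos (Im m * r) +i* - sin (Im m * r)).

Lemma ReImcexp m r : Re (cexp m r) = expR (- (Re m * r)) * cos (Im m * r) /\
 Im (cexp m r) = - (expR (- (Re m * r)) * sin (Im m * r)).
by rewrite /cexp; split; rewrite ?ReImE /=; ring. Qed.

Lemma nrm_cexp m r : nrm (cexp m r) = expR (- (Re m * r)).
rewrite nrmM nrm_real ger0_norm ?expR_ge0// nrmE /= sqrrN cos2Dsin2.
by rewrite sqrtr1 mulr1.
Qed.

Lemma nrm_cexp_le1 m r : 0 <= Re m -> 0 <= r -> nrm (cexp m r) <= 1.
by move=> m0 r0; rewrite nrm_cexp -expR0 ler_expR oppr_le0 mge0. Qed.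

Lemma cexp0 m : cexp m 0 = 1.
by rewrite /cexp !mulr0 oppr0 expR0 cos0 sin0 oppr0 mul1r.
Qed.

Lemma cexpDreal m (a : R) r : cexp (m + a%:C) r = cexp m r * (expR (- (a * r)))%:C.
rewrite /cexp !ReImE /= addr0 mulrDl opprD expRD rmorphM /= -!mulrA; congr (_ * _).
by rewrite mulrC.
Qed.

Lemma expRN_lip (a r s : R) : 0 <= a -> 0 <= r -> 0 <= s ->
 `|expR (- (a * r)) - expR (- (a * s))| <= a * `|r - s|.
move=> a0; wlog rs : r s / r <= s => [hw r0 s0|r0 s0].
 have /orP[rs|sr] := le_total r s; first exact: hw.
 by rewrite distrC [`|r - s|]distrC; exact: hw.
have e : expR (- (a * s)) = expR (- (a * r)) * expR (- (a * (s - r))).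
 by rewrite -expRD; congr expR; ring.
have h0 := expR_ge1Dx (- (a * (s - r))); have h3 := expR_ge0 (- (a * r)).
have h1 : expR (- (a * r)) <= 1 by rewrite -expR0 ler_expR oppr_le0 mge0.
have h2 : expR (- (a * (s - r))) <= 1 by rewrite -expR0 ler_expR oppr_le0 mge0 ?subr_ge0.
rewrite [`|r - s|]distrC (ger0_norm (_ : 0 <= s - r)) ?subr_ge0// e.
rewrite ger0_norm; first by nra.
by rewrite subr_ge0 ler_piMr.
Qed.

Lemma lip1 (f df : R -> R) : (forall x : R, is_derive x 1 f (df x)) -> (forall x, `|df x| <= 1) ->
 forall r s, `|f r - f s| <= `|r - s|.
move=> hf hdf r s; wlog rs : r s / r <= s => [hw|].
 have /orP[rs|sr] := le_total r s; first exact: hw.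
 by rewrite distrC [`|r - s|]distrC; exact: hw.
have cf : {within `[r, s], continuous f}.
 apply: continuous_subspaceT => x; apply: differentiable_continuous.
 by apply/derivable1_diffP; exact: (@ex_derive _ _ _ _ _ _ _ (hf x)).
have [c _ h] := MVT_segment rs (fun x _ => hf x) cf.
by rewrite distrC h [`|r - s|]distrC normrM ler_piMl.
Qed.

Lemma cos_lip r s : `|cos r - cos s| <= `|r - s|.
by apply: (lip1 (df := fun x => - sin x)) => x; rewrite normrN ler_norml sin_geN1 sin_le1.
Qed.

Lemma sin_lip r s : `|sin r - sin s| <= `|r - s|.
by apply: (lip1 (df := fun x => cos x)) => x; rewrite ler_norml cos_geN1 cos_le1.
Qed.

Lemma cexp_lip m r s : 0 <= Re m -> 0 <= r -> 0 <= s ->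
 nrm (cexp m r - cexp m s) <= 4 * nrm m * `|r - s|.
move=> m0 r0 s0; apply: le_trans (nrm_le_ReIm _) _.
rewrite ReD ReN ImD ImN; have [-> ->] := ReImcexp m r; have [-> ->] := ReImcexp m s.
set a := Re m in m0 *; set b := Im m.
have am : a <= nrm m by rewrite -(ger0_norm m0); exact: Re_le_nrm.
have bm : `|b| <= nrm m by exact: Im_le_nrm.
have e0 t := expR_ge0 (- (a * t)).
have e1 t : 0 <= t -> expR (- (a * t)) <= 1 by move=> t0; rewrite -expR0 ler_expR oppr_le0 mge0.
have lip (f : R -> R) : (forall x, `|f x| <= 1) -> (forall x y, `|f x - f y| <= `|x - y|) ->
 `|expR (- (a * r)) * f (b * r) - expR (- (a * s)) * f (b * s)| <= 2 * nrm m * `|r - s|.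
 move=> f1 fl; have -> : expR (- (a * r)) * f (b * r) - expR (- (a * s)) * f (b * s) =
  (expR (- (a * r)) - expR (- (a * s))) * f (b * r) + expR (- (a * s)) * (f (b * r) - f (b * s)) by ring.
 apply: le_trans (ler_normD _ _) _.
 rewrite (_ : 2 * nrm m * `|r - s| = nrm m * `|r - s| + nrm m * `|r - s|); last by ring.
 apply: lerD; rewrite normrM.
  rewrite -[leRHS]mulr1; apply: ler_pM => //.
  by apply: le_trans (expRN_lip m0 r0 s0) _; exact: lewr.
 rewrite -[leRHS]mul1r; apply: ler_pM => //; first by rewrite ger0_norm// e1.
 by apply: le_trans (fl _ _) _; rewrite -mulrBr normrM; exact: lewr.
have c1 : `|expR (- (a * r)) * cos (b * r) - expR (- (a * s)) * cos (b * s)| <= 2 * nrm m * `|r - s|.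
 by apply: lip cos_lip => x; rewrite ler_norml cos_geN1 cos_le1.
have c2 : `|expR (- (a * r)) * sin (b * r) - expR (- (a * s)) * sin (b * s)| <= 2 * nrm m * `|r - s|.
 by apply: lip sin_lip => x; rewrite ler_norml sin_geN1 sin_le1.
rewrite (_ : 4 * nrm m * `|r - s| = 2 * nrm m * `|r - s| + 2 * nrm m * `|r - s|); last by ring.
by apply: lerD => //; rewrite opprK addrC distrC.
Qed.

Lemma cexp_cvg (m_ : nat -> R[i]) m r : ccvg m_ m -> ccvg (fun k => cexp (m_ k) r) (cexp m r).
move=> [h1 h2]; have k1 : (fun k => Re (m_ k) * r) @ \oo --> Re m * r by exact: cvgMl.
have k2 : (fun k => Im (m_ k) * r) @ \oo --> Im m * r by exact: cvgMl.
have c1 : (fun k => cos (Im (m_ k) * r)) @ \oo --> cos (Im m * r).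
 exact: (cvg_comp _ _ k2 (@continuous_cos R _)).
have c2 : (fun k => sin (Im (m_ k) * r)) @ \oo --> sin (Im m * r).
 exact: (cvg_comp _ _ k2 (@continuous_sin R _)).
have c3 : (fun k => expR (- (Re (m_ k) * r))) @ \oo --> expR (- (Re m * r)).
 by apply: (cvg_comp _ _ (cvgN k1)); exact: continuous_expR.
split.
 under eq_fun do rewrite (proj1 (ReImcexp _ _)); rewrite (proj1 (ReImcexp _ _)).
 exact: cvgM.
under eq_fun do rewrite (proj2 (ReImcexp _ _)); rewrite (proj2 (ReImcexp _ _)).
by apply: cvgN; exact: cvgM.
Qed.

Lemma mC_cexp d (T : measurableType d) (f : T -> R) m : mR f -> mC (fun x => cexp m (f x)).
move=> mf; apply: mC_M; first by meas; meas.
by apply: mC_pair; meas.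
Qed.

End Exponential.

(** * The free kernel, Kato bounds for balls, and the splitting of V *)

Section Kernels.
Implicit Types (x y w : R3 R) (m : R[i]) (W V : RF).

Lemma geometric_kbd (E : R3 R -> R3 R -> RF) q (rho : R) D : mR2 q -> (forall y x, 0 <= q y x) ->
 kbd E q rho -> 0 <= rho -> dom E D -> geomp q D 1 rho.
move=> mq q0 kE r0 hD f M hf M0; elim=> [|k ih] /=; first by rewrite expr0 mul1r mulr1.
have := bddN (app_bdd mq q0 kE hD ih _).
rewrite (_ : rho * (1 * M * rho ^+ k) = 1 * M * rho ^+ k.+1); last by rewrite exprS; ring.
by apply; pos.
Qed.

(** The free resolvent kernel $e^{-m|x-y|}/(4\pi|x-y|)$; on the diagonal it is 0 by the convention
    [0^-1 = 0]. *)
Definition Rk m x y : R[i] := ((nc * dist x y)^-1)%:C * cexp m (dist x y).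

Lemma RkC m x y : Rk m x y = Rk m y x.
by rewrite /Rk enormBC. Qed.

Lemma mC2_Rk m : mC2 (Rk m).
rewrite /mC2 /Rk; apply: mC_M; first by meas; meas.
by apply: mC_cexp; meas.
Qed.

Lemma nrm_Rk m x y : nrm (Rk m x y) = expR (- (Re m * dist x y)) / (nc * dist x y).
rewrite nrmM nrm_real ger0_norm ?nrm_cexp 1?mulrC//.
pos.
Qed.

Lemma Rk_le m x y : 0 <= Re m -> nrm (Rk m x y) <= nc^-1 * (dist x y)^-1.
move=> m0; rewrite nrm_Rk invfM; apply: ler_piMl.
 pos.
by rewrite -expR0 ler_expR oppr_le0 mge0 ?enge0.
Qed.

Lemma Rk_cvg (m_ : nat -> R[i]) m x y : ccvg m_ m -> ccvg (fun k => Rk (m_ k) x y) (Rk m x y).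
by move=> h; apply: ccvgM; [exact: ccvg_cst|exact: cexp_cvg]. Qed.

Definition Tk V m x w : R[i] := Rk m x w * (V w)%:C.
Definition E0 W (y x w : R3 R) : R := nc^-1 * (W w * (dist x w)^-1).

Lemma nrm_Tk V m x w : nrm (Tk V m x w) = nrm (Rk m x w) * `|V w|.
by rewrite /Tk nrmM nrm_real. Qed.

Lemma mC2_Tk V m : mRX V -> mC2 (Tk V m).
move=> mV; rewrite /mC2 /Tk; apply: mC_M; first exact: mC2_Rk.
meas; meas.
Qed.

Lemma mC3_cst2 (T : KF) : mC2 T -> mC3 (cst2 T).
move=> mT; rewrite /mC3 /cst2.
by apply: (mC_c mT (h := fun p : (X * X * X)%type => ((p.1.2, p.2) : (X * X)%type))); mproj.
Qed.

Lemma kbd_E0 W A : katob W A -> kbd (E0 W) (@om) (nc^-1 * (3 * A)).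
move=> kW; have [mW W0 _] := kW; have n0 : 0 <= nc^-1 by pos.
split.
- by rewrite /mR3 /E0; meas.
- by move=> y x w; rewrite /E0 !mge0// invr_ge0 enge0.
- move=> y x; rewrite (eq_n3 (g2 := fun w => nc^-1 * (W w * ((dist x w)^-1 * omega w)))).
  rewrite n3Z//; last 2 first.
  + by rewrite /omega; meas.
  + pos.
  rewrite -mulrA EFinM; apply: leewl; rewrite ?lee_fin//.
  exact: kato_weight_omega.
 by move=> w; rewrite /E0 /om; ring.
Qed.

Lemma dom_Tk V m : mRX V -> 0 <= Re m -> dom (E0 (fun w => `|V w|)) (cst2 (Tk V m)).
move=> mV m0; split; first by apply: mC3_cst2; exact: mC2_Tk.
move=> y x w; rewrite /cst2 /Tk /E0 nrmM nrm_real [_ / _]mulrC mulrA.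
by apply: lewr => //; exact: Rk_le.
Qed.

Lemma kato_norm_bound V (A : R) : mRX V -> (kato_norm V <= A%:E)%E -> katob (fun x => `|V x|) A.
move=> mV h; split => // [|y]; first by meas.
rewrite -(leb3E (fun x : X => (`|V x| * (enorm ((x : R3 R) - y))^-1)%:E)).
by apply: le_trans h; apply: ereal_sup_ubound; exists y.
Qed.

Lemma testf_mR (phi : RF) : testf phi -> mRX phi.
by case=> /(_ [::])[/= c _] _; exact: continuous_mR. Qed.

Lemma continuous_bounded_support (phi : RF) : continuous phi -> bounded_support phi ->
 exists B r : R, [/\ 0 <= B, 0 < r & forall x, `|phi x| <= B * ballf 0 r x].
move=> cphi [r0 hr]; pose r := `|r0| + 1.
have rp : 0 < r by rewrite ltr_wpDl.
pose I : set R := `[- r, r]%classic.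
have cI : compact (I `*` I `*` I : set (R3 R)).
 by apply: compact_setX; [apply: compact_setX; exact: segment_compact|exact: segment_compact].
have := compact_bounded (continuous_compact (continuous_subspaceT cphi) cI).
move=> [M [_ hM]]; have {}hM := hM (`|M| + 1).
have {}hM : forall y : R, (phi @` (I `*` I `*` I)) y -> `|y| <= `|M| + 1.
 by apply: hM; rewrite (lelt (ler_norm _)) ?ltrDl.
exists (`|M| + 1), r; split => // x.
rewrite /ballf subr0; case: ifPn => [xr|]; last first.
 rewrite -ltNge => xr; rewrite mulr0 hr ?normr0//; apply: lt_trans xr; by rewrite ltr_pwDr// ler_norm.
rewrite mulr1; apply: hM; exists x => //; rewrite /I /=.
have h1 := ler_coord1 x; have h2 := ler_coord2 x; have h3 := ler_coord3 x.
split; [split|]; rewrite /= in_itv /=.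
- by rewrite -ler_norml (le_trans h1).
- by rewrite -ler_norml (le_trans h2).
- by rewrite -ler_norml (le_trans h3).
Qed.

Lemma sqr_inv_le_near2 y w (e : R) : 0 < e -> (dist w y) ^- 2 <= near2 y e w + e ^- 2.
move=> e0; rewrite /near2; have h := enge0 (w - y); case: ltP => hr.
 by rewrite lerDl invr_ge0 exprn_ge0// ltW.
rewrite add0r lef_pV2 ?posrE ?exprn_gt0//; last by apply: lt_le_trans hr.
by apply: lerXn2r => //; rewrite nnegrE// ltW.
Qed.

Lemma ball_sqr_inv (r : R) y : 0 < r ->
 (\I_w (ballf 0 r w * (dist w y) ^- 2) <= (64 + 8 * r ^+ 3)%:E)%E.
move=> r0; have mb := mR_ballf 0 r; have mn := mR_near2 y 1.
apply: (via (\I_w (near2 y 1 w + ballf 0 r w))%E).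
 apply: n3le => //; first by meas.
 - meas.
 - pos.
 move=> w; have := sqr_inv_le_near2 y w ltr01; rewrite expr1n invr1 /ballf subr0.
 by case: ifP => _; rewrite ?mul1r// mul0r addr0 near2_ge0.
rewrite n3D//; [|by move=> w; exact: near2_ge0|by move=> w; pos].
rewrite EFinD; apply: leeD.
 by have := nnint_near2 y ltr01; rewrite mulr1.
exact: nnballf (ltW r0).
Qed.

Lemma ball_kato (r : R) : 0 < r -> exists2 A : R, 0 < A & katob (ballf (0 : R3 R) r) A.
move=> r0; exists (64 + 8 * r ^+ 3 + 8 * r ^+ 3).
 pos.
have mb := mR_ballf 0 r.
split => // [x|y]; first pos.
apply: (via (\I_w (ballf 0 r w * (dist w y) ^- 2 + ballf 0 r w))%E).
 apply: n3le => //.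
 - by meas.
 - meas; meas.
 - pos.
 move=> w; rewrite [leRHS](_ : _ = ballf 0 r w * (dist w y ^- 2 + 1)); last by rewrite mulrDr mulr1.
 apply: lewl; first pos.
 by rewrite -exprVn; move: (dist w y)^-1 => a; nra.
rewrite n3D//; [|by meas|pos|by move=> w; pos].
rewrite EFinD; apply: leeD; first exact: ball_sqr_inv.
exact: nnballf (ltW r0).
Qed.

Lemma ball_omega (r : R) x w : 0 < r -> enorm w <= r ->
 (dist x w)^-1 <= (1 + r) * omega x * (1 + (dist x w)^-1).
move=> r0 wr; have [->|h0] := eqVneq (dist x w) 0.
 by rewrite invr0 addr0 mulr1 mge0 ?omega_ge0// addr_ge0// ltW.
have hp : 0 < dist x w by rewrite lt_def h0 enge0.
have h := enorm_le_add x w; have hx := enge0 x.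
have o1 : 0 < 1 + enorm x by lra.
rewrite /omega -mulrA mulrCA ler_pdivlMl// -[X in (1 + r) * X](_ : (dist x w + 1) / dist x w = _); last first.
 by rewrite mulrDl mulfV// mul1r.
rewrite mulrA ler_pM2r ?invr_gt0//; nra.
Qed.

(** A weight of bounded support removes the singularity at x = y and gives decay in both variables.
    By [ball_omega] each inverse distance is at most $(1+r)\omega(1+a)$, a being itself, and
    $(1+a)(1+b)\le2+a^2+b^2$ is integrable over the ball. *)
Lemma ball_pair (r : R) x y : 0 < r ->
 (\I_w (ballf 0 r w * ((dist x w)^-1 * (dist w y)^-1)) <=
  ((1 + r) ^+ 2 * (128 + 32 * r ^+ 3) * (omega x * omega y))%:E)%E.
move=> r0; have mb := mR_ballf 0 r; pose k := (1 + r) ^+ 2 * (omega x * omega y).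
have k0 : 0 <= k by rewrite mge0 ?sqr_ge0// mge0 ?omega_ge0.
have b0 w : 0 <= ballf 0 r w by pos.
have s0 (a : R3 R) w : 0 <= ballf 0 r w * (dist w a) ^- 2 by pos.
pose g w : R := 2 * ballf 0 r w + (ballf 0 r w * (dist w x) ^- 2 + ballf 0 r w * (dist w y) ^- 2).
have m2 (a : R3 R) : mRX (fun w => ballf 0 r w * (dist w a) ^- 2) by meas.
have mg : mRX g.
 by apply: mR_D; [meas; meas|meas; exact: m2].
apply: (via (\I_w (k * g w))%E).
 apply: n3le.
 - by meas.
 - meas; meas.
 - pos.
 move=> w; rewrite /g /ballf subr0; case: ifPn => wr; last by rewrite !mul0r mulr0 !addr0 mulr0.
 have h1 := ball_omega x r0 wr; have h2 := ball_omega y r0 wr.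
 rewrite enormBC in h2; rewrite !mul1r mulr1 -!exprVn.
 rewrite enormBC in h1 *; move: h1 h2; rewrite /k.
 have := enge0 (w - x); have := enge0 (w - y).
 rewrite -invr_ge0; set b := (dist w y)^-1; rewrite -[0 <= enorm _]invr_ge0; set a := (dist w x)^-1.
 move=> ha hb h1 h2.
 have ox := omega_ge0 x; have oy := omega_ge0 y.
 apply: le_trans (ler_pM hb ha h1 h2) _.
 rewrite [leLHS](_ : _ = ((1 + r) ^+ 2 * (omega x * omega y)) * ((1 + a) * (1 + b))); last by ring.
 apply: lewl => //; have := sqr_ge0 (a - b); have := sqr_ge0 (1 - a); have := sqr_ge0 (1 - b).
 by clear; nra.
rewrite n3Z//; last by move=> w; rewrite addr_ge0 ?mge0 ?addr_ge0.
rewrite (_ : (1 + r) ^+ 2 * (128 + 32 * r ^+ 3) * (omega x * omega y) = k * (128 + 32 * r ^+ 3)); last first.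
 by rewrite /k; ring.
rewrite (EFinM k); apply: leewl; first pos.
rewrite n3D//; [|meas; meas|meas; exact: m2|pos|pos].
rewrite n3Z// n3D//.
apply: (via (2%:E * (8 * r ^+ 3)%:E + ((64 + 8 * r ^+ 3)%:E + (64 + 8 * r ^+ 3)%:E))%E).
 apply: leeD; first by apply: leewl => //; exact: nnballf (ltW r0).
 by apply: leeD; exact: ball_sqr_inv.
by rewrite -!EFinM -!EFinD lee_fin; lra.
Qed.

Lemma kato_split V (e : R) : kato0 V -> 0 < e -> exists V1 : RF,
 [/\ mRX V1, exists B r : R, [/\ 0 <= B, 0 < r & forall x, `|V1 x| <= B * ballf 0 r x] &
   katob (fun x => `|V x - V1 x|) e].
move=> [mV h] e0; have [phi tphi hphi] := h e e0.
have mphi := testf_mR tphi.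
exists phi; split => //.
 by have [/(_ [::])[/= c _] b] := tphi; exact: continuous_bounded_support.
apply: kato_norm_bound; last exact: ltW.
meas; meas.
Qed.

Lemma kato_boundZ W A (B : R) : 0 <= B -> katob W A -> katob (fun x => B * W x) (B * A).
move=> B0 [mW W0 hW]; split.
- meas; meas.
- pos.
- move=> y; rewrite (eq_n3 (g2 := fun x => B * (W x * (dist x y)^-1))); last by move=> x; rewrite mulrA.
 rewrite n3Z//; last pos.
  by rewrite EFinM; apply: leewl; rewrite ?lee_fin.
 by meas.
Qed.

Lemma kato_boundD W1 W2 A1 A2 : katob W1 A1 -> katob W2 A2 ->
 katob (fun x => W1 x + W2 x) (A1 + A2).
move=> [m1 p1 h1] [m2 p2 h2]; split; [meas|pos|move=> y].
have i0 x : 0 <= (dist x y)^-1 by pos.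
rewrite (eq_n3 (g2 := fun x => W1 x * (dist x y)^-1 + W2 x * (dist x y)^-1)); last first.
 by move=> x; rewrite mulrDl.
rewrite n3D; [by rewrite EFinD; exact: leeD|by meas|by meas|pos|pos].
Qed.

Lemma kato_bound_le W W' A : mRX W -> nneg W -> (forall x, W x <= W' x) ->
 katob W' A -> katob W A.
move=> mW W0 h [mW' _ hW]; split => // y; apply: le_trans (hW y).
have i0 x : 0 <= (dist x y)^-1 by pos.
apply: n3le; [by meas|by meas|pos|].
by move=> x; apply: lewr.
Qed.

(** Closeness to a single test function is enough, since a bounded function of bounded support has a
    finite Kato norm. *)
Lemma kato0_bound V : kato0 V -> exists2 A : R, 0 < A & katob (fun x => `|V x|) A.
move=> kV; have [mV _] := kV; have [V1 [m1 [B [r [B0 r0 h1]]] k2]] := kato_split kV ltr01.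
have [A A0 kA] := ball_kato r0.
exists (1 + B * A); first pos.
apply: kato_bound_le (kato_boundD k2 (kato_boundZ B0 kA)) => //; first by rewrite /mRX; meas.
move=> x; apply: le_trans (_ : `|V x - V1 x| + `|V1 x| <= _); last by rewrite lerD2l.
by rewrite -{1}(subrK (V1 x) (V x)); exact: ler_normD.
Qed.

End Kernels.

(** * Construction of the perturbed kernel as [Gk - Qk] *)

Section Construction.
Implicit Types (x y w : R3 R) (m : R[i]).

Definition q2 y x : R := (dist x y)^-1.
Lemma mR2_q2 : mR2 q2. Proof. by rewrite /q2; meas. Qed.
Lemma q2_ge0 y x : 0 <= q2 y x. Proof. by rewrite invr_ge0 enge0. Qed.
Lemma nci_ge0 : 0 <= nc^-1. Proof. pos. Qed.

(* vanishes on the diagonal, where [q2] takes the junk value [0] *)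
Definition off y x : R := if dist x y <= 0 then 0 else 1.

Lemma offE y x : x <> y -> off y x = 1.
by move=> /enorm_gt0; rewrite /off leNgt => ->. Qed.

Lemma off_ge0 y x : 0 <= off y x. Proof. by rewrite /off; case: ifP. Qed.

Lemma mR3_off : mR3 (fun y x w : R3 R => off y x).
by rewrite /mR3 /off; apply: mR_leif; meas. Qed.

Variables (V V1 : RF) (B r A e : R).
Let V2 x := V x - V1 x.
Hypotheses (mV : mRX V) (mV1 : mRX V1) (B0 : 0 <= B) (r0 : 0 < r) (A0 : 0 < A).
Hypotheses (hV1 : forall x, `|V1 x| <= B * ballf 0 r x) (kV : katob (fun x => `|V x|) A).
Hypotheses (kV2 : katob (fun x => `|V2 x|) e) (e0 : 0 < e) (he : nc^-1 * (2 * e) <= 2^-1).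

Let mV2 : mRX V2. Proof. by apply: mR_D => //; meas. Qed.

(** The factor [off] clears the row x = y, where [q2] is 0 and no multiple of it could be an upper
    bound. *)
Definition E2 y x w : R := off y x * E0 (fun x => `|V2 x|) y x w.
Definition D2 m y x w : R[i] := (off y x)%:C * Tk V2 m x w.

Lemma kbd_E2 : kbd E2 q2 2^-1.
have [mW W0 _] := kV2; have [m1 p1 _] := kbd_E0 kV2.
split.
- by rewrite /mR3 /E2; apply: mR_M; [exact: mR3_off|exact: m1].
- by move=> y x w; rewrite /E2 mge0// off_ge0.
- move=> y x; rewrite /E2; have [->|/eqP xy] := eqVneq x y.
  rewrite (eq_n3 (g2 := fun=> 0)); last by move=> w; rewrite /off subrr enorm0 lexx !mul0r.
  by rewrite integral0 lee_fin mge0 ?q2_ge0.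
 rewrite (eq_n3 (g2 := fun w => nc^-1 * (`|V2 w| * ((dist x w)^-1 * (dist w y)^-1)))); last first.
  by move=> w; rewrite offE// /E0 /q2; ring.
 rewrite n3Z ?nci_ge0//; last 2 first.
 + by meas.
 + pos.
 apply: (via ((nc^-1)%:E * (2 * e / dist x y)%:E)%E).
  apply: leewl; first pos.
  exact: kato_weight_dist kV2 xy.
 by rewrite -EFinM lee_fin mulrA lewr// invr_ge0 enge0.
Qed.

Section OneParameter.
Variable m : R[i].
Hypothesis m0 : 0 <= Re m.

Lemma dom_D2 : dom E2 (D2 m).
have [m1 h1] := dom_Tk mV2 m0; split.
 by apply: mC_M; [apply: mC_real; exact: mR3_off|exact: m1].
move=> y x w; rewrite nrmM nrm_real ger0_norm ?off_ge0//.
by apply: lewl; [exact: off_ge0|exact: h1].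
Qed.

Lemma geo_D2 : geomp q2 (D2 m) 1 2^-1.
exact: (geometric_kbd mR2_q2 q2_ge0 kbd_E2 _ dom_D2). Qed.

Lemma bdd_Rk : bdd q2 (fun y x => Rk m x y) nc^-1.
split; last by move=> y x; exact: Rk_le.
by have mR := mC2_Rk m; rewrite /mC2; apply: (mC_c mR (h := fun p : (X * X)%type => ((p.2, p.1) : (X * X)%type))); mproj.
Qed.

(** The resolvent kernel of [V2] alone, with the parameter y as first argument; it carries the
    singularity of the final kernel. *)
Definition Gk : KF := neumann (D2 m) (fun y x => Rk m x y).

Let half0 : 0 <= 2^-1 :> R. Proof. pos. Qed.
Let half1 : 2^-1 < 1 :> R. Proof. by rewrite invf_lt1// ltr1n. Qed.

Lemma bdd_Gk : bdd q2 Gk (1 / (1 - 2^-1) * nc^-1).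
exact: (neumann_bdd q2_ge0 ler01 half0 half1 dom_D2 geo_D2 bdd_Rk nci_ge0). Qed.

Let cG : R := 1 / (1 - 2^-1) * nc^-1.
Let cG0 : 0 <= cG. Proof. by rewrite mge0 ?nci_ge0// divr_ge0// subr_ge0 ltW. Qed.

Lemma GkP y x : x <> y -> Gk y x + cI (fun w => Tk V2 m x w * Gk y w) = Rk m x y.
move=> xy; rewrite -(neumannP mR2_q2 q2_ge0 kbd_E2 ler01 half0 half1 dom_D2 geo_D2 bdd_Rk nci_ge0 y x).
congr (_ + _); apply: eq_cI => w; rewrite /D2 offE//; congr (_ * _).
by rewrite mul1r.
Qed.

(** $R_0V_1G$ multiplied by $1+|y|$, so that its bound by [omega x] is uniform in y; [Qk] divides
    the factor out again. *)
Definition Hk y x : R[i] := (1 + enorm y)%:C * cI (fun w => Tk V1 m x w * Gk y w).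

Definition cH : R := nc^-1 * (B * cG) * ((1 + r) ^+ 2 * (128 + 32 * r ^+ 3)).

Lemma cH_ge0 : 0 <= cH.
apply: mge0; first pos.
pos.
Qed.

Lemma T1G_dom y x : exists2 g : RF, mRX g &
 (forall w, nrm (Tk V1 m x w * Gk y w) <= g w) /\
 (\I_w (g w) <= (cH * (omega x * omega y))%:E)%E.
have mb := mR_ballf 0 r; have [_ hG] := bdd_Gk; have i0 a : 0 <= (enorm a)^-1 :> R by pos.
pose c := nc^-1 * (B * cG); have c0 : 0 <= c := mge0 nci_ge0 (mge0 B0 cG0).
exists (fun w => c * (ballf 0 r w * ((dist x w)^-1 * (dist w y)^-1))).
 by meas.
split.
 move=> w; rewrite nrmM nrm_Tk.
 have h1 := Rk_le x w m0; have h2 := hG y w; have h3 := hV1 w.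
 apply: (via (nc^-1 * (dist x w)^-1 * (B * ballf 0 r w) * (cG * q2 y w))).
  apply: ler_pM => //; [pos; pos|pos|].
  by apply: ler_pM => //; pos.
 by apply: eqle; rewrite /c /q2; ring.
rewrite n3Z//; last pos.
 apply: (via (c%:E * ((1 + r) ^+ 2 * (128 + 32 * r ^+ 3) * (omega x * omega y))%:E)%E).
  by apply: leewl => //; exact: ball_pair.
 by rewrite -EFinM lee_fin le_eqVlt; apply/orP; left; apply/eqP; rewrite /cH /c; ring.
by meas.
Qed.

Lemma T1G_int y x : cL1 (fun w => Tk V1 m x w * Gk y w).
have [g mg [h1 h2]] := T1G_dom y x; have mT := mC2_Tk m mV1; have [mG _] := bdd_Gk.
have m1 := mC2_r x mT; have m2 := mC2_r y mG.
apply: (cL1_le _ mg h1); first by meas.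
by apply: lelt h2 _; exact: ltry.
Qed.

Lemma bdd_Hk : bdd (@om) Hk cH.
have mT := mC2_Tk m mV1; have [mG _] := bdd_Gk.
have c := mC_app (mC3_cst2 mT) mG.
split; first by rewrite /mC2 /Hk; apply: mC_M; [meas; meas|exact: c].
move=> y x; have [g mg [h1 h2]] := T1G_dom y x.
have m1 := mC2_r x mT; have m2 := mC2_r y mG.
have h3 : nrm (cI (fun w => Tk V1 m x w * Gk y w)) <= cH * (omega x * omega y).
 by apply: (cI_le _ mg h1 h2); meas.
have e1 : 0 < 1 + enorm y by have := enge0 y; lra.
rewrite /Hk nrmM nrm_real gtr0_norm//.
apply: (via ((1 + enorm y) * (cH * (omega x * omega y)))).
 by apply: lewl; first pos.
by apply: eqle; rewrite /om /omega; field; rewrite !gt_eqF//; have := enge0 x; lra.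
Qed.

End OneParameter.

Variables (n : nat) (l : 'I_n -> CF) (Bl Mr : R) (r_ : R[i] -> 'I_n -> CF).
Variables (Ed : R3 R -> R3 R -> RF) (Bd Ag rho : R) (P : R[i] -> Prop).
Hypotheses (ml : forall i, mCX (l i)) (Bl0 : 0 <= Bl) (Mr0 : 0 <= Mr).
Hypothesis (hl : forall i, (\I_w (nrm (l i w) * omega w) <= Bl%:E)%E).
Hypotheses (kEd : kbd Ed (@om) Bd) (Ag0 : 0 <= Ag) (rho0 : 0 <= rho) (rho1 : rho < 1).
Hypothesis P0 : forall m, P m -> 0 <= Re m.
(** The contraction left when the finite-rank part is removed from $R_0V$. The choice [n = 0], made
    at high energies, leaves $R_0V$ itself. *)
Definition T0k m x w : R[i] := Tk V m x w - \sum_i r_ m i x * l i w.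
Hypothesis hD : forall m, P m -> dom Ed (cst2 (T0k m)).
Hypothesis gD : forall m, P m -> geomp (@om) (cst2 (T0k m)) Ag rho.
Hypothesis hr : forall m, P m -> forall i, bdd (@om) (fun=> r_ m i) Mr.
Hypothesis r_cvg : forall (m_ : nat -> R[i]) m i x, ccvg m_ m -> ccvg (fun k => r_ (m_ k) i x) (r_ m i x).

Definition fdet m : R[i] := \det (fmx l (T0k m) (r_ m)).
(** $(1+R_0V)^{-1}R_0V_1G$. As $(1+R_0V_2)G=R_0$ gives $(1+R_0V)G=R_0+R_0V_1G$, subtracting [Qk]
    from [Gk] solves the resolvent equation. *)
Definition Qk m y x : R[i] := (omega y)%:C * solve l (T0k m) (r_ m) (Hk m) y x.
Definition Kk m x y : R[i] := Gk m y x - Qk m y x.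

Definition sconst (d : R) : R := solve_const Ag rho n Bl Mr d * cH.

Lemma fullT_T0k m : fullT l (T0k m) (r_ m) = Tk V m.
by fext => x; fext => w; rewrite /fullT subrK. Qed.

Lemma bdd_solve m : P m -> bdd (@om) (solve l (T0k m) (r_ m) (Hk m)) (sconst (nrm (fdet m))).
move=> Pm; exact: (solve_bdd Ag0 rho0 rho1 ml Bl0 Mr0 hl (hD Pm) (gD Pm) (hr Pm)
 (bdd_Hk (P0 Pm)) cH_ge0).
Qed.

(** Through this, a lower bound on the determinant is all that uniformity in m requires. *)
Lemma solve_const_mono (d d' : R) : 0 < d -> d <= d' -> sconst d' <= sconst d.
move=> d0 dd; apply: lewr; first exact: cH_ge0.
have S0 : 0 <= Ag / (1 - rho) by rewrite divr_ge0// subr_ge0 ltW.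
have b0 : 0 <= 1 + Bl * (Ag / (1 - rho) * Mr) := addr_ge0 ler01 (mge0 Bl0 (mge0 S0 Mr0)).
rewrite /solve_const lerD2l; apply: lewr; first pos.
apply: lewr; last by rewrite lef_pV2// posrE (lt_le_trans d0).
pos.
Qed.

Lemma mC2_Kk m : P m -> mC2 (Kk m).
move=> Pm; have [mG _] := bdd_Gk (P0 Pm); have [mS _] := bdd_solve Pm.
have a1 := mC_c mG (h := fun p : (X * X)%type => ((p.2, p.1) : (X * X)%type)).
have a2 := mC_c mS (h := fun p : (X * X)%type => ((p.2, p.1) : (X * X)%type)).
rewrite /mC2 /Kk /Qk; apply: mC_D; first by apply: a1; mproj.
apply: mC_N; apply: mC_M; last by apply: a2; mproj.
by apply: mC_real; rewrite /omega; meas.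
Qed.

Definition cK (d : R) : R := 1 / (1 - 2^-1) * nc^-1 + sconst d.

Lemma Kk_le' m x y : P m -> nrm (Kk m x y) <=
 1 / (1 - 2^-1) * nc^-1 * (dist x y)^-1 + sconst (nrm (fdet m)) * (omega x * omega y).
move=> Pm; have [_ hG] := bdd_Gk (P0 Pm); have [_ hS] := bdd_solve Pm.
apply: le_trans (nrmB _ _) _; apply: lerD; first exact: hG.
rewrite /Qk nrmM nrm_real (ger0_norm (omega_ge0 y)).
apply: le_trans (lewl (omega_ge0 y) (hS y x)) _.
by apply: eqle; rewrite /om; ring.
Qed.

(** $|x-y|\le(1+|x|)(1+|y|)$; this returns the correction [Qk] to the weight of the theorem. *)
Lemma omega_pair x y : x <> y -> omega x * omega y <= (dist x y)^-1.
move=> /enorm_gt0 xy; rewrite /omega -invfM lef_pV2 ?posrE//; last first.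
 pos.
have h1 := enge0 x; have h2 := enge0 y; have := ler_enormD x (- y).
by rewrite enormN; nra.
Qed.

Lemma Kk_le m x y : P m -> x <> y -> nrm (Kk m x y) <= cK (nrm (fdet m)) / dist x y.
move=> Pm xy; apply: le_trans (Kk_le' x y Pm) _; rewrite /cK mulrDl lerD2l.
have [_ hS] := bdd_solve Pm.
have s0 : 0 <= sconst (nrm (fdet m)).
 have := le_trans (nge0 _) (hS 0 0).
 by rewrite pmulr_lge0// /om omega_gt0.
by apply: lewl => //; exact: omega_pair.
Qed.

Lemma TQ_int m x y : P m -> cL1 (fun w => Tk V m x w * Qk m y w).
move=> Pm; have hS := bdd_solve Pm; set C := sconst _ in hS.
have hS' : bdd (@om) (solve l (T0k m) (r_ m) (Hk m)) `|C|.
 by apply: (bdd_le om_ge0 hS); exact: ler_norm.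
have h := app_integrable mR2_om om_ge0 (kbd_E0 kV) y x (dom_Tk mV (P0 Pm)) hS' (normr_ge0 _).
rewrite /Qk; have := cL1_Z (omega y)%:C h.
have -> // : (fun w => (omega y)%:C * (cst2 (Tk V m) y x w * solve l (T0k m) (r_ m) (Hk m) y w)) =
 (fun w => Tk V m x w * ((omega y)%:C * solve l (T0k m) (r_ m) (Hk m) y w)).
by fext => w; rewrite mulrCA.
Qed.

Lemma T2G_int m x y : P m -> x <> y -> cL1 (fun w => Tk V2 m x w * Gk m y w).
move=> Pm xy; have hG := bdd_Gk (P0 Pm).
have c0 : 0 <= 1 / (1 - 2^-1) * nc^-1 :> R.
 by rewrite mge0 ?nci_ge0// divr_ge0// subr_ge0 invf_le1// ler1n.
have := app_integrable mR2_q2 q2_ge0 kbd_E2 y x (dom_D2 (P0 Pm)) hG c0.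
have -> // : (fun w => D2 m y x w * Gk m y w) = (fun w => Tk V2 m x w * Gk m y w).
by fext => w; rewrite /D2 offE// mul1r.
Qed.

Lemma KkP m x y : P m -> fdet m != 0 -> x <> y ->
 Kk m x y + cI (fun w => Tk V m x w * Kk m w y) = Rk m x y.
move=> Pm d0 xy; have m0 := P0 Pm.
have iQ := TQ_int x y Pm; have i2 := T2G_int Pm xy; have i1 := T1G_int m0 y x.
have e1 : cI (fun w => Tk V m x w * Kk m w y) =
  cI (fun w => Tk V1 m x w * Gk m y w) + cI (fun w => Tk V2 m x w * Gk m y w) -
  cI (fun w => Tk V m x w * Qk m y w).
 rewrite -cI_D// -cI_B//; last exact: cL1_D.
 apply: eq_cI => w; rewrite /Kk mulrBr -mulrDl; congr (_ * _ - _).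
 by rewrite /Tk -mulrDr -rmorphD /= /V2 addrC subrK.
have e2 : Qk m y x + cI (fun w => Tk V m x w * Qk m y w) = cI (fun w => Tk V1 m x w * Gk m y w).
 have hH := bdd_Hk m0.
 have := solveP kEd Ag0 rho0 rho1 ml Bl0 Mr0 hl (hD Pm) (gD Pm) (hr Pm) d0 hH cH_ge0 y x.
 rewrite fullT_T0k => h.
 have hS := bdd_solve Pm; set C := sconst _ in hS.
 have hS' : bdd (@om) (solve l (T0k m) (r_ m) (Hk m)) `|C|.
  by apply: (bdd_le om_ge0 hS); exact: ler_norm.
 have hi := app_integrable mR2_om om_ge0 (kbd_E0 kV) y x (dom_Tk mV m0) hS' (normr_ge0 _).
 have -> : cI (fun w => Tk V m x w * Qk m y w) =
  (omega y)%:C * app (cst2 (Tk V m)) (solve l (T0k m) (r_ m) (Hk m)) y x.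
  by rewrite /app -cI_Z//; apply: eq_cI => w; rewrite /Qk mulrCA.
 rewrite /Qk -mulrDr h /Hk mulrA -rmorphM /= /omega mulVf ?mul1r//.
 by rewrite gt_eqF// ltr_wpDr ?enge0.
rewrite e1 -(GkP m0 xy) -e2 /Kk; ring.
Qed.

Lemma fdet_cvg (m_ : nat -> R[i]) m : (forall k, P (m_ k)) -> P m -> ccvg m_ m ->
 ccvg (fun k => fdet (m_ k)) (fdet m).
move=> Pk Pm cm; apply: ccvg_det => i j.
have cT x w : ccvg (fun k => T0k (m_ k) x w) (T0k m x w).
 apply: ccvgB; first by apply: ccvgM; [exact: Rk_cvg|exact: ccvg_cst].
 by apply: ccvg_sum => i'; apply: ccvgM; [exact: r_cvg|exact: ccvg_cst].
have [_] := fmx_cvg kEd Ag0 rho0 rho1 ml Mr0 hl (fun k => hD (Pk k)) (hD Pm)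
 (fun k => gD (Pk k)) (gD Pm) (fun k => hr (Pk k)) (hr Pm) cT (fun i x => r_cvg i x cm).
exact.
Qed.

Lemma Kk_cvg (m_ : nat -> R[i]) m x y : (forall k, P (m_ k)) -> P m -> ccvg m_ m -> fdet m != 0 ->
 ccvg (fun k => Kk (m_ k) x y) (Kk m x y).
move=> Pk Pm cm d0.
have cT x' w : ccvg (fun k => T0k (m_ k) x' w) (T0k m x' w).
 apply: ccvgB; first by apply: ccvgM; [exact: Rk_cvg|exact: ccvg_cst].
 by apply: ccvg_sum => i'; apply: ccvgM; [exact: r_cvg|exact: ccvg_cst].
have half0 : 0 <= 2^-1 :> R by pos.
have half1 : 2^-1 < 1 :> R by rewrite invf_lt1// ltr1n.
have cG y' x' : ccvg (fun k => Gk (m_ k) y' x') (Gk m y' x').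
 apply: (neumann_continuous mR2_q2 q2_ge0 kbd_E2 ler01 half0 half1 nci_ge0
  (fun k => dom_D2 (P0 (Pk k))) (dom_D2 (P0 Pm)) (fun k => geo_D2 (P0 (Pk k))) (geo_D2 (P0 Pm))
  (fun k => bdd_Rk (P0 (Pk k))) (bdd_Rk (P0 Pm))) => [x'' w|x''].
  apply: ccvgM; first exact: ccvg_cst.
  by apply: ccvgM; [exact: Rk_cvg|exact: ccvg_cst].
 exact: Rk_cvg.
have cHk x' : ccvg (fun k => Hk (m_ k) y x') (Hk m y x').
 apply: ccvgM; first exact: ccvg_cst.
 have mb := mR_ballf 0 r; have i0 a : 0 <= (enorm a)^-1 :> R by pos.
 have [g mg hg] : exists2 g : RF, mRX g & (forall k w, nrm (Tk V1 (m_ k) x' w * Gk (m_ k) y w) <= g w) /\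
   (\I_w (g w) < +oo)%E.
  pose c : R := nc^-1 * (B * (1 / (1 - 2^-1) * nc^-1)).
  have mg : mRX (fun w => c * (ballf 0 r w * ((dist x' w)^-1 * (dist w y)^-1))) by meas.
  exists (fun w => c * (ballf 0 r w * ((dist x' w)^-1 * (dist w y)^-1))) => //.
  have d1 : 0 <= 1 / (1 - 2^-1) :> R by rewrite divr_ge0// subr_ge0 ltW.
  split.
   move=> k w; rewrite nrmM nrm_Tk.
   have h1 := Rk_le x' w (P0 (Pk k)); have [_ h2] := bdd_Gk (P0 (Pk k)); have h3 := hV1 w.
   apply: (via (nc^-1 * (dist x' w)^-1 * (B * ballf 0 r w) * (1 / (1 - 2^-1) * nc^-1 * q2 y w))).
    apply: ler_pM => //; [pos; pos|pos|].
    by apply: ler_pM => //; pos.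
   by apply: eqle; rewrite /c /q2; ring.
  have c0 : 0 <= c := mge0 nci_ge0 (mge0 B0 (mge0 d1 nci_ge0)).
  rewrite n3Z//; last pos.
   rewrite ltyM ?lee_fin//.
   by apply: lelt (ball_pair x' y r0) _; exact: ltry.
  by meas.
 apply: (cI_dct (g := g)) => //; last 2 first.
 - by case: hg.
 - by case: hg.
 - move=> k; have mT := mC2_Tk (m_ k) mV1; have [mG _] := bdd_Gk (P0 (Pk k)).
  by have m1 := mC2_r x' mT; have m2 := mC2_r y mG; meas.
 - by move=> w; apply: ccvgM => //; apply: ccvgM; [exact: Rk_cvg|exact: ccvg_cst].
apply: ccvgB => //; apply: ccvgM; first exact: ccvg_cst.
exact: (solve_cvg kEd Ag0 rho0 rho1 ml Mr0 hl cH_ge0 (fun k => hD (Pk k)) (hD Pm)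
 (fun k => gD (Pk k)) (gD Pm) (fun k => hr (Pk k)) (hr Pm) cT (fun i x => r_cvg i x cm)
 (fun k => bdd_Hk (P0 (Pk k))) (bdd_Hk (P0 Pm)) cHk d0).
Qed.

End Construction.

#[local] Hint Extern 0 (is_true _) => exact: nci_ge0 : pos.

(** * Finite-rank approximation at bounded energies *)

Section LowEnergy.
Implicit Types (x y w p : R3 R) (m : R[i]).

Lemma net1 (r h : R) : 0 < h -> exists s : seq R, forall a, `|a| <= r -> exists2 b, b \in s & `|a - b| <= h.
move=> h0; exists [seq - r + h * k%:R | k <- iota 0 (Num.truncn ((r + r) / h)).+1] => a.
rewrite ler_norml => /andP[a1 a2]; pose k := Num.truncn ((a + r) / h).
have q0 : 0 <= (a + r) / h by rewrite divr_ge0 ?(ltW h0)//; lra.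
have /andP[k1 k2] := truncn_itv q0; rewrite -/k in k1 k2.
exists (- r + h * k%:R).
 apply/mapP; exists k => //; rewrite mem_iota /= add0n ltnS; apply: le_truncn.
 by rewrite ler_pM2r ?invr_gt0//; lra.
move: k1 k2; rewrite ler_pdivlMr// ltr_pdivrMr// -addn1 natrD mulrDl mul1r => k1 k2.
by rewrite ler_norml; apply/andP; split; lra.
Qed.

Lemma net3 (r h : R) : 0 < h -> exists (n : nat) (p : 'I_n -> R3 R), forall w, enorm w <= r ->
 exists i, enorm (w - p i) <= h.
move=> h0; have h3 : 0 < h / 3 by rewrite divr_gt0.
have [s hs] := net1 r h3.
pose t := [seq (ab, c) | ab <- [seq (a, b) | a <- s, b <- s], c <- s].
exists (size t), (fun i => nth (0 : R3 R) t i) => w wr.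
have [a as_ ha] := hs _ (le_trans (ler_coord1 w) wr).
have [b bs hb] := hs _ (le_trans (ler_coord2 w) wr).
have [c cs hc] := hs _ (le_trans (ler_coord3 w) wr).
have tm : (a, b, c) \in t by apply: allpairs_f => //; exact: allpairs_f.
have ti : (index (a, b, c) t < size t)%N by rewrite index_mem.
exists (Ordinal ti) => /=; rewrite nth_index//.
apply: le_trans (enorm_le_coord _) _ => /=.
rewrite (_ : h = h / 3 + h / 3 + h / 3); last by field.
by rewrite !lerD.
Qed.

(** Capping the inverse distance at [d^-1] makes the kernel Lipschitz in its centre, so that it can
    be sampled on a net; off the diagonal the cap is felt only within distance d. *)
Definition capinv (d s : R) : R := (Num.max s d)^-1.
Definition Rcap m (d : R) p x : R[i] := (nc^-1 * capinv d (dist x p))%:C * cexp m (dist x p).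

Lemma capinv_ge0 d s : 0 < d -> 0 <= capinv d s.
by move=> d0; rewrite invr_ge0 le_max (ltW d0) orbT. Qed.

Lemma capinv_weight d s : 0 < d -> 0 <= s -> capinv d s <= (1 + d^-1) / (1 + s).
move=> d0 s0; have M0 : 0 < Num.max s d by rewrite lt_max d0 orbT.
have h1 : s <= Num.max s d by rewrite le_max lexx.
have h2 : d <= Num.max s d by rewrite le_max lexx orbT.
rewrite /capinv; move: (Num.max s d) M0 h1 h2 => M M0 h1 h2.
have h3 : 1 <= d^-1 * M by rewrite ler_pdivlMl// mulr1.
rewrite ler_pdivlMr; last by lra.
by rewrite ler_pdivrMl//; lra.
Qed.

Lemma shift_weight x p : (1 + dist x p)^-1 <= (1 + enorm p) * omega x.
have h1 := enge0 (x - p); have h2 := enge0 p; have h3 := enge0 x.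
have h := enorm_le_add x p; rewrite /omega -ler_pdivrMr ?invr_gt0; last by lra.
rewrite invrK ler_pdivrMl; last by lra.
by nra.
Qed.

Lemma capinv_omega d x p : 0 < d -> capinv d (dist x p) <= (1 + d^-1) * (1 + enorm p) * omega x.
move=> d0; apply: le_trans (capinv_weight d0 (enge0 _)) _; rewrite -mulrA.
by apply: lewl; [pos|exact: shift_weight].
Qed.

Lemma nrm_Rcap m d p x : 0 <= Re m -> 0 < d ->
 nrm (Rcap m d p x) <= nc^-1 * capinv d (dist x p).
move=> m0 d0; have h := mge0 (@nci_ge0) (capinv_ge0 (dist x p) d0).
rewrite /Rcap nrmM nrm_real (ger0_norm h) -[leRHS]mulr1.
by apply: lewl => //; apply: nrm_cexp_le1 => //; pos.
Qed.

Lemma mC2_Rcap m d : mC2 (fun p x => Rcap m d p x).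
rewrite /mC2 /Rcap /capinv; apply: mC_M; last by apply: mC_cexp; meas.
apply: mC_real; apply: mR_M; first meas.
by apply: mR_inv; apply: mR_max; [meas|meas].
Qed.

Lemma capinv_lip d s t : 0 < d -> `|capinv d s - capinv d t| <= d^-1 * `|s - t| * capinv d s.
move=> d0; have hmax a : d <= Num.max a d by rewrite le_max lexx orbT.
have lip : `|Num.max s d - Num.max t d| <= `|s - t|.
 rewrite /Num.max; case: (ltP s d) => sd; case: (ltP t d) => td.
 - by rewrite subrr normr0.
 - rewrite distrC [`|s - t|]distrC !ger0_norm; lra.
 - rewrite !ger0_norm; lra.
 - by [].
rewrite /capinv; move: (hmax s) (hmax t) lip; move: (Num.max s d) (Num.max t d) => S T hS hT lip.
have S0 : 0 < S by lra.
have T0 : 0 < T by lra.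
have -> : S^-1 - T^-1 = (T - S) * T^-1 * S^-1 by field; rewrite !gt_eqF.
rewrite !normrM !(ger0_norm (_ : 0 <= _^-1)) ?invr_ge0 ?(ltW S0) ?(ltW T0)//.
apply: lewr; first pos.
rewrite mulrC; apply: ler_pM => //; first pos.
 by rewrite lef_pV2.
by rewrite distrC.
Qed.

Definition diagf (x w : R3 R) : R := if dist w x <= 0 then 1 else 0.

(** Three errors. The cap costs $1/s-1/d\le d/s^2$ for s < d. At s = 0 the free kernel is 0 by
    convention and the cap is not: [diagf] records this null set. Moving the centre from w to p
    costs h by the Lipschitz bounds. *)
Lemma Rk_Rcap m (d L h : R) x w p : 0 <= Re m -> nrm m <= L -> 0 < d -> dist w p <= h ->
 nrm (Rk m x w - Rcap m d p x) <=
  nc^-1 * (d * near2 x d w + d^-1 * diagf x w + (4 * L + d^-1) * h * capinv d (dist x w)).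
move=> m0 mL d0 wh.
have L0 : 0 <= L by apply: le_trans mL; pos.
set s := dist x w; set t := dist x p.
have s0 : 0 <= s by pos.
have t0 : 0 <= t by pos.
have st : `|s - t| <= h.
 apply: le_trans wh; rewrite ler_norml; apply/andP; split.
  have := ler_dist w x p; rewrite -/s -/t; lra.
 by have := ler_dist p x w; rewrite -/s -/t (enormBC p w); lra.
have e1 : Rk m x w - Rcap m d p x = (nc^-1)%:C * (((s^-1 - capinv d s)%:C * cexp m s) +
  ((capinv d s)%:C * (cexp m s - cexp m t) + (capinv d s - capinv d t)%:C * cexp m t)).
 by rewrite /Rk /Rcap -/s -/t invfM !rmorphM !rmorphB /=; ring.
rewrite e1 nrmM nrm_real (ger0_norm nci_ge0); apply: lewl; first pos.
apply: le_trans (nrmD _ _) _; apply: lerD.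
 rewrite nrmM nrm_real -[leRHS]mulr1; apply: ler_pM => //; [pos| |exact: nrm_cexp_le1].
 rewrite /near2 /diagf (enormBC w x) -/s /capinv.
 have [sd|ds] := ltP s d; last first.
  rewrite subrr normr0 addr_ge0// mge0 ?(ltW d0)// ?invr_ge0 ?(ltW d0)//.
  by case: ifP.
 case: (leP s 0) => hs.
  have -> : s = 0 by lra.
  by rewrite invr0 sub0r normrN expr0n /= invr0 mulr0 add0r mulr1 ger0_norm// invr_ge0 ltW.
 rewrite mulr0 addr0 ger0_norm; last by rewrite subr_ge0 lef_pV2// ltW.
 rewrite expr2 invfM mulrA; have si : 0 < s^-1 by pos.
 have di : 0 < d^-1 by pos.
 have h1 : 1 <= d * s^-1 by rewrite ler_pdivlMr// mul1r ltW.
 by nra.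
apply: le_trans (nrmD _ _) _; rewrite (mulrDl (4 * L)) (mulrDl (4 * L * h)); apply: lerD; rewrite nrmM nrm_real.
 rewrite (ger0_norm (capinv_ge0 _ d0)) mulrC; apply: lewr; first exact: capinv_ge0.
 apply: le_trans (cexp_lip m0 s0 t0) _; apply: ler_pM => //.
  pos.
 exact: lewl.
apply: le_trans (lewl (normr_ge0 _) (nrm_cexp_le1 m0 t0)) _; rewrite mulr1.
apply: le_trans (capinv_lip s t d0) _; apply: lewr; first exact: capinv_ge0.
by apply: lewl => //; pos.
Qed.

(** A measurable partition of unity over balls of radius h about the net; where no ball reaches,
    [0^-1 = 0] makes it vanish. *)
Definition punit n (p : 'I_n -> R3 R) (h : R) (i : 'I_n) w : R :=
 ballf (p i) h w / \sum_j ballf (p j) h w.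

Lemma punit_ge0 n (p : 'I_n -> R3 R) h i w : 0 <= punit p h i w.
by rewrite divr_ge0 ?ballf_ge0// sumr_ge0// => j _; pos. Qed.

Lemma mR_punit n (p : 'I_n -> R3 R) h i : mRX (punit p h i).
apply: mR_M; first exact: mR_ballf.
by apply: mR_inv; apply: mR_sum => j; exact: mR_ballf.
Qed.

Lemma punit_supp n (p : 'I_n -> R3 R) h i w : punit p h i w != 0 -> enorm (w - p i) <= h.
by rewrite /punit /ballf; case: ifP => // _; rewrite mul0r eqxx. Qed.

Lemma punit_sum n (p : 'I_n -> R3 R) h w i : enorm (w - p i) <= h -> \sum_j punit p h j w = 1.
move=> hi; rewrite -mulr_suml mulfV// gt_eqF// (bigD1 i)//= {1}/ballf hi ltr_pwDl//.
by apply: sumr_ge0 => j _; pos.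
Qed.

Lemma punit_le1 n (p : 'I_n -> R3 R) h i w : punit p h i w <= 1.
have [h0|h0] := eqVneq (\sum_j ballf (p j) h w) 0; first by rewrite /punit h0 invr0 mulr0.
have hp : 0 < \sum_j ballf (p j) h w.
 by rewrite lt_def h0 sumr_ge0// => j _; pos.
rewrite /punit ler_pdivrMr// mul1r (bigD1 i)//= lerDl.
by apply: sumr_ge0 => j _; pos.
Qed.

Variables (V V1 : RF) (B r e L : R).
Let V2 x := V x - V1 x.
Hypotheses (mV : mRX V) (mV1 : mRX V1) (B0 : 0 <= B) (r0 : 0 < r) (L0 : 0 <= L).
Hypotheses (hV1 : forall x, `|V1 x| <= B * ballf 0 r x).
Hypotheses (kV2 : katob (fun x => `|V2 x|) e) (he : nc^-1 * (3 * e) <= 4^-1).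

(** With $\chi_i$ the partition of unity, $R_0V_1$ is approximated by the sum over i of the capped
    kernel at $p_i$ times $\chi_iV_1$. The remainder has norm 1/2 on [omega]: 1/4 from [V2], 1/8
    from the cap and 1/8 from the mesh. *)
Lemma low_data : exists (n : nat) (l : 'I_n -> CF) (Bl Mr : R)
  (r_ : R[i] -> 'I_n -> CF) (Ed : R3 R -> R3 R -> RF),
 [/\ forall i, mCX (l i), 0 <= Bl, 0 <= Mr,
   forall i, (\I_w (nrm (l i w) * omega w) <= Bl%:E)%E & kbd Ed (@om) 2^-1] /\
 (forall m, 0 <= Re m /\ nrm m <= L ->
  dom Ed (cst2 (T0k V l r_ m)) /\ (forall i, bdd (@om) (fun=> r_ m i) Mr)) /\
 (forall (m_ : nat -> R[i]) m i x, ccvg m_ m -> ccvg (fun k => r_ (m_ k) i x) (r_ m i x)).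
have n0 := @nci_ge0.
have r30 : 0 <= 8 * r ^+ 3 := mge0 (ler0n _ 8) (exprn_ge0 3 (ltW r0)).
(* [c1 * d ^+ 2] will bound the cap error: [near2] integrates to [64 * d], and within distance 1 of
   the ball $1\le(2+r)\omega(x)$. *)
pose c1 := nc^-1 * B * 64 * (2 + r).
have c10 : 0 <= c1 by rewrite !mge0// addr_ge0// ltW.
pose d := (8 * (c1 + 1))^-1.
have d0 : 0 < d by rewrite invr_gt0 mulr_gt0// ltr_wpDl.
have hd : 8 * (c1 + 1) * d = 1 by rewrite mulfV// gt_eqF// mulr_gt0// ltr_wpDl.
have d1 : d <= 1 by nra.
have cd : c1 * d ^+ 2 <= 8^-1.
 have : c1 * d <= 8^-1 by nra.
 by rewrite expr2; nra.
(* [c2 * h] will bound the sampling error. It contains [d^-1], so the cap is fixed before the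
   mesh. *)
pose c2 := nc^-1 * B * (8 * r ^+ 3) * (4 * L + d^-1) * ((1 + d^-1) * (1 + r)).
have di0 : 0 <= d^-1 by pos.
have c20 : 0 <= c2.
 by rewrite /c2 !mge0 ?addr_ge0 ?mge0// ?exprn_ge0 ?(ltW r0).
pose h := (8 * (c2 + 1))^-1.
have h0 : 0 < h by rewrite invr_gt0 mulr_gt0// ltr_wpDl.
have hh : c2 * h <= 8^-1.
 have : 8 * (c2 + 1) * h = 1 by rewrite mulfV// gt_eqF// mulr_gt0// ltr_wpDl.
 by nra.
clearbody d h; clear hd.
have [n [p hp]] := net3 r h0.
pose kap := (4 * L + d^-1) * h.
have kap0 : 0 <= kap by rewrite mge0 ?(ltW h0)// addr_ge0// mge0.
pose l i w : R[i] := (punit p h i w * V1 w)%:C.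
pose rr m i x := Rcap m d (p i) x.
pose E1 x w : R := nc^-1 * (B * ballf 0 r w) * (d * near2 x d w + d^-1 * diagf x w +
 kap * capinv d (dist x w)).
pose Ed (y x w : R3 R) := E0 (fun x => `|V2 x|) y x w + E1 x w.
pose Mr := \sum_i (nc^-1 * ((1 + d^-1) * (1 + enorm (p i)))).
have Mri i : 0 <= nc^-1 * ((1 + d^-1) * (1 + enorm (p i))).
 pos.
have Mr0 : 0 <= Mr by apply: sumr_ge0 => i _.
have mb := mR_ballf 0 r.
have b0 w : 0 <= ballf 0 r w by pos.
have bb w : ballf 0 r w <= 1 by rewrite /ballf; case: ifP.
have ol w : omega w <= 1 by rewrite /omega invf_le1 ?lerDl ?enge0// ltr_wpDr ?enge0.
have mE1 : mR2 E1.
 rewrite /E1 /near2 /diagf /capinv /mR2; apply: mR_M; first by meas.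
 apply: mR_D; first apply: mR_D.
 - by apply: mR_M; [meas|apply: mR_ltif; meas].
 - by apply: mR_M; [meas|apply: mR_leif; meas].
 - by apply: mR_M; [meas|apply: mR_inv; apply: mR_max; meas].
have dg0 x w : 0 <= diagf x w by rewrite /diagf; case: ifP.
have E10 x w : 0 <= E1 x w.
 rewrite /E1; apply: mge0; first pos.
 rewrite !addr_ge0//; [by rewrite mge0 ?near2_ge0// ltW|pos|].
 by rewrite mge0// capinv_ge0.
exists n, l, (B * (8 * r ^+ 3)), Mr, rr, Ed; split; [split|split] => //.
- by move=> i; apply: mC_real; apply: mR_M; [exact: mR_punit|exact: mV1].
- pos.
- move=> i; have mp := mR_punit p h i.
 apply: (via (\I_w (B * ballf 0 r w))%E).
  apply: n3le.
  + by rewrite /l /omega; apply: mR_M; [meas; meas; meas|meas].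
  + by meas.
  + pos.
  move=> w; rewrite /l nrm_real normrM (ger0_norm (punit_ge0 _ _ _ _)).
  apply: (via (1 * (B * ballf 0 r w) * 1)); last by rewrite mul1r mulr1.
  apply: ler_pM => //; [by rewrite mge0// punit_ge0|pos|].
  by apply: ler_pM => //; [exact: punit_ge0|exact: punit_le1].
 rewrite n3Z// EFinM; apply: leewl => //.
 exact: nnballf (ltW r0).
- have [k1 k2 k3] := kbd_E0 kV2; split.
 + apply: mR_D; first exact: k1.
  by apply: (mR_c mE1 (h := fun p : (X * X * X)%type => ((p.1.2, p.2) : (X * X)%type))); mproj.
 + by move=> y x w; rewrite addr_ge0.
 move=> y x; have m1 := mR3_r y x k1; have m2 := mR2_r x mE1.
 have mo := mR2_r y (@mR2_om).
 rewrite (eq_n3 (g2 := fun w => E0 (fun x => `|V2 x|) y x w * om y w + E1 x w * om y w)); last first.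
  by move=> w; rewrite mulrDl.
 rewrite n3D; [|by meas|by meas|pos|pos].
 have ox := omega_ge0 x.
 have -> : 2^-1 * om y x = 4^-1 * omega x + (8^-1 * omega x + 8^-1 * omega x) by rewrite /om; field.
 rewrite EFinD; apply: leeD.
  by apply: le_trans (k3 y x) _; rewrite lee_fin /om; apply: lewr.
 pose g1 w := nc^-1 * B * d * ((2 + r) * omega x) * near2 x d w.
 pose g2 w := nc^-1 * B * kap * ((1 + d^-1) * (1 + r) * omega x) * ballf 0 r w.
 have mn := mR_near2 x d.
 have mg1 : mRX g1 by apply: mR_M; [exact: mR_cst|exact: mn].
 have mg2 : mRX g2 by apply: mR_M; [exact: mR_cst|exact: mb].
 have k10 : 0 <= nc^-1 * B * d * ((2 + r) * omega x).
  pos.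
 have k20 : 0 <= nc^-1 * B * kap * ((1 + d^-1) * (1 + r) * omega x).
  pos.
 have pt (w : R3 R) : w <> x -> E1 x w * om y w <= g1 w + g2 w.
  move=> /enorm_gt0 wx.
  have dg : diagf x w = 0 by rewrite /diagf leNgt wx.
  rewrite /om /E1 dg mulr0 addr0 /g1 /g2 /ballf subr0.
  case: ifPn => wr; last by rewrite !mulr0 !mul0r addr0 mge0// near2_ge0.
  have wo := omega_ge0 w; have wo1 := ol w; rewrite !mulr1 mulrDr mulrDl.
  have nn := near2_ge0 x d w.
  have cx := capinv_omega x w d0; have ccx := capinv_ge0 (dist x w) d0.
  apply: lerD.
   rewrite /near2 in nn *; case: ltP => wd; last by rewrite !mulr0 mul0r.
   have hx : 1 <= (2 + r) * omega x.
    rewrite /omega ler_pdivlMr; last pos.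
    by have := enorm_le_add x w; rewrite (enormBC x w); lra.
   rewrite (_ : nc^-1 * B * d * _ * _ = nc^-1 * B * (d * (dist w x ^+ 2)^-1) * ((2 + r) * omega x)); last by ring.
   apply: lewl; last exact: le_trans wo1 hx.
   pos.
  rewrite (_ : nc^-1 * B * (kap * _) * _ = nc^-1 * B * kap * (capinv d (dist x w) * omega w)); last by ring.
  apply: lewl; first pos.
  apply: (via (capinv d (dist x w) * 1)); first by apply: lewl.
  rewrite mulr1; apply: le_trans cx _; apply: lewr => //; apply: lewl; first pos.
  by rewrite lerD2l.
 apply: (via (\I_w (g1 w + g2 w))%E).
  apply: n3ae_le.
  + by meas.
  + by meas.
  + pos.
  + by move=> w; rewrite addr_ge0// mge0// near2_ge0.
  by apply: (aeS (ae_neq x)) => w; exact: pt.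
 rewrite n3D//; [|by move=> w; rewrite mge0// near2_ge0|by move=> w; rewrite mge0].
 rewrite n3Z//; last by move=> w; exact: near2_ge0.
 rewrite n3Z// EFinD; apply: leeD.
  apply: (via ((nc^-1 * B * d * ((2 + r) * omega x))%:E * (64 * d)%:E)%E).
   by apply: leewl => //; exact: nnint_near2.
  rewrite -EFinM lee_fin (_ : _ * (64 * d) = c1 * d ^+ 2 * omega x); last by rewrite /c1; ring.
  by apply: lewr.
 apply: (via ((nc^-1 * B * kap * ((1 + d^-1) * (1 + r) * omega x))%:E * (8 * r ^+ 3)%:E)%E).
  by apply: leewl => //; exact: nnballf (ltW r0).
 rewrite -EFinM lee_fin (_ : _ * (8 * r ^+ 3) = c2 * h * omega x); last by rewrite /c2 /kap; ring.
 by apply: lewr.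
- move=> m [m0 mL]; split; last first.
  move=> i; split.
   have mR := mC2_Rcap m d; rewrite /mC2 /rr.
   by apply: (mC_c mR (h := fun q : (X * X)%type => ((p i, q.2) : (X * X)%type))); mproj.
  move=> y x; apply: le_trans (nrm_Rcap _ _ m0 d0) _.
  apply: (via (nc^-1 * ((1 + d^-1) * (1 + enorm (p i))) * omega x)).
   by rewrite -mulrA; apply: lewl => //; exact: capinv_omega.
  apply: lewr; first pos.
  by rewrite /Mr (bigD1 i)//= lerDl; apply: sumr_ge0.
 split.
  apply: mC3_cst2; rewrite /mC2 /T0k; apply: mC_D; first exact: mC2_Tk.
  apply: mC_N; apply: mC_sum => i.
  have mR := mC2_Rcap m d; have mp := mR_punit p h i.
  apply: mC_M; last by apply: mC_real; meas.
  by apply: (mC_c mR (h := fun q : (X * X)%type => ((p i, q.1) : (X * X)%type))); mproj.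
 move=> y x w; rewrite /cst2 /T0k /Ed.
 have -> : Tk V m x w - \sum_i rr m i x * l i w =
   Tk V2 m x w + (Tk V1 m x w - \sum_i rr m i x * l i w).
  by rewrite addrA; congr (_ - _); rewrite /Tk -mulrDr -rmorphD /= /V2 subrK.
 apply: le_trans (nrmD _ _) _; apply: lerD.
  have mV2 : mRX V2 by apply: mR_D => //; meas.
  by have [_] := dom_Tk mV2 m0; apply.
 have hw := hV1 w; move: hw; rewrite /E1; rewrite {1 2}/ballf subr0; case: ifPn => wr hw; last first.
  have v0 : V1 w = 0 by apply/eqP; rewrite -normr_le0; move: hw; rewrite mulr0.
  have -> : Tk V1 m x w - \sum_i rr m i x * l i w = 0.
   rewrite /Tk v0 mulr0 sub0r big1 ?oppr0// => i _; by rewrite /l v0 mulr0 mulr0.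
  by rewrite nrm0 !mulr0 mul0r.
 have [i0 hi0] := hp w wr; have su := punit_sum hi0.
 (* The partition of unity sums to 1 at w, so the error is an average of differences [Rk - Rcap]
    over net points within h of w. *)
 have -> : Tk V1 m x w - \sum_i rr m i x * l i w =
   (V1 w)%:C * \sum_i ((punit p h i w)%:C * (Rk m x w - rr m i x)).
  have -> : \sum_i ((punit p h i w)%:C * (Rk m x w - rr m i x)) =
    Rk m x w - \sum_i (punit p h i w)%:C * rr m i x.
   rewrite -{2}[Rk m x w]mul1r -[1]/(1%:C) -su rmorph_sum mulr_suml -sumrB.
   by apply: eq_bigr => i _; rewrite mulrBr.
  rewrite mulrBr mulr_sumr /Tk mulrC; congr (_ - _).
  by apply: eq_bigr => i _; rewrite /l rmorphM /=; ring.
 set K := (d * near2 x d w + d^-1 * diagf x w + kap * capinv d (dist x w)).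
 have K0 : 0 <= K.
  rewrite /K !addr_ge0//; [by rewrite mge0 ?near2_ge0// ltW|pos|].
  by rewrite mge0// capinv_ge0.
 rewrite nrmM nrm_real; apply: (via (B * (nc^-1 * K))); last first.
  by apply: eqle; ring.
 apply: ler_pM => //; [pos|by rewrite mulr1 in hw|].
 apply: le_trans (nrm_sum _ _) _.
 apply: (via (\sum_i punit p h i w * (nc^-1 * K))); last by rewrite -mulr_suml su mul1r.
 apply: ler_sum => i _; rewrite nrmM nrm_real (ger0_norm (punit_ge0 _ _ _ _)).
 have [->|/punit_supp pi] := eqVneq (punit p h i w) 0; first by rewrite !mul0r.
 by apply: lewl; [exact: punit_ge0|exact: (Rk_Rcap x m0 mL d0 pi)].
- move=> m_ m i x cm; apply: ccvgM; first exact: ccvg_cst.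
 exact: cexp_cvg.
Qed.

End LowEnergy.

(** * Partial derivatives along lines and integration by parts *)

Section Partial.
Implicit Types (x y : R3 R) (f g phi : RF) (i : 'I_3).

Definition crd i x : R := if i == 0 :> nat then x.1.1 else if i == 1 :> nat then x.1.2 else x.2.

Lemma ord3 i : [\/ i = 0 :> nat, i = 1 :> nat | i = 2 :> nat]%N.
by case: i => -[|[|[|k]]] h; [constructor 1|constructor 2|constructor 3|discriminate]. Qed.

Lemma crd_line i (t : R) x : crd i (t *: e_ i + x) = t + crd i x.
by rewrite /crd /unit_vec; case: (ord3 i) => -> /=; rewrite /GRing.scale /= mulr1. Qed.

Lemma enorm_line i (t : R) x : enorm (t *: e_ i + x) ^+ 2 = enorm x ^+ 2 + 2 * t * crd i x + t ^+ 2.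
rewrite !enorm_sqr /crd /unit_vec; case: (ord3 i) => -> /=.
all: rewrite /GRing.scale /= ?mulr1 ?mulr0 ?add0r; ring.
Qed.

Lemma enorm_unit i (t : R) : enorm (t *: e_ i) = `|t|.
apply/eqP; rewrite -(eqrXn2 (n := 2)) ?enge0// -[t *: _]addr0 enorm_line.
rewrite enorm0 expr0n /= add0r (_ : crd i 0 = 0) ?mulr0 ?add0r ?real_normK ?num_real//.
by rewrite /crd; case: ifP => // _; case: ifP.
Qed.

Lemma sum_crd x : \sum_(i < 3) crd i x ^+ 2 = enorm x ^+ 2.
by rewrite enorm_sqr !big_ord_recl big_ord0 /crd /= addr0 addrA. Qed.

Lemma crd_le i x : `|crd i x| <= enorm x.
by rewrite /crd; case: ifP => _; [exact: ler_coord1|case: ifP => _; [exact: ler_coord2|exact: ler_coord3]].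
Qed.

Lemma mR_crd d (T : measurableType d) i (h : T -> R3 R) : m3 h -> mR (fun t => crd i (h t)).
rewrite /crd => mh; case: (i == 0 :> nat) => /=; first exact: m3_1.
by case: (i == 1 :> nat) => /=; [exact: m3_2|exact: m3_3].
Qed.

Definition line f i x (t : R) : R := f (t *: e_ i + x).

Lemma line_quotient f i x (t : R) :
 (fun h : R => h^-1 *: ((line f i x \o shift t) (h *: 1) - line f i x t)) =
 (fun h : R => h^-1 *: ((f \o shift (t *: e_ i + x)) (h *: e_ i) - f (t *: e_ i + x))).
fext => h; congr (_ *: (_ - _)); rewrite /= /line; congr f.
by rewrite [h *: 1]mulr1 scalerDl addrA.
Qed.

Lemma is_derive_lineT f i x (t l : R) :
 is_derive (t *: e_ i + x) (e_ i) f l <-> is_derive t 1 (line f i x) l.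
have e := line_quotient f i x t.
split => -[h1 h2]; split.
- by rewrite /derivable e.
- by rewrite -h2 /derive e.
- by move: h1; rewrite /derivable e.
- by rewrite -h2 /derive e.
Qed.

Lemma is_derive_line f i x (l : R) : is_derive x (e_ i) f l <-> is_derive (0 : R) 1 (line f i x) l.
by rewrite -is_derive_lineT scale0r add0r. Qed.

Lemma derive_quotient_cvg f i x l : is_derive x (e_ i) f l ->
 (fun n => n.+1%:R * (f (n.+1%:R^-1 *: e_ i + x) - f x)) @ \oo --> l.
move=> [d <-]; have h0 : (fun n : nat => n.+1%:R^-1 : R) @ \oo --> (0 : R)^'.
 move=> A; rewrite /dnbhs /within /= => hA.
 have hh : \forall n \near \oo, (n.+1%:R^-1 != 0 :> R) -> A n.+1%:R^-1 := @cvg_harmonic R _ hA.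
 by apply: filterS hh => n; apply; rewrite gt_eqF// invr_gt0.
have := cvg_comp _ _ h0 d.
have -> // : ((fun h : R => h^-1 *: ((f \o shift x) (h *: e_ i) - f x)) \o (fun n : nat => n.+1%:R^-1)) =
 (fun n => n.+1%:R * (f (n.+1%:R^-1 *: e_ i + x) - f x)).
by fext => n /=; rewrite invrK.
Qed.

Lemma line_mvt f (df : RF) i x (h : R) : 0 <= h -> (forall x, is_derive x (e_ i) f (df x)) ->
 exists2 c, 0 <= c <= h & f (h *: e_ i + x) - f x = df (c *: e_ i + x) * h.
move=> h0 hf.
have hl (t : R) : is_derive t 1 (line f i x) (df (t *: e_ i + x)) by apply/is_derive_lineT.
have cl : {within `[0, h], continuous (line f i x)}.
 apply: continuous_subspaceT => t; apply: differentiable_continuous.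
 by apply/derivable1_diffP; exact: (@ex_derive _ _ _ _ _ _ _ (hl t)).
have [c hc e] := MVT_segment h0 (fun t _ => hl t) cl.
exists c; first by move: hc; rewrite in_itv.
by move: e; rewrite /line scale0r add0r subr0.
Qed.

(** Difference quotients have integral 0 by translation invariance, and by the mean value theorem
    they converge under a bounded majorant of bounded support. *)
Lemma cI_partial0 i f (df : RF) (M C r : R) : mRX f -> (forall x, is_derive x (e_ i) f (df x)) ->
 0 <= M -> 0 <= C -> 0 < r ->
 (forall x, `|f x| <= M * ballf 0 r x) -> (forall x, `|df x| <= C * ballf 0 r x) ->
 mRX df /\ cI (fun x => (df x)%:C) = 0.
move=> mf hf M0 C0 r0 fM dC.
pose u (n : nat) x : R[i] := (n.+1%:R * (f (n.+1%:R^-1 *: e_ i + x) - f x))%:C.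
have mb (r : R) := mR_ballf 0 r.
have ms (n : nat) : mRX (fun x => f (n.+1%:R^-1 *: e_ i + x)).
 have := mR_shift (n.+1%:R^-1 *: e_ i) mf.
 by have -> : (fun x : R3 R => f (x + n.+1%:R^-1 *: e_ i)) = (fun x => f (n.+1%:R^-1 *: e_ i + x)) by fext => x; rewrite addrC.
have mu_ n : mCX (u n).
 by apply: mC_real; apply: mR_M; [meas|apply: mR_D; [exact: ms|meas]].
have cu x : ccvg (u ^~ x) (df x)%:C by apply: ccvg_real; exact: derive_quotient_cvg.
have ud n x : nrm (u n x) <= C * ballf 0 (r + 1) x.
 rewrite nrm_real normrM ger0_norm//.
 have hn : 0 <= n.+1%:R^-1 :> R by pos.
 have [c /andP[c0 c1] ->] := line_mvt x hn hf.
 rewrite normrM mulrCA (ger0_norm hn) mulfV ?pnatr_eq0// mulr1.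
 apply: le_trans (dC _) _; apply: lewl => //; rewrite /ballf !subr0.
 case: ifPn => [h1|_]; last by case: ifP.
 rewrite ifT//; have := enorm_le_add x (- (c *: e_ i)); rewrite opprK enormN enorm_unit ger0_norm// addrC => h2.
 have c2 : c <= 1 by apply: le_trans c1 _; rewrite invf_le1 ?ler1n.
 by move: h2; rewrite addrC [x + _]addrC => h2; lra.
have fin : (\I_x (C * ballf 0 (r + 1) x) < +oo)%E.
 rewrite n3Z//; [|exact: mb|by move=> x; pos].
 rewrite ltyM ?lee_fin//; apply: lelt (nnballf _ _) _; last exact: ltry.
 pos.
have finM : (\I_x (M * ballf 0 r x) < +oo)%E.
 rewrite n3Z//; [|exact: mb|by move=> x; pos].
 rewrite ltyM ?lee_fin//; apply: lelt (nnballf _ _) _; last exact: ltry.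
 pos.
have mdf : mCX (fun x => (df x)%:C) by apply: (mC_lim (f_ := u)).
split; first by case: mdf.
have mg : mRX (fun x => C * ballf 0 (r + 1) x).
 by apply: mR_M; [meas|exact: mb].
have h := cI_dct mu_ cu mg fin ud.
apply: (ccvg_unique h).
have -> : (fun n => cI (u n)) = fun=> 0; last exact: ccvg_cst.
fext => n; have i0 : cL1 (fun x => (f x)%:C).
 apply: (cL1_le (g := fun x => M * ballf 0 r x)) => //.
 - meas.
 - by apply: mR_M; [meas|exact: mb].
 - by move=> x; rewrite nrm_real.
have i1 : cL1 (fun x => (f (x + n.+1%:R^-1 *: e_ i))%:C).
 have [m0 j0] := i0; split; first exact: (mC_shift (n.+1%:R^-1 *: e_ i) m0).
 have mm : mRX (fun x => nrm (f x)%:C) by meas.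
 have := nnint_shift (n.+1%:R^-1 *: e_ i) mm (fun x => nge0 _).
 by move=> /= ->.
rewrite (eq_cI (f2 := fun x => n.+1%:R%:C * ((f (x + n.+1%:R^-1 *: e_ i))%:C - (f x)%:C))); last first.
 by move=> x; rewrite /u (addrC _ x) rmorphM rmorphB.
rewrite cI_Z; last exact: cL1_B.
by rewrite cI_B// (cI_shift (n.+1%:R^-1 *: e_ i) (f := fun x => (f x)%:C)) ?subrr ?mulr0//; case: i0.
Qed.

Lemma cI_ibp i f (df : RF) g (dg : RF) (M B r : R) : mRX f -> mRX df -> mRX g ->
 (forall x, is_derive x (e_ i) f (df x)) -> (forall x, is_derive x (e_ i) g (dg x)) ->
 0 <= M -> 0 <= B -> 0 < r -> (forall x, `|f x| <= M) -> (forall x, `|df x| <= M) ->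
 (forall x, `|g x| <= B * ballf 0 r x) -> (forall x, `|dg x| <= B * ballf 0 r x) ->
 cI (fun x => (f x * dg x)%:C) = - cI (fun x => (df x * g x)%:C).
move=> mf mdf mg hf hg M0 B0 r0 fM dfM gB dgB.
have mb := mR_ballf 0 r.
have [mdg _] := cI_partial0 mg hg B0 B0 r0 gB dgB.
have h x : is_derive x (e_ i) (fun x => f x * g x) (f x * dg x + df x * g x).
 rewrite (_ : (fun x0 => f x0 * g x0) = f * g)//; apply: (is_derive_eq (is_deriveM (hf x) (hg x))).
 by rewrite /GRing.scale /= [g x * _]mulrC.
have MB0 : 0 <= M * B by pos.
have bd (u v : RF) x : (forall x, `|u x| <= M) -> (forall x, `|v x| <= B * ballf 0 r x) ->
  `|u x * v x| <= M * B * ballf 0 r x.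
 by move=> h1 h2; rewrite normrM -mulrA; apply: ler_pM.
have fin : (\I_x (M * B * ballf 0 r x) < +oo)%E.
 rewrite n3Z//; last by move=> x; pos.
 by rewrite ltyM ?lee_fin//; apply: lelt (nnballf _ (ltW r0)) _; exact: ltry.
have mfg : mRX (fun x => f x * g x) by meas.
have [_ e] := cI_partial0 mfg h MB0 (addr_ge0 MB0 MB0) r0 (fun x => bd f g x fM gB)
 (fun x => le_trans (ler_normD _ _) (le_trans (lerD (bd f dg x fM dgB) (bd df g x dfM gB))
  (eq_ind_r (fun z => _ <= z) (lexx _) (mulrDl (M * B) (M * B) (ballf 0 r x))))).
have L (u v : RF) : mRX u -> mRX v -> (forall x, `|u x| <= M) -> (forall x, `|v x| <= B * ballf 0 r x) ->
  cL1 (fun x => (u x * v x)%:C).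
 move=> mu_ mv h1 h2; apply: (cL1_le (g := fun x => M * B * ballf 0 r x)) => //.
 - meas; meas.
 - by meas.
 - by move=> x; rewrite nrm_real bd.
apply/eqP; rewrite -addr_eq0 -cI_D; [|exact: L|exact: L].
by rewrite -[X in _ == X]e; apply/eqP/eq_cI => x; rewrite rmorphD.
Qed.

Lemma partial_derive phi i x : smooth phi -> is_derive x (e_ i) phi (pd i phi x).
by move=> /(_ [::]) [_ /(_ i x)] /= d; split. Qed.

Lemma smooth_partial phi i : smooth phi -> smooth (pd i phi).
by move=> h s; have := h (rcons s i); rewrite foldr_rcons. Qed.

Lemma bounded_support_partial phi i : bounded_support phi -> bounded_support (pd i phi).
move=> [r hr]; exists r => x rx; rewrite /pd.
have d0 : 0 < enorm x - r by lra.
have e : \forall y \near x, phi y = cst 0 y.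
 apply: filterS (enorm_near x d0) => y hy; rewrite hr//.
 by have := enorm_le_add x y; lra.
by rewrite (near_eq_derive (g := cst 0)) ?derive_cst.
Qed.

Lemma tpd phi i : testf phi -> testf (pd i phi).
by move=> [h1 h2]; split; [exact: smooth_partial|exact: bounded_support_partial]. Qed.

Lemma test_bound phi : testf phi -> exists B r : R, [/\ 0 <= B, 0 < r,
 forall x, `|phi x| <= B * ballf 0 r x, forall i x, `|pd i phi x| <= B * ballf 0 r x &
 forall i x, `|pd i (pd i phi) x| <= B * ballf 0 r x].
have one psi : testf psi -> exists B r : R, [/\ 0 <= B, 0 < r & forall x, `|psi x| <= B * ballf 0 r x].
 by move=> [/(_ [::])[/= c _] b]; exact: continuous_bounded_support.
have mono (B B' r r' : R) x : 0 <= B -> B <= B' -> r <= r' -> B * ballf 0 r x <= B' * ballf 0 r' x.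
 move=> B0 BB rr; apply: ler_pM => //; first pos.
 rewrite /ballf; case: ifPn => [h|_]; last by case: ifP.
 by rewrite ifT//; apply: le_trans rr.
have three (F : 'I_3 -> RF) : (forall i, testf (F i)) -> exists B r : R,
  [/\ 0 <= B, 0 < r & forall i x, `|F i x| <= B * ballf 0 r x].
 move=> tF; have [B hB] := choice (fun i => one _ (tF i)); have [r hr] := choice hB.
 exists (\sum_i B i), (\sum_i r i); split.
 - by apply: sumr_ge0 => i _; have [] := hr i.
 - rewrite (bigD1 ord0)//= ltr_pwDl//; first by have [] := hr ord0.
  by apply: sumr_ge0 => i _; have [_ /ltW] := hr i.
 - move=> i x; have [b0 _ h] := hr i; apply: le_trans (h x) _; apply: mono => //.
   by rewrite (bigD1 i)//= lerDl; apply: sumr_ge0 => j _; have [] := hr j.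
  by rewrite (bigD1 i)//= lerDl; apply: sumr_ge0 => j _; have [_ /ltW] := hr j.
move=> t; have [B0 [r0 [b0 p0 h0]]] := one _ t.
have [B1 [r1 [b1 p1 h1]]] := three _ (fun i => tpd i t).
have [B2 [r2 [b2 p2 h2]]] := three _ (fun i => tpd i (tpd i t)).
exists (B0 + B1 + B2), (r0 + r1 + r2); split; [pos|pos|move=> x|move=> i x|move=> i x].
- by apply: le_trans (h0 x) _; apply: mono => //; lra.
- by apply: le_trans (h1 i x) _; apply: mono => //; lra.
- by apply: le_trans (h2 i x) _; apply: mono => //; lra.
Qed.

Lemma is_derive_crd i x y : is_derive x (e_ i) (fun x => crd i (x - y)) 1.
apply/is_derive_line; have -> : line (fun x => crd i (x - y)) i x = (fun t : R => t + crd i (x - y)).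
 by fext => t; rewrite /line -addrA crd_line.
by apply: is_derive_eq; rewrite addr0.
Qed.

(** A smoothed distance: functions of it are differentiable at the pole y too. *)
Definition rad (e : R) y x : R := Num.sqrt (dist x y ^+ 2 + e ^+ 2).

Lemma is_derive_rad (e : R) i x y (k : R -> R) (dk : R) : 0 < e -> is_derive (rad e y x) 1 k dk ->
 is_derive x (e_ i) (fun x => k (rad e y x)) (dk * (crd i (x - y) / rad e y x)).
move=> e0 hk; apply/is_derive_line.
pose q (t : R) := dist x y ^+ 2 + 2 * t * crd i (x - y) + t ^+ 2 + e ^+ 2.
have -> : line (fun x => k (rad e y x)) i x = k \o (Num.sqrt \o q).
 by fext => t; rewrite /line /= /rad -addrA enorm_line.
have q0 : q 0 = dist x y ^+ 2 + e ^+ 2 by rewrite /q mulr0 mul0r expr0n /= !addr0.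
have qp : 0 < q 0 by rewrite q0 ltr_wpDl ?sqr_ge0// exprn_gt0.
have dq : is_derive (0 : R) 1 q (2 * crd i (x - y)).
 by rewrite /q; apply: is_derive_eq; rewrite /GRing.scale /= !mulr0 !add0r !addr0; ring.
have ds := is_derive1_comp (is_derive1_sqrt qp) dq.
have hk' : is_derive ((Num.sqrt \o q) 0) 1 k dk by rewrite /= q0.
have := is_derive1_comp hk' ds => h; apply: is_derive_eq.
have -> : Num.sqrt (q 0) = rad e y x by rewrite q0.
have rp : rad e y x != 0 by rewrite gt_eqF// sqrtr_gt0 ltr_wpDl ?sqr_ge0// exprn_gt0.
by field.
Qed.

End Partial.

(** * The regularised Helmholtz kernel *)

Section Regularised.
Implicit Types (x y : R3 R) (phi : RF) (i : 'I_3) (c m : R[i]) (s e : R).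

(** Dominated convergence when the hypotheses may fail at the single point y: the factor [off]
    removes it without changing any integral. *)
Lemma cI_dct_off y (f_ : nat -> CF) f g : (forall n, mCX (f_ n)) -> mCX f ->
 (forall x, x <> y -> ccvg (f_ ^~ x) (f x)) -> mRX g -> (\I_x (g x) < +oo)%E ->
 nneg g -> (forall n x, x <> y -> nrm (f_ n x) <= g x) ->
 ccvg (fun n => cI (f_ n)) (cI f).
move=> mf_ mf cf mg gfin g0 hg.
have mo : mRX (off y) by rewrite /mRX /off; apply: mR_leif; meas.
have e (h : CF) : mCX h -> cI h = cI (fun x => (off y x)%:C * h x).
 move=> mh; apply: cI_ae => //; first by meas.
 apply: (aeS (ae_neq y)) => x xy.
 by rewrite offE// mul1r.
rewrite (e _ mf); have -> : (fun n => cI (f_ n)) = fun n => cI (fun x => (off y x)%:C * f_ n x).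
 by fext => n; exact: e.
have [|||] // := cI_dct (f_ := fun n x => (off y x)%:C * f_ n x) (f := fun x => (off y x)%:C * f x) _ _ mg gfin _.
- by move=> n; have := mf_ n => ?; meas.
- move=> x; have [->|/eqP xy] := eqVneq x y.
  have -> : off y y = 0 by rewrite /off subrr enorm0 lexx.
  by rewrite mul0r; under eq_fun do rewrite mul0r; exact: ccvg_cst.
 by apply: ccvgM; [exact: ccvg_cst|exact: cf].
- move=> n x; have [->|/eqP xy] := eqVneq x y.
  have -> : off y y = 0 by rewrite /off subrr enorm0 lexx.
  by rewrite mul0r nrm0.
 by rewrite offE// mul1r; exact: hg.
Qed.

(** The partial derivatives of the definitions act on real functions. With the free constant c,
    differentiating $\mathrm{Re}(c\,e^{-ms})$ only multiplies c by [- m], and letting c vary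
    recovers the complex kernel ([complex_ReP]). *)
Definition gam c m s : R := Re (c * cexp m s).

Lemma gamE c m s : gam c m s = Re c * (expR (- (Re m * s)) * cos (Im m * s)) +
 Im c * (expR (- (Re m * s)) * sin (Im m * s)).
by rewrite /gam ReM; have [-> ->] := ReImcexp m s; ring. Qed.

Lemma gam_le c m s : 0 <= Re m -> 0 <= s -> `|gam c m s| <= nrm c.
move=> m0 s0; apply: le_trans (Re_le_nrm _) _; rewrite nrmM ler_piMr ?nge0//.
exact: nrm_cexp_le1.
Qed.

Lemma is_derive_gam c m s : is_derive s 1 (gam c m) (gam (- m * c) m s).
set a := Re m; set b := Im m.
have dl (k : R) : is_derive s 1 (fun s => k * s) k.
 rewrite (_ : (fun s => k * s) = k *: id)//; apply: (is_derive_eq (is_deriveZ k (is_derive_id s 1))).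
 exact: mulr1.
have dE : is_derive s 1 (fun s => expR (- (a * s))) (- a * expR (- (a * s))).
 have h2 := @is_derive1_comp R expR (fun s => - a * s) s _ _ (is_derive_expR _) (dl (- a)).
 have -> : (fun s => expR (- (a * s))) = expR \o (fun s => - a * s).
  by fext => t; rewrite /= mulNr.
 by apply: (is_derive_eq h2); rewrite mulNr mulrC.
have dc : is_derive s 1 (fun s => cos (b * s)) (- b * sin (b * s)).
 have h2 := @is_derive1_comp R cos (fun s => b * s) s _ _ (is_derive_cos _) (dl b).
 by apply: (is_derive_eq h2); ring.
have ds : is_derive s 1 (fun s => sin (b * s)) (b * cos (b * s)).
 have h2 := @is_derive1_comp R sin (fun s => b * s) s _ _ (is_derive_sin _) (dl b).
 by apply: (is_derive_eq h2); ring.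
have h1 := is_deriveM dE dc; have h2 := is_deriveM dE ds.
have h := is_deriveD (is_deriveZ (Re c) h1) (is_deriveZ (Im c) h2).
have -> : gam c m = Re c *: ((fun s => expR (- (a * s))) * (fun s => cos (b * s))) +
 Im c *: ((fun s => expR (- (a * s))) * (fun s => sin (b * s))).
 by fext => t; rewrite gamE.
apply: (is_derive_eq h); rewrite gamE !ReImE -/a -/b /GRing.scale /=; ring.
Qed.

Lemma gam_cvg c m (u : nat -> R) s : u @ \oo --> s -> (fun n => gam c m (u n)) @ \oo --> gam c m s.
move=> hu; apply: (cvg_comp _ _ hu); apply: differentiable_continuous.
by apply/derivable1_diffP; exact: (@ex_derive _ _ _ _ _ _ _ (is_derive_gam c m s)).
Qed.

Section Fixed.
Variables (e : R) (y : R3 R) (m c : R[i]).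
Hypotheses (e0 : 0 < e) (m0 : 0 <= Re m).
Local Notation s x := (rad e y x).
Local Notation g0 := (gam c m).
Local Notation g1 := (gam (- m * c) m).
Local Notation g2 := (gam (- m * (- m * c)) m).

Lemma rad_ge x : dist x y <= s x /\ e <= s x.
have h : 0 <= dist x y ^+ 2 + e ^+ 2 by pos.
split; rewrite -ler_sqr ?nnegrE ?sqrtr_ge0 ?enge0 ?(ltW e0)// [s x ^+ 2]sqr_sqrtr//.
 by rewrite lerDl sqr_ge0.
by rewrite lerDr sqr_ge0.
Qed.

Lemma rad_gt0 x : 0 < s x.
by apply: lt_le_trans e0 (rad_ge x).2. Qed.

Definition Kr x : R := g0 (s x) / s x.
Definition k1 t : R := g1 t / t ^+ 2 - g0 t / t ^+ 3.
Definition dk1 t : R := g2 t / t ^+ 2 - 3 * g1 t / t ^+ 3 + 3 * g0 t / t ^+ 4.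
Definition dKr i x : R := crd i (x - y) * k1 (s x).
Definition ddKr i x : R := k1 (s x) + crd i (x - y) * (dk1 (s x) * (crd i (x - y) / s x)).

Lemma mR_rad : mRX (rad e y).
by rewrite /rad; apply: mR_sqrt; meas. Qed.

Lemma mR_gam c' : mRX (fun x => gam c' m (s x)).
have mr := mR_rad; have mc := @mC_cexp _ X (rad e y) m mr.
have [h _] : mCX (fun x => c' * cexp m (s x)) by meas; meas.
exact: h.
Qed.

Lemma mR_k1 : mRX (fun x => k1 (s x)).
by rewrite /k1; have h := mR_gam; have h1 := h c; have h2 := h (- m * c); have h3 := mR_rad; meas. Qed.

Lemma mR_dk1 : mRX (fun x => dk1 (s x)).
rewrite /dk1; have h := mR_gam; have h1 := h c; have h2 := h (- m * c); have h3 := mR_rad.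
by have h4 := h (- m * (- m * c)); meas.
Qed.

Lemma mR_crdy i : mRX (fun x => crd i (x - y)).
by apply: mR_crd; mproj. Qed.

Lemma der_inv (t : R) n : t != 0 -> is_derive t 1 (fun t => t ^- n.+1) (- n.+1%:R / t ^+ n.+2).
move=> t0; have e1 : (fun t : R => t ^+ n.+1) = id ^+ n.+1 by fext => u; rewrite exprfctE.
have h : is_derive t 1 (fun t : R => t ^+ n.+1) (n.+1%:R * t ^+ n).
 by rewrite e1; apply: (is_derive_eq (is_deriveX n.+1 (is_derive_id t 1))); rewrite /GRing.scale /= mulr1.
have tn : t ^+ n.+1 != 0 by rewrite expf_neq0.
have hV := @is_deriveV R (fun t => t ^+ n.+1) t _ 1 tn h.
apply: (is_derive_eq hV); rewrite /GRing.scale /= !exprS; field.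
by rewrite t0 expf_neq0.
Qed.

Lemma der_Kr i x : is_derive x (e_ i) Kr (dKr i x).
have sp := rad_gt0 x; have sn : s x != 0 by rewrite gt_eqF.
have h := is_deriveM (is_derive_gam c m (s x)) (der_inv 0 sn).
have h' : is_derive (s x) 1 (fun t => g0 t / t) (k1 (s x) * s x).
 have -> : (fun t => g0 t / t) = g0 * (fun t => t ^- 1) by [].
 by apply: (is_derive_eq h); rewrite /k1 /GRing.scale /=; field.
apply: (is_derive_eq (is_derive_rad i e0 h')); rewrite /dKr; field.
exact: sn.
Qed.

Lemma der_dKr i x : is_derive x (e_ i) (dKr i) (ddKr i x).
have sp := rad_gt0 x; have sn : s x != 0 by rewrite gt_eqF.
have h1 := is_deriveM (is_derive_gam (- m * c) m (s x)) (der_inv 1 sn).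
have h2 := is_deriveM (is_derive_gam c m (s x)) (der_inv 2 sn).
have h : is_derive (s x) 1 k1 (dk1 (s x)).
 have -> : k1 = g1 * (fun t => t ^- 2) - g0 * (fun t => t ^- 3) by [].
 by apply: (is_derive_eq (is_deriveB h1 h2)); rewrite /dk1 /GRing.scale /=; field.
have := is_deriveM (is_derive_crd i x y) (is_derive_rad i e0 h).
move=> h3; apply: (is_derive_eq h3); rewrite /ddKr /GRing.scale /= mulr1 addrC.
by [].
Qed.

Lemma k1_le x : `|k1 (s x)| <= nrm (- m * c) / s x ^+ 2 + nrm c / s x ^+ 3.
have sp := rad_gt0 x; apply: le_trans (ler_normB _ _) _.
have p n : 0 <= s x ^- n by pos.
apply: lerD; rewrite normrM (ger0_norm (p _)); apply: lewr => //; exact: gam_le (ltW sp).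
Qed.

Lemma dk1_le x : `|dk1 (s x)| <= nrm (- m * (- m * c)) / s x ^+ 2 +
 3 * nrm (- m * c) / s x ^+ 3 + 3 * nrm c / s x ^+ 4.
have sp := rad_gt0 x; have p n : 0 <= s x ^- n by pos.
apply: le_trans (ler_normD _ _) _; apply: lerD; first (apply: le_trans (ler_normB _ _) _; apply: lerD).
all: rewrite !normrM ?(ger0_norm (ler0n _ _)) (ger0_norm (p _)); apply: lewr => //.
- exact: gam_le (ltW sp).
- by apply: lewl => //; exact: gam_le (ltW sp).
- by apply: lewl => //; exact: gam_le (ltW sp).
Qed.

Lemma crd_rad i x : `|crd i (x - y)| <= s x.
by apply: le_trans (crd_le _ _) (rad_ge x).1. Qed.

Lemma Kr_le x : `|Kr x| <= nrm c / s x.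
have sp := rad_gt0 x; rewrite /Kr normrM (ger0_norm (_ : 0 <= (s x)^-1)) ?invr_ge0 ?(ltW sp)//.
by apply: lewr; [pos|exact: gam_le (ltW sp)].
Qed.

Lemma dKr_le i x : `|dKr i x| <= nrm (- m * c) / s x + nrm c / s x ^+ 2.
have sp := rad_gt0 x; rewrite /dKr normrM.
apply: le_trans (ler_pM _ _ (crd_rad i x) (k1_le x)) _ => //.
by apply: eqle; field; rewrite gt_eqF.
Qed.

Lemma ddKr_le i x : `|ddKr i x| <= nrm (- m * (- m * c)) / s x +
 4 * nrm (- m * c) / s x ^+ 2 + 4 * nrm c / s x ^+ 3.
have sp := rad_gt0 x; rewrite /ddKr; apply: le_trans (ler_normD _ _) _.
apply: (via ((nrm (- m * c) / s x ^+ 2 + nrm c / s x ^+ 3) +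
 (nrm (- m * (- m * c)) / s x ^+ 2 + 3 * nrm (- m * c) / s x ^+ 3 + 3 * nrm c / s x ^+ 4) * s x)).
 apply: lerD; first exact: k1_le.
 rewrite !normrM mulrCA; apply: ler_pM => //; first exact: dk1_le.
 rewrite (ger0_norm (_ : 0 <= (s x)^-1)) ?invr_ge0 ?(ltW sp)//.
 rewrite mulrA ler_pdivrMr//; apply: ler_pM => //; exact: crd_rad.
by apply: eqle; field; rewrite gt_eqF.
Qed.

(** The squared coordinates sum to $s^2-e^2$; with $s^2$ alone everything but the first term
    cancels. The remaining terms carry $e^2$, and the one in $s^{-5}$ is the approximate delta. *)
Lemma sum_ddKr x : \sum_(i < 3) ddKr i x = g2 (s x) / s x - e ^+ 2 * (g2 (s x) / s x ^+ 3) +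
 3 * e ^+ 2 * (g1 (s x) / s x ^+ 4) - 3 * e ^+ 2 * (g0 (s x) / s x ^+ 5).
have sp := rad_gt0 x.
have h : \sum_(i < 3) crd i (x - y) ^+ 2 = s x ^+ 2 - e ^+ 2.
 by rewrite sum_crd [s x ^+ 2]sqr_sqrtr ?addrK// addr_ge0// sqr_ge0.
rewrite /ddKr big_split /= sumr_const card_ord.
have -> : \sum_(i < 3) crd i (x - y) * (dk1 (s x) * (crd i (x - y) / s x)) =
 (\sum_(i < 3) crd i (x - y) ^+ 2) * (dk1 (s x) / s x).
 by rewrite mulr_suml; apply: eq_bigr => i _; ring.
by rewrite h /k1 /dk1 -mulr_natl; field; rewrite gt_eqF.
Qed.

Variable phi : RF.
Hypothesis tphi : testf phi.

Lemma inv_rad_le x n : s x ^- n <= e ^- n.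
have sp := rad_gt0 x; rewrite lef_pV2 ?posrE ?exprn_gt0//.
by apply: lerXn2r; rewrite ?nnegrE ?(ltW e0) ?(ltW sp)//; exact: (rad_ge x).2.
Qed.

Lemma ibp_Kr i : cI (fun x => (Kr x * pd i phi x)%:C) = - cI (fun x => (dKr i x * phi x)%:C).
have [B [r [B0 r0 h0 h1 h2]]] := test_bound tphi.
have mg := mR_gam c; have mr := mR_rad; have mk := mR_k1; have mc := mR_crdy i.
pose M : R := nrm c / e + (nrm (- m * c) / e + nrm c / e ^+ 2).
have q n : 0 <= e ^- n by pos.
have q1 := q 1; rewrite expr1 in q1.
have z (a : R[i]) n : 0 <= nrm a / e ^+ n by pos.
have z1 (a : R[i]) : 0 <= nrm a / e by pos.
have M0 : 0 <= M by rewrite /M !addr_ge0.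
have p1 x : (s x)^-1 <= e^-1 by have := inv_rad_le x 1; rewrite !expr1.
apply: (cI_ibp _ _ _ _ _ M0 B0 r0 _ _ h0 (h1 i)).
- by rewrite /mRX /Kr; meas.
- by rewrite /mRX /dKr; meas.
- exact: testf_mR.
- by move=> x; exact: der_Kr.
- by move=> x; apply: partial_derive; case: tphi.
- move=> x; apply: le_trans (Kr_le x) _; rewrite /M -[leLHS]addr0; apply: lerD; last pos.
 by apply: lewl => //; pos.
- move=> x; apply: le_trans (dKr_le i x) _; rewrite /M -[leLHS]add0r; apply: lerD => //.
 by apply: lerD; apply: lewl; rewrite ?nge0//; exact: inv_rad_le.
Qed.

Lemma ibp_dKr i : cI (fun x => (dKr i x * pd i phi x)%:C) = - cI (fun x => (ddKr i x * phi x)%:C).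
have [B [r [B0 r0 h0 h1 h2]]] := test_bound tphi.
have mg := mR_gam c; have mr := mR_rad; have mk := mR_k1; have mc := mR_crdy i; have mdk := mR_dk1.
pose M : R := (nrm (- m * c) / e + nrm c / e ^+ 2) + (nrm (- m * (- m * c)) / e +
 4 * nrm (- m * c) / e ^+ 2 + 4 * nrm c / e ^+ 3).
have q n : 0 <= e ^- n by pos.
have q1 := q 1; rewrite expr1 in q1.
have z (a : R[i]) n : 0 <= nrm a / e ^+ n by pos.
have z4 (a : R[i]) n : 0 <= 4 * nrm a / e ^+ n by pos.
have z1 (a : R[i]) : 0 <= nrm a / e by pos.
have M0 : 0 <= M by rewrite /M !addr_ge0.
have p1 x : (s x)^-1 <= e^-1 by have := inv_rad_le x 1; rewrite !expr1.
apply: (cI_ibp _ _ _ _ _ M0 B0 r0 _ _ h0 (h1 i)).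
- by rewrite /mRX /dKr; meas.
- by rewrite /mRX /ddKr; meas.
- exact: testf_mR.
- by move=> x; exact: der_dKr.
- by move=> x; apply: partial_derive; case: tphi.
- move=> x; apply: le_trans (dKr_le i x) _; rewrite /M -[leLHS]addr0; apply: lerD; last pos.
 by apply: lerD; apply: lewl; rewrite ?nge0//; exact: inv_rad_le.
- move=> x; apply: le_trans (ddKr_le i x) _; rewrite /M -[leLHS]add0r; apply: lerD; first pos.
 apply: lerD; first apply: lerD; apply: lewl; rewrite ?nge0 ?mge0 ?nge0//; exact: inv_rad_le.
Qed.

End Fixed.

End Regularised.

Transparent integral Rintegral.

Lemma RintE (f : RF) : \int[mu]_x f x = fine (\I_x (f x))%E.
by []. Qed.

Lemma Rint_affine (al : R) (be : R3 R) (f : RF) : 0 < al -> mRX f ->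
 \int[mu]_x f x = al ^+ 3 * \int[mu]_x f (al *: x + be).
move=> al0 mf; rewrite /Rintegral integralE [in RHS]integralE.
have a3 : 0 < al ^+ 3 by rewrite exprn_gt0.
have mp : mRX (fun x : R3 R => Num.max (f x) 0) by apply: mR_max => //; meas.
have mn : mRX (fun x : R3 R => Num.max (- f x) 0) by apply: mR_max; [meas|meas].
have p0 (x : X) : 0 <= Num.max (f x) 0 by rewrite le_max lexx orbT.
have n0 (x : X) : 0 <= Num.max (- f x) 0 by rewrite le_max lexx orbT.
have h1 := nnint3_affine be al0 mp p0; have h2 := nnint3_affine be al0 mn n0.
have -> : (\int[mu]_x ((fun x => (f x)%:E)^\+ x) = (al ^+ 3)%:E * \int[mu]_x ((fun x => (f (al *: x + be)%R)%:E)^\+ x))%E.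
 transitivity (\I_x (Num.max (f x) 0))%E.
  by apply: eq_integral => x _; rewrite funeposE EFin_max.
 by rewrite h1; congr (_ * _)%E; apply: eq_integral => x _; rewrite funeposE EFin_max.
have -> : (\int[mu]_x ((fun x => (f x)%:E)^\- x) = (al ^+ 3)%:E * \int[mu]_x ((fun x => (f (al *: x + be)%R)%:E)^\- x))%E.
 transitivity (\I_x (Num.max (- f x)%R 0))%E.
  by apply: eq_integral => x _; rewrite funenegE EFin_max EFinN.
 by rewrite h2; congr (_ * _)%E; apply: eq_integral => x _; rewrite funenegE EFin_max EFinN.
set P := (\int[mu]_x (_^\+ x))%E; set N := (\int[mu]_x (_^\- x))%E.
have P0 : (0 <= P)%E by apply: integral_ge0.
have N0 : (0 <= N)%E by apply: integral_ge0.
clearbody P N; case: P P0 => [p| |] P0; last by move: P0; rewrite leeNy_eq => /eqP hh; discriminate hh.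
 case: N N0 => [q| |] N0; last by move: N0; rewrite leeNy_eq => /eqP hh; discriminate hh.
  by rewrite -!EFinM /= mulrBr.
 by rewrite gt0_muley ?lte_fin//= mulr0.
rewrite gt0_muley ?lte_fin//; case: N N0 => [q| |] N0; last by move: N0; rewrite leeNy_eq => /eqP hh; discriminate hh.
 by rewrite /= mulr0.
by rewrite gt0_muley ?lte_fin//= mulr0.
Qed.

(** * The free kernel as a fundamental solution *)

Section FreeResolvent.
Implicit Types (x y : R3 R) (phi : RF) (i : 'I_3) (c m : R[i]) (s e : R).

Lemma cI_affine (al : R) (be : R3 R) (f : CF) : 0 < al -> mCX f ->
 cI f = (al ^+ 3)%:C * cI (fun x => f (al *: x + be)).
move=> al0 [m1 m2]; apply: ceqP; rewrite ReImE /= ?mul0r ?subr0 ?addr0.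
 exact: (Rint_affine be al0 m1).
exact: (Rint_affine be al0 m2).
Qed.

Lemma cI_Re (f : CF) : cI (fun x => (Re (f x))%:C) = (Re (cI f))%:C.
by apply: ceqP => //=; exact: (congr1 (fun z : R[i] => Im z) (cint0 mu)). Qed.

Definition eps (n : nat) : R := n.+1%:R^-1.
Lemma eps_gt0 n : 0 < eps n. Proof. by rewrite invr_gt0. Qed.
Lemma eps_cvg : eps @ \oo --> (0 : R). Proof. exact: cvg_harmonic. Qed.

Lemma rad_cvg x y : (fun n => rad (eps n) y x) @ \oo --> dist x y.
have -> : dist x y = Num.sqrt (dist x y ^+ 2 + 0 ^+ 2).
 by rewrite expr0n /= addr0 sqrtr_sqr ger0_norm ?enge0.
apply: (cvg_comp (fun n => dist x y ^+ 2 + eps n ^+ 2) Num.sqrt); last exact: sqrt_continuous.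
by apply: cvgD; [exact: cvg_cst|rewrite !expr2; apply: cvgM; exact: eps_cvg].
Qed.

Section Limit.
Variables (m c : R[i]) (y : R3 R) (phi : RF).
Hypotheses (m0 : 0 <= Re m) (tphi : testf phi).
Local Notation g0 := (gam c m).
Local Notation g1 := (gam (- m * c) m).
Local Notation g2 := (gam (- m * (- m * c)) m).

Lemma inv_pow_rad n k x : x <> y -> rad (eps n) y x ^- k <= dist x y ^- k.
move=> /enorm_gt0 xy; have sp := rad_gt0 y (eps_gt0 n) x.
rewrite lef_pV2 ?posrE ?exprn_gt0//; apply: lerXn2r; rewrite ?nnegrE ?(ltW xy) ?(ltW sp)//.
exact: (rad_ge y (eps_gt0 n) x).1.
Qed.

Lemma gam_rad_cvg c' k x : x <> y ->
 (fun n => gam c' m (rad (eps n) y x) / rad (eps n) y x ^+ k) @ \oo -->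
 gam c' m (dist x y) / dist x y ^+ k.
move=> /enorm_gt0 xy; have h := @rad_cvg x y; apply: cvgM; first exact: gam_cvg.
apply: cvgV; first by rewrite expf_neq0// gt_eqF.
exact: (@cvg_comp _ _ _ (fun n => rad (eps n) y x) (fun z => z ^+ k) _ _ _ h (@exprn_continuous R k _)).
Qed.

Lemma near_dom (M1 M2 B r : R) : 0 <= M1 -> 0 <= M2 -> 0 <= B -> 0 < r ->
 let g x := (M1 * (dist x y)^-1 + M2 * dist x y ^- 2) * (B * ballf 0 r x) in
 [/\ mRX g, forall x, 0 <= g x & (\I_x (g x) < +oo)%E].
move=> M10 M20 B0 r0 g; have mb := mR_ballf 0 r.
have i0 x : 0 <= (dist x y)^-1 by pos.
have i20 x : 0 <= dist x y ^- 2 by pos.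
have b0 x : 0 <= ballf 0 r x by pos.
have mg : mRX g by rewrite /g; meas.
split => // [x|]; first by rewrite /g mge0 ?addr_ge0 ?mge0.
have [A A0 [_ _ kA]] := ball_kato r0.
rewrite (eq_n3 (g2 := fun x => M1 * B * (ballf 0 r x * (dist x y)^-1) + M2 * B * (ballf 0 r x * dist x y ^- 2))); last first.
 by move=> x; rewrite /g; ring.
rewrite n3D; [|by meas|by meas|pos|pos].
rewrite n3Z; [|by meas|pos|pos].
rewrite n3Z; [|by meas|pos|pos].
rewrite lte_add_pinfty// ltyM ?lee_fin ?mge0//.
 by apply: lelt (kA y) _; exact: ltry.
by apply: lelt (ball_sqr_inv y r0) _; exact: ltry.
Qed.

Lemma mR_gam_dist c' k : mRX (fun x => gam c' m (dist x y) / dist x y ^+ k).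
have [h _] : mCX (fun x => c' * cexp m (dist x y)).
 by apply: mC_M; [meas|apply: mC_cexp; meas].
meas.
Qed.

Lemma real_newton_partial i :
 cI (fun x => (g0 (dist x y) / dist x y ^+ 1 * pd i phi x)%:C) =
 - cI (fun x => (crd i (x - y) * (g1 (dist x y) / dist x y ^+ 2 -
    g0 (dist x y) / dist x y ^+ 3) * phi x)%:C).
have [B [r [B0 r0 h0 h1 h2]]] := test_bound tphi.
have mphi := testf_mR tphi; have mdphi := testf_mR (tpd i tphi).
have [mg g0' gfin] := near_dom (addr_ge0 (nge0 c) (nge0 (- m * c))) (nge0 c) B0 r0.
have md c' k := mR_gam_dist c' k.
have d1 := md c 1%N; have d2 := md (- m * c) 2%N; have d3 := md c 3%N; have mcr := mR_crdy y i.
have L1 : ccvg (fun n => cI (fun x => (Kr (eps n) y m c x * pd i phi x)%:C))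
 (cI (fun x => (g0 (dist x y) / dist x y ^+ 1 * pd i phi x)%:C)).
 apply: (cI_dct_off (y := y) _ _ _ mg gfin g0') => [n||x xy|n x xy].
 - have h := mR_gam (eps n) y m c; have hr := mR_rad (eps n) y.
  by apply: mC_real; rewrite /Kr; meas.
 - by apply: mC_real; apply: mR_M; [exact: d1|exact: mdphi].
 - apply: ccvg_real; apply: cvgMl; have := @gam_rad_cvg c 1 x xy; rewrite expr1.
  by under eq_fun do rewrite expr1.
 - rewrite nrm_real normrM; have b0 := ballf_ge0 (0 : R3 R) r x.
  apply: ler_pM => //; apply: le_trans (Kr_le y c (eps_gt0 n) m0 x) _.
  rewrite mulrDl -[leLHS]addr0; apply: lerD; last first.
   pos.
  have := inv_pow_rad n 1 xy; rewrite !expr1 => h3.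
  have i0 : 0 <= (dist x y)^-1 by pos.
  have := lewl (nge0 c) h3; have := mge0 (nge0 (- m * c)) i0; lra.
have L2 : ccvg (fun n => cI (fun x => (dKr (eps n) y m c i x * phi x)%:C))
 (cI (fun x => (crd i (x - y) * (g1 (dist x y) / dist x y ^+ 2 -
    g0 (dist x y) / dist x y ^+ 3) * phi x)%:C)).
 apply: (cI_dct_off (y := y) _ _ _ mg gfin g0') => [n||x xy|n x xy].
 - have h := mR_k1 (eps n) y m c; have hr := mR_rad (eps n) y.
  by apply: mC_real; rewrite /dKr; meas.
 - apply: mC_real; apply: mR_M; last exact: mphi.
  by apply: mR_M; [exact: mcr|apply: mR_D; [exact: d2|apply: mR_N; exact: d3]].
 - apply: ccvg_real; apply: cvgMl; apply: cvgMr; apply: cvgB; exact: gam_rad_cvg.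
 - rewrite nrm_real normrM; have b0 := ballf_ge0 (0 : R3 R) r x.
  apply: ler_pM => //; apply: le_trans (dKr_le y c (eps_gt0 n) m0 i x) _.
  have := inv_pow_rad n 1 xy; rewrite !expr1 => h3; have h4 := inv_pow_rad n 2 xy.
  have i0 : 0 <= (dist x y)^-1 by pos.
  apply: lerD; last by apply: lewl => //; pos.
  have := lewl (nge0 (- m * c)) h3; have := mge0 (nge0 c) i0; lra.
apply: (ccvg_unique L1).
have -> : (fun n => cI (fun x => (Kr (eps n) y m c x * pd i phi x)%:C)) =
 (fun n => - cI (fun x => (dKr (eps n) y m c i x * phi x)%:C)).
 by fext => n; exact: (ibp_Kr y c (eps_gt0 n) m0 tphi i).
exact: ccvgN.
Qed.

Lemma enormZ (e : R) x : 0 <= e -> enorm (e *: x) = e * enorm x.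
move=> e0'; apply/eqP; rewrite -(eqrXn2 (n := 2)) ?mge0 ?enge0//; apply/eqP.
by rewrite exprMn !enorm_sqr /GRing.scale /= /GRing.scale /=; ring.
Qed.

Lemma cI_japan : cI (fun x : R3 R => (3 * japan x ^- 5)%:C) = nc%:C.
apply: ceqP => /=; last exact: (congr1 (fun z : R[i] => Im z) (cint0 mu)).
by rewrite RintE newtonE.
Qed.

(** Substituting $x=\epsilon x'+y$ turns $3\epsilon^2s^{-5}dx$ into $3\langle x'\rangle^{-5}dx'$,
    whose mass is [nc] by definition. *)
Lemma delta_limit : ccvg (fun n => cI (fun x => (3 * eps n ^+ 2 *
  (g0 (rad (eps n) y x) / rad (eps n) y x ^+ 5) * phi x)%:C)) (nc * Re c * phi y)%:C.
have [B [r [B0 r0 h0 h1 h2]]] := test_bound tphi; have mphi := testf_mR tphi.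
pose F n x : R := 3 * japan x ^- 5 * (g0 (eps n * japan x) * phi (eps n *: x + y)).
have mj := @mR_japan; have j0 := @japan_gt0.
have j5 x : 0 <= 3 * japan x ^- 5 by pos.
have ra n x : rad (eps n) y (eps n *: x + y) = eps n * japan x.
 have en := ltW (eps_gt0 n).
 rewrite /rad addrK enormZ// /japan -{3}(ger0_norm en) -sqrtr_sqr -sqrtrM ?sqr_ge0//.
 by congr Num.sqrt; ring.
have mF n : mCX (fun x => (F n x)%:C).
 have [h _] : mCX (fun x => c * cexp m (eps n * japan x)).
  by apply: mC_M; [meas|apply: mC_cexp; apply: mR_M; [meas|exact: mj]].
 apply: mC_real; rewrite /F; apply: mR_M; first by meas.
 apply: mR_M; first exact: h.
 apply: (mR_c mphi (h := fun x : X => eps n *: (x : R3 R) + y)).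
 by apply: m3_D; [apply: m3_Z; exact: m3_id|exact: m3_cst].
have FB n x : nrm (F n x)%:C <= nrm c * B * (3 * japan x ^- 5).
 rewrite nrm_real normrM ger0_norm// mulrC; apply: lewr => //.
 rewrite normrM; apply: ler_pM => //; first by apply: gam_le => //; rewrite mge0 ?ltW ?eps_gt0.
 by apply: le_trans (h0 _) _; rewrite -[leRHS]mulr1; apply: lewl => //; rewrite /ballf; case: ifP.
have mg : mRX (fun x => nrm c * B * (3 * japan x ^- 5)) by meas.
have fing : (\I_x (nrm c * B * (3 * japan x ^- 5)) < +oo)%E.
 rewrite n3Z ?mge0 ?nge0//; last by meas.
 by rewrite newtonE -EFinM ltry.
have e1 n : cI (fun x => (3 * eps n ^+ 2 * (g0 (rad (eps n) y x) / rad (eps n) y x ^+ 5) * phi x)%:C) =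
  cI (fun x => (F n x)%:C).
 have en := eps_gt0 n; have h := mR_gam (eps n) y m c; have hr := mR_rad (eps n) y.
 rewrite (cI_affine y en); last by meas; meas.
 rewrite (eq_cI (f2 := fun x => (eps n ^- 3)%:C * (F n x)%:C)); last first.
  move=> x; rewrite -rmorphM /= ra /F; congr (_%:C); field.
  by rewrite (gt_eqF en) (gt_eqF (j0 x)).
 rewrite cI_Z; last by apply: (cL1_le (mF n) mg (FB n) fing).
 by rewrite mulrA -rmorphM /= mulfV ?mul1r// expf_neq0// gt_eqF.
rewrite (_ : (fun n => _) = fun n => cI (fun x => (F n x)%:C)); last by fext => n; exact: e1.
have -> : (nc * Re c * phi y)%:C = cI (fun x => (3 * japan x ^- 5 * (Re c * phi y))%:C).
 rewrite (eq_cI (f2 := fun x => (Re c * phi y)%:C * (3 * japan x ^- 5)%:C)); last first.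
  by move=> x; rewrite -rmorphM /= mulrC.
 rewrite cI_Z ?cI_japan -?rmorphM /=; first by congr (_%:C); ring.
 apply: (cL1_le (g := fun x => 3 * japan x ^- 5)).
 - meas; meas.
 - by meas.
 - by move=> x; rewrite nrm_real ger0_norm.
 - by rewrite newtonE ltry.
apply: (cI_dct mF _ mg fing FB) => x; apply: ccvg_real; apply: cvgMr; apply: cvgM.
 have -> : Re c = g0 0 by rewrite /gam cexp0 mulr1.
 apply: gam_cvg; rewrite -(mul0r (japan x)); apply: cvgMl; exact: eps_cvg.
have [/(_ [::])[/= cphi _] _] := tphi.
apply: (continuous_ccvg cphi).
have -> : (fun n => enorm (eps n *: x + y - y)) = fun n => eps n * enorm x.
 by fext => n; rewrite addrK enormZ// ltW// eps_gt0.
by rewrite -(mul0r (enorm x)); apply: cvgMl; exact: eps_cvg.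
Qed.

(** At each scale both derivatives are moved onto the regularised kernel. As $\epsilon\le s$, its
    terms in $\epsilon^2s^{-3}$ and $\epsilon^2s^{-4}$ are dominated and tend to 0; the one in
    $\epsilon^2s^{-5}$ leaves the value at y. *)
Lemma real_newton_laplacian :
 \sum_(i < 3) cI (fun x => (g0 (dist x y) / dist x y ^+ 1 * pd i (pd i phi) x)%:C) =
 cI (fun x => (g2 (dist x y) / dist x y ^+ 1 * phi x)%:C) - (nc * Re c * phi y)%:C.
have [B [r [B0 r0 h0 h1 h2]]] := test_bound tphi.
have mphi := testf_mR tphi.
have mdphi i := testf_mR (tpd i (tpd i tphi)).
have [mg g0' gfin] := near_dom (nge0 c) (ler0n R 0) B0 r0.
have md c' k := mR_gam_dist c' k.
have mc0 (a : R[i]) : 0 <= nrm a := nge0 a.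
have L1 : ccvg (fun n => \sum_(i < 3) cI (fun x => (Kr (eps n) y m c x * pd i (pd i phi) x)%:C))
 (\sum_(i < 3) cI (fun x => (g0 (dist x y) / dist x y ^+ 1 * pd i (pd i phi) x)%:C)).
 apply: ccvg_sum => i; apply: (cI_dct_off (y := y) _ _ _ mg gfin g0') => [n||x xy|n x xy].
 - have h := mR_gam (eps n) y m c; have hr := mR_rad (eps n) y; have mdi := mdphi i.
  by apply: mC_real; rewrite /Kr; meas.
 - by apply: mC_real; apply: mR_M; [exact: (md c 1%N)|exact: mdphi].
 - apply: ccvg_real; apply: cvgMl; have := @gam_rad_cvg c 1 x xy; rewrite expr1.
  by under eq_fun do rewrite expr1.
 - rewrite nrm_real normrM; have b0 := ballf_ge0 (0 : R3 R) r x.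
  apply: ler_pM => //; apply: le_trans (Kr_le y c (eps_gt0 n) m0 x) _.
  rewrite mul0r addr0; apply: lewl => //.
  by have := inv_pow_rad n 1 xy; rewrite !expr1.
apply: (ccvg_unique L1).
pose P n x : R := (g2 (rad (eps n) y x) / rad (eps n) y x - eps n ^+ 2 * (g2 (rad (eps n) y x) / rad (eps n) y x ^+ 3) +
 3 * eps n ^+ 2 * (g1 (rad (eps n) y x) / rad (eps n) y x ^+ 4)) * phi x.
have mgr n c' : mRX (fun x => gam c' m (rad (eps n) y x)) := mR_gam (eps n) y m c'.
have mP n : mRX (P n).
 have a1 := mgr n (- m * c); have a2 := mgr n (- m * (- m * c)); have hr := mR_rad (eps n) y.
 by rewrite /P; meas.
pose M1 := 2 * nrm (- m * (- m * c)); pose M2 := 3 * nrm (- m * c).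
have M10 : 0 <= M1 by rewrite mge0.
have M20 : 0 <= M2 by rewrite mge0.
have [mg2 g20 g2fin] := near_dom M10 M20 B0 r0.
have PB n x : x <> y -> nrm (P n x)%:C <=
  (M1 * (dist x y)^-1 + M2 * dist x y ^- 2) * (B * ballf 0 r x).
 move=> xy; rewrite nrm_real normrM; apply: ler_pM => //.
 have sp := rad_gt0 y (eps_gt0 n) x; have se := (rad_ge y (eps_gt0 n) x).2; have en := eps_gt0 n.
 set s := rad (eps n) y x in sp se *.
 have p1 := inv_pow_rad n 1 xy; have p2 := inv_pow_rad n 2 xy; rewrite !expr1 -/s in p1 p2.
 have q2 : eps n ^+ 2 * s ^- 2 <= 1.
  by rewrite -exprVn -exprMn exprn_ile1 ?mge0 ?invr_ge0 ?(ltW sp) ?(ltW en)// ler_pdivrMr// mul1r.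
 have a2 : `|g2 s| <= nrm (- m * (- m * c)) := gam_le _ m0 (ltW sp).
 have a1 : `|g1 s| <= nrm (- m * c) := gam_le _ m0 (ltW sp).
 have s1 : 0 <= s^-1 by pos.
 have s2 k : 0 <= s ^- k by pos.
 have e2 : 0 <= eps n ^+ 2 by rewrite sqr_ge0.
 have t1 : `|g2 s / s| <= nrm (- m * (- m * c)) * (dist x y)^-1.
  by rewrite normrM (ger0_norm s1); apply: ler_pM.
 have t2 : `|eps n ^+ 2 * (g2 s / s ^+ 3)| <= nrm (- m * (- m * c)) * (dist x y)^-1.
  rewrite normrM (ger0_norm e2) normrM (ger0_norm (s2 3%N)) mulrCA; apply: ler_pM => //; first pos.
  apply: le_trans p1; rewrite (_ : _ * _ = eps n ^+ 2 * s ^- 2 * s^-1); last by field; rewrite gt_eqF.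
  by rewrite ler_piMl.
 have t3 : `|3 * eps n ^+ 2 * (g1 s / s ^+ 4)| <= M2 * dist x y ^- 2.
  rewrite normrM (ger0_norm (mge0 (ler0n R 3) e2)) normrM (ger0_norm (s2 4%N)).
  rewrite (_ : _ * _ = 3 * `|g1 s| * (eps n ^+ 2 * s ^- 2 * s ^- 2)); last by field; rewrite gt_eqF.
  apply: (ler_pM (mge0 (ler0n _ 3) (normr_ge0 _)) (mge0 (mge0 e2 (s2 2%N)) (s2 2%N)) (lewl (ler0n _ 3) a1)).
  by apply: le_trans p2; rewrite ler_piMl.
 apply: le_trans (ler_normD _ _) _; apply: lerD => //; apply: le_trans (ler_normB _ _) _.
 by rewrite /M1 mulrDl mul1r mulrDl; apply: lerD.
have LP : ccvg (fun n => cI (fun x => (P n x)%:C)) (cI (fun x => (g2 (dist x y) / dist x y ^+ 1 * phi x)%:C)).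
 apply: (cI_dct_off (y := y) _ _ _ mg2 g2fin g20) => [n||x xy|n x xy].
 - by apply: mC_real; exact: mP.
 - by apply: mC_real; apply: mR_M; [exact: (md _ 1%N)|exact: mphi].
 - apply: ccvg_real; apply: cvgMl.
  have z2 : (fun n => eps n ^+ 2) @ \oo --> (0 : R).
   rewrite -(mul0r (0 : R)); under eq_fun do rewrite expr2.
   by apply: cvgM; exact: eps_cvg.
  have c1 := @gam_rad_cvg (- m * (- m * c)) 1 x xy.
  have c3 := @gam_rad_cvg (- m * (- m * c)) 3 x xy; have c4 := @gam_rad_cvg (- m * c) 4 x xy.
  have z3 : (fun n => 3 * eps n ^+ 2) @ \oo --> (0 : R) by rewrite -(mulr0 (3 : R)); apply: cvgMr.
  rewrite [X in _ --> X](_ : _ = g2 (dist x y) / dist x y ^+ 1 -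
   0 * (g2 (dist x y) / dist x y ^+ 3) + 0 * (g1 (dist x y) / dist x y ^+ 4)); last first.
   by rewrite !mul0r subr0 addr0.
  apply: cvgD; last by apply: cvgM.
  by apply: cvgB; [exact: c1|apply: cvgM].
 - exact: PB.
have := ccvgB LP delta_limit.
have -> // : (fun n => cI (fun x => (P n x)%:C) - cI (fun x => (3 * eps n ^+ 2 *
  (g0 (rad (eps n) y x) / rad (eps n) y x ^+ 5) * phi x)%:C)) =
 (fun n => \sum_(i < 3) cI (fun x => (Kr (eps n) y m c x * pd i (pd i phi) x)%:C)).
fext => n; have en := eps_gt0 n.
have sp x := rad_gt0 y en x; have se x := (rad_ge y en x).2.
have mb := mR_ballf 0 r.
have finB (M : R) : 0 <= M -> (\I_x (M * (B * ballf 0 r x)) < +oo)%E.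
 move=> M0; rewrite (eq_n3 (g2 := fun x => M * B * ballf 0 r x)); last by move=> x; rewrite mulrA.
 rewrite n3Z ?mge0//; last by move=> x; pos.
 rewrite ltyM ?lee_fin ?mge0//; apply: lelt (nnballf _ (ltW r0)) _; exact: ltry.
have intb (f : RF) (M : R) : mRX f -> 0 <= M -> (forall x, `|f x| <= M) -> cL1 (fun x => (f x * phi x)%:C).
 move=> mf M0 fM; apply: (cL1_le (g := fun x => M * (B * ballf 0 r x))).
 - meas; meas.
 - by meas.
 - by move=> x; rewrite nrm_real normrM; apply: ler_pM.
 - exact: finB.
have ea i : cI (fun x => (Kr (eps n) y m c x * pd i (pd i phi) x)%:C) =
  cI (fun x => (ddKr (eps n) y m c i x * phi x)%:C).
 rewrite (ibp_Kr y c en m0 (tpd i tphi) i).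
 by rewrite (ibp_dKr y c en m0 tphi i) opprK.
rewrite (eq_bigr _ (fun i _ => ea i)).
have mgc := mgr n c; have hr := mR_rad (eps n) y; have mk := mR_k1 (eps n) y m c; have mdk := mR_dk1 (eps n) y m c.
have q k x : rad (eps n) y x ^- k <= eps n ^- k := inv_rad_le y en x k.
have q0 k : 0 <= eps n ^- k by pos.
rewrite -cI_sum; last first.
 move=> i; have mcr := mR_crdy y i.
 pose M : R := nrm (- m * (- m * c)) / eps n ^+ 1 + 4 * nrm (- m * c) / eps n ^+ 2 + 4 * nrm c / eps n ^+ 3.
 apply: (intb _ M).
 - by rewrite /ddKr /mRX; meas.
 - by rewrite /M !addr_ge0// mge0// mge0.
 - move=> x; apply: le_trans (ddKr_le y c en m0 i x) _; rewrite /M.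
  apply: lerD; first apply: lerD; apply: lewl; rewrite ?mge0//.
  by have := q 1%N x; rewrite !expr1.
have absd (f g : RF) (k : nat) : (forall x, `|f x| <= g x) -> forall x, `|f x / rad (eps n) y x ^+ k| <= g x / eps n ^+ k.
 move=> fg x; rewrite normrM (ger0_norm (_ : 0 <= _ ^- _)) ?invr_ge0 ?exprn_ge0 ?(ltW (sp x))//.
 by apply: ler_pM => //; pos.
have ga c' x : `|gam c' m (rad (eps n) y x)| <= nrm c' := gam_le c' m0 (ltW (sp x)).
have e2 : 0 <= eps n ^+ 2 by rewrite sqr_ge0.
have e32 : 0 <= 3 * eps n ^+ 2 by pos.
have mgr1 := mgr n (- m * c); have mgr2 := mgr n (- m * (- m * c)).
have z (a : R[i]) k : 0 <= nrm a / eps n ^+ k by pos.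
have LPn : cL1 (fun x => (P n x)%:C).
 pose M : R := nrm (- m * (- m * c)) / eps n ^+ 1 + eps n ^+ 2 * (nrm (- m * (- m * c)) / eps n ^+ 3) +
  3 * eps n ^+ 2 * (nrm (- m * c) / eps n ^+ 4).
 apply: (intb _ M).
 - by rewrite /mRX; meas.
 - by rewrite /M !addr_ge0// mge0.
 - move=> x; apply: le_trans (ler_normD _ _) _; apply: lerD.
   apply: le_trans (ler_normB _ _) _; apply: lerD; first exact: (absd _ (fun=> _) 1%N (ga _)).
   by rewrite normrM (ger0_norm e2); apply: lewl => //; exact: (absd _ (fun=> _) 3%N (ga _)).
  by rewrite normrM (ger0_norm e32); apply: lewl => //; exact: (absd _ (fun=> _) 4%N (ga _)).
rewrite -cI_B//.
 by apply: eq_cI => x; rewrite -rmorphB -rmorph_sum /= -mulr_suml (sum_ddKr y m c en) /P -mulrBl.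
apply: (intb _ (3 * eps n ^+ 2 * (nrm c / eps n ^+ 5))).
- by rewrite /mRX; meas.
- pos.
- by move=> x; rewrite normrM (ger0_norm e32); apply: lewl => //; exact: (absd _ (fun=> _) 5%N (ga _)).
Qed.

End Limit.

Definition dRk i m x y : R[i] := (nc^-1 * crd i (x - y))%:C *
 ((- m * (dist x y ^- 2)%:C - (dist x y ^- 3)%:C) * cexp m (dist x y)).

Lemma mC2_dRk i m : mC2 (dRk i m).
rewrite /mC2 /dRk; apply: mC_M; first by apply: mC_real; apply: mR_M; [meas|apply: mR_crd; mproj].
by apply: mC_M; [meas|apply: mC_cexp; meas].
Qed.

Lemma dRk_le i m x y : 0 <= Re m -> nrm (dRk i m x y) <=
 nc^-1 * (nrm m * (dist x y)^-1 + dist x y ^- 2) * expR (- (Re m * dist x y)).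
move=> m0; have r0 := enge0 (x - y); rewrite /dRk 2!nrmM nrm_cexp mulrA; apply: lewr.
 exact: expR_ge0.
rewrite nrm_real normrM (ger0_norm nci_ge0) -mulrA; apply: lewl; first pos.
have [e0|/eqP e0] := eqVneq (dist x y) 0.
 by rewrite e0 !expr0n /= !invr0 mulr0 subr0 nrm0 !mulr0 addr0.
have rp : 0 < dist x y by rewrite lt_def r0 andbT; apply/eqP.
apply: (via (dist x y * (nrm m * dist x y ^- 2 + dist x y ^- 3))).
 apply: ler_pM => //; [pos|exact: crd_le|].
 apply: le_trans (nrmB _ _) _; apply: lerD.
  by rewrite nrmM nrmN nrm_real ger0_norm ?invr_ge0 ?exprn_ge0.
 by rewrite nrm_real ger0_norm ?invr_ge0 ?exprn_ge0.
by apply: eqle; field; rewrite gt_eqF.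
Qed.

Lemma kernel_test_int m y phi (k : CF) (M1 M2 : R) : mCX k -> mRX phi -> 0 <= M1 -> 0 <= M2 ->
 (forall x, nrm (k x) <= M1 * (dist x y)^-1 + M2 * dist x y ^- 2) ->
 (exists B r : R, [/\ 0 <= B, 0 < r & forall x, `|phi x| <= B * ballf 0 r x]) ->
 cL1 (fun x => k x * (phi x)%:C).
move=> mk mphi M10 M20 hk [B [r [B0 r0 h0]]].
have [mg g0 gfin] := near_dom y M10 M20 B0 r0.
apply: (cL1_le _ mg _ gfin); first by meas.
by move=> x; rewrite nrmM nrm_real; apply: ler_pM => //; pos.
Qed.

Lemma cI_ReZ (c : R[i]) (f : CF) : cL1 f -> cI (fun x => (Re (c * f x))%:C) = (Re (c * cI f))%:C.
by move=> h; rewrite (cI_Re (fun x => c * f x)) cI_Z. Qed.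

Lemma complex_ReP (a b : R[i]) : (forall c, Re (c * a) = Re (c * b)) -> a = b.
move=> h; apply: ceqP; first by have := h 1; rewrite !mul1r.
by have := h (0 -i* 1); rewrite !ReM /= !mul0r !sub0r !mulN1r !opprK.
Qed.

Lemma test_near phi : testf phi -> exists B r : R, [/\ 0 <= B, 0 < r & forall x, `|phi x| <= B * ballf 0 r x].
by move=> /test_bound[B [r [B0 r0 h _ _]]]; exists B, r. Qed.

Lemma Rk_test_int m y phi : 0 <= Re m -> testf phi -> cL1 (fun x => Rk m x y * (phi x)%:C).
move=> m0 tphi; apply: (kernel_test_int m (M1 := nc^-1) (M2 := 0) (y := y)) => //.
- exact: (mC2_l y (mC2_Rk m)).
- exact: testf_mR.
- pos.
- by move=> x; rewrite mul0r addr0; exact: Rk_le.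
- exact: test_near.
Qed.

Lemma dRk_le2 i m x y : 0 <= Re m -> nrm (dRk i m x y) <=
 nc^-1 * nrm m * (dist x y)^-1 + nc^-1 * dist x y ^- 2.
move=> m0; apply: le_trans (dRk_le i x y m0) _; rewrite [leRHS](_ : _ = nc^-1 * (nrm m * (dist x y)^-1 + dist x y ^- 2) * 1); last by ring.
apply: ler_pM => //.
- pos.
- by rewrite -expR0 ler_expR oppr_le0 mge0 ?enge0.
Qed.

Lemma dRk_test_int i m y phi : 0 <= Re m -> testf phi -> cL1 (fun x => dRk i m x y * (phi x)%:C).
move=> m0 tphi; apply: (kernel_test_int m (M1 := nc^-1 * nrm m) (M2 := nc^-1) (y := y)) => //.
- exact: (mC2_l y (mC2_dRk i m)).
- exact: testf_mR.
- pos.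
- pos.
- by move=> x; exact: dRk_le2.
- exact: test_near.
Qed.

Lemma Rk_partial i m y phi : 0 <= Re m -> testf phi ->
 cI (fun x => Rk m x y * (pd i phi x)%:C) = - cI (fun x => dRk i m x y * (phi x)%:C).
move=> m0 tphi; have i1 := Rk_test_int y m0 (tpd i tphi); have i2 := dRk_test_int i y m0 tphi.
apply: complex_ReP => c; apply: (@complexI R); rewrite -cI_ReZ// mulrN ReN rmorphN /= -cI_ReZ//.
have := real_newton_partial (nc^-1%:C * c) y m0 tphi i.
rewrite (eq_cI (f2 := fun x => (Re (c * (Rk m x y * (pd i phi x)%:C)))%:C)); last first.
 by move=> x; congr (_%:C); rewrite /gam /Rk invfM expr1 !ReImE /=; ring.
move=> ->; congr (- _); apply: eq_cI => x; congr (_%:C); rewrite /gam /dRk.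
by move: (cexp m _) (enorm _ ^- 2) (enorm _ ^- 3) => z a b; rewrite !ReImE /=; ring.
Qed.

(** The weak form of $(-\Delta+m^2)R_0(\cdot,y)=\delta_y$. Only local integrability of the kernel
    enters, so the boundary case [Re m = 0] is included. *)
Lemma Rk_laplacian m y phi : 0 <= Re m -> testf phi ->
 cI (fun x => Rk m x y * (lap phi x)%:C) = m ^+ 2 * cI (fun x => Rk m x y * (phi x)%:C) - (phi y)%:C.
move=> m0 tphi; have i1 i := Rk_test_int y m0 (tpd i (tpd i tphi)).
have i2 := Rk_test_int y m0 tphi.
have -> : cI (fun x => Rk m x y * (lap phi x)%:C) = \sum_(i < 3) cI (fun x => Rk m x y * (pd i (pd i phi) x)%:C).
 rewrite -cI_sum//; apply: eq_cI => x; rewrite /lap rmorph_sum mulr_sumr.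
 by apply: eq_bigr.
apply: complex_ReP => c; apply: (@complexI R).
have -> : (Re (c * \sum_(i < 3) cI (fun x => Rk m x y * (pd i (pd i phi) x)%:C)))%:C =
 \sum_(i < 3) cI (fun x => (Re (c * (Rk m x y * (pd i (pd i phi) x)%:C)))%:C).
 rewrite mulr_sumr (raddf_sum (@complex.Re R)) rmorph_sum /=; apply: eq_bigr => i _.
 by rewrite -cI_ReZ.
have := real_newton_laplacian (nc^-1%:C * c) y m0 tphi.
rewrite (eq_bigr (fun i => cI (fun x => (Re (c * (Rk m x y * (pd i (pd i phi) x)%:C)))%:C))); last first.
 move=> i _; apply: eq_cI => x; congr (_%:C); rewrite /gam /Rk invfM expr1.
 by move: (cexp m _) (enorm _)^-1 => z a; rewrite !ReImE /=; ring.
move=> ->; set I := cI (fun x => Rk m x y * (phi x)%:C).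
have -> : (Re (c * (m ^+ 2 * I - (phi y)%:C)))%:C = (Re (c * m ^+ 2 * I))%:C - (Re (c * (phi y)%:C))%:C.
 by rewrite mulrBr mulrA ReD ReN rmorphB.
rewrite /I -(cI_ReZ (c * m ^+ 2) i2); congr (_ - _).
 apply: eq_cI => x; congr (_%:C); rewrite /gam /Rk invfM expr1.
 by move: (cexp m _) (enorm _)^-1 => z a; rewrite !expr2 !ReImE /=; ring.
congr (_%:C); rewrite !ReImE /=; field.
by rewrite gt_eqF// newton_gt0.
Qed.

End FreeResolvent.

(** * Smooth bump functions *)

Section Smooth.
Implicit Types (x y : R3 R) (f g phi : RF) (i j : 'I_3).

(** Recursion on the order of differentiability lets the sum and product rules be proved by
    induction, which the formulation by lists of indices does not. *)
Fixpoint Ck k phi : Prop := continuous phi /\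
 if k is k'.+1 then forall i, (forall x, derivable phi x (e_ i)) /\ Ck k' (pd i phi) else True.

Lemma smoothP phi : (forall k, Ck k phi) -> smooth phi.
move=> h s; elim/last_ind: s phi h => [|s i ih] phi h.
 by split => [|i x]; [have [] := h 0%N|have [_ /(_ i)[]] := h 1%N].
by rewrite foldr_rcons; apply: ih => k; have [_ /(_ i)[]] := h k.+1.
Qed.

Lemma Ck_intro k phi (dphi : 'I_3 -> RF) : continuous phi ->
 (forall i x, is_derive x (e_ i) phi (dphi i x)) -> (forall i, Ck k (dphi i)) -> Ck k.+1 phi.
move=> c d h; split => // i; split; first by move=> x; case: (d i x).
have -> // : pd i phi = dphi i.
by fext => x; rewrite /pd; case: (d i x).
Qed.

Lemma smooth_Ck phi : smooth phi -> forall k, Ck k phi.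
move=> + k; elim: k phi => [|k ih] phi h; first by split; [have [] := h [::]|].
apply: (Ck_intro (dphi := fun i => pd i phi)); first by have [] := h [::].
 by move=> i x; exact: partial_derive.
by move=> i; apply: ih; exact: smooth_partial.
Qed.

Lemma Ck_continuous k phi : Ck k phi -> continuous phi.
by case: k => [|k] []. Qed.

Lemma Ck_derive k phi i x : Ck k.+1 phi -> is_derive x (e_ i) phi (pd i phi x).
by move=> [_ /(_ i)[/(_ x) d _]]; split. Qed.

Lemma CkS k phi : Ck k.+1 phi -> Ck k phi.
elim: k phi => [|k ih] phi h; first by split; [exact: Ck_continuous h|].
apply: (Ck_intro (dphi := fun i => pd i phi)); first exact: Ck_continuous h.
 by move=> i x; exact: Ck_derive h.
by move=> i; apply: ih; case: h => _ /(_ i)[].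
Qed.

Lemma Ck_cst k (c : R) : Ck k (fun=> c).
elim: k c => [|k ih] c; first by split => //; move=> x; exact: cvg_cst.
apply: (Ck_intro (dphi := fun=> fun=> 0)); last by move=> i; exact: (ih 0).
 by move=> x; exact: cvg_cst.
Qed.

Lemma CkD k f g : Ck k f -> Ck k g -> Ck k (fun x => f x + g x).
elim: k f g => [|k ih] f g hf hg.
 by split => // x; apply: cvgD; [exact: (Ck_continuous hf)|exact: (Ck_continuous hg)].
apply: (Ck_intro (dphi := fun i x => pd i f x + pd i g x)).
- by move=> x; apply: cvgD; [exact: (Ck_continuous hf)|exact: (Ck_continuous hg)].
- by move=> i x; exact: (is_deriveD (Ck_derive i x hf) (Ck_derive i x hg)).
- by move=> i; apply: ih; [case: hf => _ /(_ i)[]|case: hg => _ /(_ i)[]].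
Qed.

Lemma CkM k f g : Ck k f -> Ck k g -> Ck k (fun x => f x * g x).
elim: k f g => [|k ih] f g hf hg.
 by split => // x; apply: cvgM; [exact: (Ck_continuous hf)|exact: (Ck_continuous hg)].
apply: (Ck_intro (dphi := fun i x => f x * pd i g x + g x * pd i f x)).
- by move=> x; apply: cvgM; [exact: (Ck_continuous hf)|exact: (Ck_continuous hg)].
- by move=> i x; exact: (is_deriveM (Ck_derive i x hf) (Ck_derive i x hg)).
- move=> i; apply: CkD; apply: ih; try exact: CkS.
  by case: hg => _ /(_ i)[].
 by case: hf => _ /(_ i)[].
Qed.

(** The family $t^{-n}e^{-1/t}$ is closed under differentiation: index n leads to indices n+2 and
    n+1. *)
Definition flat n (t : R) : R := if 0 < t then t ^- n * expR (- t^-1) else 0.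

Lemma flat_ge0 n t : 0 <= flat n t.
by rewrite /flat; case: ifP => // t0; rewrite mge0 ?expR_ge0// invr_ge0 exprn_ge0// ltW. Qed.

(** $e^{1/t}=(e^{1/((n+1)t)})^{n+1}\ge((n+1)t)^{-(n+1)}$. A bound linear in t is what the derivative
    at 0 needs, applied to index n+1. *)
Lemma flat_le n t : flat n t <= n.+1%:R ^+ n.+1 * `|t|.
rewrite /flat; case: ifPn => [t0|_]; last pos.
rewrite (ger0_norm (ltW t0)) ler_pdivrMl ?exprn_gt0// mulrCA -exprSr -exprMn expRN.
have y0 : 0 < n.+1%:R * t by pos.
rewrite -[X in _ <= X]invrK lef_pV2 ?posrE ?expR_gt0 ?invr_gt0 ?exprn_gt0//.
have -> : t^-1 = (n.+1%:R * t)^-1 *+ n.+1.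
 have n0 : n.+1%:R != 0 :> R by rewrite pnatr_eq0.
 by rewrite -[RHS]mulr_natl invfM mulrA mulfV// mul1r.
rewrite -[X in expR X]mulr_natl expRM_natl -exprVn; apply: lerXn2r; rewrite ?nnegrE ?expR_ge0 ?invr_ge0 ?(ltW y0)//.
by have := expR_ge1Dx (n.+1%:R * t)^-1; apply: le_trans; rewrite lerDr.
Qed.

Lemma is_derive_flat n (t : R) : is_derive t 1 (flat n) (flat n.+2 t - n%:R * flat n.+1 t).
have [t0|] := ltP 0 t; last rewrite le_eqVlt => /orP[/eqP->|t0].
- have tn : t != 0 by rewrite gt_eqF.
 have e : \near t, (t ^- n * expR (- t^-1)) = flat n t.
  by near=> s; rewrite /flat ifT//; near: s; exact: lt_nbhsr.
 have d1 : is_derive t 1 (fun t : R => t^-1) (- t ^- 2).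
  have := @is_deriveV R id t _ 1 tn (is_derive_id t 1) => h; apply: (is_derive_eq h).
  by rewrite /GRing.scale /= mulr1.
 have d2 := is_deriveN d1.
 have d3 := @is_derive1_comp _ expR (fun t : R => - t^-1) t _ _ (is_derive_expR (- t^-1)) d2.
 have d4 : is_derive t 1 (fun t : R => t ^- n) (- (n%:R * t ^- n.+1)).
  case: n {e} => [|n].
   have -> : (fun t : R => t ^- 0) = cst 1 by fext => s; rewrite expr0 invr1.
   by apply: (is_derive_eq (is_derive_cst _ _ _)); rewrite mul0r oppr0.
  by apply: (is_derive_eq (der_inv n tn)); rewrite mulNr.
 apply: (near_eq_is_derive e).
 apply: (is_derive_eq (is_deriveM d4 d3)); rewrite /flat t0 /GRing.scale /= !exprS.
 by field; rewrite tn expf_neq0.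
- rewrite {2 3}/flat ltxx mulr0 subr0.
 have q : (fun h : R => h^-1 *: ((flat n \o shift 0) (h *: 1) - flat n 0)) @ 0^' --> (0 : R).
  apply/cvgrPdist_lt => e e0.
  have C0 : 0 < n.+2%:R ^+ n.+2 :> R by rewrite exprn_gt0.
  near=> h; rewrite sub0r normrN /= [h *: 1]mulr1 addr0 {2}/flat ltxx subr0.
  have h0 : h != 0 by near: h; exact: nbhs_dnbhs_neq.
  apply: (vialt (n.+2%:R ^+ n.+2 * `|h|)).
   rewrite /GRing.scale /= {1}/flat; case: ifPn => [hp|_]; last by rewrite mulr0 normr0 mge0// ltW.
   have := flat_le n.+1 h; rewrite /flat hp (ger0_norm (ltW hp)) ger0_norm; last first.
    by rewrite mge0 ?invr_ge0 ?(ltW hp)//; apply: mge0 (expR_ge0 _); pos.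
   by rewrite mulrA -invfM -exprS.
  rewrite -ltr_pdivlMl// mulrC; near: h; apply: dnbhs0_lt; pos.
 by split; [apply/cvg_ex; exists 0|exact: cvg_lim q].
- have e : \near t, cst 0 t = flat n t.
  by near=> s; rewrite /flat ifF//; apply/negbTE; rewrite -leNgt ltW//; near: s; exact: lt_nbhsl.
 apply: (near_eq_is_derive e).
 have f0 k : flat k t = 0 by rewrite /flat ifF// ltNge (ltW t0).
 by apply: (is_derive_eq (is_derive_cst _ _ _)); rewrite !f0 mulr0 subr0.
Unshelve. all: by end_near.
Qed.

Lemma crd_line2 i j (t : R) x : crd i (t *: e_ j + x) = t * (i == j)%:R + crd i x.
rewrite -val_eqE /= /crd /unit_vec; case: (ord3 i) => ->; case: (ord3 j) => -> /=.
all: by rewrite /GRing.scale /=.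
Qed.

Lemma continuous_crd i : continuous (crd i : RF).
move=> x; apply: seq_continuous => u hu; apply/cvgrPdist_lt => e e0.
move/cvgrPdist_lt : hu => /(_ e e0); apply: filterS => n.
rewrite sub0r normrN ger0_norm ?enge0//; apply: lelt; rewrite distrC.
by have := crd_le i (u n - x); rewrite /crd; case: ifP => // _; case: ifP.
Qed.

Lemma Ck_flat k n i (a b : R) : Ck k (fun x => flat n (a * crd i x + b)).
have c m : continuous (fun x => flat m (a * crd i x + b)).
 move=> x; apply: (continuous_comp (f := fun x => a * crd i x + b) (g := flat m)).
  by apply: cvgD; [apply: cvgMr; exact: continuous_crd|exact: cvg_cst].
 apply: differentiable_continuous; apply/derivable1_diffP.
 by case: (is_derive_flat m (a * crd i x + b)).
elim: k n => [|k ih] n; first by split.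
apply: (Ck_intro (dphi := fun j x => (a * (i == j)%:R) * (flat n.+2 (a * crd i x + b) + - n%:R * flat n.+1 (a * crd i x + b)))).
- exact: c.
- move=> j x; apply/is_derive_line.
 have -> : line (fun x => flat n (a * crd i x + b)) j x =
  flat n \o ((fun t => (a * (i == j)%:R) * t) + cst (a * crd i x + b)).
  by fext => t; rewrite /line /= !fctE crd_line2; congr flat; ring.
 have d1 : is_derive (0 : R) 1 (fun t => (a * (i == j)%:R) * t) (a * (i == j)%:R).
  rewrite (_ : (fun s => _ * s) = (a * (i == j)%:R) *: id)//.
  have h := is_deriveZ (a * (i == j)%:R) (is_derive_id (0 : R) (1 : R)).
  by apply: (is_derive_eq h); exact: mulr1.
 have d2 := is_deriveD d1 (is_derive_cst (a * crd i x + b) (0 : R) (1 : R)).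
 have := is_derive1_comp (is_derive_flat n _) d2; rewrite !fctE mulr0 add0r addr0 => h.
 by apply: (is_derive_eq h); rewrite mulrC mulNr.
- by move=> j; apply: CkM; [exact: Ck_cst|apply: CkD => //; apply: CkM => //; exact: Ck_cst].
Qed.

(* positive exactly on the open box with corners [a] and [b]; tends to its indicator as [n] grows *)
Definition bump (n : R) (a b : 'I_3 -> R) x : R :=
 \prod_(i < 3) (flat 0 (n * crd i x + - n * a i) * flat 0 (- n * crd i x + n * b i)).

Lemma bump_supp (n : R) a b x : 0 < n -> \sum_i (`|a i| + `|b i|) < enorm x -> bump n a b x = 0.
move=> n0; apply: contraPP => nz.
have {}nz i : a i < crd i x < b i.
 have : flat 0 (n * crd i x + - n * a i) * flat 0 (- n * crd i x + n * b i) != 0.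
  by apply/eqP => h; apply: nz; rewrite /bump (bigD1 i)//= h mul0r.
 rewrite mulf_eq0 negb_or /flat => /andP[].
 case: ifPn => [h1 _|_ /eqP]//; case: ifPn => [h2 _|_ /eqP]//.
 by apply/andP; split; rewrite -(ltr_pM2l n0); lra.
apply/negP; rewrite -leNgt.
have := enorm_le_coord x; move/le_trans; apply.
rewrite !big_ord_recl big_ord0 addr0.
have h i : `|crd i x| <= `|a i| + `|b i|.
 have /andP[h1 h2] := nz i; rewrite ler_norml; apply/andP; split.
  by have := ler_norm (- a i); rewrite normrN; have := normr_ge0 (b i); lra.
 by have := ler_norm (b i); have := normr_ge0 (a i); lra.
by rewrite addrA; apply: lerD; [apply: lerD|]; [exact: (h ord0)|exact: (h (lift ord0 ord0))|exact: (h (lift ord0 (lift ord0 ord0)))].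
Qed.

Lemma test_bump (n : R) a b : 0 < n -> testf (bump n a b).
move=> n0; split.
 apply: smoothP => k; rewrite /bump.
 have -> : (fun x => \prod_(i < 3) (flat 0 (n * crd i x + - n * a i) * flat 0 (- n * crd i x + n * b i))) =
  (fun x => (flat 0 (n * crd 0 x + - n * a 0) * flat 0 (- n * crd 0 x + n * b 0)) *
   ((flat 0 (n * crd 1 x + - n * a 1) * flat 0 (- n * crd 1 x + n * b 1)) *
   (flat 0 (n * crd (inord 2) x + - n * a (inord 2)) * flat 0 (- n * crd (inord 2) x + n * b (inord 2))))).
  fext => x; rewrite !big_ord_recl big_ord0 mulr1 /=.
  have -> : lift ord0 ord0 = 1 :> 'I_3 by exact/val_inj.
  by have -> : lift ord0 (lift ord0 ord0) = inord 2 :> 'I_3 by apply/val_inj; rewrite /= inordK.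
 by do ![apply: CkM]; exact: Ck_flat.
by exists (\sum_i (`|a i| + `|b i|)) => x; exact: bump_supp.
Qed.

Lemma flat0_le1 t : flat 0 t <= 1.
rewrite /flat; case: ifPn => // t0; rewrite expr0 invr1 mul1r -expR0 ler_expR oppr_le0.
pos.
Qed.

Lemma bump_bound n a b x : 0 <= bump n a b x <= 1.
apply/andP; split; first by apply: prodr_ge0 => i _; rewrite mge0 ?flat_ge0.
apply: prodr_ile1 => i _; rewrite mge0 ?flat_ge0//=.
by rewrite mulr_ile1 ?flat_ge0 ?flat0_le1.
Qed.

Lemma flat_cvg (t : R) : (fun k => flat 0 (k.+1%:R * t)) @ \oo --> ((0 < t)%R%:R : R).
have [t0|t0] := ltP 0 t; last first.
 have -> : (fun k => flat 0 (k.+1%:R * t)) = fun=> 0; last exact: cvg_cst.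
 by fext => k; rewrite /flat ifF// pmulr_rgt0// ltNge t0.
have -> : (fun k => flat 0 (k.+1%:R * t)) = fun k => expR (- (t^-1 * k.+1%:R^-1)).
 by fext => k; rewrite /flat pmulr_rgt0// t0 expr0 invr1 mul1r invfM mulrC.
have h : (fun k => - (t^-1 * k.+1%:R^-1)) @ \oo --> (0 : R).
 rewrite [X in _ --> X](_ : _ = - (t^-1 * 0)); last by rewrite mulr0 oppr0.
 by apply: cvgN; apply: cvgM; [exact: cvg_cst|exact: cvg_harmonic].
rewrite [X in _ --> X](_ : _ = expR 0); last by rewrite expR0.
by apply: (@cvg_comp _ _ _ _ expR _ _ _ h); exact: continuous_expR.
Qed.

Definition oitv (a b : R) : R -> R := \1_(`]a, b[%classic : set (mTR R)).

Lemma oitvE a b t : oitv a b t = (0 < t - a)%R%:R * (0 < b - t)%R%:R.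
by rewrite /oitv indicE mem_setE in_itv /= !subr_gt0 -natrM mulnb. Qed.

Lemma bump_cvg a b x : (fun k => bump k.+1%:R a b x) @ \oo --> (\prod_(i < 3) oitv (a i) (b i) (crd i x) : R).
apply: cvg_big => [|i _]; first exact: mul_continuous.
have e1 (k : nat) : k.+1%:R * crd i x + - k.+1%:R * a i = k.+1%:R * (crd i x - a i) by ring.
have e2 (k : nat) : - k.+1%:R * crd i x + k.+1%:R * b i = k.+1%:R * (b i - crd i x) by ring.
rewrite oitvE; under eq_fun do rewrite e1 e2.
by apply: cvgM; exact: flat_cvg.
Qed.

End Smooth.

(** * Fundamental lemma of the calculus of variations *)

Section Fundamental.
Let mu := @mu3 R.
Implicit Types (x y : R3 R) (v u : CF).

(** The sets on which the image under h of the complex measure v dx vanishes form a lambda-system.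
    The map h allows one coordinate to be treated at a time. *)
Lemma dynkin d (T : measurableType d) (G : set (set T)) (h : R3 R -> T) v :
 measurable_fun setT (h : measurable_R3 R -> T) -> @measurable _ T = <<s G >> -> setI_closed G ->
 cL1 v -> cI v = 0 -> (forall A, G A -> cI (fun x => (\1_A (h x) : R)%:C * v x) = 0) ->
 forall A, measurable A -> cI (fun x => (\1_A (h x) : R)%:C * v x) = 0.
move=> mh GE GI [mv v1] v0 Gv A; rewrite {1}GE => sA.
have m1 B : measurable B -> mRX (fun x => \1_B (h x)).
 by move=> mB; apply: (@mR_c _ _ _ _ _ (\1_B) h) => //; exact: measurable_indic.
have mf B : measurable B -> mCX (fun x => (\1_B (h x) : R)%:C * v x).
 by move=> mB; apply: mC_M => //; apply: mC_real; exact: m1.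
have lf B : measurable B -> cL1 (fun x => (\1_B (h x) : R)%:C * v x).
 move=> mB; apply: (cL1_le (mf _ mB) (mC_nrm mv) _ v1) => x.
 rewrite nrmM nrm_real ger0_norm//; apply: ler_piMl; first pos.
 by rewrite indicE; case: (_ \in _).
move: sA; apply: (dynkin_induction (P := fun A => cI (fun x => (\1_A (h x) : R)%:C * v x) = 0)) => //.
- by rewrite -{}v0; apply: eq_cI => x; rewrite indicT mul1r.
- move=> S mS S0; rewrite -(subr0 0) -{1}v0 -S0 -cI_B//; last exact: lf.
 by apply: eq_cI => x; rewrite -{2}[v x]mul1r -mulrBl; congr (_ * _); rewrite !indicE in_setC; case: (_ \in _); rewrite /= ?subrr ?subr0.
- move=> F mF tF F0.
 have : ccvg (fun n => cI (fun x => \sum_(k < n) ((\1_(F k) (h x) : R)%:C * v x)))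
   (cI (fun x => (\1_(\bigcup_k F k) (h x) : R)%:C * v x)).
  have key x : (exists2 k0, \1_(\bigcup_k F k) (h x) = 1 :> R & forall k, \1_(F k) (h x) = (k == k0)%:R :> R) \/
    (\1_(\bigcup_k F k) (h x) = 0 :> R /\ forall k, \1_(F k) (h x) = 0 :> R).
   have [[k0 _ hk]|hn] := pselect ((\bigcup_k F k) (h x)); [left; exists k0|right; split].
   + by rewrite indicE mem_set//; exists k0.
   + move=> k; rewrite indicE; case: eqP => [->|ne]; first by rewrite mem_set.
    rewrite memNset// => hk'; apply: ne.
    by apply: (tF k k0) => //; exists (h x).
   + by rewrite indicE memNset.
   + by move=> k; rewrite indicE memNset// => hk; apply: hn; exists k.
  apply: (cI_dct _ _ (mC_nrm mv) v1).
  + by move=> n; apply: mC_sum => k; exact: mf.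
  + move=> x; case: (key x) => [[k0 -> e]|[-> e]]; last first.
    rewrite mul0r (_ : (fun n : nat => _) = fun=> 0); first exact: ccvg_cst.
    by fext => n; rewrite big1// => k _; rewrite e mul0r.
   rewrite mul1r; apply/ccvgP; apply: cvg_near_cst; exists k0.+1 => // n /= kn.
   rewrite (bigD1 (Ordinal kn))//= big1 => [|k /negbTE nk]; last first.
    by rewrite e; move: nk; rewrite -val_eqE /= => ->; rewrite mul0r.
   by rewrite e eqxx mul1r addr0 subrr nrm0.
  + move=> n x; rewrite -mulr_suml nrmM; apply: ler_piMl; first pos.
   rewrite (_ : \sum_(k < n) _ = (\sum_(k < n) \1_(F k) (h x) : R)%:C); last by rewrite rmorph_sum.
   rewrite nrm_real; case: (key x) => [[k0 _ e]|[_ e]]; last first.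
    by rewrite big1 ?normr0.
   under eq_bigr do rewrite e.
   have [kn|kn] := ltnP k0 n.
    rewrite (bigD1 (Ordinal kn))//= eqxx big1 ?addr0 ?normr1// => k.
    by rewrite -val_eqE /= => /negbTE ->.
   rewrite big1 ?normr0// => k _; rewrite ltn_eqF//; exact: leq_trans kn.
 have -> : (fun n => cI (fun x => \sum_(k < n) ((\1_(F k) (h x) : R)%:C * v x))) = fun=> 0.
  fext => n; rewrite (cI_sum (index_enum 'I_n) (F := fun (k : 'I_n) x => (\1_(F k) (h x) : R)%:C * v x)).
   by rewrite big1.
  by move=> k; exact: lf.
 by move=> h0; apply: (ccvg_unique h0); exact: ccvg_cst.
Qed.

(** The rays that generate the sigma-algebra of the line are increasing limits of the bounded
    intervals in the hypothesis. *)
Lemma dynkinR (h : RF) v : mRX h -> cL1 v -> (forall a b, cI (fun x => (oitv a b (h x))%:C * v x) = 0) ->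
 forall A : set (mTR R), measurable A -> cI (fun x => (\1_A (h x) : R)%:C * v x) = 0.
move=> mh [mv v1] h0.
have mo a b : mRX (fun x => oitv a b (h x)).
 by apply: (@mR_c _ _ _ _ _ (oitv a b) h) => //; exact: measurable_indic.
have cv (a b : nat -> R) (s : R -> R) : mRX (fun x => s (h x)) ->
  (forall t, \forall n \near \oo, oitv (a n) (b n) t = s t) -> cI (fun x => (s (h x))%:C * v x) = 0.
 move=> ms hs.
 have : ccvg (fun n => cI (fun x => (oitv (a n) (b n) (h x))%:C * v x)) (cI (fun x => (s (h x))%:C * v x)).
  apply: (cI_dct _ _ (mC_nrm mv) v1).
  + by move=> n; apply: mC_M => //; apply: mC_real; exact: mo.
  + move=> x; apply: ccvgM; last exact: ccvg_cst.
   by apply: ccvg_real; apply: cvg_near_cst; exact: hs.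
  + move=> n x; rewrite nrmM nrm_real ger0_norm ?oitvE ?mge0//.
   apply: ler_piMl; first pos.
   by rewrite -natrM lern1; case: (_ < _); case: (_ < _).
 by under eq_fun do rewrite h0; move=> /ccvg_unique /(_ (ccvg_cst 0)).
have big (t : R) : \forall n \near \oo, `|t| < n%:R.
 by near=> n; rewrite (lt_le_trans (truncnS_gt _))// ler_nat; near: n; exact: nbhs_infty_ge.
apply: (@dynkin _ (mTR R) (@RGenInftyO.G R) h v) => //.
- exact: RGenInftyO.measurableE.
- move=> _ _ [x ->] [y ->]; exists (Num.min x y); apply/seteqP; split => t /=; rewrite !in_itv /= lt_min.
  by move=> [-> ->].
 by move=> /andP[].
- have := cv (fun n => - n%:R) (fun n => n%:R) (fun=> 1); rewrite (_ : (fun x => 1%:C * v x) = v).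
  apply; first meas.
  by move=> t; apply: filterS (big t) => n; rewrite ltr_norml oitvE opprK -ltrBlDr sub0r subr_gt0 => /andP[-> ->]; rewrite mulr1.
 by fext => x; rewrite mul1r.
- move=> _ [b ->]; apply: (cv (fun n => - n%:R) (fun=> b) (\1_(`]-oo, b[%classic : set (mTR R)))).
  by apply: (@mR_c _ _ _ _ _ (\1_(_ : set (mTR R))) h) => //; exact: measurable_indic.
 move=> t; apply: filterS (big t) => n; rewrite ltr_norml => /andP[t1 _].
 by rewrite oitvE opprK -ltrBlDr sub0r t1 mul1r indicE mem_setE in_itv /= subr_gt0.
Unshelve. all: by end_near.
Qed.

Lemma cL1_ind d (T : measurableType d) (h : R3 R -> T) (A : set T) v : measurable_fun setT (h : measurable_R3 R -> T) ->
 measurable A -> cL1 v -> cL1 (fun x => (\1_A (h x) : R)%:C * v x).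
move=> mh mA [mv v1]; apply: (cL1_le _ (mC_nrm mv) _ v1) => [|x].
 apply: mC_M => //; apply: mC_real; apply: (@mR_c _ _ _ _ _ (\1_A) h) => //; exact: measurable_indic.
rewrite nrmM nrm_real ger0_norm//; apply: ler_piMl; first pos.
by rewrite indicE; case: (_ \in _).
Qed.

(** Sides of the box are replaced by measurable sets one after the other; measurable rectangles then
    generate the two nested product sigma-algebras. *)
Lemma boxes_cI0 v : cL1 v ->
 (forall a b : 'I_3 -> R, cI (fun x => (\prod_(i < 3) oitv (a i) (b i) (crd i x))%:C * v x) = 0) ->
 forall A : set (measurable_R3 R), measurable A -> cI (fun x => (\1_A x : R)%:C * v x) = 0.
move=> v1 hb.
have m11 : measurable_fun setT ((fun x : R3 R => x.1.1) : measurable_R3 R -> _) by mproj.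
have m12 : measurable_fun setT ((fun x : R3 R => x.1.2) : measurable_R3 R -> _) by mproj.
have m2 : measurable_fun setT ((fun x : R3 R => x.2) : measurable_R3 R -> _) by mproj.
have m1 : measurable_fun setT ((fun x : R3 R => x.1) : measurable_R3 R -> _) by mproj.
have mi a b : measurable (`]a, b[%classic : set (mTR R)) by exact: measurable_itv.
have b3 a1 b1 a2 b2 a3 b3 : cI (fun x => (oitv a1 b1 x.1.1)%:C * ((oitv a2 b2 x.1.2)%:C * ((oitv a3 b3 x.2)%:C * v x))) = 0.
 rewrite -(hb (fun i => if i == 0 :> nat then a1 else if i == 1 :> nat then a2 else a3)
  (fun i => if i == 0 :> nat then b1 else if i == 1 :> nat then b2 else b3)).
 by apply: eq_cI => x; rewrite !big_ord_recl big_ord0 mulr1 /crd /= !rmorphM /= !mulrA.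
have s1 A a2 b2 a3 b3' : measurable A -> cI (fun x => (\1_A x.1.1 : R)%:C * ((oitv a2 b2 x.1.2)%:C * ((oitv a3 b3' x.2)%:C * v x))) = 0.
 move=> mA; apply: (dynkinR (h := fun x => x.1.1)) => //.
 by apply: (@cL1_ind _ _ (fun x => x.1.2)) => //; exact: (@cL1_ind _ _ (fun x => x.2)).
have s2 A B a3 b3' : measurable A -> measurable B -> cI (fun x => (\1_A x.1.1 : R)%:C * ((\1_B x.1.2 : R)%:C * ((oitv a3 b3' x.2)%:C * v x))) = 0.
 move=> mA mB; under eq_cI do rewrite mulrCA.
 apply: (dynkinR (h := fun x => x.1.2)) => //.
  by apply: (@cL1_ind _ _ (fun x => x.1.1)) => //; exact: (@cL1_ind _ _ (fun x => x.2)).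
 by move=> a b; under eq_cI do rewrite mulrCA; exact: s1.
have s3 A B C : measurable A -> measurable B -> measurable C -> cI (fun x => (\1_A x.1.1 : R)%:C * ((\1_B x.1.2 : R)%:C * ((\1_C x.2 : R)%:C * v x))) = 0.
 move=> mA mB mC; have e x (p q r s : R[i]) : p * (q * (r * s)) = r * (p * (q * s)) by ring.
 under eq_cI do rewrite e//.
 apply: (dynkinR (h := fun x => x.2)) => //.
  by apply: (@cL1_ind _ _ (fun x => x.1.1)) => //; exact: (@cL1_ind _ _ (fun x => x.1.2)).
 by move=> a b; under eq_cI do rewrite -e//; exact: s2.
have i1 : setI_closed [set A `*` B | A in @measurable _ (mTR R) & B in @measurable _ (mTR R)].
 move=> _ _ [A1 mA1 [A2 mA2 <-]] [B1 mB1 [B2 mB2 <-]].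
 exists (A1 `&` B1); first exact: measurableI.
 by exists (A2 `&` B2); [exact: measurableI|rewrite setXI].
have i2 : setI_closed [set A `*` B | A in @measurable _ (mTR R * mTR R)%type & B in @measurable _ (mTR R)].
 move=> _ _ [A1 mA1 [A2 mA2 <-]] [B1 mB1 [B2 mB2 <-]].
 exists (A1 `&` B1); first exact: measurableI.
 by exists (A2 `&` B2); [exact: measurableI|rewrite setXI].
have v0 : cI v = 0.
 rewrite -(s3 _ _ _ measurableT measurableT measurableT).
 by apply: eq_cI => x; rewrite !indicT !mul1r.
have s4 A C : measurable A -> measurable C -> cI (fun x => (\1_A x.1 : R)%:C * ((\1_C x.2 : R)%:C * v x)) = 0.
 move=> mA mC; apply: (dynkin (h := fun x => x.1) _ (@measurable_prod_measurableType _ _ _ _)) => //.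
 - exact: (@cL1_ind _ _ (fun x => x.2)).
 - by rewrite -(s3 _ _ _ measurableT measurableT mC); apply: eq_cI => x; rewrite !indicT !mul1r.
 - move=> _ [A1 mA1 [A2 mA2 <-]]; rewrite -(s3 _ _ _ mA1 mA2 mC); apply: eq_cI => x.
  by rewrite [in RHS]mulrA -rmorphM /= !indicE in_setX -natrM mulnb.
apply: (dynkin (h := id) _ (@measurable_prod_measurableType _ _ _ _)) => //.
move=> _ [A1 mA1 [A2 mA2 <-]]; rewrite -(s4 _ _ mA1 mA2); apply: eq_cI => x.
by rewrite [in RHS]mulrA -rmorphM /= !indicE in_setX -natrM mulnb.
Qed.

Transparent Rintegral.
Lemma cI_sets_ae0 v : cL1 v ->
 (forall A : set (measurable_R3 R), measurable A -> cI (fun x => (\1_A x : R)%:C * v x) = 0) ->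
 {ae mu, forall x : R3 R, v x = 0}.
move=> v1 hv.
have key (w : RF) : mRX w -> (\int[mu]_x `|w x|%:E < +oo)%E ->
  (forall A : set (measurable_R3 R), measurable A -> (\int[mu]_x (\1_A x * w x) = 0)%R) ->
  {ae mu, forall x : R3 R, w x = 0}.
 move=> mw iw hA.
 have int A : measurable A -> mu.-integrable setT (EFin \o (fun x => \1_A x * w x)).
  move=> mA; have m1 : mRX (fun x => \1_A x * w x) by apply: mR_M => //; exact: measurable_indic.
  apply: integrable_nn => //; apply: lelt iw; apply: le_nnint => [| |//|x]; try exact: mR_norm.
  by rewrite normrM indicE; case: (_ \in _); rewrite ?normr1 ?mul1r// normr0 mul0r.
 have := integral_ae_eq measurableT (integrable_nn mw iw) (g := cst 0%E) (measurable_cst _) _.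
 move=> h; apply: (aeS (h _)) => [x /(_ I)[//]|].
 move=> E _ mE; rewrite [RHS]integral0_eq// [LHS]integral_mkcond.
 have -> : (EFin \o w) \_ E = EFin \o (fun x => \1_E x * w x).
  by fext => x; rewrite patchE /= indicE; case: ifP; rewrite ?mul1r// mul0r.
 rewrite -[LHS](fineK (integrable_fin_num measurableT (int E mE))).
 by have := hA E mE; rewrite /Rintegral => ->.
have [[m1 m2] l1] := v1.
have le (w : RF) : mRX w -> (forall x, `|w x| <= nrm (v x)) -> (\int[mu]_x `|w x|%:E < +oo)%E.
 move=> mw hw; apply: lelt l1; apply: le_nnint => //; first meas.
 by apply: mC_nrm; split.
have e1 (A : set (measurable_R3 R)) x : Re ((\1_A x : R)%:C * v x) = \1_A x * Re (v x).
 by rewrite ReImE /= mul0r subr0.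
have e2 (A : set (measurable_R3 R)) x : Im ((\1_A x : R)%:C * v x) = \1_A x * Im (v x).
 by rewrite ReImE /= mul0r addr0.
have hRe : {ae mu, forall x : R3 R, Re (v x) = 0}.
 apply: key => //; first by apply: le => // x; exact: Re_le_nrm.
 move=> A mA; have /(congr1 (@complex.Re R)) := hv A mA.
 by rewrite /cI /cint /=; under eq_Rintegral do rewrite e1.
have hIm : {ae mu, forall x : R3 R, Im (v x) = 0}.
 apply: key => //; first by apply: le => // x; exact: Im_le_nrm.
 move=> A mA; have /(congr1 (@complex.Im R)) := hv A mA.
 by rewrite /cI /cint /=; under eq_Rintegral do rewrite e2.
apply: (@filterS2 _ _ (ae_filter_ringOfSetsType mu) _ _ _ _ hRe hIm) => x h1 h2.
exact: ceqP.
Qed.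

(** Bumps tend to indicators of open boxes, and the integrals over boxes determine the measure u
    dx. *)
Lemma fundamental u : mCX u -> (forall r, (\I_x (ballf 0 r x * nrm (u x)) < +oo)%E) ->
 (forall phi, testf phi -> cI (fun x => u x * (phi x)%:C) = 0) -> {ae mu, forall x : R3 R, u x = 0}.
move=> mu_ lu hu.
pose box (a b : 'I_3 -> R) x : R := \prod_(i < 3) oitv (a i) (b i) (crd i x).
have mbox a b : mRX (box a b).
 rewrite /box; under eq_fun do rewrite !big_ord_recl big_ord0 mulr1.
 have h i : mRX (fun x => oitv (a i) (b i) (crd i x)).
  apply: (@mR_c _ _ _ _ _ (oitv (a i) (b i)) (crd i)); first exact: measurable_indic.
  by apply: mR_crd; exact: m3_id.
 by do ![apply: mR_M]; exact: h.
pose rr (a b : 'I_3 -> R) := \sum_i (`|a i| + `|b i|).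
have bl a b (n : nat) x : bump n.+1%:R a b x <= ballf 0 (rr a b) x.
 rewrite /ballf subr0; case: ifPn => [_|]; first by have /andP[] := bump_bound n.+1%:R a b x.
 by rewrite -ltNge => h; rewrite (bump_supp _ h).
have bxl a b x : 0 <= box a b x <= ballf 0 (rr a b) x.
 apply/andP; split.
  by apply: prodr_ge0 => i _; pos.
 have c := @bump_cvg a b x; rewrite /box -(cvg_lim (@Rhausdorff R) c).
 by apply: limr_le; [apply/cvg_ex; eexists; exact: c|near=> n; exact: bl].
have box0 a b : cI (fun x => (box a b x)%:C * u x) = 0.
 have : ccvg (fun n : nat => cI (fun x => u x * (bump n.+1%:R a b x)%:C)) (cI (fun x => (box a b x)%:C * u x)).
  apply: (cI_dct _ _ _ (lu (rr a b))).
  - move=> n; apply: mC_M => //; apply: mC_real; apply: testf_mR; exact: test_bump.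
  - by move=> x; rewrite mulrC; apply: ccvgM; [exact: ccvg_cst|apply: ccvg_real; exact: bump_cvg].
  - by apply: mR_M; [exact: mR_ballf|meas].
  - move=> n x; rewrite nrmM mulrC nrm_real; apply: lewr; first pos.
   by rewrite ger0_norm//; have /andP[] := bump_bound n.+1%:R a b x.
 rewrite (_ : (fun n : nat => _) = fun=> 0); first by move=> /ccvg_unique /(_ (ccvg_cst 0)).
 by fext => n; apply: hu; exact: test_bump.
have key (n : nat) : {ae mu, forall x : R3 R, (box (fun=> - n%:R) (fun=> n%:R) x)%:C * u x = 0}.
 have l1 : cL1 (fun x => (box (fun=> - n%:R) (fun=> n%:R) x)%:C * u x).
  apply: (cL1_le _ _ _ (lu (rr (fun=> - n%:R) (fun=> n%:R)))).
  - by apply: mC_M => //; apply: mC_real; exact: mbox.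
  - by apply: mR_M; [exact: mR_ballf|meas].
  - move=> x; have /andP[h1 h2] := bxl (fun=> - n%:R) (fun=> n%:R) x.
   by rewrite nrmM nrm_real ger0_norm// lewr// nge0.
 apply: cI_sets_ae0 => //; apply: boxes_cI0 => // a b.
 (* On a cube u is integrable, and a box intersected with the cube is again a box, for which the
    integral is already known to vanish. *)
 rewrite -(box0 (fun i => Num.max (a i) (- n%:R)) (fun i => Num.min (b i) n%:R)).
 apply: eq_cI => x; rewrite mulrA -rmorphM /= -big_split /=; congr (_%:C * _).
 apply: eq_bigr => i _; rewrite /oitv !indicE !mem_setE !in_itv /= -natrM mulnb lt_min gt_max.
 by congr (_%:R); rewrite !andbA; congr (_ && _); rewrite -!andbA; congr (_ && _); rewrite andbC.
have /ae_foralln : forall n : nat, {ae mu, forall x : R3 R, (box (fun=> - n%:R) (fun=> n%:R) x)%:C * u x = 0} by exact: key.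
apply: aeS => x hx.
have [n hn] : exists n : nat, enorm x < n%:R.
 by exists (Num.truncn (enorm x)).+1; exact: truncnS_gt.
have := hx n; rewrite /box big1 ?mul1r// => i _.
have := crd_le i x; rewrite ler_norml => /andP[h1 h2].
have a1 : - n%:R < crd i x by lra.
have a2 : crd i x < n%:R by lra.
by rewrite oitvE !subr_gt0 a1 a2 mulr1.
Unshelve. all: by end_near.
Qed.

End Fundamental.

(** * Convolution of an integrable kernel with a test function *)

Section Conv.
Implicit Types (x y w : R3 R) (b : RF) (i : 'I_3).

Variable k : RF.
Hypotheses (mk : mRX k) (k1 : (\int[mu]_x `|k x|%:E < +oo)%E).

(** In the form $\int k(w)b(w+y)\,dw$ all derivatives fall on b, so k need only be integrable. For
    even k it is the convolution. *)
Definition conv b y : R := Re (cI (fun w => (k w * b (w + y))%:C)).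

Lemma conv_mC b y : mRX b -> mCX (fun w => (k w * b (w + y))%:C).
by move=> mb; meas; meas; meas. Qed.

Lemma conv_dom (B : R) : 0 <= B -> mRX (fun w => B * `|k w|) /\ (\I_w (B * `|k w|) < +oo)%E.
move=> B0; have mk' : mRX (fun w => `|k w|) by meas.
split; first by meas; meas.
by rewrite n3Z// ltyM.
Qed.

Lemma conv_L1 b y (B : R) : 0 <= B -> mRX b -> (forall x, `|b x| <= B) -> cL1 (fun w => (k w * b (w + y))%:C).
move=> B0 mb hb; have [h1 h2] := conv_dom B0.
apply: (cL1_le (conv_mC _ mb) h1 _ h2) => w.
by rewrite nrm_real normrM mulrC lewr.
Qed.

Lemma convE b y : (conv b y)%:C = cI (fun w => (k w * b (w + y))%:C).
by rewrite /conv -cI_Re. Qed.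

Lemma test_sup b : testf b -> mRX b /\ exists2 B : R, 0 <= B & forall x, `|b x| <= B.
move=> tb; split; first exact: testf_mR.
have [B [r [B0 _ h]]] := test_near tb; exists B => // x; apply: le_trans (h x) _.
by apply: ler_piMr => //; rewrite /ballf; case: ifP.
Qed.

Lemma conv_continuous b : testf b -> continuous (conv b).
move=> tb y; have [mb [B B0 hb]] := test_sup tb; have [h1 h2] := conv_dom B0.
apply: seq_continuous => u hu.
have [] // : ccvg (fun n => cI (fun w => (k w * b (w + u n))%:C)) (cI (fun w => (k w * b (w + y))%:C)).
apply: (cI_dct _ _ h1 h2) => [n|w|n w]; first exact: conv_mC.
 apply: ccvg_real; apply: cvgM; first exact: cvg_cst.
 apply: continuous_ccvg; first by have [] := tb.1 [::].
 by under eq_fun do rewrite opprD addrACA subrr add0r.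
by rewrite nrm_real normrM mulrC lewr.
Qed.

Lemma test_taylor b i : testf b -> exists2 B : R, 0 <= B & forall x (h : R),
 `|b (h *: e_ i + x) - b x - h * pd i b x| <= B * h ^+ 2.
move=> tb; have tb1 := tpd i tb; have tb2 := tpd i tb1.
have [_ [B B0 hB]] := test_sup tb2; exists B => // x h.
have d1 z : is_derive z (e_ i) b (pd i b z) by exact: partial_derive tb.1.
have d2 z : is_derive z (e_ i) (pd i b) (pd i (pd i b) z) by exact: partial_derive tb1.1.
have [h0|h0] := leP 0 h.
 have [c /andP[c0 ch] ->] := line_mvt x h0 d1.
 have [c' _ e] := line_mvt x c0 d2.
 rewrite -mulrC -mulrBr e normrM normrM (ger0_norm h0) (ger0_norm c0) expr2.
 have := lewr (mge0 c0 h0) (hB (c' *: e_ i + x)).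
 have : c * h <= h * h by exact: lewr.
 by move=> /(lewl B0); lra.
have h0' : 0 <= - h by lra.
set x' := h *: e_ i + x; have ex : x = - h *: e_ i + x' by rewrite /x' addrA -scalerDl addNr scale0r add0r.
have [c /andP[c0 ch] e1] := line_mvt x' h0' d1.
have c0' : 0 <= - h - c by lra.
have [c' _ e] := line_mvt (c *: e_ i + x') c0' d2.
have -> : b x' - b x - h * pd i b x = (pd i (pd i b) (c' *: e_ i + (c *: e_ i + x')) * (- h - c)) * - h.
 have ex2 : (- h - c) *: e_ i + (c *: e_ i + x') = x by rewrite addrA -scalerDl subrK -ex.
 rewrite -e ex2; rewrite -ex in e1.
 by apply/eqP; rewrite -subr_eq0; apply/eqP; transitivity (- (b x - b x' - pd i b (c *: e_ i + x') * - h)); [ring|rewrite e1 subrr oppr0].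
rewrite !normrM (ger0_norm c0') (ger0_norm h0') -sqrrN expr2.
have := lewr (mge0 c0' h0') (hB (c' *: e_ i + (c *: e_ i + x'))).
have : (- h - c) * - h <= - h * - h by apply: lewr => //; lra.
by move=> /(lewl B0); lra.
Qed.

(** The uniform second-order Taylor bound for b makes the difference quotients converge at rate
    O(h). *)
Lemma conv_derive b i y : testf b -> is_derive y (e_ i) (conv b) (conv (pd i b) y).
move=> tb; have [mb [B B0 hb]] := test_sup tb.
have [mb1 [B1 B10 hb1]] := test_sup (tpd i tb).
have [T T0 hT] := test_taylor i tb.
have [K K0 hK] : exists2 K : R, 0 < K & (\int[mu]_x `|k x|%:E <= K%:E)%E.
 have f0 := n3ge0 (fun x => normr_ge0 (k x)).
 have ff : (\int[mu]_x `|k x|%:E)%E \is a fin_num by rewrite ge0_fin_numE.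
 exists (fine (\int[mu]_x `|k x|%:E)%E + 1); first by rewrite ltr_wpDl// fine_ge0.
 by rewrite -{1}(fineK ff) lee_fin lerDl.
have q : (fun h : R => h^-1 *: ((conv b \o shift y) (h *: e_ i) - conv b y)) @ 0^' --> conv (pd i b) y.
 apply/cvgrPdist_lt => e e0.
 have KT : 0 < K * T + 1 by pos.
 have eKT : 0 < e / (K * T + 1) by pos.
 near=> h; have h0 : h != 0 by near: h; exact: nbhs_dnbhs_neq.
 have i1 := conv_L1 (h *: e_ i + y) B0 mb hb; have i2 := conv_L1 y B0 mb hb; have i3 := conv_L1 y B10 mb1 hb1.
 have -> : conv (pd i b) y - h^-1 *: ((conv b \o shift y) (h *: e_ i) - conv b y) =
   - h^-1 * Re (cI (fun w => (k w * (b (h *: e_ i + (w + y)) - b (w + y) - h * pd i b (w + y)))%:C)).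
  have -> : cI (fun w => (k w * (b (h *: e_ i + (w + y)) - b (w + y) - h * pd i b (w + y)))%:C) =
    cI (fun w => (k w * b (w + (h *: e_ i + y)))%:C) - cI (fun w => (k w * b (w + y))%:C) -
    h%:C * cI (fun w => (k w * pd i b (w + y))%:C).
   rewrite -cI_B// -cI_Z// -cI_B//; last exact: cL1_Z; last exact: cL1_B.
   by apply: eq_cI => w; rewrite -!rmorphB -rmorphM -rmorphB /= addrCA; congr (_%:C); ring.
  rewrite -!convE -rmorphB -rmorphM -rmorphB /= /GRing.scale /=; field; exact: h0.
 have hle : `|Re (cI (fun w => (k w * (b (h *: e_ i + (w + y)) - b (w + y) - h * pd i b (w + y)))%:C))| <= K * (T * h ^+ 2).
  apply: le_trans (Re_le_nrm _) _.
  have T0' : 0 <= T * h ^+ 2 by pos.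
  have [m1 _] := conv_dom T0'.
  apply: (cI_le _ m1).
  - apply: mC_real; apply: mR_M => //.
   have s1 : mRX (fun w => b (h *: e_ i + (w + y))).
    by under eq_fun do rewrite addrCA; exact: mR_shift.
   have s2 := mR_shift y mb; have s3 := mR_shift y mb1.
   meas.
  - by move=> w; rewrite nrm_real normrM mulrC; apply: lewr.
  - rewrite n3Z//; last meas.
   by rewrite [X in (_ <= X)%E](_ : _ = (T * h ^+ 2)%:E * K%:E)%E ?leewl// -EFinM mulrC.
 rewrite normrM normrN normfV ltr_pdivrMl ?normr_gt0//; apply: lelt hle _.
 rewrite -(real_normK (num_real h)) expr2 mulrCA [X in _ < X]mulrC mulrA mulrA ltr_pM2r ?normr_gt0//.
 have : `|h| < e / (K * T + 1) by near: h; exact: dnbhs0_lt.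
 by rewrite ltr_pdivlMr// mulrDr mulr1; have := normr_ge0 h; nra.
by split; [apply/cvg_ex; eexists; exact: q|exact: cvg_lim q].
Unshelve. all: by end_near.
Qed.

Lemma conv_partial b i : testf b -> pd i (conv b) = conv (pd i b).
by move=> tb; fext => y; rewrite /pd; case: (conv_derive i y tb). Qed.

Lemma conv_Ck n b : testf b -> Ck n (conv b).
elim: n b => [|n ih] b tb; first by split => //; exact: conv_continuous.
apply: (Ck_intro (dphi := fun i => conv (pd i b))); first exact: conv_continuous.
 by move=> i x; exact: conv_derive.
by move=> i; apply: ih; exact: tpd.
Qed.

Lemma conv_test b (n : R) : (forall x, n < enorm x -> k x = 0) -> testf b -> testf (conv b).
move=> hk tb; split; first by apply: smoothP => j; exact: conv_Ck.
have [r hr] := tb.2; exists (n + r) => y hy.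
rewrite /conv (_ : cI _ = 0)//; rewrite (eq_cI (f2 := fun=> 0)); first exact: cint0.
move=> w; have [h|h] := ltP n (enorm w); first by rewrite hk// mul0r.
rewrite hr ?mulr0//.
by have := enorm_le_add y (- w); rewrite opprK enormN (addrC y); lra.
Qed.

Lemma conv_laplacian b y : testf b -> lap (conv b) y = conv (lap b) y.
move=> tb; apply: (@complexI R); rewrite convE /lap.
have e i : pd i (pd i (conv b)) = conv (pd i (pd i b)).
 by rewrite (conv_partial i tb) (conv_partial i (tpd i tb)).
transitivity (\sum_(i < 3) conv (pd i (pd i b)) y)%:C.
 by congr (_%:C); apply: eq_bigr => i _; exact: (congr1 (fun f => f y) (e i)).
rewrite (eq_cI (f2 := fun w => \sum_(i < 3) (k w * pd i (pd i b) (w + y))%:C)); last first.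
 by move=> w; rewrite mulr_sumr rmorph_sum.
rewrite cI_sum => [|i]; last first.
 by have [m1 [B B0 hB]] := test_sup (tpd i (tpd i tb)); exact: conv_L1 B0 m1 hB.
by rewrite rmorph_sum /=; apply: eq_bigr => i _; rewrite convE.
Qed.

End Conv.

(** * The Yukawa kernel and a Liouville theorem in L^2 *)

Section Liouville.
Implicit Types (x y w : R3 R) (b : RF) (u : CF).

(** The Yukawa kernel of $(1-\Delta)^{-1}$, that is [Rk] at [m = 1]: real, even, nonnegative and
    exponentially decaying. *)
Definition yuk w : R := expR (- enorm w) / (nc * enorm w).

Lemma yuk_ge0 w : 0 <= yuk w.
by rewrite /yuk divr_ge0 ?expR_ge0// mge0 ?enge0// ltW ?newton_gt0. Qed.

Lemma Rk1E x y : Rk 1 x y = (yuk (x - y))%:C.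
rewrite /Rk /yuk /cexp /= mul1r mul0r cos0 sin0 oppr0 [(_ / _)%R]mulrC rmorphM /=.
by congr (_ * _); exact: mulr1.
Qed.

Lemma mR_yuk : mRX yuk.
have [h _] := mC2_l 0 (@mC2_Rk 1); rewrite (_ : yuk = fun x => Re (Rk 1 x 0))//.
by fext => x; rewrite Rk1E subr0.
Qed.

(* (1 + s)^2 <= 4 e^s, from e^(s/2) >= 1 + s/2 *)
Lemma sqr_exp (s : R) : 0 <= s -> (1 + s) ^+ 2 <= 4 * expR s.
move=> s0; have := expR_ge1Dx (s / 2); have -> : expR s = expR (s / 2) ^+ 2.
 by rewrite expr2 -expRD; congr expR; field.
by move=> h; nra.
Qed.

(** [sqr_exp] at t/2 gives $(1+t)^2\le16e^{t/2}$, which is then squared. *)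
Lemma expN_le (t : R) : 0 <= t -> expR (- t) <= 256 * (1 + t) ^- 4.
move=> t0; rewrite expRN ler_pdivlMr ?exprn_gt0//; last by lra.
rewrite ler_pdivrMl ?expR_gt0//; have := @sqr_exp (t / 2) _; have := @sqr_exp t t0.
have e : expR t = expR (t / 2) ^+ 2 by rewrite expr2 -expRD; congr expR; field.
move=> _ /(_ ltac:(lra)) h; rewrite e; have h' : (1 + t) ^+ 2 <= 16 * expR (t / 2) by nra.
have -> : (1 + t) ^+ 4 = ((1 + t) ^+ 2) ^+ 2 by rewrite -exprM.
have -> : expR (t / 2) ^+ 2 * 256 = (16 * expR (t / 2)) ^+ 2 by ring.
by apply: lerXn2r; rewrite ?nnegrE ?sqr_ge0 ?mge0 ?expR_ge0.
Qed.

Lemma omega_le1 x : omega x <= 1.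
by have := enge0 x => x0; rewrite /omega invf_le1 ?lerDl// ltr_pwDl. Qed.

Lemma mR_omega : mRX (@omega).
by rewrite /omega; meas. Qed.

Lemma omega4_int : (\I_x (omega (x : R3 R) ^+ 4) < +oo)%E.
apply: lelt (@japan_int 4 isT); apply: n3le.
- by have mo := mR_omega; meas.
- by apply: mR_inv; apply: mR_X; exact: mR_japan.
- pos.
move=> x; rewrite -exprVn; apply: lerXn2r; rewrite ?nnegrE ?omega_ge0 ?invr_ge0 ?(ltW (japan_gt0 x))//.
have j1 := japan_gt0 x; have x0 := enge0 x.
rewrite /omega lef_pV2 ?posrE//; last by lra.
rewrite /japan -[X in _ <= X]ger0_norm; last by lra.
by rewrite -sqrtr_sqr ler_wsqrtr//; nra.
Qed.

(* dominates the kernel of [(1 - Laplacian)^-1] and its gradient *)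
Definition jk w : R := nc^-1 * ((1 + enorm w) * expR (- enorm w) * enorm w ^- 2).

Lemma jk_ge0 w : 0 <= jk w.
have := enge0 w => w0; apply: mge0; first pos.
by apply: mge0; [apply: mge0; [lra|exact: expR_ge0]|pos].
Qed.

Lemma mR_jk : mRX jk.
by rewrite /jk; meas. Qed.

Lemma yuk_jk w : yuk w <= jk w.
have n0 : 0 <= nc^-1 by pos.
rewrite /yuk /jk; have [->|w0] := eqVneq (enorm w) 0; first by rewrite !mulr0 expr0n /= !invr0 !mulr0.
have wp : 0 < enorm w by rewrite lt_def w0 enge0.
have nn : nc != 0 :> R by rewrite gt_eqF ?newton_gt0.
rewrite -subr_ge0 [leRHS](_ : _ = nc^-1 * (expR (- enorm w) * enorm w ^- 2)); last by field; rewrite nn w0.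
by apply: mge0 => //; apply: mge0; [exact: expR_ge0|pos].
Qed.

Lemma jk_riesz w : jk w <= nc^-1 * enorm w ^- 2.
have w0 := enge0 w; apply: lewl; first pos.
apply: ler_piMl; first pos.
by rewrite expRN ler_pdivrMr ?expR_gt0// mul1r expR_ge1Dx.
Qed.

Lemma jk_int : (\I_w (jk (w : R3 R)) < +oo)%E.
have n0 : 0 <= nc^-1 by pos.
have mb : mRX (fun w => ballf 0 1 w * enorm (w - 0) ^- 2) by have := mR_ballf (0 : R3 R) 1 => mb; meas.
have mo := mR_omega; have [K K0 hK] : exists2 K : R, 0 <= K & K = 1024 by exists 1024; [exact: ler0n|].
have mo4 : mRX (fun w => K * omega w ^+ 4) by apply: mR_M; [meas|meas].
have b0 w : 0 <= ballf 0 1 w * enorm (w - 0 : R3 R) ^- 2 by pos.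
have o0 (w : R3 R) : 0 <= K * omega w ^+ 4 by pos.
apply: (vialt (\I_w (nc^-1 * (ballf 0 1 w * enorm (w - 0) ^- 2 + K * omega w ^+ 4)))%E).
 apply: n3le; [exact: mR_jk|by apply: mR_M; [meas|exact: mR_D]|exact: jk_ge0|move=> w].
 have w0 := enge0 w; rewrite /jk; apply: lewl => //; rewrite /ballf subr0; case: ifPn => w1.
  apply: (via (enorm w ^- 2)); last by rewrite mul1r lerDl.
  apply: ler_piMl; first pos.
  by rewrite expRN ler_pdivrMr ?expR_gt0// mul1r expR_ge1Dx.
 rewrite mul0r add0r; rewrite -ltNge in w1.
 have h := expN_le w0; rewrite /omega.
 set t := enorm w in w0 w1 h *; have t1 : 0 < 1 + t by lra.
 have h2 : t ^- 2 <= 4 * (1 + t) ^- 2.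
  rewrite ler_pdivlMr ?exprn_gt0// ler_pdivrMl ?exprn_gt0//; last by lra.
  by rewrite !expr2; nra.
 apply: (via ((1 + t) * (256 * (1 + t) ^- 4) * (4 * (1 + t) ^- 2))).
  apply: ler_pM => //; [by apply: mge0; [lra|exact: expR_ge0]|pos|].
  by apply: lewl => //; lra.
 have -> : (1 + t) * (256 * (1 + t) ^- 4) * (4 * (1 + t) ^- 2) = (K * (1 + t)^-1 ^+ 4) * (1 + t)^-1.
  by rewrite hK; field; rewrite gt_eqF.
 by apply: ler_piMr; [pos; rewrite exprn_ge0// invr_ge0 ltW|rewrite invf_le1; lra].
rewrite n3Z//; [|exact: mR_D|by move=> w; pos].
rewrite n3D// ltyM ?lee_fin// lte_add_pinfty//.
 by apply: lelt (ball_sqr_inv 0 ltr01) _; exact: ltry.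
rewrite n3Z//; [|meas|pos].
exact: ltyM omega4_int.
Qed.

(* the smooth functions [yuk_n * psi], with [yuk_n] cut off at radius n, lie below this *)
Lemma yuk_test b : mRX b -> (exists B r : R, [/\ 0 <= B, 0 < r & forall x, `|b x| <= B * ballf 0 r x]) ->
 exists2 C : R, 0 <= C & forall y, (\I_w (yuk w * `|b (w + y)|) <= (C * omega y ^+ 2)%:E)%E.
move=> mb [B [r [B0 r0 hb]]]; have [A A0 [mA A1 hA]] := ball_kato r0.
have n0 : 0 <= nc^-1 by pos.
pose k0 := B * nc^-1 * (4 * (1 + r) ^+ 2).
have k00 : 0 <= k0 by apply: mge0; [pos|pos].
exists (k0 * A) => [|y]; first pos.
have o0 := omega_ge0 y; have oo : 0 <= k0 * omega y ^+ 2 by pos.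
have i0 x : 0 <= (dist x y)^-1 by pos.
have mfun : mRX (fun x => yuk (x - y) * `|b x|) by apply: mR_M; [exact: (mR_shift (- y) mR_yuk)|meas].
have f0 x : 0 <= yuk (x - y) * `|b x| by rewrite mge0// yuk_ge0.
rewrite (eq_n3 (g2 := fun w => yuk (w + y - y) * `|b (w + y)|)); last by move=> w; rewrite addrK.
rewrite (nnint_shift y mfun f0).
apply: (via (\I_x (k0 * omega y ^+ 2 * (ballf 0 r x * (dist x y)^-1)))%E).
 apply: n3le => //; first meas.
 move=> x; apply: le_trans (lewl (yuk_ge0 _) (hb x)) _.
 rewrite /ballf subr0; case: ifPn => xr; last by rewrite !(mulr0, mul0r).
 rewrite mulr1 mul1r.
 have hy := enorm_le_add y x; rewrite enormBC in hy.
 have key : expR (- dist x y) <= 4 * (1 + r) ^+ 2 * omega y ^+ 2.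
  have t0 := enge0 (x - y); have h4 := sqr_exp t0; have y0 := enge0 y; have x0 := enge0 x.
  have y1 : 0 < 1 + enorm y by lra.
  rewrite expRN /omega exprVn ler_pdivlMr ?exprn_gt0// ler_pdivrMl ?expR_gt0//.
  apply: (via (((1 + r) * (1 + dist x y)) ^+ 2)).
   apply: lerXn2r; rewrite ?nnegrE; [lra|pos; lra|nra].
  rewrite exprMn [leRHS](_ : _ = (1 + r) ^+ 2 * (4 * expR (dist x y))); last by ring.
  by apply: lewl => //; rewrite sqr_ge0.
 rewrite /yuk invfM -!mulrA.
 have -> : expR (- dist x y) * (nc^-1 * ((dist x y)^-1 * B)) = B * nc^-1 * expR (- dist x y) * (dist x y)^-1 by ring.
 rewrite [leRHS](_ : _ = (B / nc * (4 * (1 + r) ^+ 2 * omega y ^+ 2)) * (dist x y)^-1); last by rewrite /k0; ring.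
 apply: lewr => //; apply: lewl => //; pos.
rewrite n3Z//; [|by meas|pos].
by rewrite [X in (_ <= X)%E](_ : _ = (k0 * omega y ^+ 2)%:E * A%:E)%E ?leewl// -EFinM mulrAC.
Qed.

Lemma mR_laplacian b : testf b -> mRX (lap b).
by move=> tb; apply: mR_sum => i; exact: testf_mR (tpd i (tpd i tb)).
Qed.

Lemma helmholtz_test b : testf b -> mRX (fun x => b x - lap b x) /\
 exists B r : R, [/\ 0 <= B, 0 < r & forall x, `|b x - lap b x| <= B * ballf 0 r x].
move=> tb; split.
 by apply: mR_D; [exact: testf_mR|apply: mR_N; exact: mR_laplacian].
have [B [r [B0 r0 h0 h1 h2]]] := test_bound tb; exists (4 * B), r; split => // [|x]; first pos.
apply: le_trans (ler_normB _ _) _; rewrite /lap.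
apply: le_trans (lerD (h0 x) (ler_norm_sum _ _ _)) _.
apply: (via (B * ballf 0 r x + \sum_(i < 3) B * ballf 0 r x)).
 by rewrite lerD2l; apply: ler_sum => i _; exact: h2.
by rewrite sumr_const card_ord -mulrS -[X in X <= _]mulr_natl mulrA.
Qed.

Lemma Rk_inverts b y : testf b -> cI (fun x => Rk 1 x y * (b x - lap b x)%:C) = (b y)%:C.
move=> tb; have m1 : 0 <= Re (1 : R[i]) by exact: ler01.
have := Rk_laplacian y m1 tb; rewrite expr1n mul1r => h.
have i1 := Rk_test_int y m1 tb.
have i2 : cL1 (fun x => Rk 1 x y * (lap b x)%:C).
 have e x : Rk 1 x y * (lap b x)%:C = \sum_(i < 3) Rk 1 x y * (pd i (pd i b) x)%:C.
  by rewrite /lap rmorph_sum /= mulr_sumr.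
 rewrite (_ : (fun x => _) = fun x => \sum_(i < 3) Rk 1 x y * (pd i (pd i b) x)%:C); last exact/funext.
 by apply: cL1_sum => i; exact: Rk_test_int m1 (tpd i (tpd i tb)).
transitivity (cI (fun x => Rk 1 x y * (b x)%:C - Rk 1 x y * (lap b x)%:C)); last by rewrite cI_B// h opprB addrCA subrr addr0.
by apply: eq_cI => x; rewrite -mulrBr -rmorphB.
Qed.

Lemma yuk_shift b y : mRX b -> cI (fun w => (yuk w * b (w + y))%:C) = cI (fun x => Rk 1 x y * (b x)%:C).
move=> mb; rewrite -[RHS](cI_shift y).
 by apply: eq_cI => w; rewrite Rk1E addrK -rmorphM.
by apply: mC_M; [exact: mC2_l (@mC2_Rk 1)|meas].
Qed.

Lemma yuk_inverts b y : testf b -> cI (fun w => (yuk w * (b (w + y) - lap b (w + y)))%:C) = (b y)%:C.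
by move=> tb; rewrite (yuk_shift y (helmholtz_test tb).1) Rk_inverts. Qed.

(** For a test function b, convolving with the Yukawa kernel cut off at radius n gives test
    functions whose images under $1-\Delta$ tend to b, below a square integrable majorant. Hence u
    integrates to 0 against every b. *)
Lemma liouville u : mCX u -> (\I_x (nrm (u x) ^+ 2) < +oo)%E ->
 (forall phi, testf phi -> cI (fun x => u x * (phi x - lap phi x)%:C) = 0) ->
 {ae mu, forall x : R3 R, u x = 0}.
move=> mu_ u2 hu; have mo := mR_omega; have mu1 := mC_nrm mu_.
have mu2 : mRX (fun x => nrm (u x) ^+ 2) by meas.
have dom (g : RF) : mRX g -> nneg g -> (\I_x (g x ^+ 2) < +oo)%E ->
  mRX (fun x => g x * nrm (u x)) /\ (\I_x (g x * nrm (u x)) < +oo)%E.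
 move=> mg g0 g2; have mg2 : mRX (fun x => g x ^+ 2) by meas.
 split; first meas.
 apply: (vialt (\I_x (g x ^+ 2 + nrm (u x) ^+ 2))%E).
  apply: n3le; [meas|meas|pos|move=> x].
  by have := nge0 (u x); have := g0 x; have := sqr_ge0 (g x - nrm (u x)); nra.
 by rewrite n3D; [exact: lte_add_pinfty|exact: mg2|exact: mu2|move=> x; pos|move=> x; pos].
apply: fundamental => // [r|b tb].
 have [] // := dom (ballf 0 r) (mR_ballf 0 r) (ballf_ge0 0 r) _.
 apply: (vialt (\I_x (ballf 0 `|r| x))%E).
  apply: n3le; [apply: mR_X; exact: mR_ballf|exact: mR_ballf|by move=> x; pos|move=> x].
  rewrite /ballf; case: ifPn => h; last by rewrite expr0n; case: ifP.
  by rewrite (le_trans h (ler_norm r)) expr1n.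
 by apply: lelt (nnballf 0 (normr_ge0 r)) _; exact: ltry.
have [mpsi hpsi] := helmholtz_test tb; have [C C0 hC] := yuk_test mpsi hpsi.
set psi := fun x => _ in mpsi hpsi hC.
pose kn (n : nat) w := ballf 0 n%:R w * yuk w.
have mkn n : mRX (kn n) by apply: mR_M; [exact: mR_ballf|exact: mR_yuk].
have kn1 n w : 0 <= kn n w <= yuk w.
 apply/andP; split; first by rewrite mge0 ?ballf_ge0 ?yuk_ge0.
 by apply: ler_piMl; [exact: yuk_ge0|rewrite /ballf; case: ifP].
have kni n : (\int[mu]_w `|kn n w|%:E < +oo)%E.
 apply: lelt jk_int; apply: n3le; [by apply: mR_norm; exact: mkn|exact: mR_jk|by []|move=> w].
 by have /andP[h1 h2] := kn1 n w; rewrite ger0_norm//; apply: le_trans h2 (yuk_jk _).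
pose phi n := conv (kn n) b.
have tphi n : testf (phi n).
 apply: (conv_test (mkn n) (kni n) (n := n%:R)) => // x xn.
 by rewrite /kn /ballf subr0 leNgt xn mul0r.
have phiE n y : (phi n y - lap (phi n) y)%:C = cI (fun w => (kn n w * psi (w + y))%:C).
 have tl := mR_laplacian tb.
 rewrite conv_laplacian; [|exact: mkn|exact: kni|exact: tb].
 rewrite rmorphB /= !convE -cI_B.
 - by apply: eq_cI => w; rewrite -rmorphB /= -mulrBr.
 - by have [m1 [B B0 hB]] := test_sup tb; exact: (conv_L1 (mkn n) (kni n) y B0 m1 hB).
 - have [B [r [B0 r0 h0]]] := hpsi.
  have [m1 [B1 B10 hB]] := test_sup tb; apply: (conv_L1 (mkn n) (kni n) y (addr_ge0 B10 B0) tl) => x.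
  have -> : lap b x = b x - psi x by rewrite /psi subKr.
  apply: le_trans (ler_normB _ _) _; apply: lerD => //; apply: le_trans (h0 x) _.
  by apply: ler_piMr => //; rewrite /ballf; case: ifP.
have mw y : mRX (fun w => yuk w * `|psi (w + y)|).
 by apply: mR_M; [exact: mR_yuk|apply: mR_norm; exact: mR_shift].
have mkp n y : mCX (fun w => (kn n w * psi (w + y))%:C).
 by apply: mC_real; exact: mR_M (mkn n) (mR_shift y mpsi).
have kle n y w : nrm (kn n w * psi (w + y))%:C <= yuk w * `|psi (w + y)|.
 have /andP[h1 h2] := kn1 n w.
 by rewrite nrm_real normrM ger0_norm//; apply: lewr.
have phi_cvg y : ccvg (fun n => (phi n y - lap (phi n) y)%:C) (b y)%:C.
 rewrite -(yuk_inverts y tb); under eq_fun do rewrite phiE.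
 apply: (cI_dct _ _ (mw y) _ (kle ^~ y)).
 - by move=> n; exact: mkp.
 - move=> w; apply: ccvg_real; apply: cvgM; last exact: cvg_cst.
  apply: cvg_near_cst; near=> n; rewrite /kn /ballf subr0 ifT ?mul1r//.
  by rewrite ltW// (lt_le_trans (truncnS_gt _))// ler_nat; near: n; exact: nbhs_infty_ge.
 - by apply: lelt (hC y) _; exact: ltry.
have phi_le n y : nrm (phi n y - lap (phi n) y)%:C <= C * omega y ^+ 2.
 rewrite phiE; exact: (cI_le (mkp n y) (mw y) (kle n y) (hC y)).
have [m1 d1] : mRX (fun x => (C * omega x ^+ 2) * nrm (u x)) /\ (\I_x ((C * omega x ^+ 2) * nrm (u x)) < +oo)%E.
 have mo2 : mRX (fun x : R3 R => C * omega x ^+ 2) by apply: mR_M; [meas|meas].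
 apply: dom => //; first pos.
 rewrite (eq_n3 (g2 := fun x => C ^+ 2 * omega x ^+ 4)); last by move=> x; rewrite exprMn -exprM.
 rewrite n3Z; [|meas|pos|pos].
 by rewrite ltyM ?lee_fin ?sqr_ge0// omega4_int.
have : ccvg (fun n => cI (fun x => u x * (phi n x - lap (phi n) x)%:C)) (cI (fun x => u x * (b x)%:C)).
 apply: (cI_dct _ _ m1 d1) => [n|x|n x].
 - exact: mC_M mu_ (mC_real (helmholtz_test (tphi n)).1).
 - exact: ccvgM (ccvg_cst _) (phi_cvg x).
 - by rewrite nrmM mulrC; apply: (lewr (nge0 (u x))); exact: phi_le.
rewrite (_ : (fun n => _) = fun=> 0); first by move=> /ccvg_unique /(_ (ccvg_cst 0)).
by fext => n; exact: hu.
Unshelve. all: by end_near.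
Qed.

End Liouville.

(** * Sources of H^-1 type and their potentials *)

Section Source.
Implicit Types (x y w : R3 R) (P s : RF) (k : KF) (phi psi : RF).

(** A pointwise substitute for $H^{-1}$: finite Coulomb energy plus L^2. It contains both $Vu$, for
    u with $|V||u|^2$ integrable, and square integrable sources. *)
Definition src P := exists s1 s2 : RF,
 [/\ [/\ mRX s1, mRX s2, forall x, 0 <= s1 x & forall x, 0 <= s2 x], forall x, P x <= s1 x + s2 x,
   (energy s1 < +oo)%E & (\I_x (s2 x ^+ 2) < +oo)%E].

Definition sqi P := (\I_x (P x ^+ 2) < +oo)%E.

Lemma sqeD (a b : \bar R) : (0 <= a)%E -> (0 <= b)%E -> ((a + b) * (a + b) <= 2%:E * (a * a + b * b))%E.
have h2 : (2%:E * +oo = +oo :> \bar R)%E by rewrite gt0_muley// lte_fin.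
case: a => [a| |]//; case: b => [b| |]// a0 b0; rewrite ?addey// ?addye// ?mulyy ?addey// ?addye// ?h2 ?leey//.
by rewrite -!EFinD -!EFinM lee_fin; have := sqr_ge0 (a - b); nra.
Qed.

Definition J x y : R := jk (x - y).
Lemma J_ge0 x y : 0 <= J x y. Proof. exact: jk_ge0. Qed.
Lemma JC x y : J x y = J y x. Proof. by rewrite /J /jk enormBC. Qed.
Lemma mR2_J : mR2 J.
by rewrite /J /jk; meas. Qed.

Lemma J_int : exists2 A : R, 0 <= A & forall y, (\I_x (J x y) <= A%:E)%E.
have f0 := n3ge0 (@jk_ge0).
have ff : (\I_x (jk (x : R3 R)))%E \is a fin_num by rewrite ge0_fin_numE// jk_int.
exists (fine (\I_x (jk x))%E); first exact: fine_ge0.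
by move=> y; rewrite fineK// (nnint_shift (- y) (@mR_jk) (@jk_ge0)).
Qed.

Lemma sq_conv_D s1 s2 : mRX s1 -> mRX s2 -> nneg s1 -> nneg s2 ->
 let N s := fun x => (\I_y (s y * J x y))%E in
 (\int[mu]_x (N s1 x * N s1 x) < +oo)%E -> (\int[mu]_x (N s2 x * N s2 x) < +oo)%E ->
 (\int[mu]_x (N (fun x => s1 x + s2 x)%R x * N (fun x => s1 x + s2 x)%R x) < +oo)%E.
move=> m1 m2 p1 p2 N f1 f2.
have p12 x : 0 <= s1 x + s2 x by pos.
have m12 : mRX (fun x => s1 x + s2 x) by meas.
have mN s : mRX s -> nneg s -> mEX (N s) by move=> ms s0; have [] := mEX_conv mR2_J J_ge0 ms s0.
have N0 s x : nneg s -> (0 <= N s x)%E by move=> s0; apply: n3ge0 => y; exact: mge0 (s0 y) (J_ge0 x y).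
have eN x : N (fun x => s1 x + s2 x) x = (N s1 x + N s2 x)%E.
 rewrite /N -n3D.
 - by apply: eq_n3 => y; rewrite mulrDl.
 - exact: mR_M m1 (mR2_r x mR2_J).
 - exact: mR_M m2 (mR2_r x mR2_J).
 - by move=> y; exact: mge0 (p1 y) (J_ge0 x y).
 - by move=> y; exact: mge0 (p2 y) (J_ge0 x y).
have M1 := mN _ m1 p1; have M2 := mN _ m2 p2; have M12 := mN _ m12 p12.
have M11 := mEX_M M1 M1; have M22 := mEX_M M2 M2; have MS := emeasurable_funD M11 M22.
have q1 x : (0 <= N s1 x * N s1 x)%E by exact: sqe_ge0.
have q2 x : (0 <= N s2 x * N s2 x)%E by exact: sqe_ge0.
apply: (vialt (\int[mu]_x (2%:E * (N s1 x * N s1 x + N s2 x * N s2 x)))%E).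
 apply: e3le; [exact: (mEX_M M12 M12)|exact: mEX_M (mEX_cst _) MS|by move=> x; exact: sqe_ge0|].
 by move=> x; rewrite eN; apply: sqeD; exact: N0.
rewrite (e3Z MS (ler0n R 2) (fun x => adde_ge0 (q1 x) (q2 x))) (e3D M11 M22 q1 q2).
exact: (ltyM (ler0n R 2 : (0 <= 2%:R%:E)%E) isT (lte_add_pinfty f1 f2)).
Qed.

Lemma energyZ (c : R) s : 0 <= c -> mRX s -> nneg s -> (energy s < +oo)%E ->
 (energy (fun x => (c * s x)%R) < +oo)%E.
move=> c0 ms s0 es.
have m2 : mR2 (fun x y => s x * s y * (dist x y)^-1) by meas.
have f0 x y : 0 <= s x * s y * (dist x y)^-1 by apply: mge0; [pos|pos].
have -> : energy (fun x => (c * s x)%R) = ((c * c)%:E * energy s)%E.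
 rewrite /energy -(e3Z (n3mE m2 f0)); [|pos|by move=> x; exact: n3ge0].
 apply: eq_integral => x _; rewrite -(n3Z (mR2_r x m2)); [|pos|exact: f0].
 by apply: eq_n3 => y; ring.
by apply: ltyM => //; pos.
Qed.

Lemma sq_conv_mono E1 E2 t1 t2 : mR2 E1 -> mR2 E2 -> (forall x y, 0 <= E1 x y) -> mRX t1 -> mRX t2 -> nneg t1 ->
  (forall x y, t1 y * E1 x y <= t2 y * E2 x y) -> (forall x y, 0 <= E2 x y) -> nneg t2 ->
  (\int[mu]_x ((\I_y (t1 y * E1 x y)) * (\I_y (t1 y * E1 x y))) <=
  \int[mu]_x ((\I_y (t2 y * E2 x y)) * (\I_y (t2 y * E2 x y))))%E.
move=> mE1 mE2 E10 mt1 mt2 t10 le E20 t20.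
have [M1 M1'] := mEX_conv mE1 E10 mt1 t10; have [M2 M2'] := mEX_conv mE2 E20 mt2 t20.
have p x y : 0 <= t1 y * E1 x y by pos.
have le' x : (\I_y (t1 y * E1 x y) <= \I_y (t2 y * E2 x y))%E.
 exact: n3le (mR2_r x M1) (mR2_r x M2) (p x) (le x).
have g0 x : (0 <= \I_y (t1 y * E1 x y))%E by exact: n3ge0.
by apply: e3le; [exact: (mEX_M M1' M1')|exact: (mEX_M M2' M2')|by move=> x; exact: sqe_ge0|move=> x; exact: lee_pmul].
Qed.

(** The kernel J lies below a Riesz kernel, which treats the finite-energy part, and is integrable,
    which treats the L^2 part by Schur's test. *)
Lemma src_J P : mRX P -> nneg P -> src P ->
 (\int[mu]_x ((\I_y (P y * J x y)) * (\I_y (P y * J x y))) < +oo)%E.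
move=> mP P0 [s1 [s2 [[m1 m2 p1 p2] hP e1 e2]]].
have [A A0 hA] := J_int; have n0 : 0 <= nc^-1 by pos.
have mS : mRX (fun x => s1 x + s2 x) by meas.
have pS x : 0 <= s1 x + s2 x by pos.
apply: lelt (sq_conv_mono mR2_J mR2_J J_ge0 mP mS P0 (fun x y => lewr (J_ge0 x y) (hP y)) J_ge0 pS) _.
apply: sq_conv_D => //.
 have mr : mR2 (@riesz) by rewrite /riesz; meas.
 have r0 := @riesz_ge0.
 have mc : mRX (fun x => nc^-1 * s1 x) by meas.
 have c0 x : 0 <= nc^-1 * s1 x by pos.
 apply: lelt (sq_conv_mono mR2_J mr J_ge0 m1 mc p1 _ r0 c0) _.
  by move=> x y; rewrite [X in _ <= X * _]mulrC -mulrA; apply: lewl => //; exact: jk_riesz.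
 apply: lelt (riesz_energy mc c0) _; apply: ltyM; [pos|by []|exact: energyZ].
apply: lelt (schur mR2_J J_ge0 A0 _ hA m2 p2) _; last by apply: ltyM => //; pos.
by move=> x; rewrite (eq_n3 (g2 := J ^~ x))// => y; exact: JC.
Qed.

Lemma sqi_src P : mRX P -> nneg P -> sqi P -> src P.
move=> mP P0 hP; exists (fun=> 0), P; split => //.
- by split => //; meas.
- by move=> x; rewrite add0r.
- by rewrite /energy integral0_eq// => x _; rewrite integral0_eq// => y _; rewrite !mul0r.
Qed.

Lemma sqi_le P Q : mRX P -> mRX Q -> (forall x, `|P x| <= Q x) -> sqi Q -> sqi P.
move=> mP mQ le; apply: lelt; apply: n3le; [meas|meas|by move=> x; pos|].
by move=> x; rewrite -(real_normK (num_real (P x))); apply: lerXn2r; rewrite ?nnegrE ?normr_ge0// (le_trans _ (le x)).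
Qed.

Lemma sqiD P1 P2 : mRX P1 -> mRX P2 -> sqi P1 -> sqi P2 -> sqi (fun x => P1 x + P2 x).
move=> m1 m2 h1 h2; have M1 : mRX (fun x => P1 x ^+ 2) := mR_X 2 m1; have M2 : mRX (fun x => P2 x ^+ 2) := mR_X 2 m2.
have M12 : mRX (fun x => P1 x ^+ 2 + P2 x ^+ 2) := mR_D M1 M2.
have q1 x : 0 <= P1 x ^+ 2 by pos.
have q2 x : 0 <= P2 x ^+ 2 by pos.
apply: (vialt (\I_x (2 * (P1 x ^+ 2 + P2 x ^+ 2)))%E).
 apply: n3le; [meas|exact: mR_M (mR_cst _) M12|by move=> x; pos|].
 by move=> x; have := sqr_ge0 (P1 x - P2 x); rewrite sqrrB sqrrD; lra.
rewrite (n3Z M12 (ler0n R 2) (fun x => addr_ge0 (q1 x) (q2 x))) (n3D M1 M2 q1 q2).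
exact: (ltyM (ler0n R 2 : (0 <= 2%:R%:E)%E) isT (lte_add_pinfty h1 h2)).
Qed.

Lemma srcD P1 P2 : mRX P2 -> nneg P2 -> src P1 -> sqi P2 -> src (fun x => P1 x + P2 x).
move=> mP p0 [s1 [s2 [[m1 m2 q1 q2] hP e1 e2]]] h2; exists s1, (fun x => s2 x + P2 x); split => //.
- by split => //; [meas|move=> x; pos].
- by move=> x; rewrite addrA lerD2r.
- exact: sqiD.
Qed.

Lemma src_le P Q : (forall x, P x <= Q x) -> src Q -> src P.
by move=> le [s1 [s2 [h hP e1 e2]]]; exists s1, s2; split => // x; exact: le_trans (hP x).
Qed.

Lemma lty_sq (h : R3 R -> \bar R) s : mEX h -> (forall x, (0 <= h x)%E) -> mRX s -> nneg s ->
 (\int[mu]_x (h x * h x) < +oo)%E -> sqi s -> (\int[mu]_x ((s x)%:E * h x) < +oo)%E.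
move=> mh h0 ms s0 hh hs; have ms2 : mEX (fun x => (s x ^+ 2)%:E) := mEX_EFin (mR_X 2 ms).
have c0 : 0 <= 2^-1 :> R by pos.
have mhh := mEX_M mh mh; have q1 x : (0 <= (s x ^+ 2)%:E)%E by rewrite lee_fin sqr_ge0.
have q2 x : (0 <= h x * h x)%E by exact: sqe_ge0.
have q x : (0 <= (s x ^+ 2)%:E + h x * h x)%E by exact: adde_ge0 (q1 x) (q2 x).
have mS := emeasurable_funD ms2 mhh.
apply: (vialt (\int[mu]_x ((2^-1)%:E * ((s x ^+ 2)%:E + (h x * h x))))%E).
 apply: e3le; [exact: mEX_M (mEX_EFin ms) mh|exact: mEX_M (mEX_cst _) mS|by move=> x; rewrite mule_ge0// lee_fin|].
 by move=> x; rewrite ge0_muleDr//; have := amgm_ereal (s0 x) (h0 x) (@ltr01 R); rewrite mulr1 mul1r.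
rewrite (e3Z mS c0 q) (e3D ms2 mhh q1 q2).
by apply: ltyM; [pos|exact: isT|exact: lte_add_pinfty].
Qed.

Lemma nrm_cI_le (f : CF) : mCX f -> ((nrm (cI f))%:E <= \I_x (nrm (f x)))%E.
move=> mf; have f0 := n3ge0 (fun x => nge0 (f x)); set I := (\int[mu]_x _)%E in f0 *.
have [fN|] := ltP I +oo%E; last by move=> h; apply: le_trans h; exact: leey.
have ff : I \is a fin_num by rewrite ge0_fin_numE.
rewrite -(fineK ff) lee_fin; apply: (cI_le mf (mC_nrm mf)) => [x|]; first exact: lexx.
by rewrite fineK.
Qed.

Lemma sqi_L1 (u v : CF) : mCX u -> mCX v -> sqi (fun x => nrm (u x)) -> sqi (fun x => nrm (v x)) ->
 cL1 (fun x => u x * v x).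
move=> mu_ mv hu hv; split; first meas.
have := @lty_sq (fun x => (nrm (v x))%:E) _ (mEX_EFin (mC_nrm mv)) _ (mC_nrm mu_) (fun x => nge0 (u x)) _ hu.
have -> : (\I_x (nrm (u x * v x)) = \int[mu]_x ((nrm (u x))%:E * (nrm (v x))%:E))%E.
 by apply: eq_integral => x _; rewrite nrmM EFinM.
apply; first pos.
exact: hv.
Qed.

Lemma ae_fin (h : R3 R -> \bar R) : mEX h -> (forall x, (0 <= h x)%E) -> (\int[mu]_x h x < +oo)%E ->
 {ae mu, forall x : R3 R, (h x < +oo)%E}.
move=> mh h0 hi; have ih : mu.-integrable setT h.
 apply/integrableP; split; first exact: mh.
 rewrite [X in (X < _)%E](_ : _ = \int[mu]_x h x)%E; first exact: hi.
 by apply: eq_integral => x _; rewrite gee0_abs.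
have := integrable_ae measurableT ih.
by apply: aeS => x /(_ I); rewrite ge0_fin_numE.
Qed.

Section Potential.
Variables (E : R3 R -> RF) (k : KF) (Q : CF).
Hypotheses (mE : mR2 E) (E0 : forall x y, 0 <= E x y).
Hypotheses (mk : mC2 k) (kJ : forall x y, nrm (k x y) <= E x y) (mQ : mCX Q).
Let N y := (\I_x (nrm (Q x) * E y x))%E.
Definition pot y : R[i] := cI (fun x => k y x * Q x).

Lemma mC2_pot : mC2 (fun y x => k y x * Q x).
meas; apply: (@mC_c _ _ _ _ _ Q snd mQ); mproj. Qed.

Lemma mC_pot : mCX pot.
by apply: cI_cI; meas. Qed.

Lemma pot_N : mEX N /\ forall y, (0 <= N y)%E.
have mq := mC_nrm mQ; have q0 x := nge0 (Q x).
have [_ h] := mEX_conv mE E0 mq q0.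
by split; [exact: h|move=> y; apply: n3ge0 => x; pos].
Qed.

Lemma kQ_N y : (\I_x (nrm (k y x * Q x)) <= N y)%E.
have mq := mC_nrm mQ; apply: n3le.
- exact: mC_nrm (mC2_r y mC2_pot).
- exact: mR_M mq (mR2_r y mE).
- by move=> x; pos.
- by move=> x; rewrite nrmM mulrC; apply: lewl; [pos|exact: kJ].
Qed.

Lemma pot_le y : ((nrm (pot y))%:E <= N y)%E.
exact: le_trans (nrm_cI_le (mC2_r y mC2_pot)) (kQ_N y). Qed.

Lemma pot_sqi : (\int[mu]_y (N y * N y) < +oo)%E -> sqi (fun y => nrm (pot y)).
move=> fN; have [mN N0] := pot_N; have mp := mC_nrm mC_pot; apply: lelt fN; apply: e3le.
- exact: mEX_EFin (mR_X 2 mp).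
- exact: (mEX_M mN mN).
- pos.
- move=> y; rewrite expr2 EFinM; have := pot_le y; have : (0 <= (nrm (pot y))%:E)%E by rewrite lee_fin nge0.
 by move=> h1 h2; exact: lee_pmul.
Qed.

Lemma pot_fubini (h : CF) : mCX h -> (\int[mu]_y ((nrm (h y))%:E * N y) < +oo)%E ->
 [/\ cL1 (fun y => pot y * h y), cL1 (fun x => Q x * cI (fun y => k y x * h y)) &
  cI (fun y => pot y * h y) = cI (fun x => Q x * cI (fun y => k y x * h y))].
move=> mh fh; have [mN N0] := pot_N; have mq := mC_nrm mQ; have mh' := mC_nrm mh.
pose F y x := k y x * Q x * h y.
have mF : mC2 F by apply: mC_M mC2_pot _; apply: (@mC_c _ _ _ _ _ h fst mh); mproj.
have mF' : mR2 (fun y x => nrm (F y x)) := mC_nrm mF.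
have F0 y x := nge0 (F y x).
have mkh : mC2 (fun x y => k y x * h y).
 apply: mC_M; last by apply: (@mC_c _ _ _ _ _ h snd mh); mproj.
 by apply: (@mC_c _ _ _ _ _ (fun p => k p.1 p.2) (fun p => (p.2, p.1)) mk); mproj.
have eF x y : nrm (F y x) = nrm (Q x) * nrm (k y x * h y) by rewrite /F !nrmM; ring.
have iF y : (\I_x (nrm (F y x)) = (nrm (h y))%:E * \I_x (nrm (k y x * Q x)))%E.
 rewrite -(n3Z (mC_nrm (mC2_r y mC2_pot)) (nge0 (h y)) (fun x => nge0 _)).
 by apply: eq_n3 => x; rewrite /F [LHS]nrmM mulrC.
have iF' x : (\I_y (nrm (F y x)) = (nrm (Q x))%:E * \I_y (nrm (k y x * h y)))%E.
 rewrite -(n3Z (mC_nrm (mC2_r x mkh)) (nge0 (Q x)) (fun y => nge0 _)).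
 by apply: eq_n3 => y; exact: eF.
have mpot := mC_pot; have h0 y : (0 <= (nrm (h y))%:E)%E by rewrite lee_fin nge0.
have m1 := mEX_M (mEX_EFin mh') mN; have M1 := n3mE mF' F0.
have fF : (\int[mu]_y \I_x (nrm (F y x)) < +oo)%E.
 apply: lelt fh; apply: e3le => [||y|y]; [exact: M1|exact: m1|by apply: n3ge0|].
 by rewrite iF; apply: leewl; [exact: h0|exact: kQ_N].
have mR : mCX (fun x => cI (fun y => k y x * h y)) by exact: cI_cI mkh.
have fF' : (\int[mu]_x \I_y (nrm (F y x)) < +oo)%E by rewrite -(n3tonelli mF' F0).
have M2 := n3mE (mR2_swap mF') (fun x y => F0 y x).
split.
- split; first exact: mC_M mpot mh.
 apply: lelt fh; apply: e3le => [||y|y]; [exact: mEX_EFin (mC_nrm (mC_M mpot mh))|exact: m1|pos|].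
 by rewrite nrmM mulrC EFinM; apply: leewl; [exact: h0|exact: pot_le].
- split; first meas.
 apply: lelt fF'; apply: e3le => [||x|x]; [exact: mEX_EFin (mC_nrm (mC_M mQ mR))|exact: M2|pos|].
 rewrite iF' nrmM EFinM; apply: leewl; first pos.
 exact: nrm_cI_le (mC2_r x mkh).
- transitivity (cI (fun y => cI (F y))).
  apply: cI_ae; [exact: mC_M mpot mh|exact: cI_cI mF|].
  have hN0 y : (0 <= (nrm (h y))%:E * N y)%E by rewrite mule_ge0.
  have := ae_fin m1 hN0 fh.
  apply: aeS => y hy.
  (* The inner integral is known to converge only where h does not vanish; elsewhere both sides are
     0 because of the factor h. *)
  have [hy0|hn] := eqVneq (h y) 0.
   by rewrite hy0 mulr0 (eq_cI (f2 := fun=> 0)) => [|x]; [rewrite /cI cint0|rewrite /F hy0 mulr0].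
  have kq : cL1 (fun x => k y x * Q x).
   split; first exact: mC2_r y mC2_pot.
   apply: lelt (kQ_N y) _; move: hy; have : 0 < nrm (h y).
    by rewrite lt_def nge0 andbT; apply/eqP => /nrm_eq0/eqP; exact/negP.
   by move: (N0 y); case: (N y) => [a| |] q0 q1; rewrite ?ltry// gt0_muley ?lte_fin// ltxx.
  by rewrite mulrC -(cI_Z (h y) kq); apply: eq_cI => x; rewrite mulrC.
 have mFs : mC2 (fun x y => F y x) by apply: (@mC_c _ _ _ _ _ (fun p => F p.1 p.2) (fun p => (p.2, p.1)) mF); mproj.
 rewrite (cI_fubini mF fF); apply: cI_ae; [exact: cI_cI mFs|meas|].
 have := ae_fin M2 (fun x => n3ge0 (fun y => F0 y x)) fF'.
 apply: aeS => x hx.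
 have [Q0|Qn] := eqVneq (Q x) 0.
  by rewrite Q0 mul0r; rewrite (eq_cI (f2 := fun=> 0)); [exact: cint0|move=> y; rewrite /F Q0 mulr0 mul0r].
 have kh : cL1 (fun y => k y x * h y).
  split; first exact: mC2_r x mkh.
  move: hx; rewrite iF'; have : (0 < nrm (Q x)).
   by rewrite lt_def nge0 andbT; apply/eqP => /nrm_eq0/eqP; exact/negP.
  by case: (\I_y (nrm (k y x * h y)))%E => [a| |] q0; rewrite ?ltry// gt0_muley ?lte_fin// ltxx.
 by rewrite -(cI_Z (Q x) kh); apply: eq_cI => y; rewrite /F; ring.
Qed.

End Potential.

Lemma potJ k Q (mk : mC2 k) (kJ : forall x y, nrm (k x y) <= J x y) (mQ : mCX Q) (sQ : src (fun x => nrm (Q x))) :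
 sqi (fun y => nrm (pot k Q y)) /\ forall h, mCX h -> sqi (fun y => nrm (h y)) ->
 [/\ cL1 (fun y => pot k Q y * h y), cL1 (fun x => Q x * cI (fun y => k y x * h y)) &
  cI (fun y => pot k Q y * h y) = cI (fun x => Q x * cI (fun y => k y x * h y))].
have fN := src_J (mC_nrm mQ) (fun x => nge0 (Q x)) sQ.
split; first exact: pot_sqi mR2_J J_ge0 mk kJ mQ fN.
move=> h mh sh; apply: (pot_fubini mR2_J J_ge0 mk kJ mQ mh).
by have [mN N0] := pot_N mR2_J J_ge0 mQ; exact: lty_sq mN N0 (mC_nrm mh) (fun y => nge0 (h y)) fN sh.
Qed.
End Source.

(** * Inverting 1 - Laplacian on weak solutions *)

Section Elliptic.
Implicit Types (x y w : R3 R) (phi psi : RF) (u F : CF) (g : 'I_3 -> CF) (i : 'I_3).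

Lemma sum3 (T : nmodType) (a : 'I_3 -> T) :
 \sum_(i < 3) a i = a ord0 + (a (lift ord0 ord0) + a (lift ord0 (lift ord0 ord0))).
by rewrite !big_ord_recl big_ord0 addr0. Qed.

Lemma Rk1_J x y : nrm (Rk 1 x y) <= J x y.
by rewrite Rk1E nrm_real ger0_norm ?yuk_ge0// yuk_jk. Qed.

Lemma dRk1_J i x y : nrm (dRk i 1 x y) <= J x y.
apply: le_trans (dRk_le i x y (ler01 : 0 <= Re (1 : R[i]))) _.
have -> : nrm (1 : R[i]) = 1 by rewrite -[1]/(1%:C) nrm_real normr1.
rewrite /J /jk; set t := dist x y; have [->|t0] := eqVneq t 0.
 by rewrite expr0n /= !invr0 !mulr0 addr0 mulr0 mul0r.
have n0 : nc != 0 :> R by rewrite gt_eqF ?newton_gt0.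
by rewrite /= !mul1r [leLHS](_ : _ = nc^-1 * ((1 + t) * expR (- t) * t ^- 2))//; field; rewrite n0 t0.
Qed.

Lemma test_sqi phi : testf phi -> mCX (fun x => (phi x)%:C) /\ sqi (fun x => nrm (phi x)%:C).
move=> tp; have mp := testf_mR tp; have [B [r [B0 r0 h]]] := test_near tp.
have mb := mR_ballf 0 r.
split; first meas; apply: (vialt (\I_x (B ^+ 2 * ballf 0 r x))%E).
 apply: n3le; [meas|meas|by move=> x; pos|].
 move=> x; rewrite nrm_real; apply: (via ((B * ballf 0 r x) ^+ 2)).
  by apply: lerXn2r; rewrite ?nnegrE ?normr_ge0 ?mge0 ?ballf_ge0.
 by rewrite exprMn; apply: lewl; [pos|]; rewrite /ballf; case: ifP => _; rewrite ?expr1n// expr0n.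
rewrite (n3Z mb (sqr_ge0 B) (ballf_ge0 0 r)).
apply: ltyM; [pos|exact: isT|].
by apply: lelt (nnballf 0 (ltW r0)) _; exact: ltry.
Qed.

Lemma test_helmholtz phi : testf phi -> testf (fun x => phi x - lap phi x).
move=> tp; have [_ [B [r [B0 r0 h]]]] := helmholtz_test tp; split; last first.
 exists r => x xr; apply/eqP; rewrite -normr_le0; apply: le_trans (h x) _.
 by rewrite /ballf subr0 ifF ?mulr0//; apply/negbTE; rewrite -ltNge.
apply: smoothP => k; apply: CkD; first exact: smooth_Ck tp.1 _.
have -> : (fun x => - lap phi x) = fun x => (fun=> -1) x * (pd ord0 (pd ord0 phi) x +
  (pd (lift ord0 ord0) (pd (lift ord0 ord0) phi) x +
  pd (lift ord0 (lift ord0 ord0)) (pd (lift ord0 (lift ord0 ord0)) phi) x)).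
 by fext => x; rewrite mulN1r; congr (- _); exact: (sum3 (fun i => pd i (pd i phi) x)).
apply: CkM; first exact: Ck_cst.
have h2 i : Ck k (pd i (pd i phi)) by apply: smooth_Ck; apply: smooth_partial; apply: smooth_partial; exact: tp.1.
by apply: CkD => //; exact: CkD.
Qed.

Lemma dRk_inverts i phi x : testf phi ->
 cI (fun y => dRk i 1 y x * (phi y - lap phi y)%:C) = - (pd i phi x)%:C.
move=> tp; have th := test_helmholtz tp; have m1 : 0 <= Re (1 : R[i]) by exact: ler01.
have y1 : (\int[mu]_x `|yuk x|%:E < +oo)%E.
 apply: lelt jk_int; apply: n3le; [exact: mR_norm (@mR_yuk)|exact: mR_jk|by move=> z; pos|].
 by move=> z; rewrite ger0_norm ?yuk_ge0// yuk_jk.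
have e : conv yuk (fun x => phi x - lap phi x) = phi.
 by fext => z; apply: (@complexI R); rewrite (convE) yuk_inverts.
have -> : pd i phi x = conv yuk (pd i (fun x => phi x - lap phi x)) x.
 by rewrite -(conv_partial (@mR_yuk) y1 i th) e.
rewrite convE (yuk_shift x (testf_mR (tpd i th))).
by rewrite (Rk_partial i x m1 th) opprK.
Qed.

Section Inverse.
Variables (u F : CF) (g : 'I_3 -> CF).
Hypotheses (mu_ : mCX u) (su : sqi (fun x => nrm (u x))) (mF : mCX F) (sF : src (fun x => nrm (F x))).
Hypotheses (mg : forall i, mCX (g i)) (sg : forall i, sqi (fun x => nrm (g i x))).
Hypothesis eq_u : forall phi, testf phi -> cI (fun x => u x * (- lap phi x)%:C) =
 cI (fun x => F x * (phi x)%:C) + \sum_i cI (fun x => g i x * (pd i phi x)%:C).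

Lemma src_Fu : src (fun x => nrm (F x + u x)).
apply: (src_le (fun x => nrmD (F x) (u x))).
by apply: (srcD (mC_nrm mu_) _ sF su) => x; pos.
Qed.

Lemma sg_src i : src (fun x => nrm (g i x)).
by apply: (sqi_src (mC_nrm (mg i)) _ (sg i)) => x; pos. Qed.

(** The hypothesis reads $-\Delta u=F-\mathrm{div}\,g$, so $(1-\Delta)u=F+u-\mathrm{div}\,g$. The
    difference of the two sides is in L^2 and annihilated by $1-\Delta$, hence 0 by [liouville]. *)
Lemma inverse_ae : {ae mu, forall x : R3 R, u x = pot (Rk 1) (fun x => F x + u x) x - \sum_i pot (dRk i 1) (g i) x}.
have mQ : mCX (fun x => F x + u x) by meas.
have mR1 := @mC2_Rk 1; have mdR i := @mC2_dRk i 1; have sQ := src_Fu; have sg' := sg_src.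
pose p0 := pot (Rk 1) (fun x => F x + u x); pose pi_ i := pot (dRk i 1) (g i).
have mp0 : mCX p0 := mC_pot mR1 mQ; have mpi i : mCX (pi_ i) := mC_pot (mdR i) (mg i).
have sp0 : sqi (fun x => nrm (p0 x)) := (potJ mR1 Rk1_J mQ sQ).1.
have spi i : sqi (fun x => nrm (pi_ i x)) := (potJ (mdR i) (dRk1_J i) (mg i) (sg' i)).1.
have mS : mCX (fun x => \sum_i pi_ i x) by apply: mC_sum => i; exact: mpi.
pose w x := u x - (p0 x - \sum_i pi_ i x).
have mw : mCX w by exact: mC_D mu_ (mC_N (mC_D mp0 (mC_N mS))).
have sw : sqi (fun x => nrm (w x)).
 pose b x := (nrm (u x) + nrm (p0 x)) + (nrm (pi_ ord0 x) + (nrm (pi_ (lift ord0 ord0) x) + nrm (pi_ (lift ord0 (lift ord0 ord0)) x))).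
 have m0 := mC_nrm mu_; have m1 := mC_nrm mp0; have m2 i := mC_nrm (mpi i).
 have mb : mRX b by exact: mR_D (mR_D m0 m1) (mR_D (m2 _) (mR_D (m2 _) (m2 _))).
 apply: (sqi_le (mC_nrm mw) mb).
  move=> x; rewrite (ger0_norm (nge0 _)); apply: le_trans (nrmB _ _) _.
  rewrite /b -addrA lerD2l; apply: le_trans (nrmB _ _) _; rewrite lerD2l.
  by apply: le_trans (nrm_sum _ _) _; rewrite (sum3 (fun i => nrm (pi_ i x))).
 exact: (sqiD (mR_D m0 m1) (mR_D (m2 _) (mR_D (m2 _) (m2 _))) (sqiD m0 m1 su sp0) (sqiD (m2 _) (mR_D (m2 _) (m2 _)) (spi _) (sqiD (m2 _) (m2 _) (spi _) (spi _)))).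
have : {ae mu, forall x : R3 R, w x = 0}.
 apply: (liouville mw sw) => phi tp.
 have th := test_helmholtz tp; have [mh sh] := test_sqi th; have [mp sp] := test_sqi tp.
 set h := (fun x => (_)%:C) in mh sh.
 have [a1 a2 a3] := (potJ mR1 Rk1_J mQ sQ).2 _ mh sh.
 have b i := (potJ (mdR i) (dRk1_J i) (mg i) (sg' i)).2 _ mh sh.
 have lu := sqi_L1 mu_ mh su sh; have lup := sqi_L1 mu_ mp su sp.
 have lS : cL1 (fun x => \sum_i pi_ i x * h x) by apply: cL1_sum => i; case: (b i).
 have lP : cL1 (fun x => p0 x * h x - \sum_i pi_ i x * h x) by exact: cL1_B a1 lS.
 have -> : cI (fun x => w x * (phi x - lap phi x)%:C) = cI (fun x => u x * h x - (p0 x * h x - \sum_i pi_ i x * h x)).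
  by apply: eq_cI => x; rewrite /w -mulr_suml !mulrBl.
 rewrite (cI_B lu lP) (cI_B a1 lS) (cI_sum (index_enum 'I_3) (F := fun i x => pi_ i x * h x)); last by move=> i; case: (b i).
 have e1 x : (F x + u x) * cI (fun y => Rk 1 y x * h y) = F x * (phi x)%:C + u x * (phi x)%:C.
  by rewrite (Rk_inverts x tp) mulrDl.
 have lF : cL1 (fun x => F x * (phi x)%:C).
  have := cL1_B a2 lup; rewrite (_ : (fun x => _ - _) = fun x => F x * (phi x)%:C)//.
  by fext => x; rewrite e1 addrK.
 have -> : cI (fun x => p0 x * h x) = cI (fun x => F x * (phi x)%:C) + cI (fun x => u x * (phi x)%:C).
  by rewrite a3 -(cI_D lF lup); apply: eq_cI => x; exact: e1.
 have e2 i : cI (fun x => pi_ i x * h x) = - cI (fun x => g i x * (pd i phi x)%:C).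
  have [_ _ ->] := b i; have [mpi' spi'] := test_sqi (tpd i tp).
  rewrite -(cI_N (sqi_L1 (mg i) mpi' (sg i) spi')); apply: eq_cI => x.
  by rewrite (dRk_inverts i x tp) mulrN.
 rewrite (eq_bigr _ (fun i _ => e2 i)) sumrN opprK.
 have [ml sl] : mCX (fun x => (- lap phi x)%:C) /\ sqi (fun x => nrm (- lap phi x)%:C).
  have m1 : mCX (fun x => (- lap phi x)%:C) by apply: mC_real; apply: mR_N; exact: mR_laplacian.
  split => //; apply: (sqi_le (mC_nrm m1) (mR_D (mC_nrm mh) (mC_nrm mp))); last exact: (sqiD (mC_nrm mh) (mC_nrm mp) sh sp).
  move=> x; rewrite (ger0_norm (nge0 _)) -[X in nrm X](_ : h x - (phi x)%:C = _); first exact: nrmB.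
  by rewrite /h -rmorphB /= addrAC subrr add0r.
 have lul := sqi_L1 mu_ ml su sl.
 have -> : cI (fun x => u x * h x) = cI (fun x => u x * (phi x)%:C) + cI (fun x => u x * (- lap phi x)%:C).
  by rewrite -(cI_D lup lul); apply: eq_cI => x; rewrite -mulrDr -rmorphD.
 by rewrite (eq_u tp); ring.
apply: aeS => x /eqP; rewrite subr_eq0 => /eqP; exact.
Qed.

End Inverse.
End Elliptic.

(** * Translating the function spaces and the weak equation of the definitions *)

Section Spaces.
Implicit Types (x y w : R3 R) (V phi psi : RF) (u F f h : CF) (i : 'I_3).

Lemma eq_lty (h k : R3 R -> \bar R) : h =1 k -> (\int[mu]_x h x < +oo)%E -> (\int[mu]_x k x < +oo)%E.
by move=> /funext ->. Qed.

Lemma Lfun2P (g : RF) : g \in Lfun (@leb3 R) 2%:E <-> mRX g /\ sqi g.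
rewrite /sqi; split.
 move=> h; have /integrableP[_] := Lfun2_integrable_sqr h.
 rewrite leb3E => hi; split; first by move: h; rewrite inE => /andP[/[!inE]/=].
 by apply: eq_lty hi => x; rewrite gee0_abs// lee_fin sqr_ge0.
move=> [mg sg]; rewrite inE; apply/andP; split; rewrite inE //=.
rewrite /finite_norm unlock; apply: poweR_lty; rewrite leb3E; apply: eq_lty sg => x.
by rewrite abse_EFin poweR_EFin powR_mulrn// real_normK// num_real.
Qed.

Lemma in_L2P f : in_L2 f <-> mCX f /\ sqi (fun x => nrm (f x)).
have e : sqi (fun x => nrm (f x)) = ((\I_x (Re (f x) ^+ 2 + Im (f x) ^+ 2)) < +oo)%E.
 by rewrite /sqi (eq_n3 (g2 := fun x => Re (f x) ^+ 2 + Im (f x) ^+ 2))// => x; rewrite nrm_sqr.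
rewrite /in_L2 e; split=> [[/Lfun2P[m1 s1] /Lfun2P[m2 s2]]|[[m1 m2]]].
 split; first by split.
 rewrite (n3D (mR_X 2 m1) (mR_X 2 m2) (fun x => sqr_ge0 _) (fun x => sqr_ge0 _)); exact: lte_add_pinfty s1 s2.
rewrite (n3D (mR_X 2 m1) (mR_X 2 m2) (fun x => sqr_ge0 _) (fun x => sqr_ge0 _)) => s12.
have p1 := n3ge0 (fun x => sqr_ge0 (Re (f x))); have p2 := n3ge0 (fun x => sqr_ge0 (Im (f x))).
by split; apply/Lfun2P; split => //; apply: lelt s12; [exact: leeDl|exact: leeDr].
Qed.

Definition loc f := mCX f /\ forall r, (\I_x (ballf 0 r x * nrm (f x)) < +oo)%E.

Lemma eball_int (h : RF) r : (\int[@leb3 R]_(x in eball r) `|(h x)%:E| = \I_x (ballf 0 r x * `|h x|))%E.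
rewrite integral_mkcond leb3E; apply: eq_integral => x _.
rewrite patchE /ballf subr0 abse_EFin; case: ifPn => [/[!inE]/= hx|/negP hx].
 by rewrite hx mul1r.
by rewrite ifF ?mul0r//; apply/negP => hx'; apply: hx; rewrite inE.
Qed.

Lemma mR_eball (h : RF) (r : R) : mRX h -> measurable_fun (eball r : set X) (EFin \o h).
by move=> mh; apply: (@measurable_funTS _ _ X); exact: mEX_EFin. Qed.

Lemma loc_in_L1loc f : loc f -> in_L1loc f.
move=> [[m1 m2] lf] r; have mb := mR_ballf 0 r; have b0 := ballf_ge0 (0 : R3 R) r.
have mf : mRX (fun x => nrm (f x)) by apply: mC_nrm; split.
have key (g : RF) : mRX g -> (forall x, `|g x| <= nrm (f x)) -> leb3.-integrable (eball r) (fun x => (g x)%:E).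
 move=> mg hg; apply/integrableP; split; first exact: mR_eball.
 rewrite eball_int; apply: lelt (lf r); apply: n3le.
 - meas.
 - exact: mR_M mb mf.
 - by move=> x; pos.
 - by move=> x; apply: lewl.
by split; apply: key => // x; [exact: Re_le_nrm|exact: Im_le_nrm].
Qed.

Lemma in_L1loc_loc f : mCX f -> in_L1loc f -> loc f.
move=> mf lf; split => // r; have [m1 m2] := mf; have mb := mR_ballf 0 r; have b0 := ballf_ge0 (0 : R3 R) r.
have [/integrableP[_ i1] /integrableP[_ i2]] := lf r; rewrite !eball_int in i1 i2.
have M1 := mR_M mb (mR_norm m1); have M2 := mR_M mb (mR_norm m2).
apply: (vialt (\I_x (ballf 0 r x * `|Re (f x)| + ballf 0 r x * `|Im (f x)|))%E).
 apply: n3le; [meas|meas|by move=> x; pos|].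
 by move=> x; rewrite -mulrDr; apply: lewl; [exact: b0|exact: nrm_le_ReIm].
rewrite (n3D M1 M2 (fun x => mge0 (b0 x) (normr_ge0 _)) (fun x => mge0 (b0 x) (normr_ge0 _))).
exact: lte_add_pinfty i1 i2.
Qed.

Lemma ball_fin r : (\I_x (ballf (0 : R3 R) r x) < +oo)%E.
apply: (vialt (\I_x (ballf 0 `|r| x))%E).
 apply: n3le; [exact: mR_ballf|exact: mR_ballf|by move=> x; pos|move=> x].
 rewrite /ballf; case: ifPn => h; last by case: ifP.
 by rewrite (le_trans h (ler_norm r)).
by apply: lelt (nnballf 0 (normr_ge0 r)) _; exact: ltry.
Qed.

(* |W f| <= W + W |f|^2 *)
Lemma loc_weighted (W : RF) f : mRX W -> nneg W -> mCX f ->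
 (forall r, (\I_x (ballf 0 r x * W x) < +oo)%E) -> (\I_x (W x * nrm (f x) ^+ 2) < +oo)%E ->
 forall r, (\I_x (ballf 0 r x * (W x * nrm (f x))) < +oo)%E.
move=> mW W0 mf hW hf r; have mb := mR_ballf 0 r; have b0 := ballf_ge0 (0 : R3 R) r.
have mm := mC_nrm mf; have M1 := mR_M mb mW; have M2 := mR_M mW (mR_X 2 mm).
apply: (vialt (\I_x (ballf 0 r x * W x + W x * nrm (f x) ^+ 2))%E).
 apply: n3le; [meas|meas|by move=> x; pos|].
 move=> x; have t0 := nge0 (f x); have w0 := W0 x; rewrite /ballf; case: ifPn => _; last first.
  by rewrite !mul0r add0r; pos.
 rewrite !mul1r -{2}[W x]mulr1 -mulrDr; apply: lewl => //; have := sqr_ge0 (nrm (f x) - 1); nra.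
rewrite (n3D M1 M2 (fun x => mge0 (b0 x) (W0 x)) (fun x => mge0 (W0 x) (sqr_ge0 _))).
exact: lte_add_pinfty (hW r) hf.
Qed.

Lemma loc_sqi f : mCX f -> sqi (fun x => nrm (f x)) -> loc f.
move=> mf sf; split => // r.
rewrite (eq_n3 (g2 := fun x => ballf 0 r x * (1 * nrm (f x)))); last by move=> x; rewrite mul1r.
apply: (@loc_weighted (fun=> 1) f (mR_cst _) (fun=> ler01) mf).
 by move=> s; rewrite (eq_n3 (g2 := ballf 0 s)) => [|x]; [exact: ball_fin|rewrite mulr1].
by rewrite (eq_n3 (g2 := fun x => nrm (f x) ^+ 2)) => [|x]; [exact: sf|rewrite mul1r].
Qed.

Lemma kato_ball (W : RF) A r : katob W A -> (\I_x (ballf 0 r x * W x) < +oo)%E.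
move=> kW; have [mW W0 hW] := kW; have mo := @mR_omega; have r1 : 0 <= 1 + `|r| by pos.
apply: (vialt (\I_x ((1 + `|r|) * (W x * omega x)))%E).
 apply: n3le; [exact: mR_M (mR_ballf 0 r) mW|meas|by move=> x; pos|].
 move=> x; rewrite mulrCA mulrC; apply: lewl; first exact: W0.
 have x0 := enge0 x; have r0 := ler_norm r; rewrite /ballf subr0 /omega; case: ifPn => h; last pos.
 by rewrite ler_pdivlMr ?ltr_pwDl// mul1r; lra.
rewrite (n3Z (mR_M mW mo) r1 (fun x => mge0 (W0 x) (omega_ge0 x))).
apply: ltyM; [pos|exact: isT|by apply: lelt (kato_omega_int kW) _; exact: ltry].
Qed.

Lemma loc_V V A u : mRX V -> katob (fun x => `|V x|) A -> mCX u ->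
 (\I_x (`|V x| * nrm (u x) ^+ 2) < +oo)%E -> loc (fun x => (V x)%:C * u x).
move=> mV kV mu_ fV; split => [|r]; first meas.
rewrite (eq_n3 (g2 := fun x => ballf 0 r x * (`|V x| * nrm (u x)))) => [|x]; last by rewrite nrmM nrm_real.
by apply: loc_weighted => //; [meas|move=> s; exact: kato_ball kV].
Qed.

Lemma loc_test h phi : loc h -> testf phi -> cL1 (fun x => h x * (phi x)%:C).
move=> [mh lh] tp; have [B [r [B0 r0 hB]]] := test_near tp; have mm := mC_nrm mh.
have M := mR_M (mR_ballf 0 r) mm.
apply: (cL1_le (g := fun x => B * (ballf 0 r x * nrm (h x)))).
- exact: mC_M mh (mC_real (testf_mR tp)).
- exact: mR_M (mR_cst _) M.
- move=> x; rewrite nrmM nrm_real mulrA mulrC.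
 by apply: lewr; [pos|exact: hB].
- rewrite (n3Z M B0 (fun x => mge0 (ballf_ge0 0 r x) (nge0 _))).
 by apply: ltyM; [pos|exact: isT|exact: lh].
Qed.

Lemma lap_test h phi : loc h -> testf phi -> cL1 (fun x => h x * (- lap phi x)%:C).
move=> lh tp; have := cL1_B (loc_test lh (test_helmholtz tp)) (loc_test lh tp).
rewrite (_ : (fun x => _ - _) = fun x => h x * (- lap phi x)%:C)//.
by fext => x; rewrite -mulrBr -rmorphB /= addrAC subrr add0r.
Qed.

(** The definition puts all terms under one integral, which may be split once each term is locally
    integrable. *)
Lemma weak_eqP V u f phi : loc u -> loc (fun x => (V x)%:C * u x) -> loc f -> testf phi ->
 (cintegral (fun x => - u x * (lap phi x)%:C + (V x)%:C * u x * (phi x)%:C) =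
 cintegral (fun x => f x * (phi x)%:C)) <->
 cI (fun x => u x * (- lap phi x)%:C) = cI (fun x => (f x - (V x)%:C * u x) * (phi x)%:C).
move=> lu lV lf tp; rewrite !cintegralE -!/(cI _).
have -> : cI (fun x => - u x * (lap phi x)%:C + (V x)%:C * u x * (phi x)%:C) =
  cI (fun x => u x * (- lap phi x)%:C) + cI (fun x => (V x)%:C * u x * (phi x)%:C).
 rewrite -(cI_D (lap_test lu tp) (loc_test lV tp)); apply: eq_cI => x.
 by rewrite rmorphN /= mulrN mulNr.
have -> : cI (fun x => (f x - (V x)%:C * u x) * (phi x)%:C) =
  cI (fun x => f x * (phi x)%:C) - cI (fun x => (V x)%:C * u x * (phi x)%:C).
 by rewrite -(cI_B (loc_test lf tp) (loc_test lV tp)); apply: eq_cI => x; rewrite mulrBl.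
by split => [<-|->]; rewrite ?addrK// subrK.
Qed.

End Spaces.

(** * H^1 regularity and Green's identity *)

Section Regularity.
Implicit Types (x y w : R3 R) (V phi psi : RF) (i : 'I_3).

(** In the expanded product the finite-energy part pairs with itself because [yuk] lies below the
    Coulomb kernel; every other pair has an L^2 factor and is covered by [src_J]. *)
Lemma src_yuk P : mRX P -> nneg P -> src P ->
 (\int[mu]_y ((P y)%:E * \I_x (P x * yuk (y - x))) < +oo)%E.
move=> mP P0 [s1 [s2 [[m1 m2 p1 p2] hP e1 e2]]].
pose S x := s1 x + s2 x; have mS : mRX S := mR_D m1 m2; have S0 x : 0 <= S x := addr_ge0 (p1 x) (p2 x).
have sS : src S by exists s1, s2.
have mY : mR2 (fun x y : R3 R => yuk (x - y)) by rewrite /yuk; meas.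
have Y0 x y : 0 <= yuk (x - y : R3 R) by exact: yuk_ge0.
have YJ x y : yuk (x - y) <= J x y := yuk_jk _.
have mfst (f : RF) : mRX f -> mR2 (fun y x => f y) by move=> mf; apply: (@mR_c _ _ _ _ _ f fst mf); mproj.
have msnd (f : RF) : mRX f -> mR2 (fun y x => f x) by move=> mf; apply: (@mR_c _ _ _ _ _ f snd mf); mproj.
have mF (f g : RF) : mRX f -> mRX g -> mR2 (fun y x => f y * (g x * yuk (y - x))).
 by move=> mf mg; exact: mR_M (mfst _ mf) (mR_M (msnd _ mg) mY).
have F0 (f g : RF) : nneg f -> nneg g -> forall y x, 0 <= f y * (g x * yuk (y - x)).
 by move=> f0 g0 y x; pos.
pose I f g := (\int[mu]_y \I_x (f y * (g x * yuk (y - x))))%E.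
have eI (f g : RF) : mRX f -> mRX g -> nneg f -> nneg g ->
  (\int[mu]_y ((f y)%:E * \I_x (g x * yuk (y - x))) = I f g)%E.
 move=> mf mg f0 g0; apply: eq_integral => y _; rewrite (n3Z (mR_M mg (mR2_r y mY)) (f0 y))//.
 by move=> x; pos.
have i2 : (I s2 S < +oo)%E.
 rewrite -eI//; have [mN hN] := mEX_conv mR2_J (@J_ge0) mS S0.
 have N0 y : (0 <= \I_x (S x * J y x))%E by apply: n3ge0 => x; exact: mge0 (S0 x) (J_ge0 y x).
 have := lty_sq hN N0 m2 p2 (src_J mS S0 sS) e2; apply: lelt.
 have [_ hY] := mEX_conv mY Y0 mS S0.
 apply: e3le; [exact: mEX_M (mEX_EFin m2) hY|exact: mEX_M (mEX_EFin m2) hN|move=> y|move=> y].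
  by apply: mule_ge0; [pos|apply: n3ge0 => x; pos].
 apply: leewl; first pos.
 apply: n3le; [exact: mR_M mS (mR2_r y mY)|exact: mR_M mS (mR2_r y mR2_J)|by move=> x; pos|].
 by move=> x; apply: lewl; [exact: S0|exact: YJ].
have i3 : (I S s2 < +oo)%E.
 rewrite /I (n3tonelli (mF _ _ mS m2) (F0 _ _ S0 p2)).
 apply: (eq_lty _ i2) => y; apply: eq_n3 => x; rewrite mulrCA (_ : yuk (x - y) = yuk (y - x))//.
 by rewrite /yuk enormBC.
have i1 : (I s1 s1 < +oo)%E.
 have n0 : 0 <= nc^-1 by pos.
 have me : mR2 (fun x y => s1 x * s1 y * (dist x y)^-1) by meas.
 have e0 x y : 0 <= s1 x * s1 y * (dist x y)^-1 by apply: mge0; [pos|pos].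
 apply: (vialt (nc^-1%:E * energy s1)%E); last exact: ltyZ n0 e1.
 rewrite /energy -(e3Z (n3mE me e0) n0 (fun x => n3ge0 (e0 x))); apply: e3le.
 - exact: n3mE (mF _ _ m1 m1) (F0 _ _ p1 p1).
 - exact: mEX_M (mEX_cst _) (n3mE me e0).
 - by move=> y; apply: n3ge0; exact: F0.
 move=> y; rewrite -(n3Z (mR2_r y me) n0 (e0 y)); apply: n3le.
 - exact: mR2_r y (mF _ _ m1 m1).
 - exact: mR_M (mR_cst _) (mR2_r y me).
 - exact: F0.
 move=> x; rewrite mulrA [leRHS]mulrCA; apply: lewl; first pos.
 rewrite /yuk invfM mulrCA; apply: lewl => //; apply: ler_piMl; first pos.
 by rewrite expRN invf_le1 ?expR_gt0// -expR0 ler_expR enge0.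
rewrite (eI _ _ mP mP P0 P0); apply: (vialt (I s1 s1 + (I s2 S + I S s2))%E); last exact: lte_add_pinfty i1 (lte_add_pinfty i2 i3).
have M f g (mf : mRX f) (mg : mRX g) (f0 : forall x, 0 <= f x) (g0 : forall x, 0 <= g x) := n3mE (mF f g mf mg) (F0 f g f0 g0).
have G f g (f0 : forall x, 0 <= f x) (g0 : forall x, 0 <= g x) y := n3ge0 (F0 f g f0 g0 y).
rewrite /I -[X in (_ + X)%E](e3D (M _ _ m2 mS p2 S0) (M _ _ mS m2 S0 p2) (G _ _ p2 S0) (G _ _ S0 p2)).
rewrite -(e3D (M _ _ m1 m1 p1 p1)); last 3 first.
- exact: emeasurable_funD (M _ _ m2 mS p2 S0) (M _ _ mS m2 S0 p2).
- exact: G.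
- by move=> y; exact: adde_ge0 (G _ _ p2 S0 y) (G _ _ S0 p2 y).
apply: e3le; [exact: M|by apply: emeasurable_funD; [exact: M|apply: emeasurable_funD; exact: M]|exact: G|move=> y].
rewrite -(n3D (mR2_r y (mF _ _ m2 mS)) (mR2_r y (mF _ _ mS m2)) (F0 _ _ p2 S0 y) (F0 _ _ S0 p2 y)).
rewrite -(n3D (mR2_r y (mF _ _ m1 m1)) (mR_D (mR2_r y (mF _ _ m2 mS)) (mR2_r y (mF _ _ mS m2))) (F0 _ _ p1 p1 y)); last first.
 by move=> x; pos.
apply: n3le; [exact: mR2_r y (mF _ _ mP mP)| |exact: F0|move=> x].
 exact: mR_D (mR2_r y (mF _ _ m1 m1)) (mR_D (mR2_r y (mF _ _ m2 mS)) (mR2_r y (mF _ _ mS m2))).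
have := Y0 y x; move: (yuk (y - x)) => t t0.
rewrite [leRHS](_ : _ = (s1 y * s1 x + (s2 y * S x + S y * s2 x)) * t); last by ring.
rewrite mulrA; apply: lewr t0 _ _ _.
apply: (via (S y * S x)); first by apply: ler_pM.
by rewrite /S; have := mge0 (p2 y) (p2 x); have := p1 x; nra.
Qed.

Lemma conjM_conj (a b : R[i]) : (a * b^*%C)^*%C = b * a^*%C.
by case: a b => [a1 a2] [b1 b2]; apply: ceqP => /=; ring. Qed.

Lemma conj_realM (a : R) (b : R[i]) : (a%:C * b)^*%C = a%:C * b^*%C.
by case: b => [b1 b2]; apply: ceqP => /=; ring. Qed.

Section Green.
Variables (u F : CF).
Hypotheses (mu_ : mCX u) (su : sqi (fun x => nrm (u x))) (mF : mCX F) (sF : src (fun x => nrm (F x))).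
Hypothesis eq_u : forall phi, testf phi -> cI (fun x => u x * (- lap phi x)%:C) = cI (fun x => F x * (phi x)%:C).

Let Q x := F x + u x.
Let mQ : mCX Q := mC_D mF mu_.
Let sQ : src (fun x => nrm (Q x)) := src_Fu mu_ su sF.

Lemma u_pot : {ae mu, forall x : R3 R, u x = pot (Rk 1) Q x}.
have s0 : sqi (fun x : R3 R => nrm (0 : R[i])).
 by rewrite /sqi integral0_eq// => x _; rewrite nrm0 expr0n.
have := inverse_ae (g := fun _ _ => 0) mu_ su mF sF (fun=> mC_cst 0) (fun=> s0).
have z k x : cI (fun w => k x w * 0 : R[i]) = 0 by rewrite (eq_cI (f2 := fun=> 0)) => [|w]; [rewrite /cI cint0|rewrite mulr0].
move=> h; apply: (aeS (h _)) => [x ->|phi tp].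
 by rewrite big1 ?subr0// => i _; exact: z.
rewrite (eq_u tp) big1 ?addr0// => i _.
by rewrite (eq_cI (f2 := fun=> 0)) => [|x]; [rewrite /cI cint0|rewrite mul0r].
Qed.

(** As $u=(1-\Delta)^{-1}(F+u)$, the gradient is the potential of F + u for the differentiated
    kernel, which is also below J. *)
Lemma gradient : exists g : 'I_3 -> CF, [/\ forall i, mCX (g i), forall i, sqi (fun x => nrm (g i x)) &
 forall i phi, testf phi -> cI (fun x => u x * (pd i phi x)%:C) = - cI (fun x => g i x * (phi x)%:C)].
have mdR i := @mC2_dRk i 1.
have hg i := potJ (mdR i) (dRk1_J i) mQ sQ.
exists (fun i => pot (dRk i 1) Q); split => [i|i|i phi tp]; [exact: mC_pot (mdR i) mQ|exact: (hg i).1|].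
have [mp sp] := test_sqi tp; have [mp' sp'] := test_sqi (tpd i tp).
have [_ _ e1] := (hg i).2 _ mp sp; have [a1 _ e2] := (potJ (@mC2_Rk 1) (@Rk1_J) mQ sQ).2 _ mp' sp'.
rewrite e1; transitivity (cI (fun y => pot (Rk 1) Q y * (pd i phi y)%:C)).
 apply: cI_ae; [exact: mC_M mu_ mp'|exact: a1.1|].
 by apply: (aeS u_pot) => x ->.
have [_ l1 _] := (hg i).2 _ mp sp.
rewrite e2 -(cI_N l1); apply: eq_cI => x.
by rewrite (Rk_partial i x (ler01 : 0 <= Re (1 : R[i])) tp) mulrN.
Qed.

(** With $Q=F+u$ and $u=YQ$ for $Y=(1-\Delta)^{-1}$, the integral of $\bar Q\,YQ$ is real because
    the kernel of Y is real and symmetric; removing $|u|^2$ leaves $\bar Fu$. This is the reality of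
    $\int|\nabla u|^2$ without a gradient. *)
Lemma green : cL1 (fun x => (F x)^*%C * u x) /\ Im (cI (fun x => (F x)^*%C * u x)) = 0.
have mY : mR2 (fun x y : R3 R => yuk (x - y)) by rewrite /yuk; meas.
have Y0 x y : 0 <= yuk (x - y : R3 R) by exact: yuk_ge0.
have RY x y : nrm (Rk 1 x y) <= yuk (x - y) by rewrite Rk1E nrm_real ger0_norm.
have mQm := mC_nrm mQ; have q0 x := nge0 (Q x).
have fY := src_yuk mQm q0 sQ.
have mc : mCX (fun x => (Q x)^*%C) by meas.
have fh : (\int[mu]_y ((nrm (Q y)^*%C)%:E * \I_x (nrm (Q x) * yuk (y - x))) < +oo)%E.
 by apply: eq_lty fY => y; rewrite nrm_conj.
have [a1 a2 a3] := pot_fubini mY Y0 (@mC2_Rk 1) RY mQ mc fh.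
have mpot := mC_pot (@mC2_Rk 1) mQ.
have real : Im (cI (fun y => pot (Rk 1) Q y * (Q y)^*%C)) = 0.
 have e : cI (fun x => Q x * cI (fun y => Rk 1 y x * (Q y)^*%C)) = (cI (fun y => pot (Rk 1) Q y * (Q y)^*%C))^*%C.
  rewrite -(cI_conj a1); apply: cI_ae; [exact: a2.1|exact: mC_conj a1.1|].
  have [mN N0] := pot_N mY Y0 mQ.
  have hN0 y : (0 <= (nrm (Q y))%:E * \I_x (nrm (Q x) * yuk (y - x)))%E by apply: mule_ge0; [pos|exact: N0].
  apply: (aeS (ae_fin (mEX_M (mEX_EFin mQm) mN) hN0 fY)) => x hx.
  rewrite conjM_conj.
  have [->|Qn] := eqVneq (Q x) 0; first by rewrite !mul0r.
  congr (_ * _); have kq : cL1 (fun y => Rk 1 x y * Q y).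
   split; first exact: mC2_r x (mC2_pot (@mC2_Rk 1) mQ).
   apply: lelt (kQ_N mY (@mC2_Rk 1) RY mQ x) _; move: hx; have : 0 < nrm (Q x).
    by rewrite lt_def nge0 andbT; apply/eqP => /nrm_eq0/eqP; exact/negP.
   by move: (N0 x); case: (\int[mu]_y _)%E => [a| |] n0 n1; rewrite ?ltry// gt0_muley ?lte_fin// ltxx.
  rewrite /pot -(cI_conj kq); apply: eq_cI => y; rewrite RkC Rk1E.
  by rewrite conj_realM.
 have /(congr1 (@complex.Im R)) := a3; rewrite e; case: (cI _) => p q /= h; lra.
have l1 : cL1 (fun x => (Q x)^*%C * u x).
 split; first exact: mC_M mc mu_.
 apply: lelt a1.2; apply: n3ae_le; [meas|exact: mC_nrm a1.1|by move=> x; pos|by move=> x; pos|].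
 by apply: (aeS u_pot) => x ->; rewrite mulrC.
have e1 : cI (fun x => (Q x)^*%C * u x) = cI (fun y => pot (Rk 1) Q y * (Q y)^*%C).
 apply: cI_ae; [exact: l1.1|exact: a1.1|].
 by apply: (aeS u_pot) => x ->; rewrite mulrC.
have suc : sqi (fun x => nrm ((u x)^*%C)).
 by rewrite /sqi (eq_n3 (g2 := fun x => nrm (u x) ^+ 2)) => [|x]; [exact: su|rewrite nrm_conj].
have l2 := sqi_L1 (mC_conj mu_) mu_ suc su.
have eF : (fun x => (F x)^*%C * u x) = fun x => (Q x)^*%C * u x - (u x)^*%C * u x.
 by fext => x; rewrite /Q -mulrBl -rmorphB addrK.
rewrite eF; split; first exact: cL1_B.
rewrite (cI_B l1 l2) e1.
have -> : cI (fun x => (u x)^*%C * u x) = cI (fun x => (Re ((nrm (u x) ^+ 2)%:C))%:C).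
 apply: eq_cI => x; apply: ceqP; rewrite ReImE /= ?nrm_sqr; case: (u x) => p q /=; ring.
rewrite cI_Re; move: real; case: (cI _) => p q /= ->; ring.
Qed.

End Green.
End Regularity.

(** * Free potentials: weak equation, absorption and Green's identity *)

Section PotentialEq.
Implicit Types (x y w : R3 R) (phi : RF) (m : R[i]).

Lemma exp_sq_int (a : R) : 0 < a -> exists2 B : R, 0 <= B &
 forall y, (\I_x (expR (- (a * dist x y)) * dist x y ^- 2) <= B%:E)%E.
move=> a0; pose f (w : R3 R) : R := expR (- (a * enorm w)) * enorm w ^- 2.
have mf : mRX f by rewrite /f; meas.
have f0 w : 0 <= f w by apply: mge0; [exact: expR_ge0|pos].
suff fin : (\I_w (f w) < +oo)%E.
 have ff : (\I_w (f w))%E \is a fin_num by rewrite ge0_fin_numE// n3ge0.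
 exists (fine (\I_w (f w))%E); first by apply: fine_ge0; exact: n3ge0.
 by move=> y; rewrite fineK// -(nnint_shift (- y) mf f0).
have [c [c0 c1 ca]] : exists c : R, [/\ 0 < c, c <= 1 & c <= a].
 have [h|h] := leP a 1; [by exists a|by exists 1; rewrite ltr01 (ltW h)].
have [K K0 hK] : exists2 K : R, 0 <= K & K = 256 * c ^- 4 by exists (256 * c ^- 4); [pos|].
have mb : mRX (fun w => ballf 0 1 w * enorm (w - 0) ^- 2) by have := mR_ballf (0 : R3 R) 1 => mb; meas.
have mo4 : mRX (fun w : R3 R => omega w ^+ 4) := mR_X 4 (@mR_omega).
have o0 (w : R3 R) : 0 <= omega w ^+ 4 by rewrite exprn_ge0 ?omega_ge0.
have b0 w : 0 <= ballf 0 1 w * enorm (w - 0 : R3 R) ^- 2 by apply: mge0; [pos|pos].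
have mK : mRX (fun w : R3 R => K * omega w ^+ 4) := mR_M (mR_cst K) mo4.
apply: (vialt (\I_w (ballf 0 1 w * enorm (w - 0) ^- 2 + K * omega w ^+ 4))%E).
 apply: n3le => //; first exact: mR_D.
 move=> w; have w0 := enge0 w; have aw : 0 <= a * enorm w := mge0 (ltW a0) w0.
 have e1 : expR (- (a * enorm w)) <= 1 by rewrite -expR0 ler_expR oppr_le0.
 rewrite /f /ballf subr0; case: ifPn => w1.
  apply: (via (enorm w ^- 2)); last by rewrite mul1r lerDl mge0.
  by apply: ler_piMl => //; pos.
 rewrite mul0r add0r; rewrite -ltNge in w1.
 apply: (via (expR (- (a * enorm w)))).
  apply: ler_piMr; first exact: expR_ge0.
  by rewrite invf_le1 ?exprn_gt0 ?(lt_trans ltr01 w1)// exprn_ege1// ltW.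
 apply: le_trans (expN_le aw) _; rewrite hK -mulrA; apply: lewl; first exact: ler0n.
 have h1 : 0 < 1 + enorm w by lra.
 rewrite /omega exprVn -invfM -exprMn lef_pV2 ?posrE ?exprn_gt0 ?mulr_gt0//; last by lra.
 by apply: lerXn2r; rewrite ?nnegrE; nra.
rewrite (n3D mb mK b0 (fun w => mge0 K0 (o0 w))); apply: lte_add_pinfty.
 by apply: lelt (ball_sqr_inv 0 ltr01) _; exact: ltry.
rewrite (n3Z mo4 K0 o0); exact: ltyZ K0 (@omega4_int).
Qed.

Lemma nrm_conjM (z : R[i]) : z^*%C * z = (nrm z ^+ 2)%:C.
by rewrite nrm_sqr; case: z => p q; apply: ceqP => /=; ring. Qed.

Variables (g : CF) (C S : R).
Hypotheses (mg : mCX g) (kg : katob (fun x => nrm (g x)) C) (C0 : 0 <= C).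
Hypotheses (S0 : 0 <= S) (gS : (\I_x (nrm (g x)) <= S%:E)%E).

Let E x w : R := nc^-1 * (dist x w)^-1.
Let mE : mR2 E. Proof. by rewrite /E; meas. Qed.
Let E0 x w : 0 <= E x w. Proof. by rewrite mge0 ?invr_ge0 ?enge0// ltW ?newton_gt0. Qed.
Let n0 : 0 <= nc^-1 :> R := @nci_ge0.
Let mgm := mC_nrm mg.
Let g0 x : 0 <= nrm (g x) := nge0 (g x).
Let mr y : mRX (fun x => nrm (g x) * (dist x y)^-1). Proof. by meas. Qed.
Let r0 y x : 0 <= nrm (g x) * (dist x y)^-1. Proof. pos. Qed.

Lemma kpot_N y : (\I_x (nrm (g x) * E y x) <= (nc^-1 * C)%:E)%E.
rewrite (eq_n3 (g2 := fun x => nc^-1 * (nrm (g x) * (dist x y)^-1))); last by move=> x; rewrite /E mulrCA enormBC.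
rewrite (n3Z (mr y) n0 (r0 y)) EFinM; apply: leewl; first pos.
by have [_ _] := kg; exact.
Qed.

Lemma kato_energy1 : (energy (fun x => nrm (g x)) <= (C * S)%:E)%E.
have [_ _ hC] := kg.
have me : mR2 (fun x y => nrm (g x) * nrm (g y) * (dist x y)^-1).
 meas.
have e0 x y : 0 <= nrm (g x) * nrm (g y) * (dist x y)^-1.
 by apply: mge0; [pos|pos].
apply: (via (\int[mu]_x (C%:E * (nrm (g x))%:E))%E).
 apply: e3le; [exact: n3mE me e0|exact: mEX_M (mEX_cst _) (mEX_EFin mgm)|by move=> x; exact: n3ge0|move=> x].
 rewrite (eq_n3 (g2 := fun y => nrm (g x) * (nrm (g y) * (dist y x)^-1))); last by move=> y; rewrite -mulrA (enormBC y).
 by rewrite (n3Z (mr x) (g0 x) (r0 x)) muleC; apply: lee_wpmul2r; [pos|exact: hC].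
rewrite (e3Z (mEX_EFin mgm) C0 (fun x => _ : (0 <= (nrm (g x))%:E)%E)); last pos.
by rewrite EFinM; apply: leewl; [pos|].
Qed.

Lemma src_g : src (fun x => nrm (g x)).
exists (fun x => nrm (g x)), (fun=> 0); split => //.
- by split => //; meas.
- by move=> x; rewrite addr0.
- by apply: lelt kato_energy1 _; exact: ltry.
- by rewrite integral0_eq// => x _; rewrite expr0n.
Qed.

Section Equation.
Variable m : R[i].
Hypothesis m0 : 0 <= Re m.
Let u := pot (Rk m) g.
Let RkE x w : nrm (Rk m x w) <= E x w. Proof. exact: Rk_le. Qed.
Let mRm := @mC2_Rk m.

Lemma mC_kpot : mCX u. Proof. exact: mC_pot mRm mg. Qed.

Lemma kpot_bound x : nrm (u x) <= nc^-1 * C.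
by rewrite -lee_fin; exact: le_trans (pot_le mE mRm RkE mg x) (kpot_N x). Qed.

Lemma kpot_cL1 x : cL1 (fun w => Rk m x w * g w).
split; first exact: mC2_r x (mC2_pot mRm mg).
by apply: lelt (kQ_N mE mRm RkE mg x) _; apply: lelt (kpot_N x) _; exact: ltry.
Qed.

Lemma kpot_fubini (h : CF) : cL1 h ->
 [/\ cL1 (fun y => u y * h y), cL1 (fun x => g x * cI (fun y => Rk m y x * h y)) &
  cI (fun y => u y * h y) = cI (fun x => g x * cI (fun y => Rk m y x * h y))].
move=> [mh h1]; apply: (pot_fubini mE E0 mRm RkE mg mh); have [mN N0] := pot_N mE E0 mg.
have mhm := mEX_EFin (mC_nrm mh); have c0 : 0 <= nc^-1 * C by pos.
have h0 y : (0 <= (nrm (h y))%:E)%E by rewrite lee_fin nge0.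
apply: (vialt (\int[mu]_y ((nc^-1 * C)%:E * (nrm (h y))%:E))%E).
 apply: e3le; [exact: mEX_M mhm mN|exact: mEX_M (mEX_cst _) mhm|by move=> y; exact: mule_ge0 (h0 y) (N0 y)|move=> y].
 by rewrite muleC; apply: lee_wpmul2r; [exact: h0|exact: kpot_N].
rewrite (e3Z mhm c0 h0); exact: ltyZ c0 h1.
Qed.

Lemma kpot_loc : loc u.
split=> [|r]; first exact: mC_kpot.
have c0 : 0 <= nc^-1 * C by pos.
have mb := mR_ballf 0 r; have b0 := ballf_ge0 (0 : R3 R) r.
apply: (vialt (\I_x (nc^-1 * C * ballf 0 r x))%E).
 apply: n3le; [exact: mR_M mb (mC_nrm mC_kpot)|meas|by move=> x; pos|].
 by move=> x; rewrite mulrC; apply: lewr; [exact: b0|exact: kpot_bound].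
rewrite (n3Z mb c0 b0); exact: ltyZ c0 (ball_fin r).
Qed.

Lemma loc_cst1 : loc (fun=> 1 : R[i]).
split; first meas; move=> r; apply: (eq_lty _ (ball_fin r)) => x.
by rewrite -[1]/(1%:C) nrm_real normr1 mulr1.
Qed.

Lemma kpot_weak phi : testf phi ->
 cI (fun x => u x * (- lap phi x)%:C) = cI (fun x => (- m ^+ 2 * u x + g x) * (phi x)%:C).
move=> tp; have one (f : CF) : (fun x => 1 * f x) = f by fext => x; rewrite mul1r.
have l1 := loc_test loc_cst1 tp; rewrite (one (fun x => (phi x)%:C)) in l1.
have l2 := lap_test loc_cst1 tp; rewrite (one (fun x => (- lap phi x)%:C)) in l2.
have [a1 a2 a3] := kpot_fubini l1; have [b1 b2 b3] := kpot_fubini l2.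
have e x : g x * cI (fun y => Rk m y x * (- lap phi y)%:C) =
  - m ^+ 2 * (g x * cI (fun y => Rk m y x * (phi y)%:C)) + g x * (phi x)%:C.
 have -> : cI (fun y => Rk m y x * (- lap phi y)%:C) = - cI (fun y => Rk m y x * (lap phi y)%:C).
  have l : cL1 (fun y => Rk m y x * (- lap phi y)%:C).
   have := cL1_B (Rk_test_int x m0 (test_helmholtz tp)) (Rk_test_int x m0 tp).
   rewrite (_ : (fun y => _ - _) = fun y => Rk m y x * (- lap phi y)%:C)//.
   by fext => y; rewrite -mulrBr -rmorphB /= addrAC subrr add0r.
  rewrite -[LHS]opprK -(cI_N l); congr (- _).
  by apply: eq_cI => y; rewrite rmorphN /= mulrN opprK.
 by rewrite (Rk_laplacian x m0 tp); ring.
have lg : cL1 (fun x => g x * (phi x)%:C).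
 have := cL1_D b2 (cL1_Z (m ^+ 2) a2); rewrite (_ : (fun x => _ + _) = fun x => g x * (phi x)%:C)//.
 by fext => x; rewrite e; ring.
rewrite b3 (eq_cI e) (cI_D (cL1_Z _ a2) lg) (cI_Z _ a2) -a3 -(cI_Z _ a1) -(cI_D (cL1_Z _ a1) lg).
by apply: eq_cI => x; ring.
Qed.

Hypothesis m1 : 0 < Re m.

(** With absorption the squared kernel has a bounded integral in x, so $R_0$ maps L^1 to L^2. *)
Lemma kpot_sqi : sqi (fun x => nrm (u x)).
have a0 : 0 < 2 * Re m by pos.
have [B B0 hB] := exp_sq_int a0.
pose e x y : R := nrm (Rk m x y); have me : mR2 e := mC_nrm mRm.
have e0 x y : 0 <= e x y by pos.
have c0 : 0 <= nc^-1 ^+ 2 :> R by pos.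
have h y : (\I_x (e x y ^+ 2) <= (nc^-1 ^+ 2 * B)%:E)%E.
 rewrite (eq_n3 (g2 := fun x => nc^-1 ^+ 2 * (expR (- (2 * Re m * dist x y)) * dist x y ^- 2))); last first.
  move=> x; rewrite /e nrm_Rk -mulrA mulrDl mul1r opprD expRD invfM -exprVn; ring.
 rewrite n3Z//; [|by meas|by move=> x; apply: mge0; [exact: expR_ge0|pos]].
 rewrite [X in (_ <= X)%E](_ : _ = (nc^-1 ^+ 2)%:E * B%:E)%E; last by rewrite -EFinM.
 by apply: leewl; [pos|exact: hB].
have := conv_L1_L2 me e0 S0 (mge0 c0 B0) h mgm g0 gS; move/lelt/(_ (ltry _)); apply: lelt.
have [M1 M2] := mEX_conv me e0 mgm g0.
apply: e3le; [exact: mEX_EFin (mR_X 2 (mC_nrm mC_kpot))|exact: (mEX_M M2 M2)|pos|move=> x].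
have le : ((nrm (u x))%:E <= \I_y (nrm (g y) * e x y))%E.
 apply: le_trans (nrm_cI_le (mC2_r x (mC2_pot mRm mg))) _.
 by rewrite (eq_n3 (g2 := fun y => nrm (g y) * e x y)) => [|y]; [exact: lexx|rewrite nrmM mulrC].
by rewrite expr2 EFinM; apply: lee_pmul => //; rewrite lee_fin nge0.
Qed.

Lemma kpot_src : src (fun x => nrm (- m ^+ 2 * u x + g x)).
have mmu := mC_nrm (mC_M (mC_cst (- m ^+ 2)) mC_kpot).
apply: (@src_le _ (fun x => nrm (g x) + nrm (- m ^+ 2 * u x))); first by move=> x; rewrite addrC; exact: nrmD.
apply: (srcD mmu _ src_g); first by move=> x; pos.
have mu2 := mR_X 2 (mC_nrm mC_kpot); have k0 : 0 <= nrm (- m ^+ 2) ^+ 2 by pos.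
rewrite /sqi (eq_n3 (g2 := fun x => nrm (- m ^+ 2) ^+ 2 * nrm (u x) ^+ 2)) => [|x]; last by rewrite nrmM exprMn.
by rewrite (n3Z mu2 k0 (fun x => sqr_ge0 _)); exact: ltyM (k0 : (0 <= (nrm (- m ^+ 2) ^+ 2)%:E)%E) isT kpot_sqi.
Qed.

(** [green] for $F=-m^2u+g$: the imaginary part of $-\overline{m^2}\|u\|^2+\int\bar gu$ vanishes. *)
Lemma kpot_green : cL1 (fun x => (g x)^*%C * u x) /\
 Im (m ^+ 2) * fine (\I_x (nrm (u x) ^+ 2))%E = - Im (cI (fun x => (g x)^*%C * u x)).
have mF : mCX (fun x => - m ^+ 2 * u x + g x) := mC_D (mC_M (mC_cst (- m ^+ 2)) mC_kpot) mg.
have [l1 h] := green mC_kpot kpot_sqi mF kpot_src kpot_weak.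
have suc : sqi (fun x => nrm ((u x)^*%C)).
 by apply: eq_lty kpot_sqi => x; rewrite nrm_conj.
have l2 := sqi_L1 (mC_conj mC_kpot) mC_kpot suc kpot_sqi.
have l3 := cL1_Z ((m ^+ 2)^*%C) l2.
have e x : (- m ^+ 2 * u x + g x)^*%C * u x = (g x)^*%C * u x - (m ^+ 2)^*%C * ((u x)^*%C * u x).
 by move: (m ^+ 2) (u x) (g x) => [a1 a2] [b1 b2] [c1 c2]; apply: ceqP => /=; ring.
have lg : cL1 (fun x => (g x)^*%C * u x).
 have := cL1_D l1 l3; rewrite (_ : (fun x => _ + _) = fun x => (g x)^*%C * u x)//.
 by fext => x; rewrite e subrK.
split => //; move: h; rewrite (eq_cI e) (cI_B lg l3) (cI_Z _ l2).
have -> : cI (fun x => (u x)^*%C * u x) = (fine (\I_x (nrm (u x) ^+ 2))%E)%:C.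
 rewrite -RintE (eq_cI (fun x => nrm_conjM (u x))).
 have := cI_Re (fun x => (nrm (u x) ^+ 2)%:C); rewrite /= => ->.
 by congr (_%:C).
by move: (m ^+ 2) (cI _) (fine _) => [a1 a2] [b1 b2] I /=; rewrite mulr0 add0r mulNr => h; lra.
Qed.

End Equation.
(** $1-e^{-kr}\le kr$ cancels the pole of the kernel, so the L^1 norm of g controls the
    difference. *)
Lemma kpot_shift m (k : R) : 0 <= Re m -> 0 <= k ->
 forall x, nrm (pot (Rk (m + k%:C)) g x - pot (Rk m) g x) <= k * nc^-1 * S.
move=> m0 k0 x; have mk0 : 0 <= Re (m + k%:C) by case: m m0 => a b /=; move=> ?; pos.
have l1 := kpot_cL1 mk0 x; have l2 := kpot_cL1 m0 x.
rewrite /pot -(cI_B l1 l2).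
have c0 : 0 <= k * nc^-1 by pos.
apply: (cI_le (g := fun w => k * nc^-1 * nrm (g w))).
- exact: mC_D l1.1 (mC_N l2.1).
- meas.
- move=> w; rewrite -mulrBl nrmM; apply: lewr; first pos.
 have q0 := enge0 (x - w); rewrite /Rk -mulrBr nrmM nrm_real ger0_norm; last pos.
 rewrite cexpDreal -[X in nrm (_ - X)]mulr1 -mulrBr nrmM.
 have h1 : nrm (cexp m (dist x w)) <= 1 by exact: nrm_cexp_le1.
 have h2 : nrm ((expR (- (k * dist x w)))%:C - 1) <= k * dist x w.
  have -> : (expR (- (k * dist x w)))%:C - 1 = (expR (- (k * dist x w)) - expR (- (k * 0)))%:C :> R[i].
   by rewrite mulr0 oppr0 expR0 rmorphB.
  rewrite nrm_real; apply: le_trans (expRN_lip k0 q0 (lexx 0)) _.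
  by rewrite subr0 ger0_norm.
 have [->|rn] := eqVneq (dist x w) 0; first by rewrite mulr0 invr0 mul0r mge0.
 rewrite invfM -mulrA [leRHS]mulrC; apply: lewl => //.
 rewrite ler_pdivrMl; last by rewrite lt_def rn.
 rewrite [leRHS]mulrC -[leRHS]mul1r; apply: ler_pM => //; pos.
- rewrite (n3Z mgm c0 g0) [X in (_ <= X)%E](_ : _ = (k * nc^-1)%:E * S%:E)%E; last by rewrite -EFinM.
 by apply: leewl; [pos|exact: gS].
Qed.

Lemma kpot_green_le m : 0 <= Re m -> 0 < Re m ->
 `|Im (m ^+ 2)| * fine (\I_x (nrm (pot (Rk m) g x) ^+ 2))%E <= nc^-1 * C * S.
move=> m0 m1; have [[mc _] hg] := kpot_green m0 m1.
have I0 : 0 <= fine (\I_x (nrm (pot (Rk m) g x) ^+ 2))%E by apply: fine_ge0; apply: n3ge0 => x; pos.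
have c0 : 0 <= nc^-1 * C by pos.
rewrite -{1}(ger0_norm I0) -normrM hg normrN; apply: le_trans (Im_le_nrm _) _.
apply: (cI_le (g := fun x => (nc^-1 * C) * nrm (g x))) => [||x|]; [exact: mc|meas| |].
 by rewrite nrmM nrm_conj mulrC; apply: lewr; [pos|exact: kpot_bound].
rewrite (n3Z mgm c0 g0) [X in (_ <= X)%E](_ : _ = (nc^-1 * C)%:E * S%:E)%E; last by rewrite -EFinM.
by apply: leewl; [pos|exact: gS].
Qed.

End PotentialEq.

(** * The form sum: membership in its graph and uniqueness *)

Section Graph.
Implicit Types (x y w : R3 R) (phi : RF) (u f F : CF) (g : 'I_3 -> CF) (W : RF).

Definition grad u g := [/\ forall i, mCX (g i), forall i, sqi (fun x => nrm (g i x)) &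
 forall i phi, testf phi -> cI (fun x => u x * (pd i phi x)%:C) = - cI (fun x => g i x * (phi x)%:C)].

(* |u| <= C |x|^-2 * (|u| + |grad u|), and the form bound *)
Lemma H1_form W A u g : katob W A -> 0 < A -> mCX u -> sqi (fun x => nrm (u x)) -> grad u g ->
 (\I_x (W x * nrm (u x) ^+ 2) < +oo)%E.
move=> kW A0 mu_ su [mg sg eg].
have s0 : src (fun x : R3 R => nrm (0 : R[i])).
 apply: sqi_src; [meas; meas|by move=> x; pos|].
 by rewrite /sqi integral0_eq// => x _; rewrite nrm0 expr0n.
have lu := loc_sqi mu_ su.
have eq_u phi : testf phi -> cI (fun x => u x * (- lap phi x)%:C) =
  cI (fun x => (fun=> 0) x * (phi x)%:C) + \sum_i cI (fun x => g i x * (pd i phi x)%:C).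
 move=> tp; rewrite (eq_cI (f1 := fun x => (fun=> 0) x * _) (f2 := fun=> 0)) => [|x]; last by rewrite mul0r.
 rewrite {2}/cI cint0 add0r.
 have li i : cL1 (fun x => u x * (pd i (pd i phi) x)%:C) := loc_test lu (tpd i (tpd i tp)).
 transitivity (- \sum_i cI (fun x => u x * (pd i (pd i phi) x)%:C)).
  rewrite -(cI_sum (index_enum 'I_3) li) -(cI_N (cL1_sum (index_enum 'I_3) li)); apply: eq_cI => x.
  by rewrite /lap rmorphN /= mulrN rmorph_sum /= mulr_sumr.
 by rewrite -sumrN; apply: eq_bigr => i _; rewrite (eg i _ (tpd i tp)) opprK.
have h := inverse_ae mu_ su (mC_cst 0) s0 mg sg eq_u.
pose i0 : 'I_3 := ord0; pose i1 : 'I_3 := lift ord0 ord0; pose i2 : 'I_3 := lift ord0 (lift ord0 ord0).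
pose m1 x := nrm (u x) + (nrm (g i0 x) + (nrm (g i1 x) + nrm (g i2 x))).
have mu1 := mC_nrm mu_; have mgm i := mC_nrm (mg i).
have mm1 : mRX m1 := mR_D mu1 (mR_D (mgm _) (mR_D (mgm _) (mgm _))).
have m10 x : 0 <= m1 x by rewrite /m1 !addr_ge0 ?nge0.
have n0 : 0 <= nc^-1 :> R := @nci_ge0.
pose m x := nc^-1 * m1 x; have mm : mRX m := mR_M (mR_cst _) mm1.
have m0 x : 0 <= m x := mge0 n0 (m10 x).
have sm : (\I_x (m x ^+ 2) < +oo)%E.
 have s1 : sqi m1 by exact: sqiD mu1 (mR_D (mgm _) (mR_D (mgm _) (mgm _))) su (sqiD (mgm _) (mR_D (mgm _) (mgm _)) (sg _) (sqiD (mgm _) (mgm _) (sg _) (sg _))).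
 have c0 : 0 <= nc^-1 ^+ 2 :> R by pos.
 rewrite (eq_n3 (g2 := fun x => nc^-1 ^+ 2 * m1 x ^+ 2)) => [|x]; last by rewrite /m exprMn.
 by rewrite (n3Z (mR_X 2 mm1) c0 (fun x => sqr_ge0 _)); exact: ltyZ c0 s1.
have le : {ae mu, forall x : R3 R, ((nrm (u x))%:E <= \I_y (m y * riesz x y))%E}.
 apply: (aeS h) => x ->.
 pose N (q : RF) := (\I_y (q y * J x y))%E.
 have pl k (Q : CF) : mC2 k -> (forall x y, nrm (k x y) <= J x y) -> mCX Q -> ((nrm (pot k Q x))%:E <= N (fun y => nrm (Q y)))%E.
  by move=> mk kJ mQ; exact: pot_le mR2_J mk kJ mQ x.
 have mJ := mR2_r x (@mR2_J).
 have ND q1 q2 : mRX q1 -> mRX q2 -> nneg q1 -> nneg q2 -> N (fun y => q1 y + q2 y) = (N q1 + N q2)%E.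
  move=> mq1 mq2 q10 q20; rewrite /N -(n3D (mR_M mq1 mJ) (mR_M mq2 mJ)); [by apply: eq_n3 => y; rewrite mulrDl| |].
   by move=> y; exact: mge0 (q10 y) (J_ge0 x y).
  by move=> y; exact: mge0 (q20 y) (J_ge0 x y).
 apply: (via (N m1)); last first.
  apply: n3le; [meas|by apply: mR_M => //; rewrite /riesz; meas|by move=> y; exact: mge0 (m10 y) (J_ge0 x y)|move=> y].
  by rewrite /m [nc^-1 * _]mulrC -mulrA; apply: lewl; [exact: m10|exact: jk_riesz].
 have p0 := pl _ _ (@mC2_Rk 1) (@Rk1_J) (mC_D (mC_cst 0) mu_).
 have p i := pl _ _ (@mC2_dRk i 1) (dRk1_J i) (mg i).
 have -> : N m1 = (N (fun y => nrm (u y)) + (N (fun y => nrm (g i0 y)) + (N (fun y => nrm (g i1 y)) + N (fun y => nrm (g i2 y)))))%E.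
  have a0 i y : 0 <= nrm (g i y) := nge0 _.
  rewrite -(ND _ _ (mgm i1) (mgm i2) (a0 i1) (a0 i2)) -(ND _ _ (mgm i0) (mR_D (mgm i1) (mgm i2)) (a0 i0)) => [|y]; last pos.
  by rewrite -(ND _ _ mu1 (mR_D (mgm _) (mR_D (mgm _) (mgm _))) (fun y => nge0 _)) => [|y]; rewrite ?addr_ge0.
 have e0 : N (fun y => nrm ((fun=> 0) y + u y)) = N (fun y => nrm (u y)) by apply: eq_n3 => y; rewrite add0r.
 rewrite e0 in p0; apply: le_trans (leeD p0 (leeD (p i0) (leeD (p i1) (p i2)))).
 rewrite -!EFinD lee_fin; apply: le_trans (nrmB _ _) _; rewrite lerD2l.
 by apply: le_trans (nrm_sum _ _) _; rewrite (sum3 (fun i => nrm (pot (dRk i 1) (g i) x))).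
apply: lelt (form_bound kW A0 mu1 (fun x => nge0 _) mm m0 le) _.
exact: ltyM (mge0 (ler0n R 768) (ltW A0) : (0 <= (768%:R * A)%:E)%E) isT sm.
Qed.

Variables (V : RF) (A : R).
Hypotheses (mV : mRX V) (A0 : 0 < A) (kV : katob (fun x => `|V x|) A).

Lemma weakP i u (h : CF) : weak_partial i u h -> forall phi, testf phi ->
 cI (fun x => u x * (pd i phi x)%:C) = - cI (fun x => h x * (phi x)%:C).
by move=> [_ _ hh] phi /hh; rewrite !cintegralE. Qed.

Lemma graph_data u f : schrodinger_graph V u f -> [/\ mCX u /\ sqi (fun x => nrm (u x)),
 mCX f /\ sqi (fun x => nrm (f x)), exists g, grad u g &
 forall phi, testf phi -> cI (fun x => u x * (- lap phi x)%:C) = cI (fun x => (f x - (V x)%:C * u x) * (phi x)%:C)].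
move=> [[/in_L2P[mu_ su] hg] /in_L2P[mf sf] [_ lV _ hw]].
have [g hg'] : {g : 'I_3 -> CF & forall i, in_L2 (g i) /\ weak_partial i u (g i)}.
 by apply: (@choice _ _ (fun i (h : CF) => in_L2 h /\ weak_partial i u h)) => i; have [h h1 h2] := hg i; exists h.
split => //.
 exists g; split; [by move=> i; have [/in_L2P[]] := hg' i|by move=> i; have [/in_L2P[]] := hg' i|].
 by move=> i phi; have [_ /weakP] := hg' i; exact.
move=> phi tp; apply/weak_eqP; [exact: loc_sqi| |exact: loc_sqi|exact: tp|exact: hw].
by apply: in_L1loc_loc lV; meas.
Qed.

Lemma src_Vu u : mCX u -> (\I_x (`|V x| * nrm (u x) ^+ 2) < +oo)%E -> src (fun x => nrm ((V x)%:C * u x)).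
move=> mu_ hu; have mm := mC_nrm mu_; have mW : mRX (fun x => `|V x|) := mR_norm mV.
exists (fun x => `|V x| * nrm (u x)), (fun=> 0); split.
- split; [meas|meas|pos|by move=> x].
- by move=> x; rewrite addr0 nrmM nrm_real.
- apply: lelt (kato_energy kV (ltW A0) mm (fun x => nge0 _)) _.
 exact: ltyM (ltW A0 : (0 <= A%:E)%E) isT hu.
- by rewrite integral0_eq// => x _; rewrite expr0n.
Qed.

(** Membership in $H^1$ comes out of the equation: a square integrable u whose Laplacian is a source
    has a gradient in L^2. *)
Lemma graph_intro u f F : mCX u -> sqi (fun x => nrm (u x)) -> mCX f -> sqi (fun x => nrm (f x)) ->
 (forall x, F x = f x - (V x)%:C * u x) -> loc (fun x => (V x)%:C * u x) -> src (fun x => nrm (F x)) ->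
 (forall phi, testf phi -> cI (fun x => u x * (- lap phi x)%:C) = cI (fun x => F x * (phi x)%:C)) ->
 schrodinger_graph V u f.
move=> mu_ su mf sf eF lV sF eq_u.
have mF : mCX F by rewrite (_ : F = fun x => f x - (V x)%:C * u x); [exact: mC_D mf (mC_N lV.1)|exact/funext].
have [g [mg sg eg]] := gradient mu_ su mF sF eq_u.
have lu := loc_sqi mu_ su; have lf := loc_sqi mf sf.
split; [split; [exact/in_L2P|move=> i; exists (g i); [exact/in_L2P|]]|exact/in_L2P|].
 split; [exact: loc_in_L1loc|exact: loc_in_L1loc (loc_sqi (mg i) (sg i))|].
 by move=> phi tp; rewrite !cintegralE; exact: eg.
split; [exact: loc_in_L1loc|exact: loc_in_L1loc|exact: loc_in_L1loc|move=> phi tp].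
apply/(weak_eqP lu lV lf tp); rewrite (eq_u _ tp); apply: eq_cI => x; by rewrite eF.
Qed.

Lemma conj_shift (z a : R[i]) (v : R) : (z * a - v%:C * a)^*%C * a = z^*%C * (a^*%C * a) - v%:C * (a^*%C * a).
by case: a z => [a1 a2] [b1 b2]; apply: ceqP => /=; ring. Qed.

Lemma sq_ae0 (d : CF) : mCX d -> (\I_x (nrm (d x) ^+ 2) = 0)%E -> {ae mu, forall x : R3 R, d x = 0}.
move=> md d0; have md2 : mEX (fun x => (nrm (d x) ^+ 2)%:E) := mEX_EFin (mR_X 2 (mC_nrm md)).
have [+ _] := ae_eq_integral_abs mu measurableT md2.
have -> : (\int[mu]_x `|(nrm (d x) ^+ 2)%:E| = 0)%E.
 by rewrite -{}d0; apply: eq_integral => x _; rewrite gee0_abs// lee_fin sqr_ge0.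
move=> /(_ erefl); apply: aeS => x /(_ I) /= [] /eqP.
by rewrite sqrf_eq0 => /eqP; exact: nrm_eq0.
Qed.

(** By the form bound $|V||d|^2$ is integrable for the difference d. As V is real, [green] for
    $-\Delta d=zd-Vd$ leaves $\mathrm{Im}(z)\|d\|^2=0$. *)
Lemma graph_unique u1 u2 f (z : R[i]) : Im z != 0 ->
 schrodinger_graph V u1 (fun x => f x + z * u1 x) -> schrodinger_graph V u2 (fun x => f x + z * u2 x) ->
 {ae mu, forall x : R3 R, u1 x = u2 x}.
move=> z0 /graph_data[[m1 s1] [mf1 sf1] [g1 [mg1 sg1 eg1]] e1] /graph_data[[m2 s2] [mf2 sf2] [g2 [mg2 sg2 eg2]] e2].
pose d x := u1 x - u2 x; have md : mCX d := mC_D m1 (mC_N m2).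
have sqB (a b : CF) : mCX a -> mCX b -> sqi (fun x => nrm (a x)) -> sqi (fun x => nrm (b x)) -> sqi (fun x => nrm (a x - b x)).
 move=> ma mb sa sb; apply: sqi_le (sqiD (mC_nrm ma) (mC_nrm mb) sa sb); [meas|meas|].
 by move=> x; rewrite ger0_norm ?nge0// nrmB.
have sd := sqB _ _ m1 m2 s1 s2; have ld := loc_sqi md sd.
have l1 := loc_sqi m1 s1; have l2 := loc_sqi m2 s2.
have gd : grad d (fun i x => g1 i x - g2 i x).
 split=> [i|i|i phi tp]; [exact: mC_D (mg1 i) (mC_N (mg2 i))|exact: sqB|].
 have tp' := tpd i tp.
 transitivity (cI (fun x => u1 x * (pd i phi x)%:C - u2 x * (pd i phi x)%:C)); first by apply: eq_cI => x; rewrite mulrBl.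
 rewrite (cI_B (loc_test l1 tp') (loc_test l2 tp')) (eg1 i _ tp) (eg2 i _ tp) -opprD; congr (- _).
 have la := loc_test (loc_sqi (mg1 i) (sg1 i)) tp; have lb := loc_test (loc_sqi (mg2 i) (sg2 i)) tp.
 by rewrite -(cI_B la lb); apply: eq_cI => x; rewrite mulrBl.
have fd := H1_form kV A0 md sd gd.
have f1 := H1_form kV A0 m1 s1 (And3 mg1 sg1 eg1); have f2 := H1_form kV A0 m2 s2 (And3 mg2 sg2 eg2).
pose F x := z * d x - (V x)%:C * d x.
have mVd : mCX (fun x => (V x)%:C * d x) := mC_M (mC_real mV) md.
have mzd : mCX (fun x => z * d x) := mC_M (mC_cst z) md.
have mF : mCX F := mC_D mzd (mC_N mVd).
have szd : sqi (fun x => nrm (z * d x)).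
 have c0 := sqr_ge0 (nrm z).
 rewrite /sqi (eq_n3 (g2 := fun x => nrm z ^+ 2 * nrm (d x) ^+ 2)) => [|x]; last by rewrite nrmM exprMn.
 by rewrite (n3Z (mR_X 2 (mC_nrm md)) c0 (fun x => sqr_ge0 _)); exact: ltyZ c0 sd.
have sF : src (fun x => nrm (F x)).
 apply: (@src_le _ (fun x => nrm ((V x)%:C * d x) + nrm (z * d x))); first by move=> x; rewrite addrC; exact: nrmB.
 by apply: (srcD (mC_nrm mzd) _ (src_Vu md fd) szd) => x; pos.
have eq_d phi : testf phi -> cI (fun x => d x * (- lap phi x)%:C) = cI (fun x => F x * (phi x)%:C).
 move=> tp; transitivity (cI (fun x => u1 x * (- lap phi x)%:C - u2 x * (- lap phi x)%:C)); first by apply: eq_cI => x; rewrite mulrBl.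
 rewrite (cI_B (lap_test l1 tp) (lap_test l2 tp)) (e1 _ tp) (e2 _ tp).
 have lF (v w : CF) : loc v -> loc w -> cL1 (fun x => (v x - w x) * (phi x)%:C).
  move=> lv lw; have := cL1_B (loc_test lv tp) (loc_test lw tp); rewrite (_ : (fun x => _ - _) = fun x => (v x - w x) * (phi x)%:C)//.
  by fext => x; rewrite mulrBl.
 have L1 := lF _ _ (loc_sqi mf1 sf1) (loc_V mV kV m1 f1); have L2 := lF _ _ (loc_sqi mf2 sf2) (loc_V mV kV m2 f2).
 by rewrite -(cI_B L1 L2); apply: eq_cI => x; rewrite /F /d; ring.
have [lg hg] := green md sd mF sF eq_d.
have sdc : sqi (fun x => nrm ((d x)^*%C)) by apply: eq_lty sd => x; rewrite nrm_conj.
have L := sqi_L1 (mC_conj md) md sdc sd.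
have dz : (\I_x (nrm (d x) ^+ 2) = 0)%E.
 have eI : cI (fun x => (d x)^*%C * d x) = (fine (\I_x (nrm (d x) ^+ 2))%E)%:C.
  rewrite -RintE (eq_cI (fun x => nrm_conjM (d x))).
  have := cI_Re (fun x => (nrm (d x) ^+ 2)%:C); rewrite /= => ->; by congr (_%:C).
 have lV2 : cL1 (fun x => (V x * nrm (d x) ^+ 2)%:C).
  split; first meas.
  by apply: eq_lty fd => x; rewrite nrm_real normrM (ger0_norm (sqr_ge0 _)).
 have e x : (F x)^*%C * d x = z^*%C * ((d x)^*%C * d x) - (V x * nrm (d x) ^+ 2)%:C.
  rewrite rmorphM /= -nrm_conjM; exact: conj_shift.
 move: hg; rewrite (eq_cI e) (cI_B (cL1_Z _ L) lV2) (cI_Z _ L) eI.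
 have := cI_Re (fun x => (V x * nrm (d x) ^+ 2)%:C); rewrite /= => -> /=.
 have ff : (\I_x (nrm (d x) ^+ 2))%E \is a fin_num by rewrite ge0_fin_numE ?sd// n3ge0// => x; rewrite sqr_ge0.
 rewrite -{2}(fineK ff); move: (fine _) z0 => I; case: z {mzd szd sF e F mF eq_d lg e1 e2 mf1 sf1 mf2 sf2} => p q /= q0.
 by rewrite mulr0 oppr0 addr0 add0r mulNr => /eqP; rewrite oppr_eq0 mulf_eq0 (negbTE q0) /= => /eqP ->.
apply: (aeS (sq_ae0 md dz)) => x /eqP.
by rewrite subr_eq0 => /eqP.
Qed.

End Graph.

(** * Triviality of the kernel of 1 + R_0 V *)

Section Injectivity.
Implicit Types (x y w : R3 R) (phi : RF) (psi : CF).

Lemma ae_leb3 (P : R3 R -> Prop) : {ae (@leb3 R), forall x, P x} <-> {ae mu, forall x : R3 R, P x}.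
by rewrite /almost_everywhere /negligible /= -mu3E. Qed.

Lemma kato_sq V A psi M : mRX V -> katob (fun x => `|V x|) A -> mCX psi -> 0 <= M ->
 (forall x, nrm (psi x) <= M * omega x) -> (\I_x (`|V x| * nrm (psi x) ^+ 2) < +oo)%E.
move=> mV kV mpsi M0 hpsi; have mW : mRX (fun x => `|V x|) := mR_norm mV; have mo1 := mR_M mW (@mR_omega); have p x : 0 <= `|V x| * omega x by pos.
have M20 : 0 <= M ^+ 2 by pos.
apply: (vialt (\I_x (M ^+ 2 * (`|V x| * omega x)))%E).
 apply: n3le; [meas|exact: mR_M (mR_cst _) mo1|pos|move=> x].
 rewrite [leRHS]mulrCA; apply: lewl => //; apply: (via ((M * omega x) ^+ 2)).
  by apply: lerXn2r; rewrite ?nnegrE ?nge0 ?mge0 ?omega_ge0.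
 rewrite exprMn; apply: lewl => //; rewrite expr2; apply: ler_piMl; [pos|exact: omega_le1].
rewrite (n3Z mo1 M20 p); apply: ltyM; [pos|exact: isT|].
by apply: lelt (kato_omega_int kV) _; exact: ltry.
Qed.

Variables (V : RF) (A : R).
Hypotheses (mV : mRX V) (A0 : 0 < A) (kV : katob (fun x => `|V x|) A).
Hypotheses (no0 : ~ schrodinger_eigenvalue V 0) (nor : ~ zero_resonance V).
Hypothesis nop : forall E : R, 0 < E -> ~ schrodinger_eigenvalue V E.

Section Kernel.
Variables (tau M : R) (psi : CF).
Hypotheses (M0 : 0 <= M) (mpsi : mCX psi) (hpsi : forall x, nrm (psi x) <= M * omega x).
Let m : R[i] := 0 +i* tau.
Hypothesis eq_psi : forall x, psi x + cI (fun w => Tk V m x w * psi w) = 0.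
Let g x := - ((V x)%:C * psi x).
Let S := M * (2 * A).
Let mVp : mCX (fun x => (V x)%:C * psi x) := mC_M (mC_real mV) mpsi.
Let mg : mCX g := mC_N mVp.
Let mW : mRX (fun x => `|V x|) := mR_norm mV.
Let mo := @mR_omega.

Let g_le x : nrm (g x) <= M * (`|V x| * omega x).
by rewrite /g nrmN nrmM nrm_real mulrCA; apply: lewl. Qed.

Let kg : katob (fun x => nrm (g x)) (M * A).
apply: (kato_bound_le (mC_nrm mg) _ _ (kato_boundZ M0 kV)) => x; first pos.
apply: le_trans (g_le x) _; apply: lewl => //; apply: ler_piMr => //; exact: omega_le1.
Qed.

Let C0 : 0 <= M * A. Proof. pos. Qed.
Let S0 : 0 <= S. Proof. by rewrite /S mge0// mge0// ltW. Qed.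

Let gS : (\I_x (nrm (g x)) <= S%:E)%E.
have mo1 := mR_M mW mo; have p x : 0 <= `|V x| * omega x by pos.
apply: (via (\I_x (M * (`|V x| * omega x)))%E).
 by apply: n3le; [meas|meas|by move=> x; pos|exact: g_le].
rewrite (n3Z mo1 M0 p) EFinM; apply: leewl; [pos|exact: kato_omega_int kV].
Qed.

Let fV := kato_sq mV kV mpsi M0 hpsi.

Let m0 : 0 <= Re m. Proof. exact: lexx. Qed.

Lemma psi_pot x : psi x = pot (Rk m) g x.
have l := kpot_cL1 mg kg m0 x; have := eq_psi x.
have -> : cI (fun w => Tk V m x w * psi w) = - pot (Rk m) g x.
 by rewrite /pot -(cI_N l); apply: eq_cI => w; rewrite /g mulrN opprK /Tk mulrA.
by move=> /eqP; rewrite subr_eq0 => /eqP.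
Qed.

Let mE : - m ^+ 2 = (tau ^+ 2)%:C.
by apply: ceqP => /=; rewrite ?expr2 /=; ring. Qed.

Lemma psi_weak phi : testf phi ->
 cI (fun x => psi x * (- lap phi x)%:C) = cI (fun x => ((tau ^+ 2)%:C * psi x - (V x)%:C * psi x) * (phi x)%:C).
move=> tp; have := kpot_weak mg kg C0 m0 tp; rewrite mE => h.
rewrite (eq_cI (f2 := fun x => pot (Rk m) g x * (- lap phi x)%:C)) => [|x]; last by rewrite psi_pot.
by rewrite h; apply: eq_cI => x; rewrite -psi_pot.
Qed.

(** The equation holds at every point while its integral ignores null sets, so vanishing almost
    everywhere becomes vanishing everywhere. *)
Lemma psi_ae0 : {ae mu, forall x : R3 R, psi x = 0} -> forall x, psi x = 0.
move=> h x; have := eq_psi x; suff -> : cI (fun w => Tk V m x w * psi w) = 0 by rewrite addr0.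
transitivity (cI (fun=> 0 : R[i])); last by rewrite /cI cint0.
have mT : mCX (Tk V m x) := mC2_r x (mC2_Tk m mV).
apply: cI_ae; [meas|exact: mC_cst|].
by apply: (aeS h) => w ->; rewrite mulr0.
Qed.

Lemma psi_eigen : sqi (fun x => nrm (psi x)) -> ~ schrodinger_eigenvalue V (tau ^+ 2) -> forall x, psi x = 0.
move=> sp ne; apply: psi_ae0; apply: contrapT => nz; apply: ne; exists psi; split.
 by move=> /ae_leb3.
have mt : mCX (fun x => (tau ^+ 2)%:C * psi x) := mC_M (mC_cst _) mpsi.
have st : sqi (fun x => nrm ((tau ^+ 2)%:C * psi x)).
 have c0 := sqr_ge0 (nrm (tau ^+ 2)%:C).
 rewrite /sqi (eq_n3 (g2 := fun x => nrm (tau ^+ 2)%:C ^+ 2 * nrm (psi x) ^+ 2)) => [|x]; last by rewrite nrmM exprMn.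
 rewrite (n3Z (mR_X 2 (mC_nrm mpsi)) c0 (fun x => sqr_ge0 _)).
 exact: ltyM (c0 : (0 <= (nrm (tau ^+ 2)%:C ^+ 2)%:E)%E) isT sp.
apply: (graph_intro mpsi sp mt st (F := fun x => (tau ^+ 2)%:C * psi x - (V x)%:C * psi x)) => //.
- exact: loc_V mV kV mpsi fV.
- apply: (@src_le _ (fun x => nrm ((V x)%:C * psi x) + nrm ((tau ^+ 2)%:C * psi x))); first by move=> x; rewrite [leRHS]addrC; exact: nrmB.
 by apply: (srcD (mC_nrm mt) _ (src_Vu mV A0 kV mpsi fV) st) => x; pos.
- exact: psi_weak.
Qed.

Lemma psi_resonance : tau = 0 -> forall x, psi x = 0.
move=> t0; have [sp|nsp] := pselect (sqi (fun x => nrm (psi x))).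
 by apply: psi_eigen => //; rewrite t0 expr0n.
apply: psi_ae0; apply: contrapT => nz; apply: nor; exists psi.
have lp : loc psi.
 by have := kpot_loc mg kg C0 m0; rewrite (_ : pot (Rk m) g = psi)//; fext => x; rewrite -psi_pot.
have lV := loc_V mV kV mpsi fV.
have l0 : loc (fun=> 0 : R[i]).
 by split=> [|r]; [meas|rewrite integral0_eq// => x _; rewrite nrm0 mulr0].
split; [by move=> /ae_leb3|by move=> /in_L2P[]|split; [exact: loc_in_L1loc|exact: loc_in_L1loc|exact: loc_in_L1loc|]|].
 move=> phi tp; apply/(weak_eqP lp lV l0 tp); rewrite (psi_weak tp); apply: eq_cI => x.
 by rewrite t0 expr0n mul0r.
move=> s s2; apply/in_L2P.
have mp : mRX (fun x : R3 R => (1 + enorm x) `^ (- s)).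
 apply: (@mR_comp _ _ _ (fun t => t `^ (- s))); [exact: measurable_powR|].
 meas.
have mf := mC_M (mC_real mp) mpsi; split; first exact: mf.
have M20 : 0 <= M ^+ 2 by pos.
(* As $|\psi|\le M\omega$, the squared weighted function is at most $M^2(1+|x|)^{-2s-2}$, integrable
   on R^3 for s > 1/2. *)
have p3 : 3 < s * 2 + 2 by lra.
have mp' : mRX (fun x : R3 R => (1 + enorm x) `^ (- (s * 2 + 2))).
 apply: (@mR_comp _ _ _ (fun t => t `^ (- (s * 2 + 2)))); [exact: measurable_powR|].
 meas.
apply: (vialt (\I_x (M ^+ 2 * (1 + enorm x) `^ (- (s * 2 + 2))))%E); last first.
 rewrite (n3Z mp' M20 (fun x => powR_ge0 _ _)); exact: ltyZ M20 (omega_powR_int p3).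
apply: n3le; [meas|exact: mR_M (mR_cst _) mp'|by move=> x; pos|move=> x].
have x1 : 0 < 1 + enorm x by have := enge0 x; lra.
have -> : (1 + enorm x) `^ (- (s * 2 + 2)) = ((1 + enorm x) `^ (- s)) ^+ 2 * omega x ^+ 2.
 rewrite opprD powRD; last by apply/implyP => _; rewrite gt_eqF.
 congr (_ * _); first by rewrite -mulNr powRrM powR_mulrn// powR_ge0.
 by rewrite powRN powR_mulrn ?ltW// -exprVn.
rewrite nrmM nrm_real (ger0_norm (powR_ge0 _ _)) [leLHS]exprMn [leRHS]mulrCA; apply: lewl; first pos.
rewrite -exprMn; apply: lerXn2r; rewrite ?nnegrE ?nge0//; pos; pos.
Qed.

(* absorption regularises: -Delta u = -m^2 u + g at m = kappa + i tau has the L^2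
 solution u = R_m g, and Im int conj(g) R_(i tau) g = 0 cancels the 1/kappa of Green's identity *)
Lemma psi_L2 : tau != 0 -> sqi (fun x => nrm (psi x)).
move=> t0; pose mk (n : nat) : R[i] := m + (eps n)%:C.
have e0 n : 0 < @eps n by exact: eps_gt0.
have mk0 n : 0 < Re (mk n) by rewrite /= add0r.
pose u n := pot (Rk (mk n)) g.
have mu_ n : mCX (u n) := mC_kpot mg (mk n).
have n0 : 0 <= nc^-1 :> R := @nci_ge0.
have mgm := mC_nrm mg; have g0 x := nge0 (g x).
have du n x : nrm (u n x - psi x) <= eps n * nc^-1 * S.
 by rewrite psi_pot; have := kpot_shift mg kg gS m0 (ltW (e0 n)) x.
have cg : mCX (fun x => (g x)^*%C) := mC_conj mg.
have l3 : cL1 (fun x => (g x)^*%C * psi x).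
 split; first meas.
 by apply: eq_lty fV => x; rewrite nrmM nrm_conj /g nrmN nrmM nrm_real -mulrA expr2.
(* Here $g=-V\psi$ with V real, so $\bar g\psi=-V|\psi|^2$. *)
have im0 : Im (cI (fun x => (g x)^*%C * psi x)) = 0.
 have := cI_Re (fun x => (g x)^*%C * psi x); rewrite (eq_cI (f2 := fun x => (g x)^*%C * psi x)) => [->//|x].
 by rewrite /g; case: (psi x) => p q; apply: ceqP => /=; ring.
pose I n := fine (\I_x (nrm (u n x) ^+ 2))%E.
have fI n : (\I_x (nrm (u n x) ^+ 2) = (I n)%:E)%E.
 have h : sqi (fun x => nrm (u n x)) by have h := kpot_sqi mg S0 gS (mk0 n).
 rewrite /I fineK// ge0_fin_numE; [exact: h|by apply: n3ge0 => x; pos].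
have In n : I n <= nc^-1 * S ^+ 2 / (2 * `|tau|).
 have [lg hg] := kpot_green mg kg C0 S0 gS (ltW (mk0 n)) (mk0 n).
 have I0 : 0 <= I n by apply: fine_ge0; apply: n3ge0 => x; pos.
 have imk : Im (mk n ^+ 2) = 2 * eps n * tau by rewrite expr2 /=; ring.
 have b : `|Im (cI (fun x => (g x)^*%C * u n x))| <= S * (eps n * nc^-1 * S).
  have -> : Im (cI (fun x => (g x)^*%C * u n x)) = Im (cI (fun x => (g x)^*%C * (u n x - psi x))).
   transitivity (Im (cI (fun x => (g x)^*%C * u n x) - cI (fun x => (g x)^*%C * psi x))).
    have ImB (a c : R[i]) : Im (a - c) = Im a - Im c by case: a c => ? ? [].
    by rewrite ImB im0 subr0.
   by rewrite -(cI_B lg l3); congr Im; apply: eq_cI => x; rewrite mulrBr.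
  apply: le_trans (Im_le_nrm _) _.
  have c0 : 0 <= eps n * nc^-1 * S by pos.
  apply: (cI_le (g := fun x => (eps n * nc^-1 * S) * nrm (g x))).
  - exact: mC_M cg (mC_D (mu_ n) (mC_N mpsi)).
  - exact: mR_M (mR_cst _) mgm.
  - by move=> x; rewrite nrmM nrm_conj mulrC; apply: lewr.
  - rewrite (n3Z mgm c0 g0) (mulrC S) [X in (_ <= X)%E](_ : _ = (eps n * nc^-1 * S)%:E * S%:E)%E; last by rewrite -EFinM.
   by apply: leewl; [pos|exact: gS].
 move: hg; rewrite imk -/(u n) -/(I n) => /(congr1 Num.norm); rewrite normrN normrM (ger0_norm I0) => hg.
 move: b; rewrite -hg normrM (ger0_norm (mge0 (ler0n R 2) (ltW (e0 n)))) => b.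
 have tp : 0 < `|tau| by rewrite normr_gt0.
 rewrite ler_pdivlMr; last pos.
 rewrite -(ler_pM2l (e0 n)); apply: le_trans (_ : _ <= 2 * eps n * `|tau| * I n) _; first by rewrite [leRHS](_ : _ = eps n * (I n * (2 * `|tau|)))//; ring.
 by apply: le_trans b _; rewrite [leLHS](_ : _ = eps n * (nc^-1 * S ^+ 2))//; ring.
apply: (vialt (nc^-1 * S ^+ 2 / (2 * `|tau|))%:E); last exact: ltry.
apply: (n3fatou (f_ := fun n x => nrm (u n x) ^+ 2)).
- by move=> n; exact: mR_X 2 (mC_nrm (mu_ n)).
- by move=> n x; pos.
- move=> x; have [c1 c2] : ccvg (fun n => u n x) (psi x).
  apply/ccvgP; apply/cvgrPdist_le => e ee.
  have c : (fun n => eps n * nc^-1 * S) @ \oo --> (0 : R).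
   rewrite [X in _ --> X](_ : _ = 0 * nc^-1 * S); last by rewrite !mul0r.
   by apply: cvgM; [apply: cvgM; [exact: cvg_harmonic|exact: cvg_cst]|exact: cvg_cst].
  move/cvgrPdist_le : c => /(_ e ee); apply: filterS => n; rewrite !sub0r !normrN => h.
  by rewrite ger0_norm ?nge0//; apply: le_trans (du n x) _; apply: le_trans (ler_norm _) h.
 under eq_fun do rewrite nrm_sqr; rewrite nrm_sqr.
 by apply: cvgD; exact: cvgM.
- by move=> n; rewrite fI lee_fin.
Qed.

(** At energy 0 a solution in L^2 is an eigenfunction and any other a resonance; at energy
    $\tau^2>0$ every solution is in L^2. *)
Lemma kernel_trivial x : psi x = 0.
have [t0|t0] := eqVneq tau 0; first exact: psi_resonance.
by apply: psi_eigen; [exact: psi_L2|apply: nop; rewrite exprn_even_gt0].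
Qed.

End Kernel.
End Injectivity.

(** * Smallness of the squared operator at high energy *)

Section HighEnergy.
Implicit Types (x y w : R3 R) (m : R[i]).

Variables (V V1 : RF) (B r A e : R).
Hypotheses (mV : mRX V) (mV1 : mRX V1) (B0 : 0 <= B) (r0 : 0 < r) (A0 : 0 < A).
Hypotheses (hV1 : forall x, `|V1 x| <= B * ballf 0 r x) (kV : katob (fun x => `|V x|) A).
Hypotheses (kV2 : katob (fun x => `|V x - V1 x|) e) (e0 : 0 < e).
Let K := nc^-1 * (3 * A).
Let K1 := nc^-1 * (3 * (A + e)).
Let d := nc^-1 * (3 * e).
Hypothesis small : d * (K + K1) <= 4^-1.
Let n0 : 0 <= nc^-1 :> R := @nci_ge0.
Let b0 := ballf_ge0 (0 : R3 R) r.
Let mb := mR_ballf 0 r.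
Let r30 : 0 <= 8 * r ^+ 3. Proof. pos. Qed.

Lemma ball_weight x : (\I_w (ballf 0 r w * (1 + (dist x w)^-1) ^+ 2) <= (2 * (8 * r ^+ 3) + 2 * (64 + 8 * r ^+ 3))%:E)%E.
have ms : mRX (fun w => ballf 0 r w * dist w x ^- 2) by meas.
have s0 w : 0 <= ballf 0 r w * dist w x ^- 2 by pos.
apply: (via (\I_w (2 * (ballf 0 r w + ballf 0 r w * dist w x ^- 2)))%E).
 apply: n3le; [by meas|exact: mR_M (mR_cst _) (mR_D mb ms)|pos|move=> w].
 rewrite (enormBC w x) -exprVn; set t := (dist x w)^-1.
 rewrite [leRHS](_ : _ = ballf 0 r w * (2 * (1 + t ^+ 2))); last by ring.
 apply: lewl => //.
 by have := sqr_ge0 (1 - t); rewrite sqrrB sqrrD expr1n; lra.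
rewrite (n3Z (mR_D mb ms) (ler0n R 2) (fun w => addr_ge0 (b0 w) (s0 w))) (n3D mb ms b0 s0) -mulrDr EFinM.
apply: leewl; first pos.
by rewrite EFinD; apply: leeD; [exact: nnballf _ (ltW r0)|exact: ball_sqr_inv x r0].
Qed.

Section Square.
Variable Ab : R.
Hypotheses (Ab0 : 0 < Ab) (kAb : katob (ballf (0 : R3 R) r) Ab).
Let c1 := B * Ab.
Let s1 := B * (8 * r ^+ 3).
Let c10 : 0 <= c1. Proof. by rewrite mge0// ltW. Qed.
Let s10 : 0 <= s1. Proof. exact: mge0. Qed.

Variables (m : R[i]) (k T M : R) (f : CF).
Hypotheses (m0 : 0 <= Re m) (k0 : 0 < k) (T0 : 0 < T) (mT : T <= `|Im m|).
Hypotheses (M0 : 0 < M) (mf : mCX f) (hf : forall x, nrm (f x) <= M * omega x).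
Let h x := (V1 x)%:C * f x.
Let mh : mCX h := mC_M (mC_real mV1) mf.

Let h_le x : nrm (h x) <= (M * B) * ballf 0 r x.
rewrite /h nrmM nrm_real -mulrA mulrC; apply: ler_pM => //; first pos.
by apply: le_trans (hf x) _; apply: ler_piMr; [pos|exact: omega_le1].
Qed.

Let MB0 : 0 <= M * B. Proof. pos. Qed.
Let kh : katob (fun x => nrm (h x)) (M * c1).
rewrite /c1 mulrA; apply: (kato_bound_le (mC_nrm mh) _ h_le (kato_boundZ MB0 kAb)) => x; pos.
Qed.

Let hS : (\I_x (nrm (h x)) <= (M * s1)%:E)%E.
apply: (via (\I_x (M * B * ballf 0 r x))%E).
 by apply: n3le; [meas|meas|by move=> x; pos|exact: h_le].
rewrite (n3Z mb MB0 b0) /s1 mulrA [X in (_ <= X)%E](_ : _ = (M * B)%:E * (8 * r ^+ 3)%:E)%E; last by rewrite -EFinM.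
by apply: leewl; [pos|exact: nnballf _ (ltW r0)].
Qed.

Let u := pot (Rk m) h.
Let mu_ : mCX u := mC_kpot mh m.
Let eta := nc^-1 * c1 * s1 / (k * T) + 2 * (k * nc^-1 * s1) ^+ 2 * (8 * r ^+ 3).

(* compare with absorption [k]: R_(m+k) gains decay in Im m, R_m - R_(m+k) is O(k) *)
Lemma local_decay : (\I_x (ballf 0 r x * nrm (u x) ^+ 2) <= (M ^+ 2 * eta)%:E)%E.
have Mc0 : 0 <= M * c1 by pos.
have Ms0 : 0 <= M * s1 by pos.
have rk : Re (m + k%:C) = Re m + k by case: (m).
have ik : Im ((m + k%:C) ^+ 2) = 2 * (Re m + k) * Im m by rewrite expr2; case: (m) => p q /=; ring.
have mk1 : 0 < Re (m + k%:C) by rewrite rk ltr_wpDl.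
pose u' := pot (Rk (m + k%:C)) h; have mu' : mCX u' := mC_kpot mh _.
have hI := kpot_green_le mh kh Mc0 Ms0 hS (ltW mk1) mk1; set I := fine _ in hI.
have fI : (\I_x (nrm (u' x) ^+ 2) = I%:E)%E.
 have h' : sqi (fun x => nrm (u' x)) by have h' := kpot_sqi mh Ms0 hS mk1.
 rewrite /I fineK// ge0_fin_numE; [exact: h'|by apply: n3ge0 => x; pos].
have I0 : 0 <= I by apply: fine_ge0; apply: n3ge0 => x; pos.
have hI' : I <= nc^-1 * (M * c1) * (M * s1) / (2 * (k * T)).
 rewrite ler_pdivlMr; last pos.
 apply: le_trans hI; rewrite mulrC; apply: lewr => //; rewrite ik !normrM (ger0_norm (ler0n R 2)) -mulrA.
 apply: lewl; first exact: ler0n.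
 by apply: ler_pM => //; [pos|pos|apply: le_trans (ler_norm _); rewrite lerDr].
pose cc := (k * nc^-1 * (M * s1)) ^+ 2; have cc0 : 0 <= cc by exact: sqr_ge0.
have m2 := mR_X 2 (mC_nrm mu'); have q2 x : 0 <= nrm (u' x) ^+ 2 by pos.
have mcb : mRX (fun x => cc * ballf 0 r x) := mR_M (mR_cst cc) mb.
have cb0 x : 0 <= cc * ballf 0 r x by pos.
apply: (via (\I_x (2 * (nrm (u' x) ^+ 2 + cc * ballf 0 r x)))%E).
 apply: n3le; [exact: mR_M mb (mR_X 2 (mC_nrm mu_))|exact: mR_M (mR_cst _) (mR_D m2 mcb)|pos|move=> x].
 rewrite /ballf; case: ifPn => _; last by rewrite mul0r mulr0 addr0 mge0.
 rewrite mul1r mulr1; have hs := kpot_shift mh kh hS m0 (ltW k0) x; rewrite -/u -/u' in hs.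
 have c1' : 0 <= k * nc^-1 * (M * s1) by pos.
 have tri := nrmB (u' x) (u' x - u x); rewrite opprB addrCA subrr addr0 in tri.
 have u0 := nge0 (u x); have v0 := nge0 (u' x).
 rewrite /cc; move: hs c1' tri u0 v0; move: (nrm (u x)) (nrm (u' x)) (nrm _) (k * nc^-1 * (M * s1)).
 move=> a b c c' h1 h2 h3 h4 h5; have := sqr_ge0 (b - c'); have : a <= b + c' by lra.
 by move=> h6; have := ler_pM h4 h4 h6 h6; rewrite -!expr2 sqrrB sqrrD; lra.
rewrite (n3Z (mR_D m2 mcb) (ler0n R 2) (fun x => addr_ge0 (q2 x) (cb0 x))) (n3D m2 mcb q2 cb0) (n3Z mb cc0 b0) fI.
apply: (via (2%:E * (I%:E + cc%:E * (8 * r ^+ 3)%:E))%E).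
 apply: leewl; first pos.
 by apply: leeD => //; apply: leewl; [pos|exact: nnballf _ (ltW r0)].
rewrite -[(cc%:E * _)%E]EFinM -EFinD -EFinM lee_fin; apply: (via (2 * (nc^-1 * (M * c1) * (M * s1) / (2 * (k * T)) + cc * (8 * r ^+ 3)))).
 by apply: lewl => //; rewrite lerD2r.
apply: eqle; rewrite /cc /eta; field.
by rewrite !gt_eqF ?newton_gt0.
Qed.

Let Ca := 2 * (8 * r ^+ 3) + 2 * (64 + 8 * r ^+ 3).
Let Kf := nc^-1 * B * (1 + r).

(** Cauchy-Schwarz in AM-GM form with a free t: u is small in L^2 of the ball, where the kernel is
    at most a multiple of [omega x] times a function of bounded L^2 norm. *)
Lemma local_square x (t : R) : 0 < t ->
 nrm (cI (fun w => Tk V1 m x w * u w)) <= Kf * omega x * (t / 2 * (M ^+ 2 * eta) + (2 * t)^-1 * Ca).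
move=> t0; have o0 := omega_ge0 x; have mub := mC_nrm mu_.
have Kf0 : 0 <= Kf * omega x by rewrite !mge0// addr_ge0// ltW.
pose a w := 1 + (dist x w)^-1; have ma : mRX a by rewrite /a; meas.
have a0 w : 0 <= a w by rewrite addr_ge0// invr_ge0 enge0.
have M1 : mRX (fun w => ballf 0 r w * nrm (u w) ^+ 2) := mR_M mb (mR_X 2 mub).
have M2 : mRX (fun w => ballf 0 r w * a w ^+ 2) := mR_M mb (mR_X 2 ma).
have p1 w : 0 <= ballf 0 r w * nrm (u w) ^+ 2 by pos.
have p2 w : 0 <= ballf 0 r w * a w ^+ 2 by pos.
have t1 : 0 <= t / 2 by rewrite divr_ge0// ltW.
have t2 : 0 <= (2 * t)^-1 by pos.
have M1' := mR_M (mR_cst (t / 2)) M1; have M2' := mR_M (mR_cst (2 * t)^-1) M2.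
pose G w := t / 2 * (ballf 0 r w * nrm (u w) ^+ 2) + (2 * t)^-1 * (ballf 0 r w * a w ^+ 2).
have G0 w : 0 <= G w by rewrite addr_ge0// mge0.
apply: (cI_le (g := fun w => Kf * omega x * G w)).
- exact: mC_M (mC2_r x (mC2_Tk m mV1)) mu_.
- exact: mR_M (mR_cst _) (mR_D M1' M2').
- move=> w; rewrite nrmM nrm_Tk.
 have h1 := Rk_le x w m0; have u0 := nge0 (u w).
 apply: (via ((nc^-1 * (dist x w)^-1) * (B * ballf 0 r w) * nrm (u w))).
  apply: lewr => //; apply: ler_pM => //; pos.
 rewrite /G /ballf subr0; case: ifPn => wr; last by rewrite !(mul0r, mulr0) addr0 mulr0.
 rewrite !mul1r mulr1; apply: (via (Kf * omega x * (a w * nrm (u w)))).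
  rewrite mulrA; apply: lewr => //; rewrite /Kf mulrAC -!mulrA; apply: lewl => //; apply: lewl => //.
  by have := ball_omega x r0 wr; rewrite -mulrA.
 apply: lewl => //.
 have -> : t / 2 * nrm (u w) ^+ 2 + (2 * t)^-1 * a w ^+ 2 = a w * nrm (u w) + (2 * t)^-1 * (t * nrm (u w) - a w) ^+ 2.
  by field; rewrite gt_eqF.
 by rewrite lerDl mge0// sqr_ge0.
- rewrite (n3Z (mR_D M1' M2') Kf0 G0) [X in (_ <= X)%E]EFinM; apply: leewl; first pos.
 rewrite (n3D M1' M2' (fun w => mge0 t1 (p1 w)) (fun w => mge0 t2 (p2 w))) (n3Z M1 t1 p1) (n3Z M2 t2 p2) EFinD.
 apply: leeD.
  rewrite [X in (_ <= X)%E](_ : _ = (t / 2)%:E * (M ^+ 2 * eta)%:E)%E; last by rewrite -EFinM.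
  by apply: leewl; [pos|exact: local_decay].
 rewrite [X in (_ <= X)%E](_ : _ = (2 * t)^-1%:E * Ca%:E)%E; last by rewrite -EFinM.
 by apply: leewl; [pos|exact: ball_weight].
Qed.

End Square.

Lemma double_T1 : exists2 T : R, 0 < T & forall m (M : R) (f : CF),
 0 <= Re m -> T <= `|Im m| -> 0 < M -> mCX f -> (forall x, nrm (f x) <= M * omega x) ->
 forall x, nrm (cI (fun w => Tk V1 m x w * cI (fun z => Tk V1 m w z * f z))) <= M * 4^-1 * omega x.
have [Ab Ab0 kAb] := ball_kato r0.
pose Ca : R := 2 * (8 * r ^+ 3) + 2 * (64 + 8 * r ^+ 3).
pose Kf : R := nc^-1 * B * (1 + r).
pose c1 : R := B * Ab; pose s1 : R := B * (8 * r ^+ 3).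
have Ca0 : 0 <= Ca by rewrite addr_ge0// mge0// addr_ge0.
have Kf0 : 0 <= Kf by rewrite !mge0// addr_ge0// ltW.
have c10 : 0 <= c1 by rewrite mge0// ltW.
have s10 : 0 <= s1 by exact: mge0.
(* With [t = 4 * q / M] each term of [local_square] is to be at most M/8. For this [h] is the
   admissible size of [eta], [k] brings its second term below h/2, and [T] then its first. *)
pose q : R := Ca * Kf + 1; have q1 : 1 <= q by rewrite lerDr mge0.
have q0 : 0 < q by exact: lt_le_trans ltr01 q1.
pose h : R := (16 * q * (Kf + 1))^-1.
have h0 : 0 < h by rewrite invr_gt0 !mulr_gt0//; lra.
have h1 : h <= 1.
 rewrite invf_le1; last pos.
 rewrite -mulrA; have : 1 <= q * (Kf + 1) by rewrite -[leLHS]mulr1; apply: ler_pM => //; lra.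
 lra.
pose D : R := 2 * (nc^-1 * s1) ^+ 2 * (8 * r ^+ 3).
have D0 : 0 <= D by rewrite mge0// mge0// sqr_ge0.
pose k : R := h / (2 * (D + 1)); have D1 : 0 < 2 * (D + 1) by lra.
have k0 : 0 < k by exact: divr_gt0.
have k1 : k <= 1 by rewrite ler_pdivrMr// mul1r; lra.
pose S : R := nc^-1 * c1 * s1; have S0 : 0 <= S := mge0 (mge0 n0 c10) s10.
pose T : R := 2 * (S + 1) / (k * h); have S1 : 0 < 2 * (S + 1) by lra.
have T0 : 0 < T by rewrite divr_gt0// mulr_gt0.
exists T => // m M f m0 mT M0 mf hf x.
have t0 : 0 < 4 * q / M by pos.
have := local_square Ab0 kAb m0 k0 T0 mT M0 mf hf x t0.
rewrite -/c1 -/s1 -/Ca -/Kf -/S (eq_cI (f2 := fun w => Tk V1 m x w * cI (fun z => Tk V1 m w z * f z))) => [hx|w]; last first.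
 by congr (_ * _); apply: eq_cI => z; rewrite /Tk mulrA.
apply: le_trans hx _; set eta := S / (k * T) + _; rewrite mulrAC; apply: lewr; first pos.
have he : eta <= h.
 have a1 : S / (k * T) <= h / 2.
  have -> : k * T = 2 * (S + 1) / h by rewrite /T; field; rewrite !gt_eqF.
  rewrite invf_div mulrA ler_pdivrMr//; have : 0 <= h * S by pos.
  have := h0; nra.
 have a2 : 2 * (k * nc^-1 * s1) ^+ 2 * (8 * r ^+ 3) <= h / 2.
  apply: (via (D * k)).
   rewrite [leLHS](_ : _ = D * k * k); last by rewrite /D; ring.
   by apply: ler_piMr => //; pos.
  rewrite /k mulrA ler_pdivrMr//; have := h0; nra.
 by rewrite /eta; lra.
have hq : h * (16 * q * (Kf + 1)) = 1 by rewrite mulVf// gt_eqF// -invr_gt0.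
have e1 : Kf * (2 * q * eta) <= 8^-1.
 apply: (via (Kf * (2 * q * h))).
  by apply: lewl => //; apply: lewl => //; pos.
 rewrite [leLHS](_ : _ = 8^-1 * (h * (16 * q * (Kf + 1))) - 2 * (h * q)); last by field.
 rewrite hq mulr1 lerBlDr lerDl; pos.
have e2 : Kf * (Ca / (8 * q)) <= 8^-1.
 by rewrite mulrA ler_pdivrMr ?mulr_gt0// mulrA mulVf// mul1r mulrC /q lerDl.
rewrite [leLHS](_ : _ = M * (Kf * (2 * q * eta) + Kf * (Ca / (8 * q)))); last by field; rewrite !gt_eqF.
by apply: lewl; [pos|lra].
Qed.

Let third (a b c M : R) : 0 <= M -> a * (b + c) <= 4^-1 -> M / 4 + c * (a * M) + a * (b * M) <= M / 2.
by move=> M0 h; have := lewr M0 h; lra. Qed.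

Let base (a M : R) : 0 <= a -> 0 <= M -> M <= 2 * (1 + a) * M /\ a * M <= 2 * (1 + a) * M * (3 / 4).
by move=> a0 M0; have := mge0 a0 M0; split; lra. Qed.

Let step (z : R) : 0 <= z -> z / 2 <= z * 3 / 4 * 3 / 4.
lra. Qed.

Let kV1 : katob (fun x => `|V1 x|) (A + e).
apply: (kato_bound_le (mR_norm mV1) (fun x => normr_ge0 (V1 x)) _ (kato_boundD kV kV2)) => x.
by rewrite -{1}[V1 x](subKr (V x)); exact: ler_normB.
Qed.

Lemma high_energy : exists2 T : R, 0 < T & forall m,
 0 <= Re m -> T <= `|Im m| -> geomp om (cst2 (Tk V m)) (2 * (1 + K)) (3 / 4).
have [T T0 hT] := double_T1; exists T => // m m0 mT.
have K0 : 0 <= K by rewrite mge0// mge0// ltW.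
have K10 : 0 <= K1 by rewrite mge0// mge0// addr_ge0// ltW.
have d0 : 0 <= d by rewrite mge0// mge0// ltW.
have mom : mR2 om by exact: mR2_om.
have om0 y x : 0 <= om y x by pos.
pose V2 x := V x - V1 x; have mV2 : mRX V2 := mR_D mV (mR_N mV1).
pose D0 := cst2 (Tk V m); pose D1 := cst2 (Tk V1 m); pose D2 := cst2 (Tk V2 m).
have dm0 := dom_Tk mV m0; have dm1 := dom_Tk mV1 m0; have dm2 := dom_Tk mV2 m0.
have kb0 := kbd_E0 kV; have kb1 := kbd_E0 kV1; have kb2 := kbd_E0 kV2.
have b0' f M : bdd om f M -> 0 <= M -> bdd om (app D0 f) (K * M) by move=> ? ?; exact: (app_bdd mom om0 kb0 dm0).
have b1' f M : bdd om f M -> 0 <= M -> bdd om (app D1 f) (K1 * M) by move=> ? ?; exact: (app_bdd mom om0 kb1 dm1).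
have b2' f M : bdd om f M -> 0 <= M -> bdd om (app D2 f) (d * M) by move=> ? ?; exact: (app_bdd mom om0 kb2 dm2).
have split f M : bdd om f M -> 0 <= M -> forall y x, app D0 f y x = app D1 f y x + app D2 f y x.
 move=> hf M0 y x; have l1 := app_integrable mom om0 kb1 y x dm1 hf M0; have l2 := app_integrable mom om0 kb2 y x dm2 hf M0.
 rewrite /app -(cI_D l1 l2); apply: eq_cI => w; rewrite /D0 /D1 /D2 /cst2 /Tk -mulrDl -mulrDr; congr (_ * _ * _).
 by rewrite -rmorphD /= addrC subrK.
(* $T^2=T_1^2+T_1T_2+T_2T$: the first term has norm at most 1/4 by [double_T1], the other two
   together at most 1/4 because [V2] is small. *)
have half f M : bdd om f M -> 0 <= M -> bdd om (app D0 (app D0 f)) (M / 2).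
 move=> hf M0; have KM : 0 <= K * M by pos.
 have dM : 0 <= d * M by pos.
 have KM1 : 0 <= K1 * M by pos.
 have h0 := b0' _ _ hf M0; have h00 := b0' _ _ h0 KM; split; first exact: h00.1.
 move=> y x; rewrite (split _ _ h0 KM).
 have h1 := b1' _ _ hf M0; have h2 := b2' _ _ hf M0.
 have -> : app D1 (app D0 f) y x = app D1 (app D1 f) y x + app D1 (app D2 f) y x.
  have l1 := app_integrable mom om0 kb1 y x dm1 h1 KM1; have l2 := app_integrable mom om0 kb1 y x dm1 h2 dM.
  by rewrite {1 3 4}/app -(cI_D l1 l2); apply: eq_cI => w; rewrite -mulrDr (split _ _ hf M0).
 have t1 : nrm (app D1 (app D1 f) y x) <= M / 4 * omega x.
  have o1 := omega_le1 x; have o0 := omega_ge0 x.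
  (* [double_T1] wants a positive bound, while M may be 0. *)
  apply/ler_addgt0Pr => ep ep0; have Me : 0 < M + ep by rewrite ltr_wpDl.
  have hfy z : nrm (f y z) <= (M + ep) * omega z.
   by apply: le_trans (hf.2 y z) _; apply: lewr; [pos|rewrite lerDl ltW].
  have h := hT m (M + ep) (f y) m0 mT Me (mC2_r y hf.1) hfy x; apply: le_trans h _.
  nra.
 have t2 := (b1' _ _ h2 dM).2 y x; have t3 := (b2' _ _ h0 KM).2 y x.
 apply: le_trans (nrmD _ _) _; apply: le_trans (lerD (nrmD _ _) (lexx _)) _.
 apply: le_trans (lerD (lerD t1 t2) t3) _; rewrite /om -!mulrDl; apply: lewr; first pos.
 exact: third M0 small.
move=> f M hf M0 k.
have Ag0 : 0 <= 2 * (1 + K) * M by pos.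
(* Two consecutive iterates are carried along, since only the square contracts: $1/2\le(3/4)^2$
   gives the ratio, and the factor [2 * (1 + K)] pays for the first two. *)
suff [] : bdd om (npow D0 f k) (2 * (1 + K) * M * (3 / 4) ^+ k) /\ bdd om (npow D0 f k.+1) (2 * (1 + K) * M * (3 / 4) ^+ k.+1) by [].
elim: k => [|k [h1 h2]]; split.
- by apply: (bdd_le om0 hf); rewrite expr0 mulr1; have [] := base K0 M0.
- by apply: (bdd_le om0 (bddN (b0' _ _ hf M0))); rewrite expr1; have [] := base K0 M0.
- exact: h2.
- have q0 : 0 <= 2 * (1 + K) * M * (3 / 4) ^+ k by pos.
 have := half _ _ h1 q0; have -> : npow D0 f k.+2 = app D0 (app D0 (npow D0 f k)).
  fext => y; fext => x; rewrite /= {1 3}/app -cI_N; last first.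
   exact: (app_integrable mom om0 kb0 y x dm0 (bddN (b0' _ _ h1 q0)) (mge0 K0 q0)).
  by apply: eq_cI => w; rewrite mulrN opprK.
 move=> h; apply: (bdd_le om0 h); rewrite 2!exprSr !mulrA; exact: step q0.
Qed.

End HighEnergy.

(** * From the kernel to the resolvent and its boundary values *)

Section BoundaryValues.
Implicit Types (x y w : R3 R) (f g u : CF) (m : R[i]).

(** The last clause turns a kernel bounded by $C/|x-y|$ into a function bounded by a multiple of
    [omega]. *)
Definition source f (C : R) := [/\ mCX f, sqi (fun x => nrm (f x)), katob (fun x => nrm (f x)) C,
 (\I_x (nrm (f x)) <= C%:E)%E & forall x, (\I_w (nrm (f w) / dist x w) <= (C * omega x)%:E)%E].

Lemma L2comp_source f : in_L2comp f -> exists2 C : R, 0 <= C & source f C.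
move=> [/in_L2P [mf f2] [r1 hr1]]; pose r : R := `|r1| + 1.
have r0 : 0 < r by rewrite ltr_wpDl.
have fr x : r < enorm x -> f x = 0.
 by move=> h; apply: hr1; apply: lelt (ler_norm _) _; apply: lt_trans h; rewrite ltrDl.
have mm := mC_nrm mf; have p x := nge0 (f x); have m2 := mR_X 2 mm; have p2 x : 0 <= nrm (f x) ^+ 2 by pos.
have mb := mR_ballf 0 r; have b0 := ballf_ge0 (0 : R3 R) r.
pose F := fine (\I_x (nrm (f x) ^+ 2))%E.
have fF : (\I_x (nrm (f x) ^+ 2) = F%:E)%E by rewrite /F fineK// ge0_fin_numE; [exact: f2|exact: n3ge0].
have F0 : 0 <= F by apply: fine_ge0; exact: n3ge0.
have sq (a b : R) : a * b <= a ^+ 2 + b ^+ 2 by have := sqr_ge0 (a - b); have := sqr_ge0 (a + b); rewrite sqrrB sqrrD; lra.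
have r3 : 0 <= 8 * r ^+ 3 by pos.
pose S := F + 8 * r ^+ 3; have S0 : 0 <= S by exact: addr_ge0.
pose A := F + (64 + 8 * r ^+ 3); have A0 : 0 <= A by rewrite addr_ge0// addr_ge0.
have hS : (\I_x (nrm (f x)) <= S%:E)%E.
 apply: (via (\I_x (nrm (f x) ^+ 2 + ballf 0 r x))%E).
  apply: n3le => // [|x]; first meas.
  rewrite /ballf subr0; case: (leP (enorm x) r) => h; last by rewrite fr// nrm0 expr0n addr0.
  by have := sq (nrm (f x)) 1; rewrite mulr1 expr1n.
 by rewrite (n3D m2 mb p2 b0) fF EFinD; apply: leeD => //; exact: nnballf _ (ltW r0).
have hA y : (\I_x (nrm (f x) / dist x y) <= A%:E)%E.
 have ms : mRX (fun w => ballf 0 r w * dist w y ^- 2) by meas.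
 have s0 w : 0 <= ballf 0 r w * dist w y ^- 2 by pos.
 apply: (via (\I_x (nrm (f x) ^+ 2 + ballf 0 r x * dist x y ^- 2))%E).
  apply: n3le; [by meas|meas|pos|move=> x].
  rewrite /ballf subr0; case: (leP (enorm x) r) => h; last by rewrite fr// nrm0 !mul0r expr0n addr0.
  by rewrite mul1r -exprVn.
 rewrite (n3D m2 ms p2 s0) fF EFinD; apply: leeD => //; exact: ball_sqr_inv y r0.
pose C := (1 + r) * (S + A); have r1' : 1 <= 1 + r by rewrite lerDl ltW.
have SA : 0 <= S + A by pos.
have C1 : S + A <= C by exact: ler_peMl.
exists C; first exact: le_trans C1.
split=> //.
- split=> // y; apply: le_trans (hA y) _; rewrite lee_fin; apply: le_trans C1; by rewrite lerDr.
- by apply: le_trans hS _; rewrite lee_fin; apply: le_trans C1; rewrite lerDl.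
- move=> x; have o0 := omega_ge0 x.
 have c0 : 0 <= (1 + r) * omega x by pos.
 have mi : mRX (fun w => nrm (f w) / dist w x) by meas.
 have i0 w : 0 <= nrm (f w) / dist w x by pos.
 apply: (via (\I_w ((1 + r) * omega x * (nrm (f w) + nrm (f w) / dist w x)))%E).
  apply: n3le; [by meas|meas|pos|move=> w].
  have [h|h] := leP (enorm w) r; last by rewrite fr// nrm0 !mul0r addr0 mulr0.
  rewrite -[X in _ * (X + _)]mulr1 -mulrDr mulrCA enormBC; apply: lewl => //.
  by have := ball_omega x r0 h; rewrite enormBC.
 rewrite (n3Z (mR_D mm mi) c0 (fun w => addr_ge0 (p w) (i0 w))) (n3D mm mi p i0).
 rewrite [X in (_ <= X)%E](_ : _ = ((1 + r) * omega x)%:E * (S%:E + A%:E))%E; last by rewrite -EFinD -EFinM /C mulrAC.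
 by apply: leewl; [pos|exact: leeD].
Qed.

Variables (V : RF) (A : R).
Hypotheses (mV : mRX V) (A0 : 0 < A) (kV : katob (fun x => `|V x|) A).

Section Kernel.
Variables (m : R[i]) (K : KF) (C : R) (f : CF) (Cf : R).
Hypotheses (m0 : 0 <= Re m) (mK : mC2 K) (C0 : 0 <= C) (hK : forall x y, nrm (K x y) <= C / dist x y).
Hypothesis eqK : forall x y, x <> y -> K x y + cI (fun w => Tk V m x w * K w y) = Rk m x y.
Hypotheses (Cf0 : 0 <= Cf) (hf : source f Cf).
Let u := pot K f.
Let M := C * Cf.
Let mf : mCX f. Proof. by have [] := hf. Qed.
Let mm := mC_nrm mf.
Let p x := nge0 (f x).
Let kf : katob (fun x => nrm (f x)) Cf. Proof. by have [] := hf. Qed.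
Let M0 : 0 <= M. Proof. exact: mge0. Qed.
Let mu_ : mCX u := mC_pot mK mf.

Let mi x : mRX (fun w => nrm (f w) / dist x w). Proof. by meas. Qed.
Let i0 x w : 0 <= nrm (f w) / dist x w. Proof. pos. Qed.

Let kint x : (\I_w (nrm (K x w * f w)) <= (M * omega x)%:E)%E.
apply: (via (\I_w (C * (nrm (f w) / dist x w)))%E).
 apply: n3le; [exact: mC_nrm (mC_M (mC2_r x mK) mf)|meas|by move=> w; pos|move=> w].
 by rewrite nrmM [leRHS]mulrCA mulrC; apply: lewl.
rewrite (n3Z (mi x) C0 (i0 x)) /M -mulrA EFinM; apply: leewl; first pos.
by have [_ _ _ _ h] := hf; exact: h.
Qed.

Lemma pot_omega x : nrm (u x) <= M * omega x.
by rewrite -lee_fin; apply: le_trans (kint x); exact: nrm_cI_le (mC_M (mC2_r x mK) mf). Qed.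

Let Vu w := (V w)%:C * u w.
Let mVu : mCX Vu := mC_M (mC_real mV) mu_.
Let Vu_le w : nrm (Vu w) <= M * (`|V w| * omega w).
by rewrite /Vu nrmM nrm_real mulrCA; apply: lewl => //; exact: pot_omega. Qed.
Let kVu : katob (fun x => nrm (Vu x)) (M * A).
apply: (kato_bound_le (mC_nrm mVu) (fun x => nge0 (Vu x)) _ (kato_boundZ M0 kV)) => x.
by apply: le_trans (Vu_le x) _; apply: lewl => //; apply: ler_piMr => //; exact: omega_le1.
Qed.

Let g w := f w - Vu w.
Let mg : mCX g := mC_D mf (mC_N mVu).
Let g_le w : nrm (g w) <= nrm (f w) + nrm (Vu w). Proof. exact: nrmB. Qed.
Let kg : katob (fun x => nrm (g x)) (Cf + M * A).
exact: (kato_bound_le (mC_nrm mg) (fun x => nge0 (g x)) g_le (kato_boundD kf kVu)). Qed.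
Let S := Cf + M * (2 * A).
Let gS : (\I_x (nrm (g x)) <= S%:E)%E.
have mW := mR_norm mV; have mo1 := mR_M mW (@mR_omega); have po x : 0 <= `|V x| * omega x by pos.
have mVm := mC_nrm mVu; have pV x := nge0 (Vu x).
apply: (via (\I_x (nrm (f x) + nrm (Vu x)))%E).
 by apply: n3le; [meas|meas|by move=> x; pos|exact: g_le].
rewrite (n3D mm mVm p pV) /S EFinD; apply: leeD; first by have [] := hf.
apply: (via (\I_x (M * (`|V x| * omega x)))%E).
 by apply: n3le; [exact: mVm|exact: mR_M (mR_cst _) mo1|exact: pV|exact: Vu_le].
rewrite (n3Z mo1 M0 po) [X in (_ <= X)%E](_ : _ = M%:E * (2 * A)%:E)%E; last by rewrite -EFinM.
by apply: leewl; [pos|exact: kato_omega_int kV].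
Qed.
Let CA0 : 0 <= Cf + M * A. Proof. pos. Qed.
Let S0 : 0 <= S. Proof. by rewrite addr_ge0// !mge0// ltW. Qed.

Let TK_int x y : x <> y -> cL1 (fun w => Tk V m x w * K w y).
move=> xy; have mW := mR_norm mV; have q0 w : 0 <= `|V w| * ((dist x w)^-1 * (dist w y)^-1) by pos.
have mq : mRX (fun w => `|V w| * ((dist x w)^-1 * (dist w y)^-1)) by meas.
have c0 : 0 <= nc^-1 * C by pos.
apply: (cL1_le (g := fun w => nc^-1 * C * (`|V w| * ((dist x w)^-1 * (dist w y)^-1)))).
- exact: mC_M (mC2_r x (mC2_Tk m mV)) (mC2_l y mK).
- exact: mR_M (mR_cst _) mq.
- move=> w; rewrite nrmM nrm_Tk.
 rewrite [leRHS](_ : _ = nc^-1 / dist x w * `|V w| * (C / dist w y)); last by ring.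
 apply: ler_pM => //; [pos|pos|apply: lewr => //; exact: Rk_le].
- rewrite (n3Z mq c0 q0); apply: ltyZ c0 _.
 exact: lelt (kato_weight_dist kV xy) (ltry _).
Qed.

Let Tu x : cI (fun w => Tk V m x w * u w) = pot (Rk m) f x - u x.
have l1 := kpot_cL1 mf kf m0 x.
have l2 : cL1 (fun w => K x w * f w) by split; [exact: mC_M (mC2_r x mK) mf|exact: lelt (kint x) (ltry _)].
pose F w y := Tk V m x w * (K w y * f y).
have mT := mC2_r x (mC2_Tk m mV).
have mF : mC2 F.
 apply: mC_M; first by apply: (mC_c mT (h := fun q : (X * X)%type => q.1)); mproj.
 meas.
have iF w : (\I_y (nrm (F w y)) <= (nrm (Tk V m x w) * (M * omega w))%:E)%E.
 have mKf := mC_nrm (mC_M (mC2_r w mK) mf).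
 rewrite (eq_n3 (g2 := fun y => nrm (Tk V m x w) * nrm (K w y * f y))) => [|y]; last by rewrite /F nrmM.
 rewrite (n3Z mKf (nge0 _) (fun y => nge0 (K w y * f y))) EFinM.
 by apply: leewl; [pos|exact: kint].
have fin : (\int[mu]_w \I_y (nrm (F w y)) < +oo)%E.
 have mTm := mC_nrm mT; have mW := mR_norm mV.
 have mW1 : mRX (fun w => `|V w| / dist w x) by meas.
 have p1 w : 0 <= `|V w| / dist w x by pos.
 have mo : mRX (fun w => M * nc^-1 * (`|V w| / dist w x)) := mR_M (mR_cst _) mW1.
 have c0 : 0 <= M * nc^-1 by pos.
 have mI := n3mE (mC_nrm mF) (fun w y => nge0 (F w y)).
 apply: (vialt (\I_w (M * nc^-1 * (`|V w| / dist w x)))%E).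
  apply: e3le; [exact: mI|exact: mEX_EFin mo|by move=> w; apply: n3ge0 => y; rewrite nge0|move=> w].
  apply: le_trans (iF w) _; rewrite lee_fin nrm_Tk mulrCA -mulrA; apply: lewl => //.
  rewrite mulrA; apply: (via (nrm (Rk m x w) * `|V w|)).
   by apply: ler_piMr; [pos|exact: omega_le1].
  rewrite [leRHS]mulrAC; apply: lewr => //; rewrite enormBC; exact: Rk_le.
 rewrite (n3Z mW1 c0 p1); apply: ltyZ c0 _.
 by have [_ _ h] := kV; exact: lelt (h x) (ltry _).
rewrite (eq_cI (f2 := fun w => cI (F w))) => [|w]; last by rewrite /u /pot -cI_Z//; split; [exact: mC_M (mC2_r w mK) mf|exact: lelt (kint w) (ltry _)].
rewrite (cI_fubini mF fin) /u /pot -(cI_B l1 l2); apply: cI_ae.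
- have [mF1 mF2] := mF.
 have s1 := mR2_swap (F := fun a c => Re (F a c)) mF1; have s2 := mR2_swap (F := fun a c => Im (F a c)) mF2.
 exact: (cI_cI (F := fun y w => F w y) (conj s1 s2)).
- exact: mC_D l1.1 (mC_N l2.1).
- apply: (aeS (ae_neq x)) => y /nesym xy.
 have := eqK xy; have l := TK_int xy.
 rewrite (eq_cI (f1 := F^~ y) (f2 := fun w => f y * (Tk V m x w * K w y))) => [<-|w]; last by rewrite /F mulrA mulrC.
 by rewrite (cI_Z _ l); ring.
Qed.

Let u_pot : u = pot (Rk m) g.
fext => x; have l1 := kpot_cL1 mf kf m0 x; have l2 := kpot_cL1 mVu kVu m0 x.
rewrite /pot /g (eq_cI (f2 := fun w => Rk m x w * f w - Rk m x w * Vu w)) => [|w]; last by rewrite mulrBr.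
rewrite (cI_B l1 l2) [X in _ - X](_ : _ = cI (fun w => Tk V m x w * u w)); last by apply: eq_cI => w; rewrite mulrA.
by rewrite Tu opprB addrCA subrr addr0.
Qed.

(** By [u_pot] u is the free potential of f - Vu, so square integrability, the weak equation and the
    source property come from the free theory. *)
Lemma kernel_graph : 0 < Re m -> schrodinger_graph V u (fun x => f x - m ^+ 2 * u x).
move=> m1; have su : sqi (fun x => nrm (u x)) by rewrite u_pot; have h := kpot_sqi mg S0 gS m1.
have fV := kato_sq mV kV mu_ M0 pot_omega.
have mu2 : mCX (fun x => - m ^+ 2 * u x) := mC_M (mC_cst (- m ^+ 2)) mu_.
have mF : mCX (fun x => f x - m ^+ 2 * u x).
 by apply: mC_D mf _; apply: mC_N; exact: mC_M (mC_cst _) mu_.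
apply: (graph_intro (F := fun x => - m ^+ 2 * u x + g x)) => //.
- have [_ sf _ _ _] := hf; have m2f := mR_X 2 mm; have m2u := mR_X 2 (mC_nrm mu_).
 pose c := nrm (m ^+ 2) ^+ 2; have c0 : 0 <= c by exact: sqr_ge0.
 have q1 x : 0 <= nrm (f x) ^+ 2 by pos.
 have q2 x : 0 <= nrm (u x) ^+ 2 by pos.
 have m3 : mRX (fun x => c * nrm (u x) ^+ 2) := mR_M (mR_cst c) m2u.
 have q3 x : 0 <= c * nrm (u x) ^+ 2 by pos.
 apply: (vialt (\I_x (2 * (nrm (f x) ^+ 2 + c * nrm (u x) ^+ 2)))%E).
  apply: n3le; [exact: mR_X 2 (mC_nrm mF)|exact: mR_M (mR_cst _) (mR_D m2f m3)|by move=> x; pos|move=> x].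
  rewrite /c -exprMn -nrmM; have h := nrmB (f x) (m ^+ 2 * u x).
  have := nge0 (f x - m ^+ 2 * u x); move: h; move: (nrm _) (nrm _) (nrm _) => a b d h1 h2.
  by have := ler_pM h2 h2 h1 h1; rewrite -!expr2; have := sqr_ge0 (b - a); rewrite sqrrB sqrrD; lra.
 rewrite (n3Z (mR_D m2f m3) (ler0n R 2) (fun x => addr_ge0 (q1 x) (q3 x))) (n3D m2f m3 q1 q3) (n3Z m2u c0 q2).
 apply: ltyM (ler0n R 2 : (0 <= (2 : R)%:E)%E) isT _; apply: lte_add_pinfty sf _.
 exact: ltyZ c0 su.
- by move=> x; rewrite /g /Vu; ring.
- exact: loc_V mV kV mu_ fV.
- by rewrite u_pot; have h := kpot_src mg kg CA0 S0 gS m1.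
- by move=> phi tp; rewrite u_pot; have h := kpot_weak mg kg CA0 m0 tp.
Qed.

(** [resolvent] chooses some solution. As u is one, the chosen function solves the equation too, and
    uniqueness identifies them almost everywhere. *)
Lemma resolvent_kernel : Im (m ^+ 2) != 0 -> 0 < Re m ->
 mCX (resolvent V (- m ^+ 2) f) /\ {ae mu, forall x : R3 R, resolvent V (- m ^+ 2) f x = u x}.
move=> z0 m1; have G := kernel_graph m1.
have G' : schrodinger_graph V u (fun x => f x + - m ^+ 2 * u x).
 by rewrite (_ : (fun x => f x + - m ^+ 2 * u x) = fun x => f x - m ^+ 2 * u x)//; fext => x; rewrite mulNr.
have G1 : schrodinger_graph V (resolvent V (- m ^+ 2) f) (fun x => f x + - m ^+ 2 * resolvent V (- m ^+ 2) f x).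
 exact: (xgetI (fun=> 0) (P := [set u | schrodinger_graph V u (fun x => f x + - m ^+ 2 * u x)]) G').
have [[mr _] _ _ _] := graph_data mV G1; split; first exact: mr.
have z1 : Im (- m ^+ 2) != 0 by move: z0; case: (m ^+ 2) => a b /=; rewrite oppr_eq0.
have h := graph_unique mV A0 kV z1 G1 G'; exact: h.
Qed.

Lemma kernel_L2loc : in_L2loc u.
move=> r; rewrite (_ : (fun x => (\1_(eball r) x)%:C * u x) = fun x => (ballf 0 r x)%:C * u x); last first.
 by fext => x; rewrite indicE /ballf subr0; case: (leP (enorm x) r) => h; [rewrite mem_set|rewrite memNset// => /=; apply/negP; rewrite -ltNge].
apply/in_L2P.
have mb := mR_ballf 0 r; have b0 := ballf_ge0 (0 : R3 R) r.
have mbu : mCX (fun x => (ballf 0 r x)%:C * u x) := mC_M (mC_real mb) mu_.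
split => //; have M2 : 0 <= M ^+ 2 by pos.
apply: (vialt (\I_x (M ^+ 2 * ballf 0 r x))%E).
 apply: n3le; [meas|exact: mR_M (mR_cst _) mb|by move=> x; pos|move=> x].
 rewrite nrmM nrm_real (ger0_norm (b0 x)) exprMn mulrC.
 have hu : nrm (u x) <= M.
  by apply: le_trans (pot_omega x) _; apply: ler_piMr => //; exact: omega_le1.
 apply: ler_pM; [pos|pos|by apply: lerXn2r; rewrite ?nnegrE ?nge0|].
 by rewrite /ballf; case: ifP; rewrite ?expr1n// expr0n.
rewrite (n3Z mb M2 b0); apply: ltyZ M2 _; exact: ball_fin.
Qed.

End Kernel.

(** The root m of $-m^2=\lambda\pm ie$ with nonnegative real part. For [b = false] its imaginary
    part is nonpositive, so that [cexp] yields $e^{+i\sqrt\lambda r}$ in the limit. *)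
Definition root (b : bool) (lam e : R) : R[i] :=
 Num.sqrt ((Num.sqrt (lam ^+ 2 + e ^+ 2) - lam) / 2) +i* (- (-1) ^+ b * Num.sqrt ((Num.sqrt (lam ^+ 2 + e ^+ 2) + lam) / 2)).

Section Root.
Variables (b : bool) (lam : R).
Hypothesis lam0 : 0 <= lam.

Let rho_ge e : lam <= Num.sqrt (lam ^+ 2 + e ^+ 2).
by rewrite -{1}(ger0_norm lam0) -sqrtr_sqr ler_sqrt ?addr_ge0 ?sqr_ge0// lerDl sqr_ge0. Qed.

Lemma root_sqr e : 0 <= e -> - root b lam e ^+ 2 = lam +i* ((-1) ^+ b * e).
move=> e0; have h := rho_ge e; rewrite expr2 /root; set rho := Num.sqrt (lam ^+ 2 + e ^+ 2) in h *.
have r2 : rho ^+ 2 = lam ^+ 2 + e ^+ 2 by rewrite sqr_sqrtr// addr_ge0// sqr_ge0.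
have p1 : 0 <= (rho - lam) / 2 by rewrite divr_ge0// subr_ge0.
have p2 : 0 <= (rho + lam) / 2 by rewrite divr_ge0// addr_ge0// (le_trans lam0).
have s1 := sqr_sqrtr p1; have s2 := sqr_sqrtr p2.
have s3 : Num.sqrt ((rho - lam) / 2) * Num.sqrt ((rho + lam) / 2) = e / 2.
 have E : (rho - lam) / 2 * ((rho + lam) / 2) = (e / 2) ^+ 2.
  by transitivity ((rho ^+ 2 - lam ^+ 2) / 4); [field|rewrite r2; field].
 by rewrite -sqrtrM// E sqrtr_sqr ger0_norm// divr_ge0.
move: s1 s2 s3; set p := Num.sqrt _; set q := Num.sqrt _ => s1 s2 s3.
have sb : ((-1) ^+ b) ^+ 2 = 1 :> R by rewrite sqrr_sign.
set s : R := (-1) ^+ b in sb *.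
apply: ceqP => /=.
 by transitivity (s ^+ 2 * q ^+ 2 - p ^+ 2); [ring|rewrite sb s1 s2; field].
by transitivity (2 * s * (p * q)); [ring|rewrite s3; field].
Qed.

Lemma root_Re e : 0 <= Re (root b lam e). Proof. exact: sqrtr_ge0. Qed.

Lemma root_Re_gt0 e : 0 < e -> 0 < Re (root b lam e).
move=> e0; rewrite sqrtr_gt0 divr_gt0// subr_gt0 -{1}(ger0_norm lam0) -sqrtr_sqr ltr_sqrt ?ltrDl ?exprn_gt0//.
pos.
Qed.

Lemma root_Im e : Num.sqrt lam <= `|Im (root b lam e)|.
rewrite normrM normrN normrX normrN1 expr1n mul1r ger0_norm ?sqrtr_ge0// ler_sqrt; last first.
 by rewrite divr_ge0// addr_ge0// sqrtr_ge0.
by rewrite ler_pdivlMr// mulrDr mulr1 lerD.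
Qed.

Lemma root0 : root b lam 0 = 0 +i* (- (-1) ^+ b * Num.sqrt lam).
have E : (lam + lam) / 2 = lam by field.
by rewrite /root [(0 : R) ^+ 2]expr2 mulr0 addr0 sqrtr_sqr ger0_norm// subrr mul0r sqrtr0 E.
Qed.

Lemma nrm_root0 : nrm (root b lam 0) = Num.sqrt lam.
by rewrite root0 /= expr0n add0r sqrtr_sqr normrM normrN normrX normrN1 expr1n mul1r ger0_norm ?sqrtr_ge0.
Qed.

Lemma root_cvg (es : nat -> R) : es @ \oo --> (0 : R) -> ccvg (fun n => root b lam (es n)) (root b lam 0).
move=> h; have hs (a_ : nat -> R) (a : R) : a_ @ \oo --> a -> (fun n => Num.sqrt (a_ n)) @ \oo --> Num.sqrt a.
 by move=> ha; apply: continuous_cvg => //; exact: sqrt_continuous.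
have hr : (fun n => Num.sqrt (lam ^+ 2 + es n ^+ 2)) @ \oo --> Num.sqrt (lam ^+ 2 + 0 ^+ 2).
 by apply: hs; apply: cvgD; [exact: cvg_cst|rewrite expr2; under eq_cvg do rewrite expr2; exact: cvgM].
split; rewrite /root /=.
 by apply: hs; apply: cvgMl; apply: cvgB => //; exact: cvg_cst.
by apply: cvgMr; apply: hs; apply: cvgMl; apply: cvgD => //; exact: cvg_cst.
Qed.

End Root.

Section Limit.
Variables (b : bool) (lam C : R) (K_ : R[i] -> KF) (N : R[i] -> Prop).
Hypotheses (lam0 : 0 <= lam) (C0 : 0 <= C).
Hypothesis mK : forall m, N m -> mC2 (K_ m).
Hypothesis hK : forall m, N m -> forall x y, nrm (K_ m x y) <= C / dist x y.
Hypothesis eqK : forall m, N m -> forall x y, x <> y -> K_ m x y + cI (fun w => Tk V m x w * K_ m w y) = Rk m x y.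
Hypothesis cK_ : forall (m_ : nat -> R[i]) m, (forall n, N (m_ n)) -> N m -> ccvg m_ m ->
 forall x y, ccvg (fun n => K_ (m_ n) x y) (K_ m x y).
Let m0 := root b lam 0.
Hypothesis N0 : N m0.
Hypothesis N_ev : forall es : nat -> R, (forall n, 0 < es n) -> es @ \oo --> (0 : R) ->
 exists k, forall n, N (root b lam (es (n + k)%N)).

(** The one-sided limit is tested on sequences. Once the roots are in N the kernels share a bound
    and converge pointwise, and dominated convergence applies twice, to the integral against f and
    to the pairing with g. *)
Lemma kernel_boundary : boundary_resolvent V b lam (integral_operator (K_ m0)).
move=> f /L2comp_source [Cf Cf0 sf]; have opE (K : KF) : integral_operator K f = pot K f.
 by fext => x; exact: cintegralE.
rewrite opE; split; first exact: kernel_L2loc (mK N0) C0 (hK N0) Cf0 sf.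
move=> g /L2comp_source [Cg Cg0 sg]; apply/cvg_at_rightP => es [e0 ecv].
have [k hk] := N_ev e0 ecv; rewrite -(cvg_shiftn k).
pose m_ n := root b lam (es (n + k)%N).
have mcv : ccvg m_ m0 := ccvg_shift k (root_cvg b lam ecv).
have [mf _ _ _ _] := sf; have [mg _ _ gS _] := sg; have cg := mC_conj mg.
pose u n := pot (K_ (m_ n)) f; pose u0 := pot (K_ m0) f.
have mu_ n : mCX (u n) := mC_pot (mK (hk n)) mf.
have z_ n : lam +i* ((-1) ^+ b * es (n + k)%N) = - m_ n ^+ 2 by rewrite root_sqr// ltW.
have res n : pairing (resolvent V (lam +i* ((-1) ^+ b * es (n + k)%N)) f) g = cI (fun x => u n x * (g x)^*%C).
 rewrite z_; have im : Im (m_ n ^+ 2) != 0.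
  have /(congr1 (@complex.Im R)) := z_ n; case: (m_ n ^+ 2) => p q /= hq; apply/eqP => q0.
  by move: hq; rewrite q0 oppr0 => /eqP; rewrite mulf_eq0 signr_eq0 /= => /eqP h; have := e0 (n + k)%N; rewrite h ltxx.
 have [mr er] := resolvent_kernel (root_Re _ _ _) (mK (hk n)) C0 (hK (hk n)) (eqK (hk n)) Cf0 sf im (root_Re_gt0 b lam0 (e0 (n + k)%N)).
 rewrite /pairing cintegralE; apply: cI_ae; [meas|exact: mC_M (mu_ n) cg|].
 by apply: (aeS er) => x ->.
have ucv x : ccvg (fun n => u n x) (u0 x).
 have mi : mRX (fun w => nrm (f w) / dist x w) by have mm := mC_nrm mf; meas.
 have i0 w : 0 <= nrm (f w) / dist x w by pos.
 apply: (cI_dct (g := fun w => C * (nrm (f w) / dist x w))).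
 - by move=> n; exact: mC_M (mC2_r x (mK (hk n))) mf.
 - by move=> w; exact: ccvgM (cK_ hk N0 mcv x w) (ccvg_cst _).
 - meas.
 - rewrite (n3Z mi C0 i0); apply: ltyZ C0 _.
  by have [_ _ _ _ h] := sf; exact: lelt (h x) (ltry _).
 - move=> n w; rewrite nrmM [leRHS]mulrCA mulrC; apply: lewl; [pos|exact: hK (hk n) _ _].
have M0 : 0 <= C * Cf by pos.
have pcv : ccvg (fun n => cI (fun x => u n x * (g x)^*%C)) (cI (fun x => u0 x * (g x)^*%C)).
 have mg1 := mC_nrm mg; have g0 x := nge0 (g x).
 apply: (cI_dct (g := fun x => C * Cf * nrm (g x))).
 - by move=> n; exact: mC_M (mu_ n) cg.
 - by move=> x; exact: ccvgM (ucv x) (ccvg_cst _).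
 - meas.
 - rewrite (n3Z mg1 M0 g0); apply: ltyZ M0 _; exact: lelt gS (ltry _).
 - move=> n x; rewrite nrmM nrm_conj; apply: lewr => //.
  apply: le_trans (pot_omega (mK (hk n)) C0 (hK (hk n)) sf x) _; apply: ler_piMr => //; exact: omega_le1.
have /ccvgP := pcv; apply: cvg_trans; apply: near_eq_cvg; apply: nearW => n.
transitivity (nrm (pairing (resolvent V (lam +i* ((-1) ^+ b * es (n + k)%N)) f) g - pairing u0 g)); last by [].
by rewrite res [X in _ = nrm (_ - X)]cintegralE.
Qed.

End Limit.
End BoundaryValues.

(** * Uniform bounds at high and low energies *)

Section Assembly.
Implicit Types (x y w : R3 R) (m : R[i]).

Definition boundary_kernel V b (lam C : R) := exists K : KF,
 [/\ jointly_measurable K, boundary_resolvent V b lam (integral_operator K) &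
   forall x y : R3 R, x <> y -> nrm (K x y) <= C / dist x y].

Lemma boundary_kernel_le V b lam (C C' : R) : C <= C' -> boundary_kernel V b lam C -> boundary_kernel V b lam C'.
move=> h [K [h1 h2 h3]]; exists K; split=> // x y xy; apply: le_trans (h3 _ _ xy) _.
by apply: lewr => //; pos.
Qed.

Lemma ccvg_nrm (u : nat -> R[i]) l : ccvg u l -> (fun n => nrm (u n)) @ \oo --> nrm l.
move=> /ccvgP /cvgrPdist_le h; apply/cvgrPdist_le => e e0; apply: filterS (h e e0) => n; rewrite sub0r normrN ger0_norm ?nge0// => hd.
have h1 := nrmD (u n - l) l; have h2 := nrmB (u n) (u n - l).
rewrite subrK in h1; rewrite opprB addrCA subrr addr0 in h2.
by rewrite ler_norml; apply/andP; split; lra.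
Qed.

Lemma eventually_le (u : nat -> R) (p L : R) : u @ \oo --> p -> p < L -> exists k, forall n, u (n + k)%N <= L.
by move=> h pL; have [k _ hk] := cvgr_lt p h L pL; exists k => n; apply: ltW; apply: hk; rewrite /= leq_addl.
Qed.

Variables (V V1 : RF) (B r A e : R).
Hypotheses (mV : mRX V) (mV1 : mRX V1) (B0 : 0 <= B) (r0 : 0 < r) (A0 : 0 < A).
Hypotheses (hV1 : forall x, `|V1 x| <= B * ballf 0 r x) (kV : katob (fun x => `|V x|) A).
Hypotheses (kV2 : katob (fun x => `|V x - V1 x|) e) (e0 : 0 < e) (he : nc^-1 * (2 * e) <= 2^-1).

Section Family.
Variables (n : nat) (l : 'I_n -> CF) (Bl Mr : R) (r_ : R[i] -> 'I_n -> CF).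
Variables (Ed : R3 R -> R3 R -> RF) (Bd Ag rho : R) (P : R[i] -> Prop) (d : R).
Hypotheses (ml : forall i, mCX (l i)) (Bl0 : 0 <= Bl) (Mr0 : 0 <= Mr).
Hypotheses (hl : forall i, (\I_w (nrm (l i w) * omega w) <= Bl%:E)%E) (kEd : kbd Ed om Bd).
Hypotheses (Ag0 : 0 <= Ag) (rho0 : 0 <= rho) (rho1 : rho < 1) (P0 : forall m, P m -> 0 <= Re m).
Hypotheses (hD : forall m, P m -> dom Ed (cst2 (T0k V l r_ m))).
Hypotheses (gD : forall m, P m -> geomp om (cst2 (T0k V l r_ m)) Ag rho).
Hypotheses (hr : forall m, P m -> forall i, bdd om (fun=> r_ m i) Mr).
Hypothesis r_cvg : forall (m_ : nat -> R[i]) m i x, ccvg m_ m -> ccvg (fun k => r_ (m_ k) i x) (r_ m i x).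
Hypothesis d0 : 0 < d.
(** Parameters with the determinant at distance at least d from 0: there one constant C serves all
    kernels. *)
Let N m := P m /\ d <= nrm (fdet V l r_ m).
Let C : R := `|cK B r n Bl Mr Ag rho d|.
(** With the diagonal cleared, the bound by [C / dist x y] holds at x = y as well, where it reads
    0. *)
Let K m x y := (off y x)%:C * Kk V V1 l r_ m x y.

Let mK m : P m -> mC2 (K m).
move=> Pm; apply: mC_M; last exact: (mC2_Kk mV mV1 B0 r0 hV1 kV2 he ml Bl0 Mr0 hl Ag0 rho0 rho1 P0 hD gD hr Pm).
by apply: mC_real; rewrite /off; apply: mR_leif; meas.
Qed.

Let K_le m : N m -> forall x y, nrm (K m x y) <= C / dist x y.
move=> [Pm dm] x y; rewrite /K; have [->|/eqP xy] := eqVneq x y.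
 by rewrite /off subrr enorm0 lexx mul0r nrm0 invr0 mulr0.
rewrite offE// mul1r.
apply: le_trans (Kk_le mV mV1 B0 r0 hV1 kV2 he ml Bl0 Mr0 hl Ag0 rho0 rho1 P0 hD gD hr Pm xy) _.
apply: lewr; first pos.
apply: le_trans (ler_norm _); rewrite /cK lerD2l.
exact: (solve_const_mono B0 r0 n Bl0 Mr0 Ag0 rho1 d0 dm).
Qed.

Let K_eq m : N m -> forall x y, x <> y -> K m x y + cI (fun w => Tk V m x w * K m w y) = Rk m x y.
move=> [Pm dm] x y xy.
have f0 : fdet V l r_ m != 0 by apply/eqP => h; have := lt_le_trans d0 dm; rewrite h nrm0 ltxx.
rewrite -(KkP mV mV1 B0 r0 hV1 kV kV2 he ml Bl0 Mr0 hl kEd Ag0 rho0 rho1 P0 hD gD hr Pm f0 xy).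
have mT := mC2_r x (mC2_Tk m mV).
have mKk := mC2_Kk mV mV1 B0 r0 hV1 kV2 he ml Bl0 Mr0 hl Ag0 rho0 rho1 P0 hD gD hr Pm.
congr (_ + _); first by rewrite /K offE// mul1r.
apply: cI_ae; [exact: mC_M mT (mC2_l y (mK Pm))|exact: mC_M mT (mC2_l y mKk)|].
by apply: (aeS (ae_neq y)) => w wy; rewrite /K offE// mul1r.
Qed.

Let K_cvg (m_ : nat -> R[i]) m : (forall k, N (m_ k)) -> N m -> ccvg m_ m ->
 forall x y, ccvg (fun k => K (m_ k) x y) (K m x y).
move=> Nk [Pm dm] h x y; have f0 : fdet V l r_ m != 0 by apply/eqP => h0; have := lt_le_trans d0 dm; rewrite h0 nrm0 ltxx.
apply: ccvgM (ccvg_cst _) _.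
exact: (Kk_cvg mV mV1 B0 r0 hV1 kV2 he ml Mr0 hl kEd Ag0 rho0 rho1 P0 hD gD hr r_cvg x y (fun k => (Nk k).1) Pm h f0).
Qed.

Lemma family_kernel b (lam : R) : 0 <= lam -> N (root b lam 0) ->
 (forall es : nat -> R, (forall k, 0 < es k) -> es @ \oo --> (0 : R) -> exists k, forall j, N (root b lam (es (j + k)%N))) ->
 boundary_kernel V b lam C.
move=> lam0 N0 Nev; exists (K (root b lam 0)); split.
- exact: mK N0.1.
- have h := kernel_boundary mV A0 kV (N := N) lam0 (normr_ge0 _ : 0 <= C) (fun m Nm => mK Nm.1) K_le K_eq K_cvg N0 Nev; exact: h.
- by move=> x y _; exact: K_le.
Qed.

End Family.

Lemma high_kernels : nc^-1 * (3 * e) * (nc^-1 * (3 * A) + nc^-1 * (3 * (A + e))) <= 4^-1 ->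
 exists2 T : R, 0 < T & exists C : R, forall b (lam : R), 0 <= lam -> T <= Num.sqrt lam -> boundary_kernel V b lam C.
move=> small; have q1 : 3 / 4 < 1 :> R by lra.
have [T T0 hT] := high_energy mV mV1 B0 r0 A0 hV1 kV kV2 e0 small; exists T => //.
(* At high energy the full operator has decaying iterates, so the finite-rank part is empty and its
   determinant is 1. *)
have no (i : 'I_0) : False by have := ltn_ord i; rewrite ltn0.
pose l (i : 'I_0) (x : R3 R) : R[i] := 0; pose r_ (m : R[i]) (i : 'I_0) (x : R3 R) : R[i] := 0.
pose P m := 0 <= Re m /\ T <= `|Im m|.
have TE m : T0k V l r_ m = Tk V m by fext => x; fext => w; rewrite /T0k big_ord0 subr0.
have dE m : nrm (fdet V l r_ m) = 1 by rewrite /fdet det_mx00 /= expr1n expr0n addr0 sqrtr1.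
have K0 : 0 <= 2 * (1 + nc^-1 * (3 * A)) by pos.
have q0 : 0 <= 3 / 4 :> R by rewrite divr_ge0.
have hD m : P m -> dom (E0 (fun w => `|V w|)) (cst2 (T0k V l r_ m)) by move=> [m0 _]; rewrite TE; exact: dom_Tk.
have gD m : P m -> geomp om (cst2 (T0k V l r_ m)) (2 * (1 + nc^-1 * (3 * A))) (3 / 4) by move=> [m0 mT]; rewrite TE; exact: hT.
exists `|cK B r 0 0 0 (2 * (1 + nc^-1 * (3 * A))) (3 / 4) 1| => b lam lam0 hl.
have NP e' : P (root b lam e') by split; [exact: root_Re|apply: le_trans hl (root_Im b lam0 e')].
apply: (@family_kernel 0 l 0 0 r_ _ _ _ _ P 1 _ _ _ _ (kbd_E0 kV) K0 q0 q1 (fun m Pm => Pm.1) hD gD) => //.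
- by split; [exact: NP|rewrite dE].
- by move=> es _ _; exists 0%N => j; split; [exact: NP|rewrite dE].
Qed.

Lemma low_kernels (T : R) : nc^-1 * (3 * e) <= 4^-1 -> ~ schrodinger_eigenvalue V 0 -> ~ zero_resonance V ->
 (forall E : R, 0 < E -> ~ schrodinger_eigenvalue V E) -> 0 < T ->
 exists C : R, forall b (lam : R), 0 <= lam -> Num.sqrt lam <= T -> boundary_kernel V b lam C.
(* The unit of room above T keeps the roots with small absorption in the range of [low_data]. *)
move=> he3 no0 nor nop T0; pose L := T + 1; have L0 : 0 <= L by rewrite addr_ge0// ltW.
have TL : T < L by rewrite ltrDl.
have [n [l [Bl [Mr [r_ [Ed [[ml Bl0 Mr0 hl kEd] [hP rcv]]]]]]]] := low_data mV mV1 B0 r0 L0 hV1 kV2 he3.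
pose P m := 0 <= Re m /\ nrm m <= L.
have hD m : P m -> dom Ed (cst2 (T0k V l r_ m)) by move=> Pm; have [] := hP m Pm.
have hr m : P m -> forall i, bdd om (fun=> r_ m i) Mr by move=> Pm; have [] := hP m Pm.
have h0 : 0 <= 2^-1 :> R by pos.
have h1 : 2^-1 < 1 :> R by rewrite invf_lt1// ltr1n.
have gD m : P m -> geomp om (cst2 (T0k V l r_ m)) 1 2^-1.
 by move=> Pm; exact: (geometric_kbd mR2_om om_ge0 kEd h0 (hD m Pm)).
have fcv := fdet_cvg ml Mr0 hl kEd ler01 h0 h1 hD gD hr rcv.
have mi (t : R) : nrm (0 +i* t) = `|t| by rewrite /= expr0n add0r sqrtr_sqr.
have Pi (t : R) : `|t| <= L -> P (0 +i* t) by move=> tL; split; [exact: lexx|rewrite mi].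
(* A zero of the determinant would produce a nonzero solution of $\psi+R_0V\psi=0$ bounded by
   [omega], which [kernel_trivial] excludes. *)
have nz (t : R) : `|t| <= L -> fdet V l r_ (0 +i* t) != 0.
 move=> tL; have Pt := Pi t tL; apply/eqP => dz.
 have [u [M M0 hu] [eu nu]] := singular_kernel kEd ler01 h0 h1 ml Mr0 hl (hD _ Pt) (gD _ Pt) (hr _ Pt) dz.
 apply: nu; have mu_ : mCX u := mC2_r (0 : R3 R) hu.1.
 apply: (kernel_trivial mV A0 kV no0 nor nop (tau := t) M0 mu_ (fun x => hu.2 x x)) => x.
 by have := eu x x; rewrite fullT_T0k.
have ev (m_ : nat -> R[i]) m : (forall k, 0 <= Re (m_ k)) -> 0 <= Re m -> nrm m < L -> ccvg m_ m ->
  exists k, (forall j, P (m_ (j + k)%N)) /\ ccvg (fun j => fdet V l r_ (m_ (j + k)%N)) (fdet V l r_ m).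
 move=> Rk0 R0 mL h; have [k hk] := eventually_le (ccvg_nrm h) mL.
 have Pk j : P (m_ (j + k)%N) by split; [exact: Rk0|exact: hk].
 by exists k; split=> //; apply: fcv Pk _ (ccvg_shift k h); split=> //; pos.
pose F (t : R) := nrm (fdet V l r_ (0 +i* t)).
have Fc : {within `[(- T), T], continuous F}.
 apply: continuous_in_subspaceT => p; rewrite inE/= in_itv/= -ler_norml => pT.
 apply: (@cvg_nbhsP R R^o F p (F p)).2 => u hu; have pL : nrm (0 +i* p) < L by rewrite mi; exact: lelt pT TL.
 have cu : ccvg (fun k => 0 +i* u k) (0 +i* p) by split; [exact: cvg_cst|exact: hu].
 have [k [_ hk]] := ev (fun k => 0 +i* u k) (0 +i* p) (fun k => lexx 0) (lexx 0) pL cu.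
 by rewrite -(cvg_shiftn k); exact: ccvg_nrm hk.
have TT : - T <= T by rewrite (le_trans _ (ltW T0))// oppr_le0 ltW.
(* The determinant has a positive minimum modulus over the compact range of boundary parameters;
   half of it remains a lower bound for small absorption. *)
have [c cT Fmin] := EVT_min TT Fc; rewrite in_itv/= -ler_norml in cT.
have Fc0 : 0 < F c.
 rewrite lt_def nge0 andbT; apply: contra (nz c (le_trans cT (ltW TL))) => /eqP /nrm_eq0 ->; exact: eqxx.
pose d := F c / 2; have d0 : 0 < d by rewrite divr_gt0.
have dF : d < F c by rewrite /d ltr_pdivrMr// mulr_natr mulr2n ltrDl.
exists `|cK B r n Bl Mr 1 2^-1 d| => b lam lam0 lamT.
have m0L : nrm (root b lam 0) < L by rewrite nrm_root0//; exact: lelt lamT TL.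
have hd : F c <= nrm (fdet V l r_ (root b lam 0)).
 have hin : - (-1) ^+ b * Num.sqrt lam \in `[(- T), T].
  by rewrite in_itv/= -ler_norml normrM normrN normrX normrN1 expr1n mul1r (ger0_norm (sqrtr_ge0 lam)).
 by have h := Fmin _ hin; rewrite (root0 b lam0).
apply: (@family_kernel n l Bl Mr r_ _ _ _ _ P d ml Bl0 Mr0 hl kEd ler01 h0 h1 (fun m Pm => Pm.1) hD gD hr rcv d0 b lam lam0).
- by split; [split; [exact: root_Re|pos]|exact: ltW (lt_le_trans dF hd)].
- move=> es _ ecv; have mcv := root_cvg b lam ecv.
 have [k1 [Pk fk]] := ev _ _ (fun k => root_Re b lam (es k)) (root_Re b lam 0) m0L mcv.
 have [k2 _ hk2] := cvgr_gt _ (ccvg_nrm fk) d (lt_le_trans dF hd).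
 exists (k2 + k1)%N => j; rewrite addnA; split; first exact: Pk.
 by apply: ltW; apply: hk2; rewrite /= leq_addl.
Qed.

End Assembly.

End Main.

(** With [N] standing for [nc^-1], the three conditions serve the Neumann series of [Gk], the
    low-energy remainder and the high-energy square. The choice $e=1/(100(1+N)^2(1+A))$ meets all of
    them. *)
Lemma split_size {R : realType} (N A : R) : 0 <= N -> 0 < A -> exists2 e : R, 0 < e &
 [/\ N * (2 * e) <= 2^-1, N * (3 * e) <= 4^-1 & N * (3 * e) * (N * (3 * A) + N * (3 * (A + e))) <= 4^-1].
move=> N0 A0; pose q : R := 100 * ((1 + N) ^+ 2 * (1 + A)).
have q0 : 0 < q by rewrite !mulr_gt0// ?exprn_gt0// ltr_wpDr// ltW.
have [e e0 eq] : exists2 e : R, 0 < e & e * q = 1 by exists q^-1; [rewrite invr_gt0|rewrite mulVf// gt_eqF].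
exists e => //.
have a1 : 0 <= e * N by rewrite mge0// ltW.
have a2 : 0 <= e * N ^+ 2 by rewrite mge0 ?sqr_ge0// ltW.
have a3 : 0 <= e * A by rewrite mge0// ltW.
have a4 : 0 <= e * N * A by rewrite mge0// ltW.
have a5 : 0 <= e * N ^+ 2 * A by rewrite mge0// ltW.
have h : 100 * (e + 2 * (e * N) + e * N ^+ 2 + e * A + 2 * (e * N * A) + e * N ^+ 2 * A) = 1.
 by rewrite -[RHS]eq /q; ring.
have ee : e <= 1 by lra.
have a6 : e * N ^+ 2 * e <= e * N ^+ 2 by rewrite -[leRHS]mulr1; apply: lewl.
have h1 : N * (2 * e) = 2 * (e * N) by ring.
have h2 : N * (3 * e) = 3 * (e * N) by ring.
have h3 : N * (3 * e) * (N * (3 * A) + N * (3 * (A + e))) = 18 * (e * N ^+ 2 * A) + 9 * (e * N ^+ 2 * e) by ring.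
by rewrite h3 h2 h1; split; lra.
Qed.

Unset Implicit Arguments.
Set Strict Implicit.
Set Printing Implicit Defensive.

Theorem corollary3p1 (R : realType) (V : R3 R -> R)
  (V_kato0 : kato0 V)
  (no_zero_eigenvalue : ~ schrodinger_eigenvalue V 0)
  (no_zero_resonance : ~ zero_resonance V)
  (no_positive_eigenvalue : forall E : R, 0 < E -> ~ schrodinger_eigenvalue V E) :
  exists C : R, forall (b : bool) (lam : R), 0 <= lam ->
    exists K : R3 R -> R3 R -> R[i],
      [/\ jointly_measurable K,
          boundary_resolvent V b lam (integral_operator K) &
          forall x y : R3 R, x <> y -> modulus (K x y) <= C / enorm (x - y)].
Proof.
have [A A0 kV] := kato0_bound V_kato0; have [mV _] := V_kato0.
have [e e0 [e1 e2 e4]] := split_size (@nci_ge0 R) A0.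
have [V1 [mV1 [B [r [B0 r0 hV1]]] kV2]] := kato_split V_kato0 e0.
(* The threshold comes out of the high-energy half; the low-energy half then works on the compact
   range left below it. *)
have [T T0 [C1 high]] := high_kernels mV mV1 B0 r0 A0 hV1 kV kV2 e0 e1 e4.
have [C2 low] := low_kernels mV mV1 B0 r0 A0 hV1 kV kV2 e1 e2 no_zero_eigenvalue no_zero_resonance no_positive_eigenvalue T0.
exists (Num.max C1 C2) => b lam lam0.
have [h|h] := leP T (Num.sqrt lam).
  by apply: boundary_kernel_le (high b lam lam0 h); rewrite le_max lexx.
by apply: boundary_kernel_le (low b lam lam0 (ltW h)); rewrite le_max lexx orbT.
Qed.
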